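(* For each $n = 1, 2, \dots$, let $K_n$ be the closure of the 3-braid $\beta_n = (\sigma_1^{-1})^{2n+3}\,\sigma_2\,(\sigma_1)^3\,\sigma_2$, regarded as a transverse knot. Then the Ozsváth–Szabó–Thurston transverse invariant satisfies $\hat\theta(K_n) \neq 0$.
   Context: Transverse knots in the standard contact 3-space are represented by closures of braids; $\sigma_1,\sigma_2$ are the standard generators of the 3-strand braid group (each $\sigma_i$ closing up to a positive crossing). The Ozsváth–Szabó–Thurston invariant $\hat\theta(T)\in\widehat{HFK}(m(K))$ of a transverse knot $T$ of topological type $K$ (with $m(K)$ the mirror of $K$) is defined as follows. Let $G$ be an $N\times N$ grid diagram, on a torus, with one $O$ and one $X$ in each row and column; it represents an oriented knot by joining $O$ to $X$ horizontally in each row and $X$ to $O$ vertically in each column, vertical segments passing over horizontal ones. To $G$ one associates a Legendrian front of the mirror of this knot: smooth the northwest and southeast corners, regard the northeast and southwest corners as cusps, tilt by $45^\circ$ clockwise (so that northeast corners become right cusps and southwest corners left cusps), with all crossings reversed. Choose $G$ whose associated Legendrian knot has positive transverse push-off transversely isotopic to $T$. The grid complex $CFK^-(G)$ is the free $\mathbb{F}_2[U_1,\dots,U_N]$-module generated by the $N$-tuples $\mathbf x$ of intersection points of the horizontal and vertical circles of the toroidal grid with one point on each circle, with differential $$\partial^-\mathbf x=\sum_{\mathbf y}\ \sum_{r}U_1^{O_1(r)}\cdots U_N^{O_N(r)}\,\mathbf y,$$ where $r$ runs over the empty rectangles in the torus from $\mathbf x$ to $\mathbf y$ (no component of $\mathbf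 x$ in the interior) that contain no $X$, and $O_i(r)\in\{0,1\}$ counts whether $O_i$ lies in $r$. Setting $U_i=0$ for one chosen $i$ yields a complex whose homology is $\widehat{HFK}(m(K))$. The generator $\mathbf x^+$ consisting of the upper right (northeast) corners of all squares containing an $X$ is a cycle, and $\hat\theta(T)$ is its homology class in $\widehat{HFK}(m(K))$. The vanishing or non-vanishing of $\hat\theta(T)$ depends only on the transverse isotopy class of $T$. *)

(* Defs.v *)
From Stdlib Require Import Reals.
From Coquelicot Require Import Coquelicot.
From mathcomp Require Import all_boot all_order all_fingroup all_algebra.
From mathcomp.multinomials Require Import mpoly.

Set Implicit Arguments.
Unset Strict Implicit.
Unset Printing Implicit Defensive.

Import GRing.Theory.

(* Column [a] has its [O] in row [gridO a] and its [X] in row [gridX a].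
   Columns are numbered from left to right and rows from bottom to top. *)
Record grid (N : nat) := Grid {
  gridO : {perm 'I_N};
  gridX : {perm 'I_N};
  gridOX : forall a : 'I_N, gridO a != gridX a }.

(* From the X of column [a], vertically to the O of column [a], then
   horizontally to the X of the row reached: the column of that X. *)
Definition next_col N (G : grid N) (a : 'I_N) : 'I_N :=
  (gridX G)^-1%g (gridO G a).

Definition is_knot_grid N (G : grid N) : Prop :=
  forall a b : 'I_N, exists k : nat, b = iter k (next_col G) a.

(* The corners (column, row) met along the oriented diagram, starting at the X
   of column [a0]: X's at even times, O's at odd times.  The edge from corner
   [j] to corner [j.+1] is vertical for [j] even and horizontal for [j] odd. *)
Definition corner N (G : grid N) (a0 : 'I_N) (j : nat) : 'I_N * 'I_N :=
  let a := iter j./2 (next_col G) a0 in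
  (a, if odd j then gridO G a else gridX G a).

(* The corner at the O (if [isO]) or X (otherwise) of column [a] is a northeast
   corner if its horizontal edge goes to the left and its vertical edge goes
   down, and a southwest corner if they go right and up. *)
Definition is_cusp N (G : grid N) (isO : bool) (a : 'I_N) : bool :=
  let here := if isO then gridO G else gridX G in
  let there := if isO then gridX G else gridO G in
  (there^-1%g (here a) < a)%N == (there a < here a)%N.

Section GridComplex.
Local Open Scope ring_scope.

(* Circle [a] bounds column (or row) [a] on the left (or from below), so the
   lattice point (a, b) is the lower left corner of the square (a, b). A
   generator [x] consists of the points (a, x a). *)
Definition generator (N : nat) : predArgType := {perm 'I_N}.

Definition chain (N : nat) : predArgType :=
  {ffun {perm 'I_N} -> {mpoly 'F_2[N]}}.

(* Membership in the cyclic half-open interval [i, j), for [i != j]. *)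
Definition cyc N (i j a : 'I_N) : bool :=
  ((a + N - i) %% N < (j + N - i) %% N)%N.

(* A rectangle on the torus is given by its left, right, bottom and top sides;
   it extends from the left side rightwards and from the bottom side upwards,
   wrapping around if necessary. *)
Definition rectangle (N : nat) : predArgType :=
  (('I_N * 'I_N) * ('I_N * 'I_N))%type.
Definition rleft N (r : rectangle N) := r.1.1.
Definition rright N (r : rectangle N) := r.1.2.
Definition rbottom N (r : rectangle N) := r.2.1.
Definition rtop N (r : rectangle N) := r.2.2.

Definition in_rect N (r : rectangle N) (a b : 'I_N) : bool :=
  cyc (rleft r) (rright r) a && cyc (rbottom r) (rtop r) b.

Definition in_interior N (r : rectangle N) (a b : 'I_N) : bool :=
  [&& in_rect r a b, a != rleft r & b != rbottom r].

(* [x] and [y] agree off the two vertical sides of [r], the lower left and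
   upper right corners of [r] belong to [x], the other two to [y]. *)
Definition connects N (x y : generator N) (r : rectangle N) : bool :=
  [&& rleft r != rright r,
      x (rleft r) == rbottom r, x (rright r) == rtop r,
      y (rleft r) == rtop r, y (rright r) == rbottom r &
      [forall a, (a != rleft r) && (a != rright r) ==> (x a == y a)]].

Definition empty_rect N (x : generator N) (r : rectangle N) : bool :=
  [forall a, ~~ in_interior r a (x a)].

Definition no_X N (G : grid N) (r : rectangle N) : bool :=
  [forall a, ~~ in_rect r a (gridX G a)].

(* The O of column [i] is the one carrying the variable [U_i = 'X_i]. *)
Definition countO N (G : grid N) (r : rectangle N) (i : 'I_N) : nat :=
  in_rect r i (gridO G i).

Definition d_coef N (G : grid N) (x y : generator N) : {mpoly 'F_2[N]} :=
  \sum_(r : rectangle N | [&& connects x y r, empty_rect x r & no_X G r])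
     \prod_(i < N) 'X_i ^+ countO G r i.

Definition diff_minus N (G : grid N) (c : chain N) : chain N :=
  [ffun y => \sum_(x : {perm 'I_N}) c x * d_coef G x y].

Definition gen_chain N (x : generator N) : chain N :=
  [ffun y => (y == x)%:R].

Definition mulU N (i : 'I_N) (c : chain N) : chain N :=
  [ffun y => 'X_i * c y].

(* The lattice point at the upper right corner of the square (a, b) is
   (a + 1, b + 1) modulo N; conjugation by the shift sends the points
   (a, gridX a) to the points (a + 1, gridX a + 1). *)
Definition xplus N (G : grid N) : generator N :=
  (gridX G ^ perm (@ordS_inj N))%g.

(* A chain of CFK^-(G) represents a boundary of the quotient complex
   CFK^-(G) / U_i CFK^-(G), i.e. of the complex obtained by setting U_i = 0. *)
Definition hat_boundary N (G : grid N) (i : 'I_N) (c : chain N) : Prop :=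
  exists b e : chain N, c = diff_minus G b + mulU i e.

(* xplus is always a cycle: a rectangle starting at xplus contains the X at its
   upper right corner. *)
Definition theta_hat_class_nonzero N (G : grid N) (i : 'I_N) : Prop :=
  ~ hat_boundary G i (gen_chain (xplus G)).

End GridComplex.

Local Open Scope R_scope.

Record curve := Curve { cx : R -> R; cy : R -> R; cz : R -> R }.

Definition smooth (f : R -> R) : Prop := forall k t, ex_derive_n f k t.

(* Curves are parametrized by R / Z; the parametrization carries the
   orientation. *)
Definition is_knot (g : curve) : Prop :=
  [/\ smooth (cx g) /\ smooth (cy g) /\ smooth (cz g),
      forall t, [/\ cx g (t + 1) = cx g t, cy g (t + 1) = cy g t
                  & cz g (t + 1) = cz g t],
      forall t, ~ [/\ Derive (cx g) t = 0, Derive (cy g) t = 0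
                    & Derive (cz g) t = 0]
    & forall t u, 0 <= t < 1 -> 0 <= u < 1 ->
        cx g t = cx g u -> cy g t = cy g u -> cz g t = cz g u -> t = u].

(* The contact form dz - y dx evaluated on the velocity of [g]. *)
Definition contact_form (g : curve) (t : R) : R :=
  Derive (cz g) t - cy g t * Derive (cx g) t.

Definition legendrian (g : curve) : Prop :=
  is_knot g /\ forall t, contact_form g t = 0.

Definition transverse (g : curve) : Prop :=
  is_knot g /\ forall t, 0 < contact_form g t.

(* One-parameter families, continuous for the C^1 topology on curves. *)
Definition C1_family (f : R -> R -> R) : Prop :=
  forall s t, continuity_2d_pt f s t /\
              continuity_2d_pt (fun s t => Derive (f s) t) s t.

Definition continuous_family (H : R -> curve) : Prop :=
  [/\ C1_family (fun s => cx (H s)), C1_family (fun s => cy (H s))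
    & C1_family (fun s => cz (H s))].

Definition transverse_isotopic (T T' : curve) : Prop :=
  exists H : R -> curve,
    [/\ continuous_family H, forall s, 0 <= s <= 1 -> transverse (H s),
        H 0 = T & H 1 = T'].

(* A transverse knot obtained by pushing L off itself through positively
   transverse knots.  In a standard neighbourhood of L, with contact form
   dz - p dq, the knots C^1-close to L are the graphs (q, p(q), z(q)), and the
   positively transverse ones form the convex set z' > p: the result is
   therefore unique up to transverse isotopy. *)
Definition transverse_pushoff (L T : curve) : Prop :=
  exists H : R -> curve,
    [/\ continuous_family H, forall s, 0 < s <= 1 -> transverse (H s),
        H 0 = L & H 1 = T].

(* The clockwise rotation by 45 degrees, followed by a dilation by sqrt 2, sends
   the point (a, b) of the plane of the grid to (x, z) = (a + b, b - a).  These
   are the coordinates (a, b) of the front projection of [L]. *)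
Definition front_a (L : curve) (t : R) : R := (cx L t - cz L t) / 2.
Definition front_b (L : curve) (t : R) : R := (cx L t + cz L t) / 2.

(* With parameter u / 2N, the front is at corner j for u near j, and on the
   straight j-th edge for u between j + 1/4 and j + 3/4. *)
Definition grid_time (N : nat) (u : R) : R := u / (2 * INR N).

Definition follows_edge N (G : grid N) (a0 : 'I_N) (L : curve) (j : nat) :
  Prop :=
  let a := INR (corner G a0 j).1 in let b := INR (corner G a0 j).2 in
  let a' := INR (corner G a0 j.+1).1 in let b' := INR (corner G a0 j.+1).2 in
  forall u, INR j + 1/4 <= u <= INR j + 3/4 ->
    let t := grid_time N u in
    [/\ Rmin a a' <= front_a L t <= Rmax a a',
        Rmin b b' <= front_b L t <= Rmax b b'
      & 0 < (a' - a) * Derive (front_a L) t + (b' - b) * Derive (front_b L) t].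

(* Near the j-th corner the front is a graph over the x-axis (a smoothed
   corner), except for one cusp at a northeast or southwest corner.  Together with the two adjacent edges it is
   embedded, so that all crossings of the front are crossings of the grid. *)
Definition rounds_corner N (G : grid N) (a0 : 'I_N) (L : curve) (j : nat) :
  Prop :=
  let a := (corner G a0 j).1 in let b := (corner G a0 j).2 in
  (forall u, INR j - 1/4 <= u <= INR j + 1/4 ->
     let t := grid_time N u in
     [/\ Rabs (front_a L t - INR a) <= 1/4,
         Rabs (front_b L t - INR b) <= 1/4
       & Derive (cx L) t = 0 <-> is_cusp G (odd j) a /\ u = INR j]) /\
  (forall u v, INR j - 3/4 <= u <= INR j + 3/4 ->
     INR j - 3/4 <= v <= INR j + 3/4 ->
     front_a L (grid_time N u) = front_a L (grid_time N v) ->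
     front_b L (grid_time N u) = front_b L (grid_time N v) -> u = v).

(* The crossings need not be specified: z' = y x' determines y as the slope of
   the front, which is 1 on vertical edges and -1 on horizontal ones, and the
   y-axis points away from the viewer of the (x, z)-plane.  So the horizontal
   strands pass over the vertical ones, as required for the mirror. *)
Definition legendrian_of_grid N (G : grid N) (L : curve) : Prop :=
  legendrian L /\
  exists a0 : 'I_N, forall j : nat, (j < 2 * N)%N ->
    follows_edge G a0 L j /\ rounds_corner G a0 L j.

Definition represents N (G : grid N) (T : curve) : Prop :=
  is_knot_grid G /\
  exists L T' : curve,
    [/\ legendrian_of_grid G L, transverse_pushoff L T'
      & transverse_isotopic T' T].

(* The invariant of T is computed from a grid representing T; whether it
   vanishes depends neither on that grid nor on the chosen index. *)
Definition theta_hat_nonzero (T : curve) : Prop :=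
  exists (N : nat) (G : grid N),
    represents G T /\ forall i : 'I_N, theta_hat_class_nonzero G i.

(* The letter (i, true) is sigma_i and (i, false) its inverse, for i >= 1. *)
Definition braid_word := seq (nat * bool).

Definition sigma (i : nat) : nat * bool := (i, true).
Definition sigma_inv (i : nat) : nat * bool := (i, false).

(* An m-strand closed braid winding around an axis, in cylindrical coordinates:
   at angle 2 pi u its strands are at radius r (u + k) and height h (u + k), for
   k < m.  It is projected along the axis, larger heights passing over, and
   positions are counted from the axis outwards. *)
Definition crossing_at (m : nat) (r h : R -> R) (u : R) (s : nat * bool) :
  Prop :=
  exists over under : 'I_m,
    let o := u + INR over in let d := u + INR under in
    [/\ over != under /\ r o = r d, h d < h o,
        #|[set k : 'I_m | Rlt_dec (r (u + INR k)) (r o)]|.+1 = s.1,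
        forall k l : 'I_m, k != l -> r (u + INR k) = r (u + INR l) ->
          (k = over /\ l = under) \/ (k = under /\ l = over)
        (* counterclockwise, a crossing is positive if its over strand moves
           outwards with respect to the under strand *)
      & if s.2 then Derive r d < Derive r o else Derive r o < Derive r d].

Definition reads_word (m : nat) (r h : R -> R) (w : braid_word) : Prop :=
  exists tau : nat -> R,
    [/\ forall j, (j < size w)%N -> 0 < tau j < 1,
        forall j k, (j < k < size w)%N -> tau j < tau k,
        forall j, (j < size w)%N -> crossing_at m r h (tau j) (nth (sigma 0) w j)
      & forall u, 0 <= u < 1 ->
          (forall j, (j < size w)%N -> u <> tau j) ->
          injective (fun k : 'I_m => r (u + INR k))].

(* Closed braids are transverse knots for the rotationally symmetric contact
   form dw + rho^2 dtheta = dw + u dv - v du.  The map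
     (u, v, w) |-> (x, y, z) = (u, 2 v, w + u v)
   preserves orientation and pulls dz - y dx back to this form. *)
Definition braid_closure (m : nat) (w : braid_word) (T : curve) : Prop :=
  transverse T /\
  exists r h : R -> R,
    [/\ forall u, 0 < r u,
        forall t, let u := INR m * t in
          [/\ cx T t = r u * cos (2 * PI * u),
              cy T t = 2 * (r u * sin (2 * PI * u))
            & cz T t = h u + r u * cos (2 * PI * u) * (r u * sin (2 * PI * u))]
      & reads_word m r h w].

Definition beta (n : nat) : braid_word :=
  nseq (2 * n + 3) (sigma_inv 1) ++ [:: sigma 2] ++ nseq 3 (sigma 1)
    ++ [:: sigma 2].

(* Submission.v *)
From Stdlib Require Import Reals ZArith Lra Lia ClassicalEpsilon FunctionalExtensionality.
From Coquelicot Require Import Coquelicot.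
Require Import Defs.
From mathcomp Require Import all_boot all_fingroup.

Set Implicit Arguments.
Unset Strict Implicit.
Unset Printing Implicit Defensive.

(** With k = 2n + 3, the knot is represented by a grid of size k + 11 whose rows
    3, ..., k + 7 carry the crossings of the word, each by one horizontal edge;
    all columns but three are followed upwards.  The corners at which the
    vertical direction is reversed have their horizontal edge outside of the rest
    of the diagram.  Tilting the front slightly there and making the slope
    coordinate y very large, positive on descending and negative on ascending
    parts, turns the push-off of the Legendrian knot into a closed 3-braid through
    transverse knots.  A closed braid remains transverse when its radii and
    heights are deformed, provided that the order of the heights at the double
    points of its projection is kept; since the grid and the word give
    the same order of the strands between crossings and the same over strands,
    linear interpolations join this closed braid to the given one.

    For the invariant, let y_I, for a set I of integers in [1, k] without
    consecutive elements, be obtained from x^+ by cyclic permutations of three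
    values, one for each element of I, starting with the largest one.  The
    rectangles without X and O that end in y_I correspond to the i in [1, k] with
    no neighbour in I, and they start at a generator that does not change when i is
    added to I or removed from it.  Hence the sum over I of the constant terms of
    the coefficients at y_I vanishes modulo 2 on boundaries and on multiples of
    U_i, while its value on x^+ is 1. *)

Local Open Scope R_scope.

(** All isotopies are explicit formulas, so that transversality is an inequality between derivatives
    and embeddedness is checked at the double points of a planar projection. The obstacle to the
    push-off are the cusps: lowering the slope y by s times the speed X of the x-coordinate gives
    the contact form the value s X^2, which vanishes there, and the tilt supplies the missing
    positive term. The word orders the strands by their radii, whereas the columns of the grid order
    them by their heights. Therefore the given braid is first squeezed into a thin tube, whose
    cross-section can be turned by a quarter turn; this exchanges the two roles. A horizontal edge
    between ascending columns is the outermost strand at its middle, and this is how it becomes the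
    over strand of a letter. On the algebraic side, the functional is a cocycle for the complex in
    which all [U_i] are 0, which treats all choices of [i] at once. The y_I arise by cancellation: a
    rectangle ending in x^+ has to be compensated by another one with the same initial generator,
    whose end then joins the family. *)

(** * Smooth functions of a real variable *)

Fixpoint Ck (k : nat) (f : R -> R) : Prop :=
  match k with
  | 0 => True
  | k'.+1 => (forall t, ex_derive f t) /\ Ck k' (Derive f)
  end.

Lemma ex_derive_n_Derive f k t :
  ex_derive_n (Derive f) k.+1 t <-> ex_derive_n f k.+2 t.
Proof.
have H u : Derive_n (Derive f) k u = Derive_n f k.+1 u.
  by rewrite -[Derive f]/(Derive_n f 1) Derive_n_comp; congr Derive_n; lia.
rewrite /=; split; apply: ex_derive_ext => u; rewrite H //.
Qed.

(** Differentiating from the inside, as [Ck] does, allows closure under products, composition and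
    inverses to be proved by induction on the order, with the first-order rules only. *)
Lemma smoothP f : smooth f <-> forall k, Ck k f.
Proof.
split.
  move=> H k; elim: k f H => [|k IH] f H //=; split; first exact: (H 1%N).
  apply: IH => -[|j] t //; exact/ex_derive_n_Derive.
move=> H k; move: (H k); elim: k f {H} => [|k IH] f //= [H1 H2] t.
case: k IH H2 => [|k] IH H2; first exact: H1.
exact/ex_derive_n_Derive/IH.
Qed.

Lemma CkS k f : Ck k.+1 f -> Ck k f.
Proof.
elim: k f => [|k IH] f //= [H1 [H2 H3]]; split => //.
by apply: IH; split.
Qed.

Lemma Ck_const k c : Ck k (fun _ => c).
Proof.
elim: k c => [|k IH] c //=; split; first by move=> t; apply: ex_derive_const.
have -> : Derive (fun _ => c) = fun _ => 0.
  by apply: functional_extensionality => t; rewrite Derive_const.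
exact: IH.
Qed.

Lemma Ck_plus k f g : Ck k f -> Ck k g -> Ck k (fun t => f t + g t).
Proof.
elim: k f g => [|k IH] f g //= [F1 F2] [G1 G2]; split.
  by move=> t; apply: (ex_derive_plus f g).
have -> : Derive (fun t => f t + g t) = fun t => Derive f t + Derive g t.
  by apply: functional_extensionality => t; rewrite Derive_plus.
exact: IH.
Qed.

Lemma Ck_mult k f g : Ck k f -> Ck k g -> Ck k (fun t => f t * g t).
Proof.
elim: k f g => [|k IH] f g // F G.
have F0 := CkS F; have G0 := CkS G.
case: F G => [F1 F2] [G1 G2]; split.
  by move=> t; apply: ex_derive_mult.
have -> : Derive (fun t => f t * g t) =
          fun t => Derive f t * g t + f t * Derive g t.
  by apply: functional_extensionality => t; rewrite Derive_mult.
by apply: Ck_plus; apply: IH.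
Qed.

Lemma Ck_comp k f g : Ck k f -> Ck k g -> Ck k (fun t => f (g t)).
Proof.
elim: k f g => [|k IH] f g // F G.
have G0 := CkS G.
case: F G => [F1 F2] [G1 G2]; split.
  by move=> t; apply: ex_derive_comp.
have -> : Derive (fun t => f (g t)) = fun t => Derive g t * Derive f (g t).
  by apply: functional_extensionality => t; rewrite Derive_comp.
by apply: Ck_mult => //; apply: IH.
Qed.

Lemma Ck_inv k f : (forall t, f t <> 0) -> Ck k f -> Ck k (fun t => / f t).
Proof.
move=> f0; elim: k => [|k IH] // F.
have F0 := CkS F; case: F => [F1 F2]; split.
  by move=> t; apply: ex_derive_inv.
have -> : Derive (fun t => / f t) =
          fun t => (-1) * Derive f t * (/ f t * / f t).
  apply: functional_extensionality => t; rewrite Derive_inv //.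
  by field.
apply: Ck_mult; last by apply: Ck_mult; apply: IH.
by apply: Ck_mult => //; apply: Ck_const.
Qed.

Lemma smooth_antideriv F f :
  (forall t, is_derive F t (f t)) -> smooth f -> smooth F.
Proof.
move=> HF /smoothP Hf; apply/smoothP => -[|k] //=; split.
  by move=> t; exists (f t).
have -> // : Derive F = f.
by apply: functional_extensionality => t; apply: is_derive_unique.
Qed.

Lemma smooth_Derive f : smooth f -> smooth (Derive f).
Proof. by move=> /smoothP H; apply/smoothP => k; case: (H k.+1). Qed.

Lemma smooth_ex_derive f t : smooth f -> ex_derive f t.
Proof. by move=> H; apply: (H 1%N). Qed.

Lemma smooth_continuous f t : smooth f -> continuous f t.
Proof. by move=> H; apply: ex_derive_continuous; apply: smooth_ex_derive. Qed.

Lemma smooth_const c : smooth (fun _ => c).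
Proof. by apply/smoothP => k; apply: Ck_const. Qed.

Lemma smooth_id : smooth (fun t => t).
Proof.
apply: (@smooth_antideriv _ (fun _ => 1)); last exact: smooth_const.
by move=> t; apply: is_derive_id.
Qed.

Lemma smooth_plus f g : smooth f -> smooth g -> smooth (fun t => f t + g t).
Proof. by move=> /smoothP F /smoothP G; apply/smoothP => k; apply: Ck_plus. Qed.

Lemma smooth_mult f g : smooth f -> smooth g -> smooth (fun t => f t * g t).
Proof. by move=> /smoothP F /smoothP G; apply/smoothP => k; apply: Ck_mult. Qed.

Lemma smooth_opp f : smooth f -> smooth (fun t => - f t).
Proof.
move=> F; have -> : (fun t => - f t) = (fun t => (-1) * f t).
  by apply: functional_extensionality => t; ring.
by apply: smooth_mult => //; apply: smooth_const.
Qed.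

Lemma smooth_minus f g : smooth f -> smooth g -> smooth (fun t => f t - g t).
Proof. by move=> F G; apply: smooth_plus => //; apply: smooth_opp. Qed.

Lemma smooth_comp f g : smooth f -> smooth g -> smooth (fun t => f (g t)).
Proof. by move=> /smoothP F /smoothP G; apply/smoothP => k; apply: Ck_comp. Qed.

Lemma smooth_inv f : (forall t, f t <> 0) -> smooth f -> smooth (fun t => / f t).
Proof. by move=> f0 /smoothP F; apply/smoothP => k; apply: Ck_inv. Qed.

Lemma smooth_div f g :
  (forall t, g t <> 0) -> smooth f -> smooth g -> smooth (fun t => f t / g t).
Proof. by move=> g0 F G; apply: smooth_mult => //; apply: smooth_inv. Qed.

Lemma smooth_cos_sin : smooth cos /\ smooth sin.
Proof.
have H k : Ck k cos /\ Ck k sin.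
  elim: k => [|k [IH1 IH2]] //=; split; split.
  - by move=> t; exists (- sin t); apply: is_derive_cos.
  - have -> : Derive cos = fun t => (-1) * sin t.
      apply: functional_extensionality => t.
      by rewrite (is_derive_unique _ _ _ (is_derive_cos t)); ring.
    by apply: Ck_mult => //; apply: Ck_const.
  - by move=> t; exists (cos t); apply: is_derive_sin.
  - have -> // : Derive sin = cos.
    apply: functional_extensionality => t.
    by rewrite (is_derive_unique _ _ _ (is_derive_sin t)).
by split; apply/smoothP => k; case: (H k).
Qed.

Lemma smooth_cos f : smooth f -> smooth (fun t => cos (f t)).
Proof. by move=> F; apply: (smooth_comp (proj1 smooth_cos_sin)). Qed.

Lemma smooth_sin f : smooth f -> smooth (fun t => sin (f t)).
Proof. by move=> F; apply: (smooth_comp (proj2 smooth_cos_sin)). Qed.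

Lemma smooth_local f :
  (forall t, exists g, smooth g /\ locally t (fun u => g u = f u)) -> smooth f.
Proof.
move=> H k t; have [g [Sg E]] := H t.
exact: (ex_derive_n_ext_loc g).
Qed.

Ltac smo := repeat first
  [ assumption | apply: smooth_const | apply: smooth_id | apply: smooth_plus
  | apply: smooth_minus | apply: smooth_mult | apply: smooth_opp
  | apply: smooth_cos | apply: smooth_sin | apply: smooth_Derive ].

(** * A smooth step *)

(** The functions x^(-n) exp(-1/x), extended by 0, span a space that is stable under
    differentiation: the derivative of the n-th one is a combination of those of index n + 1 and n +
    2. A single induction then shows that all of them are smooth. *)
Definition flat (n : nat) (x : R) : R :=
  if Rle_dec x 0 then 0 else (/ x) ^ n * exp (- / x).

Lemma exp_pow z m : exp (INR m * z) = exp z ^ m.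
Proof.
elim: m => [|m IH]; first by rewrite Rmult_0_l exp_0.
by rewrite S_INR Rmult_plus_distr_r Rmult_1_l exp_plus IH /=; ring.
Qed.

(** The inequality t <= exp t at t = y / (m + 1), raised to the power m + 1. *)
Lemma pow_le_exp (y : R) (m : nat) :
  0 <= y -> y ^ m.+1 <= INR m.+1 ^ m.+1 * exp y.
Proof.
move=> y0; have m0 : 0 < INR m.+1 by apply: lt_0_INR; lia.
have -> : exp y = exp (y / INR m.+1) ^ m.+1.
  by rewrite -exp_pow; congr exp; field; lra.
rewrite -Rpow_mult_distr; apply: pow_incr; split => //.
have H : y / INR m.+1 <= exp (y / INR m.+1).
  by have := exp_ineq1_le (y / INR m.+1); lra.
have -> : y = INR m.+1 * (y / INR m.+1) by field; lra.
have E : INR m.+1 * (y / INR m.+1) / INR m.+1 = y / INR m.+1 by field; lra.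
by rewrite E; apply: Rmult_le_compat_l => //; lra.
Qed.

Lemma flat_ge0 n x : 0 <= flat n x.
Proof.
rewrite /flat; case: Rle_dec => H; first exact: Rle_refl.
apply: Rmult_le_pos; last exact/Rlt_le/exp_pos.
by apply: pow_le; apply/Rlt_le/Rinv_0_lt_compat; lra.
Qed.

Lemma flat_gt0 n x : 0 < x -> 0 < flat n x.
Proof.
move=> x0; rewrite /flat; case: Rle_dec => H; first lra.
apply: Rmult_lt_0_compat; last exact: exp_pos.
by apply: pow_lt; apply: Rinv_0_lt_compat.
Qed.

Lemma flat_eq0 n x : x <= 0 -> flat n x = 0.
Proof. by rewrite /flat; case: Rle_dec. Qed.

(** This is [pow_le_exp] at 1 / x. A quadratic bound makes the difference quotient at 0 tend to
    0. *)
Lemma flat_bound n x : flat n x <= INR n.+2 ^ n.+2 * x ^ 2.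
Proof.
have M0 : 0 <= INR n.+2 ^ n.+2 by apply: pow_le; apply: pos_INR.
rewrite /flat; case: Rle_dec => H.
  by apply: Rmult_le_pos => //; apply: pow2_ge_0.
have x0 : 0 < x by lra.
have H1 := @pow_le_exp (/ x) n.+1 (Rlt_le _ _ (Rinv_0_lt_compat _ x0)).
have E := exp_pos (- / x).
have H2 : (/ x) ^ n.+2 * exp (- / x) <= INR n.+2 ^ n.+2.
  apply: (Rle_trans _ (INR n.+2 ^ n.+2 * exp (/ x) * exp (- / x))).
    by apply: Rmult_le_compat_r => //; lra.
  rewrite Rmult_assoc -exp_plus.
  have -> : / x + - / x = 0 by ring.
  by rewrite exp_0; lra.
have -> : (/ x) ^ n * exp (- / x) = (/ x) ^ n.+2 * exp (- / x) * x ^ 2.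
  by rewrite /=; field; lra.
by apply: Rmult_le_compat_r => //; apply: pow2_ge_0.
Qed.

Lemma is_derive_flat n x :
  is_derive (flat n) x (- INR n * flat n.+1 x + flat n.+2 x).
Proof.
case: (total_order_T x 0) => [[xl|->]|xg].
- rewrite !flat_eq0 ?Rmult_0_r; try lra.
  rewrite Rplus_0_r; apply: (is_derive_ext_loc (fun _ => 0)); last first.
    exact: is_derive_const.
  have d0 : 0 < - x by lra.
  exists (mkposreal _ d0) => y; rewrite /ball /= /AbsRing_ball /abs /minus /plus /opp /= => By.
  by rewrite flat_eq0 //; move: (Rabs_def2 _ _ By); lra.
- rewrite !flat_eq0 ?Rmult_0_r ?Rplus_0_r; try lra.
  apply/is_derive_Reals => eps eps0.
  set M := INR n.+2 ^ n.+2.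
  have M0 : 0 < M by apply: pow_lt; apply: lt_0_INR; lia.
  have d0 : 0 < eps / M by apply: Rdiv_lt_0_compat.
  exists (mkposreal _ d0) => h h0 /= hd.
  rewrite Rplus_0_l (flat_eq0 _ (Rle_refl 0)) !Rminus_0_r.
  rewrite Rabs_div // (Rabs_pos_eq (flat n h)); last exact: flat_ge0.
  have ha : 0 < Rabs h by apply: Rabs_pos_lt.
  apply: (Rle_lt_trans _ (M * Rabs h)).
    apply/Rle_div_l => //; apply: (Rle_trans _ _ _ (flat_bound n h)).
    rewrite -/M -pow2_abs; apply: Req_le; ring.
  have -> : eps = M * (eps / M) by field; lra.
  exact: Rmult_lt_compat_l.
- have -> : - INR n * flat n.+1 x + flat n.+2 x =
            (- INR n * (/ x) ^ n.+1 + (/ x) ^ n.+2) * exp (- / x).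
    by rewrite /flat; case: Rle_dec => H; [lra | rewrite Rmult_plus_distr_r Rmult_assoc].
  apply: (is_derive_ext_loc (fun x => (/ x) ^ n * exp (- / x))).
    exists (mkposreal _ xg) => y; rewrite /ball /= /AbsRing_ball /abs /minus /plus /opp /= => By.
    rewrite /flat; case: Rle_dec => // H.
    by move: (Rabs_def2 _ _ By); lra.
  have D1 : is_derive (fun x => exp (- / x)) x (/ x ^ 2 * exp (- / x)).
    by auto_derive; [lra | field; lra].
  have D2 : is_derive (fun x => (/ x) ^ n) x (- INR n * (/ x) ^ n.+1).
    have D3 : is_derive (fun x => / x) x (- / x ^ 2).
      by auto_derive; [lra | field; lra].
    have := is_derive_pow (fun x => / x) n x _ D3.
    congr is_derive; case: n {D1 D3} => [|n]; first by rewrite /=; ring.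
    by rewrite /=; field; lra.
  have := is_derive_mult _ _ _ _ _ D2 D1 Rmult_comm.
  congr is_derive; rewrite /mult /plus /=.
  by rewrite /=; field; lra.
Qed.

Lemma smooth_flat n : smooth (flat n).
Proof.
apply/smoothP => k; elim: k n => [|k IH] n //=; split.
  by move=> t; exists (- INR n * flat n.+1 t + flat n.+2 t); apply: is_derive_flat.
have -> : Derive (flat n) = fun t => - INR n * flat n.+1 t + flat n.+2 t.
  by apply: functional_extensionality => t; apply/is_derive_unique/is_derive_flat.
by apply: Ck_plus => //; apply: Ck_mult => //; apply: Ck_const.
Qed.

Definition step_den (x : R) := flat 0 (x + 1/4) + flat 0 (1/4 - x).
(** The transition takes place in [-1/4, 1/4]. The symmetric form of the quotient gives the value
    1/2 exactly at 0, so that cusps fall on the times of corners, and it balances the rounding of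
    corners in [corner_gain]. *)
Definition step (x : R) : R := flat 0 (x + 1/4) / step_den x.
Definition dstep : R -> R := Derive step.

Lemma step_den_gt0 x : 0 < step_den x.
Proof.
rewrite /step_den; have H1 := flat_ge0 0 (x + 1/4).
have H2 := flat_ge0 0 (1/4 - x).
case: (Rlt_le_dec 0 (x + 1/4)) => H.
  by have := flat_gt0 0 H; lra.
have : 0 < flat 0 (1/4 - x) by apply: flat_gt0; lra.
lra.
Qed.

Lemma smooth_step : smooth step.
Proof.
have S1 : smooth (fun x => flat 0 (x + 1/4)).
  by apply: (smooth_comp (@smooth_flat 0)); smo.
have S2 : smooth (fun x => flat 0 (1/4 - x)).
  by apply: (smooth_comp (@smooth_flat 0)); smo.
apply: smooth_div => //; last by apply: smooth_plus.
by move=> t; have := step_den_gt0 t; lra.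
Qed.

Lemma step0 x : x <= -1/4 -> step x = 0.
Proof. by move=> H; rewrite /step flat_eq0 /Rdiv ?Rmult_0_l //; lra. Qed.

Lemma step1 x : 1/4 <= x -> step x = 1.
Proof.
move=> H; have := step_den_gt0 x; rewrite /step /step_den.
rewrite (@flat_eq0 _ (1/4 - x)); last lra.
by rewrite Rplus_0_r => H1; field; lra.
Qed.

Lemma step_sym x : step (- x) = 1 - step x.
Proof.
have := step_den_gt0 x; rewrite /step /step_den.
have -> : 1/4 - - x = x + 1/4 by ring.
have -> : - x + 1/4 = 1/4 - x by ring.
by move=> H; field; lra.
Qed.

Lemma step_half : step 0 = 1/2.
Proof. by have := step_sym 0; rewrite Ropp_0; lra. Qed.

Lemma dstep_eq x : is_derive step x
  ((flat 2 (x + 1/4) * flat 0 (1/4 - x) + flat 0 (x + 1/4) * flat 2 (1/4 - x))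
   / step_den x ^ 2).
Proof.
have d0 := step_den_gt0 x.
have A : is_derive (fun x => flat 0 (x + 1/4)) x (flat 2 (x + 1/4)).
  have D := is_derive_flat 0 (x + 1/4).
  have I : is_derive (fun x => x + 1/4) x 1 by auto_derive; [done | ring].
  have := is_derive_comp _ _ _ _ _ D I; congr is_derive.
  by rewrite /scal /= /mult /=; ring.
have B : is_derive (fun x => flat 0 (1/4 - x)) x (- flat 2 (1/4 - x)).
  have D := is_derive_flat 0 (1/4 - x).
  have I : is_derive (fun x => 1/4 - x) x (-1) by auto_derive; [done | ring].
  have := is_derive_comp _ _ _ _ _ D I; congr is_derive.
  by rewrite /scal /= /mult /=; ring.
have C := is_derive_plus _ _ _ _ _ A B.
have d1 : step_den x <> 0 by lra.
have := is_derive_div _ _ _ _ _ A C d1; congr is_derive.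
by rewrite /plus /= /step_den; field; move: d1; rewrite /step_den; lra.
Qed.

Lemma dstep_ge0 x : 0 <= dstep x.
Proof.
rewrite /dstep (is_derive_unique _ _ _ (dstep_eq x)).
have d0 := step_den_gt0 x.
apply: Rmult_le_pos; last by apply/Rlt_le/Rinv_0_lt_compat/pow_lt.
by apply: Rplus_le_le_0_compat; apply: Rmult_le_pos; apply: flat_ge0.
Qed.

Lemma dstep_gt0 x : -1/4 < x < 1/4 -> 0 < dstep x.
Proof.
move=> H; rewrite /dstep (is_derive_unique _ _ _ (dstep_eq x)).
have d0 := step_den_gt0 x.
apply: Rdiv_lt_0_compat; last exact: pow_lt.
by apply: Rplus_lt_0_compat; apply: Rmult_lt_0_compat; apply: flat_gt0; lra.
Qed.

Lemma dstep_eq0 x : 1/4 <= Rabs x -> dstep x = 0.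
Proof.
rewrite /dstep (is_derive_unique _ _ _ (dstep_eq x)).
rewrite /Rabs; case: Rcase_abs => H1 H2.
  by rewrite !(@flat_eq0 _ (x + 1/4)) /Rdiv; try lra; ring.
by rewrite !(@flat_eq0 _ (1/4 - x)) /Rdiv; try lra; ring.
Qed.

Lemma is_derive_step x : is_derive step x (dstep x).
Proof. by apply/Derive_correct/smooth_ex_derive/smooth_step. Qed.

Lemma smooth_dstep : smooth dstep.
Proof. exact/smooth_Derive/smooth_step. Qed.

(** * Monotonicity *)

Lemma incr_le (f df : R -> R) (a b : R) :
  (forall t, a <= t <= b -> is_derive f t (df t)) ->
  (forall t, a < t < b -> 0 <= df t) ->
  a <= b -> f a <= f b.
Proof.
move=> D P ab; have [<-|H] := Req_dec a b; first lra.
have [||c [E Hc]] := @MVT_cor2 f df a b; first lra.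
  by move=> t Ht; apply/is_derive_Reals/D.
have H1 : 0 <= b - a by lra.
by have := Rmult_le_pos _ _ (P c Hc) H1; lra.
Qed.

Lemma incr_lt (f df : R -> R) (a b : R) :
  (forall t, a <= t <= b -> is_derive f t (df t)) ->
  (forall t, a < t < b -> 0 < df t) ->
  a < b -> f a < f b.
Proof.
move=> D P ab; have [||c [E Hc]] := @MVT_cor2 f df a b => //.
  by move=> t Ht; apply/is_derive_Reals/D.
have H1 : 0 < b - a by lra.
by have := Rmult_lt_0_compat _ _ (P c Hc) H1; lra.
Qed.

Lemma step_lt x y : -1/4 <= x -> x < y -> y <= 1/4 -> step x < step y.
Proof.
move=> Hx xy Hy; apply: (@incr_lt step dstep) => // t Ht.
  exact: is_derive_step.
by apply: dstep_gt0; lra.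
Qed.

Lemma step_le x y : x <= y -> step x <= step y.
Proof.
move=> xy; apply: (@incr_le step dstep) => // t Ht.
  exact: is_derive_step.
exact: dstep_ge0.
Qed.

Lemma step_bounds x : 0 <= step x <= 1.
Proof.
split.
  have H := @step_le (Rmin x (-1/4)) x (Rmin_l _ _).
  by rewrite step0 in H => //; apply: Rmin_r.
have H := @step_le x (Rmax x (1/4)) (Rmax_l _ _).
by rewrite (@step1 (Rmax _ _)) in H => //; apply: Rmax_r.
Qed.

Global Opaque step dstep.

Ltac smo ::= repeat first
  [ assumption | apply: smooth_step | apply: smooth_dstep
  | apply: (smooth_comp smooth_step) | apply: (smooth_comp smooth_dstep)
  | apply: smooth_const | apply: smooth_id | apply: smooth_plus
  | apply: smooth_minus | apply: smooth_mult | apply: smooth_opp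
  | apply: smooth_cos | apply: smooth_sin | apply: smooth_Derive ].

(** * Families of curves *)

(** Smoothness is asked in the time only. In the parameter, continuity is enough for isotopies and
    admits piecewise linear parameters. *)
Definition smooth_family (f : R -> R -> R) : Prop :=
  (forall s, smooth (f s)) /\ C1_family f.

Lemma continuity_2d_fst (p : R -> R) s t :
  continuity_pt p s -> continuity_2d_pt (fun s _ => p s) s t.
Proof.
by move=> H; apply: (continuity_1d_2d_pt_comp p (fun s _ => s)) => //; apply: continuity_2d_pt_id1.
Qed.

Lemma continuity_2d_snd (p : R -> R) s t :
  continuity_pt p t -> continuity_2d_pt (fun _ t => p t) s t.
Proof.
by move=> H; apply: (continuity_1d_2d_pt_comp p (fun _ t => t)) => //; apply: continuity_2d_pt_id2.
Qed.

Lemma ex_derive_continuity_pt (f : R -> R) t : ex_derive f t -> continuity_pt f t.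
Proof. by move=> H; apply/continuity_pt_filterlim/(ex_derive_continuous f). Qed.

Lemma smooth_continuity_pt f t : smooth f -> continuity_pt f t.
Proof. by move=> H; apply/continuity_pt_filterlim/smooth_continuous. Qed.

Lemma sf_static g : smooth g -> smooth_family (fun _ => g).
Proof.
move=> G; split=> // s t; split; apply: continuity_2d_snd; apply: smooth_continuity_pt => //.
exact: smooth_Derive.
Qed.

Lemma sf_param p : (forall s, continuity_pt p s) -> smooth_family (fun s _ => p s).
Proof.
move=> P; split=> [s|s t]; first exact: smooth_const.
split; first exact: continuity_2d_fst.
apply: (continuity_2d_pt_ext (fun _ _ => 0)) => [x y|]; first by rewrite Derive_const.
exact: continuity_2d_pt_const.
Qed.

Lemma sf_plus f g : smooth_family f -> smooth_family g ->
  smooth_family (fun s t => f s t + g s t).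
Proof.
move=> [F F'] [G G']; split=> [s|s t]; first exact: smooth_plus.
have [F1 F2] := F' s t; have [G1 G2] := G' s t.
split; first exact: continuity_2d_pt_plus.
apply: (continuity_2d_pt_ext (fun s t => Derive (f s) t + Derive (g s) t)) => [x y|].
  by rewrite Derive_plus //; apply: smooth_ex_derive.
exact: continuity_2d_pt_plus.
Qed.

Lemma sf_mult f g : smooth_family f -> smooth_family g ->
  smooth_family (fun s t => f s t * g s t).
Proof.
move=> [F F'] [G G']; split=> [s|s t]; first exact: smooth_mult.
have [F1 F2] := F' s t; have [G1 G2] := G' s t.
split; first exact: continuity_2d_pt_mult.
apply: (continuity_2d_pt_ext (fun s t => Derive (f s) t * g s t + f s t * Derive (g s) t)) => [x y|].
  by rewrite Derive_mult //; apply: smooth_ex_derive.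
by apply: continuity_2d_pt_plus; apply: continuity_2d_pt_mult.
Qed.

Lemma sf_const c : smooth_family (fun _ _ => c).
Proof. by apply: sf_static; apply: smooth_const. Qed.

Lemma sf_opp f : smooth_family f -> smooth_family (fun s t => - f s t).
Proof.
move=> F; have -> : (fun s t => - f s t) = (fun s t => (-1) * f s t).
  by apply: functional_extensionality => s; apply: functional_extensionality => t; ring.
by apply: sf_mult => //; apply: sf_const.
Qed.

Lemma sf_minus f g : smooth_family f -> smooth_family g ->
  smooth_family (fun s t => f s t - g s t).
Proof. by move=> F G; apply: sf_plus => //; apply: sf_opp. Qed.

Lemma sf_comp (h : R -> R) f : smooth h -> smooth_family f ->
  smooth_family (fun s t => h (f s t)).
Proof.
move=> S [F F']; split=> [s|s t]; first exact: smooth_comp.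
have [F1 F2] := F' s t.
split; first by apply: continuity_1d_2d_pt_comp => //; apply: smooth_continuity_pt.
apply: (continuity_2d_pt_ext (fun s t => Derive (f s) t * Derive h (f s t))) => [x y|].
  by rewrite (Derive_comp h (f x)) //; apply: smooth_ex_derive.
apply: continuity_2d_pt_mult => //.
apply: continuity_1d_2d_pt_comp => //; apply: smooth_continuity_pt.
exact: smooth_Derive.
Qed.

Lemma sf_inv f : (forall s t, f s t <> 0) -> smooth_family f ->
  smooth_family (fun s t => / f s t).
Proof.
move=> f0 [F F']; split=> [s|s t]; first exact: smooth_inv.
have [F1 F2] := F' s t.
split; first exact: continuity_2d_pt_inv.
apply: (continuity_2d_pt_ext (fun s t => - Derive (f s) t * (/ f s t * / f s t))) => [x y|].
  rewrite Derive_inv //; last by apply: smooth_ex_derive.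
  by field.
apply: continuity_2d_pt_mult; first exact: continuity_2d_pt_opp.
by apply: continuity_2d_pt_mult; apply: continuity_2d_pt_inv.
Qed.

Lemma sf_div f g : (forall s t, g s t <> 0) -> smooth_family f -> smooth_family g ->
  smooth_family (fun s t => f s t / g s t).
Proof. by move=> g0 F G; apply: sf_mult => //; apply: sf_inv. Qed.

(** [C1_family] speaks of all real parameters, while the isotopies are controlled on [0, 1] only.
    Freezing the parameter outside of this interval keeps denominators away from 0 and allows
    concatenation. *)
Definition clamp (s : R) : R := Rmax 0 (Rmin 1 s).

Lemma clampP s :
  [\/ s <= 0 /\ clamp s = 0, 0 <= s <= 1 /\ clamp s = s | 1 <= s /\ clamp s = 1].
Proof.
rewrite /clamp /Rmin; case: Rle_dec => H.
  by constructor 3; split=> //; rewrite Rmax_right; lra.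
by rewrite /Rmax; case: Rle_dec => ?; [constructor 2 | constructor 1]; lra.
Qed.

Lemma continuity_clamp s : continuity_pt clamp s.
Proof.
rewrite continuity_pt_locally => eps; exists eps => t Ht.
have {Ht} := Rabs_def2 _ _ Ht; rewrite /minus /plus /opp /= => -[H1 H2].
by apply: Rabs_def1; case: (clampP s) => -[? ->]; case: (clampP t) => -[? ->]; lra.
Qed.

Lemma clamp_bounds s : 0 <= clamp s <= 1.
Proof. by case: (clampP s) => -[? ->]; lra. Qed.

Lemma clamp_id s : 0 <= s <= 1 -> clamp s = s.
Proof. by case: (clampP s) => -[? ->]; lra. Qed.

Lemma clamp0 : clamp 0 = 0. Proof. by apply: clamp_id; lra. Qed.
Lemma clamp1 : clamp 1 = 1. Proof. by apply: clamp_id; lra. Qed.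

Lemma sf_clamp : smooth_family (fun s _ => clamp s).
Proof. by apply: sf_param => s; apply: continuity_clamp. Qed.

Lemma sf_param_id : smooth_family (fun s _ => s).
Proof. by apply: (@sf_param (fun s => s)) => s; apply: continuity_pt_id. Qed.

Ltac smf := repeat first
  [ assumption | apply: sf_const | apply: sf_clamp | apply: sf_param_id | apply: sf_plus
  | apply: sf_minus | apply: sf_mult | apply: sf_opp | apply: sf_static
  | apply: (sf_comp (proj1 smooth_cos_sin)) | apply: (sf_comp (proj2 smooth_cos_sin))].

(** * Transverse isotopies *)

Definition periodic (f : R -> R) : Prop := forall t, f (t + 1) = f t.

Definition cform (x y z : R -> R) (t : R) : R := Derive z t - y t * Derive x t.

Definition embedded (x y z : R -> R) : Prop :=
  forall t u, x t = x u -> y t = y u -> z t = z u -> exists n : Z, u = t + IZR n.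

(** Where the contact form is positive, the velocity cannot vanish. *)
Lemma transverseI x y z :
  smooth x -> smooth y -> smooth z ->
  periodic x -> periodic y -> periodic z ->
  (forall t, 0 < cform x y z t) -> embedded x y z ->
  transverse (Curve x y z).
Proof.
move=> Sx Sy Sz Px Py Pz A E; split=> //; split=> //=.
- move=> t [X _ Z]; have := A t; rewrite /cform X Z; lra.
- move=> t u Ht Hu H1 H2 H3; have [n Hn] := E t u H1 H2 H3.
  have n0 : (n = 0)%Z.
    have : (-1 < n < 1)%Z by split; apply: lt_IZR; lra.
    lia.
  by rewrite Hn n0 Rplus_0_r.
Qed.

Lemma periodicZ f : periodic f -> forall t (n : Z), f (t + IZR n) = f t.
Proof.
move=> P t n; have H (m : nat) u : f (u + INR m) = f u.
  elim: m u => [|m IH] u; first by rewrite Rplus_0_r.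
  by rewrite S_INR -Rplus_assoc P IH.
case: (Z.le_gt_cases 0 n) => Hn.
  by rewrite -(Z2Nat.id n) // -INR_IZR_INZ H.
rewrite -(H (Z.to_nat (- n)) (t + _)) INR_IZR_INZ Z2Nat.id; last lia.
by congr f; rewrite opp_IZR; ring.
Qed.

Lemma transverse_embedded T : transverse T -> embedded (cx T) (cy T) (cz T).
Proof.
move=> [[_ P _ E] _] t u H1 H2 H3.
have Px : periodic (cx T) by move=> v; case: (P v).
have Py : periodic (cy T) by move=> v; case: (P v).
have Pz : periodic (cz T) by move=> v; case: (P v).
have F v : exists n : Z, 0 <= v + IZR n < 1.
  exists (- Int_part v)%Z; rewrite opp_IZR.
  by have [] := base_Int_part v; lra.
have [n Hn] := F t; have [m Hm] := F u.
have := E _ _ Hn Hm; rewrite !periodicZ // => /(_ H1 H2 H3) H.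
by exists (n - m)%Z; rewrite minus_IZR; lra.
Qed.

Lemma curve_eta T : T = Curve (cx T) (cy T) (cz T).
Proof. by case: T. Qed.

Lemma transverse_isotopicI (X Y Z : R -> R -> R) :
  smooth_family X -> smooth_family Y -> smooth_family Z ->
  (forall s, 0 <= s <= 1 -> transverse (Curve (X s) (Y s) (Z s))) ->
  transverse_isotopic (Curve (X 0) (Y 0) (Z 0)) (Curve (X 1) (Y 1) (Z 1)).
Proof.
move=> [_ X2] [_ Y2] [_ Z2] H.
by exists (fun s => Curve (X s) (Y s) (Z s)); split.
Qed.

Lemma transverse_isotopic_trans T1 T2 T3 :
  transverse_isotopic T1 T2 -> transverse_isotopic T2 T3 -> transverse_isotopic T1 T3.
Proof.
move=> [H [[CX CY CZ] HT H0 H1]] [H' [[CX' CY' CZ'] HT' H0' H1']].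
pose p s := clamp (2 * s); pose q s := clamp (2 * s - 1).
have Kp s : continuity_pt p s.
  apply: (continuity_pt_comp (fun s => 2 * s) clamp); last exact: continuity_clamp.
  by apply: ex_derive_continuity_pt; auto_derive.
have Kq s : continuity_pt q s.
  apply: (continuity_pt_comp (fun s => 2 * s - 1) clamp); last exact: continuity_clamp.
  by apply: ex_derive_continuity_pt; auto_derive.
pose J s := if Rle_dec s (1/2) then H (p s) else H' (q s).
exists J; rewrite /J; split; last first.
- case: Rle_dec => ?; first lra; rewrite /q.
  have -> : 2 * 1 - 1 = 1 by ring.
  by rewrite clamp1.
- case: Rle_dec => ?; last lra; by rewrite /p Rmult_0_r clamp0.
- move=> s Hs; case: Rle_dec => ?; [apply: HT | apply: HT']; exact: clamp_bounds.
have glue (c : curve -> R -> R) :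
  C1_family (fun s => c (H s)) -> C1_family (fun s => c (H' s)) ->
  C1_family (fun s => c (if Rle_dec s (1/2) then H (p s) else H' (q s))).
  move=> C C'.
  have L (g : curve -> R -> R) :
    (forall s t, continuity_2d_pt (fun s t => g (H s) t) s t) ->
    (forall s t, continuity_2d_pt (fun s t => g (H' s) t) s t) ->
    forall s t, continuity_2d_pt (fun s t => g (if Rle_dec s (1/2) then H (p s) else H' (q s)) t) s t.
    move=> G G' s t.
    (* On either half one of [p] and [q] is constant, so that one of the first two terms equals
       [g (H 1) t] and cancels against the last one. The sum is continuous without any distinction
       of cases. *)
    apply: (continuity_2d_pt_ext (fun s t => g (H (p s)) t + g (H' (q s)) t - g (H 1) t)).
      move=> u v; case: Rle_dec => Hu.
        have -> : q u = 0 by rewrite /q; case: (clampP (2 * u - 1)) => -[? ->]; lra.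
        by rewrite H0' H1 /=; ring.
      have -> : p u = 1 by rewrite /p; case: (clampP (2 * u)) => -[? ->]; lra.
      by rewrite /=; ring.
    have par (r : R -> R) h : continuity_pt r s ->
      continuity_2d_pt h (r s) t -> continuity_2d_pt (fun s t => h (r s) t) s t.
      move=> P K eps; have [d Hd] := K eps.
      move: P; rewrite continuity_pt_locally => /(_ d) [d' Hd'].
      exists (mkposreal _ (Rmin_stable_in_posreal d d')) => u v /= Hu Hv.
      apply: Hd; last exact: (Rlt_le_trans _ _ _ Hv (Rmin_l _ _)).
      by apply: Hd'; apply: (Rlt_le_trans _ _ _ Hu (Rmin_r _ _)).
    apply: continuity_2d_pt_minus; first apply: continuity_2d_pt_plus.
    - exact: (par p (fun s t => g (H s) t)).
    - exact: (par q (fun s t => g (H' s) t)).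
    - apply: (par (fun _ => 1) (fun s t => g (H s) t)) => //.
      exact: continuity_pt_const.
  move=> s t; split; first by apply: L => a b; [case: (C a b) | case: (C' a b)].
  apply: (L (fun T => Derive (c T))) => a b; [by case: (C a b) | by case: (C' a b)].
by split; apply: glue.
Qed.

(** * Interpolation of integer sequences *)

Definition near_int (u : R) : Z := Int_part (u + 1/2).

(* The value is [v j] for u in [j + 1/4, j + 3/4]. *)
Definition interp (v : Z -> R) (u : R) : R :=
  let j := near_int u in v (j - 1)%Z + (v j - v (j - 1)%Z) * step (u - IZR j).

Lemma near_intP u : - (1/2) <= u - IZR (near_int u) < 1/2.
Proof. by rewrite /near_int; have [] := base_Int_part (u + 1/2); lra. Qed.

(** [step] is constant beyond 1/4, so that the formulas belonging to neighbouring integers agree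
    where their windows of radius 3/4 overlap. *)
Lemma interp_near v u j : Rabs (u - IZR j) <= 3/4 ->
  interp v u = v (j - 1)%Z + (v j - v (j - 1)%Z) * step (u - IZR j).
Proof.
move=> H; have {H} [H1 H2] : - (3/4) <= u - IZR j <= 3/4.
  by move: H; rewrite /Rabs; case: Rcase_abs; lra.
rewrite /interp; have := near_intP u; set i := near_int u => Hi.
have : (-2 < i - j < 2)%Z by split; apply: lt_IZR; rewrite minus_IZR; lra.
move=> Hij; have : (i = j \/ i = j + 1 \/ i = j - 1)%Z by lia.
case=> [->|[E|E]] //; rewrite E in Hi *.
- rewrite plus_IZR in Hi *; have -> : (j + 1 - 1 = j)%Z by lia.
  by rewrite (@step0 (u - (_ + _))) ?(@step1 (u - IZR j)); lra.
- rewrite minus_IZR in Hi *.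
  by rewrite (@step1 (u - (_ - _))) ?(@step0 (u - IZR j)); lra.
Qed.

Lemma interp_flat v u j : IZR j + 1/4 <= u <= IZR j + 3/4 -> interp v u = v j.
Proof.
move=> H; rewrite (@interp_near _ _ j); first by rewrite step1; lra.
by rewrite Rabs_pos_eq; lra.
Qed.

Lemma locally_Rabs (x e : R) (Q : R -> Prop) :
  0 < e -> (forall y, Rabs (y - x) < e -> Q y) -> locally x Q.
Proof. by move=> e0 H; exists (mkposreal _ e0). Qed.

Lemma is_derive_eq (f : R -> R) (t l m : R) : is_derive f t l -> l = m -> is_derive f t m.
Proof. by move=> D <-. Qed.

Lemma is_derive_affine (f : R -> R) (a c t l : R) :
  is_derive f (a * t + c) l -> is_derive (fun t => f (a * t + c)) t (a * l).
Proof.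
move=> D; apply: (is_derive_comp f (fun t => a * t + c)) => //.
by auto_derive; [done | ring].
Qed.

Lemma is_derive_shift (f : R -> R) (c t l : R) :
  is_derive f (t + c) l -> is_derive (fun t => f (t + c)) t l.
Proof.
move=> D; rewrite -[l]Rmult_1_l.
apply: (is_derive_ext (fun t => f (1 * t + c))) => [x|]; first by rewrite Rmult_1_l.
by apply: is_derive_affine; rewrite Rmult_1_l.
Qed.

Lemma is_derive_lin (f : R -> R) (c k t l : R) :
  is_derive f t l -> is_derive (fun t => c + k * f t) t (k * l).
Proof.
move=> D; have K := is_derive_scal _ _ k _ D.
have := is_derive_plus _ _ _ _ _ (is_derive_const c t) K; congr is_derive.
by rewrite /plus /zero /=; ring.
Qed.

Lemma is_derive_lin2 (f : R -> R) (c k t l : R) :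
  is_derive f t l -> is_derive (fun t => c * t + k * f t) t (c + k * l).
Proof.
move=> D; have K := is_derive_scal _ _ k _ D.
have I : is_derive (fun t => c * t) t c by auto_derive; [done | ring].
exact: (is_derive_plus _ _ _ _ _ I K).
Qed.

Lemma is_derive_lin3 (f g : R -> R) (c k t l m : R) :
  is_derive f t l -> is_derive g t m ->
  is_derive (fun t => c * f t + k * g t) t (c * l + k * m).
Proof.
move=> D E; have K := is_derive_scal _ _ c _ D; have L := is_derive_scal _ _ k _ E.
exact: (is_derive_plus _ _ _ _ _ K L).
Qed.

Lemma is_derive_interp v u j : Rabs (u - IZR j) < 3/4 ->
  is_derive (interp v) u ((v j - v (j - 1)%Z) * dstep (u - IZR j)).
Proof.
move=> H.
apply: (is_derive_ext_loc (fun u => v (j - 1)%Z + (v j - v (j - 1)%Z) * step (u - IZR j))).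
  apply: (@locally_Rabs _ (3/4 - Rabs (u - IZR j))) => [|y Hy]; first lra.
  rewrite (@interp_near _ _ j) //.
  have -> : y - IZR j = (y - u) + (u - IZR j) by ring.
  by have := Rabs_triang (y - u) (u - IZR j); lra.
have D : is_derive (fun u => step (u - IZR j)) u (dstep (u - IZR j)).
  exact: (is_derive_shift (is_derive_step (u - IZR j))).
exact: is_derive_lin.
Qed.

Lemma smooth_interp v : smooth (interp v).
Proof.
apply: smooth_local => t; set j := near_int t.
exists (fun u => v (j - 1)%Z + (v j - v (j - 1)%Z) * step (u - IZR j)); split.
  by smo.
apply: (@locally_Rabs _ (1/4)) => [|y Hy]; first lra.
rewrite (@interp_near _ _ j) //.
have := near_intP t; rewrite -/j => Hj.
by have {Hy} := Rabs_def2 _ _ Hy; move=> Hy; apply: Rabs_le; lra.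
Qed.

Lemma interp_shift v w u (p : Z) : (forall j, v (j + p)%Z = w j) ->
  interp v (u + IZR p) = interp w u.
Proof.
move=> H; have := near_intP u; set j := near_int u => Hj.
have A : Rabs (u - IZR j) <= 3/4 by apply: Rabs_le; lra.
have B : u + IZR p - IZR (j + p) = u - IZR j by rewrite plus_IZR; ring.
rewrite (@interp_near _ (u + _) (j + p)%Z) ?B // (@interp_near _ _ j) //.
have -> : (j + p - 1 = (j - 1) + p)%Z by lia.
by rewrite !H.
Qed.

Lemma interp_add v c u : interp (fun j => v j + c) u = interp v u + c.
Proof. by rewrite /interp; ring. Qed.

Lemma interp_range v (lo hi : R) u :
  (forall j, lo <= v j <= hi) -> lo <= interp v u <= hi.
Proof.
move=> H; rewrite /interp; set j := near_int u.
have := step_bounds (u - IZR j); set g := step _ => Hg.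
have H1 := H (j - 1)%Z; have H2 := H j.
have -> : v (j - 1)%Z + (v j - v (j - 1)%Z) * g = (1 - g) * v (j - 1)%Z + g * v j by ring.
by split; nra.
Qed.

(** * Antiderivatives *)

Lemma is_derive_prim f : smooth f -> forall x, is_derive (fun x => RInt f 0 x) x (f x).
Proof.
move=> S x; apply: (is_derive_RInt f _ 0).
  exists (mkposreal 1 Rlt_0_1) => y _; apply: RInt_correct.
  by apply: ex_RInt_continuous => z _; apply: smooth_continuous.
exact: smooth_continuous.
Qed.

Lemma deriv_le_lip (f df : R -> R) (c a b : R) :
  (forall t, a <= t <= b -> is_derive f t (df t)) ->
  (forall t, a <= t <= b -> Rabs (df t) <= c) ->
  a <= b -> Rabs (f b - f a) <= c * (b - a).
Proof.
move=> D H ab; apply: Rabs_le.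
have A t : a <= t <= b -> - c <= df t <= c.
  by move=> Ht; have := H t Ht; move/Rabs_le_between.
have H1 := @incr_le (fun t => c * t + (-1) * f t) (fun t => c + (-1) * df t) a b.
have H2 := @incr_le (fun t => c * t + 1 * f t) (fun t => c + 1 * df t) a b.
suff : c * a + (-1) * f a <= c * b + (-1) * f b /\ c * a + 1 * f a <= c * b + 1 * f b by lra.
split; [apply: H1|apply: H2] => // t Ht.
- exact/is_derive_lin2/D.
- by have := A t ltac:(lra); lra.
- exact/is_derive_lin2/D.
- by have := A t ltac:(lra); lra.
Qed.

Lemma deriv0_const (f : R -> R) (a b : R) :
  (forall t, a <= t <= b -> is_derive f t 0) -> a <= b -> f b = f a.
Proof.
move=> D ab; have := @deriv_le_lip f (fun _ => 0) 0 a b D.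
rewrite Rmult_0_l Rabs_R0 => /(_ (fun _ _ => Rle_refl 0) ab) H.
by have [K _] := Rabs_le_between (f b - f a) 0; have := K H; lra.
Qed.

(** An even function: its values at 1/4 and -1/4 agree, and subtracting a multiple of it does not
    affect the net change over a corner. *)
Definition wob (t : R) : R := RInt (fun t => step t - 1/2) 0 t.

Lemma is_derive_wob t : is_derive wob t (step t - 1/2).
Proof. by apply: is_derive_prim; smo; apply: smooth_step. Qed.

Lemma wob_even t : wob (- t) = wob t.
Proof.
have H t0 : is_derive (fun t => 1 * wob t + (-1) * wob ((-1) * t + 0)) t0 0.
  have D := @is_derive_affine wob (-1) 0 t0 _ (is_derive_wob _).
  apply: (is_derive_eq (is_derive_lin3 1 (-1) (is_derive_wob t0) D)).
  have -> : (-1) * t0 + 0 = - t0 by ring.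
  by rewrite step_sym; lra.
have K a b : a <= b -> wob b - wob (- b) = wob a - wob (- a).
  move=> ab; have := @deriv0_const _ a b (fun t _ => H t) ab.
  have N x : (-1) * x + 0 = - x by ring.
  by rewrite !N; lra.
have K0 : wob 0 - wob (- 0) = 0 by rewrite Ropp_0; ring.
by case: (Rle_lt_dec 0 t) => Ht; [have := K _ _ Ht | have := K _ _ (Rlt_le _ _ Ht)]; lra.
Qed.

(** * One coordinate of the front along the grid *)

(** The speed at which corners are rounded. It bounds the displacement at a corner by 1/16 and that
    over two units of time by 1/4, well below the distance of grid lines. *)
Definition slow : R := 1/8.

Definition moving (M : Z -> bool) (u : R) : R := interp (fun j => if M j then 1 else 0) u.

Lemma moving_bounds M u : 0 <= moving M u <= 1.
Proof. by apply: interp_range => j; case: (M j); lra. Qed.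

Lemma moving_flat M j u : IZR j + 1/4 <= u <= IZR j + 3/4 ->
  moving M u = if M j then 1 else 0.
Proof. exact: interp_flat. Qed.

(* A coordinate going from [C j] to [C (j + 1)] along the [j]-th edge, in the
   direction [sg j] if [j] is in [M], and constant otherwise.  The function [sf]
   is the direction of a slow motion, which rounds the corners. *)
Record coord_data (P : Z) (M : Z -> bool) (C : Z -> Z) (sf : R -> R) (sg : Z -> R) : Prop :=
  CoordData {
  cd_alt : forall j, M (j + 1)%Z = ~~ M j;
  cd_perM : forall j, M (j + P)%Z = M j;
  cd_perC : forall j, C (j + P)%Z = C j;
  cd_sg : forall j, sg j = 1 \/ sg j = -1;
  cd_rest : forall j, ~~ M j -> C (j + 1)%Z = C j;
  cd_move : forall j, M j -> 1 <= sg j * (IZR (C (j + 1)%Z) - IZR (C j));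
  cd_smooth : smooth sf;
  cd_persf : forall u, sf (u + IZR P) = sf u;
  cd_bound : forall u, -1 <= sf u <= 1;
  cd_flat : forall j u, M j -> IZR j + 1/4 <= u <= IZR j + 3/4 -> sf u = sg j;
  cd_corner : forall j, exists s0 s1, (s0 = 1 \/ s0 = -1) /\ (s1 = 1 \/ s1 = -1) /\
    (M j -> s1 = sg j) /\ (M (j - 1)%Z -> s0 = sg (j - 1)%Z) /\
    forall u, Rabs (u - IZR j) <= 1/4 -> sf u = s0 + (s1 - s0) * step (u - IZR j) }.

Section Coordinate.
Variables (P : Z) (M : Z -> bool) (C : Z -> Z) (sf : R -> R) (sg : Z -> R).
Hypothesis cd : coord_data P M C sf sg.
Let HM := cd_alt cd.
Let PM := cd_perM cd.
Let PC := cd_perC cd.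
Let sg1 := cd_sg cd.
Let Hrest := cd_rest cd.
Let Hmove := cd_move cd.

Definition base_speed (u : R) : R := slow * (sf u * moving M u).
Definition base (u : R) : R := RInt base_speed 0 u.
(** The middle of the edge at corner [j] along which the coordinate rests. The correction [bulk]
    makes the coordinate equal to [C j] there. *)
Definition rest_time (j : Z) : R := if M j then IZR j - 1/2 else IZR j + 1/2.
Definition bulk (j : Z) : R := IZR (C j) - base (rest_time j).
(** The integrated slow motion plus a fast one confined to the middle halves of the moving edges.
    The shift by 1/2 carries the transitions of [interp] from the corners to the midpoints of
    edges. *)
Definition coord (u : R) : R := base u + interp bulk (u + 1/2).

Lemma smooth_base_speed : smooth base_speed.
Proof.
apply: smooth_mult; first exact: smooth_const.
by apply: smooth_mult; [exact: (cd_smooth cd) | exact: smooth_interp].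
Qed.

Lemma is_derive_base u : is_derive base u (base_speed u).
Proof. exact/is_derive_prim/smooth_base_speed. Qed.

Lemma base_speed_bound u : Rabs (base_speed u) <= slow.
Proof.
have [H1 H2] := moving_bounds M u; have [H3 H4] := cd_bound cd u.
apply: Rabs_le; rewrite /base_speed /slow; split; nra.
Qed.

Lemma MP1 j : M (j - 1)%Z = ~~ M j.
Proof. by have := HM (j - 1)%Z; have -> : (j - 1 + 1 = j)%Z; [lia | move=> ->; rewrite negbK]. Qed.

Lemma bulk_rest j : ~~ M j -> bulk (j + 1)%Z = bulk j.
Proof.
move=> H; rewrite /bulk Hrest // /rest_time HM H (negbTE H) plus_IZR.
by congr (_ - base _); lra.
Qed.

(** The edge has length at least 1, and the slow motion between the two adjacent resting times,
    which are 2 apart, amounts to at most [2 * slow = 1/4]. *)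
Lemma bulk_move j : M j -> 3/4 <= sg j * (bulk (j + 1)%Z - bulk j).
Proof.
move=> H; have := Hmove H; rewrite /bulk /rest_time HM H /= plus_IZR.
have := @deriv_le_lip base base_speed slow (IZR j - 1/2) (IZR j + 1 + 1/2)
  (fun t _ => is_derive_base t) (fun t _ => base_speed_bound t) ltac:(lra).
set X := base _; set Y := base _; rewrite /slow => /Rabs_le_between HB.
by case: (sg1 j) => ->; lra.
Qed.

Lemma is_derive_coord u j : Rabs (u - IZR j - 1/2) < 3/4 ->
  is_derive coord u (base_speed u + (bulk (j + 1)%Z - bulk j) * dstep (u - IZR j - 1/2)).
Proof.
move=> H.
have E : u + 1/2 - IZR (j + 1) = u - IZR j - 1/2 by rewrite plus_IZR; lra.
have D : is_derive (fun u => interp bulk (u + 1/2)) u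
           ((bulk (j + 1)%Z - bulk j) * dstep (u - IZR j - 1/2)).
  have K := @is_derive_interp bulk (u + 1/2) (j + 1)%Z.
  rewrite E in K; have {}K := K H.
  by have := is_derive_shift K; have -> : (j + 1 - 1 = j)%Z by lia.
exact: (is_derive_plus _ _ _ _ _ (is_derive_base u) D).
Qed.

Lemma is_derive_coord_corner u j : Rabs (u - IZR j) <= 1/4 ->
  is_derive coord u (base_speed u).
Proof.
move=> /Rabs_le_between H; have [Hu|Hu] := Rle_lt_dec (IZR j) u.
  have := @is_derive_coord u j; rewrite (@dstep_eq0 (u - IZR j - 1/2)).
    by rewrite Rmult_0_r Rplus_0_r; apply; apply: Rabs_def1; lra.
  by rewrite Rabs_left; lra.
have := @is_derive_coord u (j - 1)%Z; rewrite minus_IZR (@dstep_eq0 (u - _ - 1/2)).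
  by rewrite Rmult_0_r Rplus_0_r; apply; apply: Rabs_def1; lra.
by rewrite Rabs_pos_eq; lra.
Qed.

Lemma smooth_coord : smooth coord.
Proof.
apply: smooth_plus; last by apply: (smooth_comp (smooth_interp bulk)); smo.
exact: (smooth_antideriv is_derive_base smooth_base_speed).
Qed.

Lemma base_speed_periodic u : base_speed (u + IZR P) = base_speed u.
Proof.
rewrite /base_speed /moving (cd_persf cd).
rewrite (@interp_shift _ (fun j => if M j then 1 else 0)) // => j.
by rewrite PM.
Qed.

(** The slow motion need not close up; what [base] gains over a period is exactly what [bulk]
    loses. *)
Lemma coord_periodic u : coord (u + IZR P) = coord u.
Proof.
have B x : base (x + IZR P) = base x + base (IZR P).
  have D t : is_derive (fun x => 1 * base (x + IZR P) + (-1) * base x) t 0.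
    apply: (is_derive_eq (is_derive_lin3 1 (-1)
      (is_derive_shift (is_derive_base (t + IZR P))) (is_derive_base t))).
    by rewrite base_speed_periodic; ring.
  have K a b : a <= b -> base (b + IZR P) - base b = base (a + IZR P) - base a.
    by move=> ab; have := @deriv0_const _ a b (fun t _ => D t) ab; lra.
  have B0 : base 0 = 0 by rewrite /base RInt_point.
  case: (Rle_lt_dec 0 x) => Hx; [have := K _ _ Hx | have := K _ _ (Rlt_le _ _ Hx)];
  rewrite Rplus_0_l B0; lra.
rewrite /coord B.
have -> : u + IZR P + 1/2 = (u + 1/2) + IZR P by ring.
rewrite (@interp_shift bulk (fun j => bulk j + - base (IZR P))).
  by rewrite interp_add; ring.
move=> j; rewrite /bulk PC /rest_time PM.
have -> : (if M j then IZR (j + P) - 1/2 else IZR (j + P) + 1/2) =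
          (if M j then IZR j - 1/2 else IZR j + 1/2) + IZR P.
  by rewrite plus_IZR; case: (M j); ring.
by rewrite B; ring.
Qed.

Lemma coord_rest j u : ~~ M j -> IZR j + 1/4 <= u <= IZR j + 3/4 -> coord u = IZR (C j).
Proof.
move=> H Hu; have D t : IZR j + 1/4 <= t <= IZR j + 3/4 -> is_derive coord t 0.
  move=> Ht; have := @is_derive_coord t j; rewrite bulk_rest // /base_speed.
  rewrite (moving_flat M Ht) (negbTE H).
  have -> : slow * (sf t * 0) + (bulk j - bulk j) * dstep (t - IZR j - 1/2) = 0 by ring.
  by apply; apply: Rabs_def1; lra.
have -> : coord u = coord (IZR j + 1/2).
  have [L|L] := Rle_lt_dec (IZR j + 1/2) u.
    by apply: (@deriv0_const coord) => // t Ht; apply: D; lra.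
  by symmetry; apply: (@deriv0_const coord); [move=> t Ht; apply: D|]; lra.
rewrite /coord (@interp_near _ _ (j + 1)%Z); last first.
  by apply: Rabs_le; rewrite plus_IZR; lra.
have -> : (j + 1 - 1 = j)%Z by lia.
by rewrite bulk_rest // /bulk /rest_time (negbTE H); ring.
Qed.

Lemma coord_corner j u : Rabs (u - IZR j) <= 1/4 -> Rabs (coord u - IZR (C j)) <= 1/16.
Proof.
move=> /Rabs_le_between Hu.
have L x y : IZR j - 1/4 <= x -> x <= y -> y <= IZR j + 1/4 -> Rabs (coord y - coord x) <= 1/16.
  move=> Hx xy Hy.
  suff : Rabs (coord y - coord x) <= slow * (y - x) by rewrite /slow; lra.
  apply: (@deriv_le_lip coord base_speed) => // t Ht; last exact: base_speed_bound.
  by apply: (@is_derive_coord_corner _ j); apply: Rabs_le; lra.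
case E: (M j).
  have H : ~~ M (j - 1)%Z by rewrite MP1 E.
  have <- : coord (IZR j - 1/4) = IZR (C j).
    rewrite (@coord_rest (j - 1)%Z) //; last by rewrite minus_IZR; lra.
    by have := Hrest H; have -> : (j - 1 + 1 = j)%Z; [lia | move=> ->].
  by apply: L; lra.
have <- : coord (IZR j + 1/4) = IZR (C j) by rewrite (@coord_rest j) ?E //; lra.
by rewrite Rabs_minus_sym; apply: L; lra.
Qed.

Lemma coord_speed j u : M j -> IZR j + 1/4 <= u <= IZR j + 3/4 ->
  exists2 l, is_derive coord u l & slow <= sg j * l.
Proof.
move=> H Hu; have D : Rabs (u - IZR j - 1/2) < 3/4 by apply: Rabs_def1; lra.
exists (base_speed u + (bulk (j + 1)%Z - bulk j) * dstep (u - IZR j - 1/2)).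
  exact: is_derive_coord.
have := bulk_move H; have := dstep_ge0 (u - IZR j - 1/2).
set X := dstep _; set Y := bulk _ - _ => HX HY.
rewrite /base_speed (moving_flat M Hu) H (cd_flat cd H Hu).
by case: (sg1 j) HY => ->; nra.
Qed.

(** With g = [step t], a reversed direction gives [slow] times (2 g - 1) g = (2 g - 1)^2 / 2 + (g -
    1/2) for the speed in direction [s1], and the last term integrates to 0 by symmetry. So the slow
    motion does not carry the coordinate beyond the end of an edge. *)
Lemma corner_gain (s0 s1 : R) (F : R -> R) :
  (s0 = 1 \/ s0 = -1) -> (s1 = 1 \/ s1 = -1) ->
  (forall t, Rabs t <= 1/4 ->
     is_derive F t (slow * ((s0 + (s1 - s0) * step t) * step t))) ->
  0 <= s1 * (F (1/4) - F (- (1/4))).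
Proof.
move=> H0 H1 D.
pose q t := s1 * F t + - slow * ((1 - s0 * s1) / 2) * wob t.
have I : q (- (1/4)) <= q (1/4).
  apply: (@incr_le q (fun t => s1 * (slow * ((s0 + (s1 - s0) * step t) * step t))
       + - slow * ((1 - s0 * s1) / 2) * (step t - 1/2))); last lra.
    move=> t Ht; apply: is_derive_lin3; last exact: is_derive_wob.
    by apply: D; apply: Rabs_le; lra.
  move=> t Ht; have := step_bounds t; set g := step t => Hg.
  have : 0 <= (2 * g - 1) * (2 * g - 1) by apply: Rle_0_sqr.
  by case: H0 => ->; case: H1 => ->; rewrite /slow; lra.
by move: I; rewrite /q wob_even; lra.
Qed.

(** The coordinate is monotone on the middle half of the edge, and by [corner_gain] it enters and
    leaves this part between the two ends. *)
Lemma coord_move j u : M j -> IZR j + 1/4 <= u <= IZR j + 3/4 ->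
  0 <= sg j * (coord u - IZR (C j)) /\ 0 <= sg j * (IZR (C (j + 1)%Z) - coord u).
Proof.
move=> H Hu.
have Mon x y : IZR j + 1/4 <= x -> x <= y -> y <= IZR j + 3/4 ->
    0 <= sg j * (coord y - coord x).
  move=> Hx xy Hy.
  have [df Hdf] : exists df, forall t, IZR j + 1/4 <= t <= IZR j + 3/4 ->
      is_derive coord t (df t) /\ slow <= sg j * df t.
    exists (fun t => Derive coord t) => t Ht.
    by have [l Dl Hl] := coord_speed H Ht; rewrite (is_derive_unique _ _ _ Dl).
  suff : sg j * coord x <= sg j * coord y by lra.
  apply: (@incr_le (fun t => sg j * coord t) (fun t => sg j * df t)) => // t Ht.
    by apply: is_derive_scal; apply: (proj1 (Hdf t _)); lra.
  by have := proj2 (Hdf t ltac:(lra)); rewrite /slow; lra.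
have [p0 [p1 [Hp0 [Hp1 [Ep1 [_ Fp]]]]]] := cd_corner cd j.
have [q0 [q1 [Hq0 [Hq1 [_ [Eq0 Fq]]]]]] := cd_corner cd (j + 1)%Z.
have {}Ep1 := Ep1 H; have {}Eq0 : q0 = sg j.
  by have X : (j + 1 - 1 = j)%Z; [lia | rewrite X in Eq0; exact: Eq0].
have S1 := sg1 j.
have G0 := @corner_gain p0 (sg j) (fun t => coord (1 * t + IZR j)) Hp0 S1.
(* The far end of the edge is treated with time and sign reversed. *)
have G1 := @corner_gain q1 (sg j) (fun t => - coord ((-1) * t + (IZR j + 1))) Hq1 S1.
have {}G0 : 0 <= sg j * (coord (IZR j + 1/4) - IZR (C j)).
  have R0 : ~~ M (j - 1)%Z by rewrite MP1 H.
  have <- : coord (IZR j - 1/4) = IZR (C j).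
    rewrite (@coord_rest (j - 1)%Z) //; last by rewrite minus_IZR; lra.
    by have := Hrest R0; have -> : (j - 1 + 1 = j)%Z; [lia | move=> ->].
  have -> : IZR j + 1/4 = 1 * (1/4) + IZR j by ring.
  have -> : IZR j - 1/4 = 1 * (- (1/4)) + IZR j by ring.
  apply: G0 => t Ht.
  have Et : 1 * t + IZR j - IZR j = t by ring.
  have := @is_derive_coord_corner (1 * t + IZR j) j; rewrite Et => /(_ Ht) K.
  apply: (is_derive_eq (is_derive_affine K)).
  have Ht' : Rabs (1 * t + IZR j - IZR j) <= 3/4 by rewrite Et; lra.
  rewrite /base_speed /moving (interp_near _ Ht') Fp Et // H (negbTE R0) Ep1; ring.
have {}G1 : 0 <= sg j * (IZR (C (j + 1)%Z) - coord (IZR j + 3/4)).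
  have R1 : ~~ M (j + 1)%Z by rewrite HM H.
  have <- : coord (IZR j + 5/4) = IZR (C (j + 1)%Z).
    by rewrite (@coord_rest (j + 1)%Z) // plus_IZR; lra.
  have -> : coord (IZR j + 5/4) - coord (IZR j + 3/4) =
     - coord ((-1) * (1/4) + (IZR j + 1)) - - coord ((-1) * (- (1/4)) + (IZR j + 1)).
    have -> : (-1) * (1/4) + (IZR j + 1) = IZR j + 3/4 by lra.
    have -> : (-1) * (- (1/4)) + (IZR j + 1) = IZR j + 5/4 by lra.
    by ring.
  apply: G1 => t Ht.
  have Et : (-1) * t + (IZR j + 1) - IZR (j + 1) = - t by rewrite plus_IZR; ring.
  have := @is_derive_coord_corner ((-1) * t + (IZR j + 1)) (j + 1)%Z.
  rewrite Et Rabs_Ropp => /(_ Ht) K.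
  apply: (is_derive_eq (is_derive_opp _ _ _ (is_derive_affine K))).
  have Ht' : Rabs ((-1) * t + (IZR j + 1) - IZR (j + 1)) <= 3/4 by rewrite Et Rabs_Ropp; lra.
  rewrite /base_speed /moving (interp_near _ Ht') Fq Et ?Rabs_Ropp // (negbTE R1) Eq0.
  have -> : (j + 1 - 1 = j)%Z by lia.
  by rewrite H step_sym /opp /=; ring.
have K1 := Mon (IZR j + 1/4) u ltac:(lra) ltac:(lra) ltac:(lra).
have K2 := Mon u (IZR j + 3/4) ltac:(lra) ltac:(lra) ltac:(lra).
by case: (sg1 j) G0 G1 K1 K2 => ->; lra.
Qed.

End Coordinate.

Lemma incr_lt_except (f df : R -> R) (a b c : R) :
  (forall t, a <= t <= b -> is_derive f t (df t)) ->
  (forall t, a < t < b -> t <> c -> 0 < df t) ->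
  a < b -> f a < f b.
Proof.
move=> D Q ab.
have H x y : a <= x -> x < y -> y <= b -> (c <= x \/ y <= c) -> f x < f y.
  move=> ax xy yb Hc; apply: (@incr_lt f df) => // t Ht; first by apply: D; lra.
  by apply: Q; lra.
case: (Rle_lt_dec c a) => Hca; first by apply: H; lra.
case: (Rle_lt_dec b c) => Hbc; first by apply: H; lra.
by have := H a c; have := H c b; lra.
Qed.

(** * Closed rectilinear paths and their fronts *)

Lemma Zeven_odd j : Z.odd j = ~~ Z.even j.
Proof. by rewrite Z.negb_even. Qed.

(* A closed rectilinear path of period [P]: the even edges are vertical, and every
   column or row contains a single edge of a period. *)
Record closed_path (P : Z) (CA CB : Z -> Z) : Prop := ClosedPath {
  cp_gt0 : (0 < P)%Z;
  cp_even : Z.even P;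
  cp_perA : forall j, CA (j + P)%Z = CA j;
  cp_perB : forall j, CB (j + P)%Z = CB j;
  cp_vert : forall j, Z.even j -> CA (j + 1)%Z = CA j;
  cp_hori : forall j, Z.odd j -> CB (j + 1)%Z = CB j;
  cp_vert_move : forall j, Z.even j -> CB (j + 1)%Z <> CB j;
  cp_hori_move : forall j, Z.odd j -> CA (j + 1)%Z <> CA j;
  cp_column : forall i j, Z.even i -> Z.even j -> CA i = CA j ->
    exists n, (j = i + n * P)%Z;
  cp_row : forall i j, Z.odd i -> Z.odd j -> CB i = CB j ->
    exists n, (j = i + n * P)%Z }.

Lemma even_succ j : Z.even (j + 1)%Z = ~~ Z.even j.
Proof. by rewrite Z.add_1_r Z.even_succ Zeven_odd. Qed.

Lemma odd_succ j : Z.odd (j + 1)%Z = ~~ Z.odd j.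
Proof. by rewrite !Zeven_odd even_succ. Qed.

Lemma pred_succ j : (j - 1 + 1 = j)%Z. Proof. by lia. Qed.

Lemma even_pred j : Z.even (j - 1)%Z = ~~ Z.even j.
Proof. by rewrite -[X in ~~ Z.even X]pred_succ even_succ negbK. Qed.

Section Front.
Variables (P : Z) (CA CB : Z -> Z).
Hypothesis cp : closed_path P CA CB.
Let P_gt0 := cp_gt0 cp.
Let P_even := cp_even cp.
Let PCA := cp_perA cp.
Let PCB := cp_perB cp.
Let vert := cp_vert cp.
Let hori := cp_hori cp.
Let vert_move := cp_vert_move cp.
Let hori_move := cp_hori_move cp.
Let column_inj := cp_column cp.
Let row_inj := cp_row cp.

(* The sign of the x-coordinate of the velocity along the edge [j]. *)
Definition dir (j : Z) : R :=
  IZR (Z.sgn (CA (j + 1)%Z - CA j + (CB (j + 1)%Z - CB j))).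

Definition vedge (j : Z) : Z := if Z.even j then j else (j - 1)%Z.
Definition hedge (j : Z) : Z := if Z.even j then (j - 1)%Z else j.

(* The direction of the vertical edge at the corner [j], and its interpolation,
   which changes sign at the middle of the horizontal edges. *)
Definition vdir (j : Z) : R := dir (vedge j).
Definition vsign (u : R) : R := interp vdir (u + 1/2).

(** Both coordinates are rounded in the direction [interp dir] of x = a + b. Near a corner x then
    moves with speed [slow * interp dir], which vanishes only at a reversal, exactly at the time of
    the corner. *)
Definition fa : R -> R := coord Z.odd CA (interp dir).
Definition fb : R -> R := coord Z.even CB (interp dir).
(* The same as [fb], except that it is monotone at every corner. *)
Definition ft : R -> R := coord Z.even CB vsign.
Definition hweight : R -> R := moving Z.odd.
Definition fy (u : R) : R := 1 - 2 * hweight u.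
Definition fX (u : R) : R := Derive fa u + Derive fb u.

Lemma even_P j : Z.even (j + P)%Z = Z.even j.
Proof. by rewrite Z.even_add P_even; case: (Z.even j). Qed.

Lemma odd_P j : Z.odd (j + P)%Z = Z.odd j.
Proof. by rewrite !Zeven_odd even_P. Qed.

Lemma dir_P j : dir (j + P)%Z = dir j.
Proof.
rewrite /dir; have -> : (j + P + 1 = j + 1 + P)%Z by lia.
by rewrite !PCA !PCB.
Qed.

Lemma dir1 j : dir j = 1 \/ dir j = -1.
Proof.
rewrite /dir.
have : (CA (j + 1) - CA j + (CB (j + 1) - CB j) <> 0)%Z.
  case E: (Z.even j).
    by have := vert E; have := vert_move E; lia.
  have O : Z.odd j by rewrite Zeven_odd E.
  by have := hori O; have := hori_move O; lia.
set d := (_ - _ + _)%Z => Hd; have : (Z.sgn d = 1 \/ Z.sgn d = -1)%Z by lia.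
by case=> ->; [left|right].
Qed.

Lemma dir_hori j : Z.odd j -> 1 <= dir j * (IZR (CA (j + 1)%Z) - IZR (CA j)).
Proof.
move=> O; have H := hori O; have H' := hori_move O.
rewrite /dir H -minus_IZR -mult_IZR; apply: IZR_le; nia.
Qed.

Lemma dir_vert j : Z.even j -> 1 <= dir j * (IZR (CB (j + 1)%Z) - IZR (CB j)).
Proof.
move=> O; have H := vert O; have H' := vert_move O.
rewrite /dir H -minus_IZR -mult_IZR; apply: IZR_le; nia.
Qed.

Lemma rest_a j : ~~ Z.odd j -> CA (j + 1)%Z = CA j.
Proof. by rewrite Zeven_odd negbK; apply: vert. Qed.

Lemma rest_b j : ~~ Z.even j -> CB (j + 1)%Z = CB j.
Proof. by rewrite -Zeven_odd; apply: hori. Qed.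

Lemma interp_dir_data (M : Z -> bool) (C : Z -> Z) :
  (forall j, M (j + 1)%Z = ~~ M j) -> (forall j, M (j + P)%Z = M j) ->
  (forall j, C (j + P)%Z = C j) -> (forall j, ~~ M j -> C (j + 1)%Z = C j) ->
  (forall j, M j -> 1 <= dir j * (IZR (C (j + 1)%Z) - IZR (C j))) ->
  coord_data P M C (interp dir) dir.
Proof.
move=> H1 H2 H3 H4 H5; split=> //; first exact: dir1.
- exact: smooth_interp.
- by move=> u; apply: interp_shift => j; apply: dir_P.
- by move=> u; apply: interp_range => j; case: (dir1 j) => ->; lra.
- by move=> j u _; apply: interp_flat.
- move=> j; exists (dir (j - 1)%Z), (dir j); do 2 (split; first exact: dir1).
  by do 2 split => //; move=> u Hu; apply: interp_near; lra.
Qed.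

Lemma fa_data : coord_data P Z.odd CA (interp dir) dir.
Proof.
by apply: interp_dir_data; [exact: odd_succ|exact: odd_P|exact: PCA|exact: rest_a|exact: dir_hori].
Qed.

Lemma fb_data : coord_data P Z.even CB (interp dir) dir.
Proof.
by apply: interp_dir_data; [exact: even_succ|exact: even_P|exact: PCB|exact: rest_b|exact: dir_vert].
Qed.

Lemma vdir_succ j : Z.even j -> vdir (j + 1)%Z = vdir j.
Proof. by rewrite /vdir /vedge even_succ => ->; congr dir; lia. Qed.

Lemma vdir_even j : Z.even j -> vdir j = dir j.
Proof. by rewrite /vdir /vedge => ->. Qed.

Lemma vdir1 j : vdir j = 1 \/ vdir j = -1.
Proof. exact: dir1. Qed.

Lemma vsign_near j u : Rabs (u - IZR j - 1/2) <= 3/4 ->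
  vsign u = vdir j + (vdir (j + 1)%Z - vdir j) * step (u - IZR j - 1/2).
Proof.
move=> H; have E : u + 1/2 - IZR (j + 1) = u - IZR j - 1/2 by rewrite plus_IZR; lra.
rewrite /vsign (@interp_near _ _ (j + 1)%Z) ?E //.
by have -> : (j + 1 - 1 = j)%Z by lia.
Qed.

Lemma vsign_corner j u : Rabs (u - IZR j) <= 1/4 -> vsign u = vdir j.
Proof. by move=> /Rabs_le_between H; apply: interp_flat; lra. Qed.

Lemma vsign_vert j u : Z.even j -> IZR j + 1/4 <= u <= IZR j + 3/4 -> vsign u = dir j.
Proof.
move=> E H; rewrite (@vsign_near j); last by apply: Rabs_le; lra.
by rewrite vdir_succ // vdir_even //; ring.
Qed.

Lemma vsign_bounds u : -1 <= vsign u <= 1.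
Proof. by apply: interp_range => j; case: (vdir1 j) => ->; lra. Qed.

Lemma vsign_periodic u : vsign (u + IZR P) = vsign u.
Proof.
rewrite /vsign; have -> : u + IZR P + 1/2 = u + 1/2 + IZR P by ring.
apply: interp_shift => j; rewrite /vdir /vedge even_P; case: (Z.even j).
  exact: dir_P.
by rewrite -(dir_P (j - 1)); congr dir; lia.
Qed.

Lemma smooth_vsign : smooth vsign.
Proof. by apply: (smooth_comp (smooth_interp vdir)); smo. Qed.

Lemma ft_data : coord_data P Z.even CB vsign dir.
Proof.
split; [exact: even_succ|exact: even_P|exact: PCB|exact: dir1|exact: rest_b|exact: dir_vert
  |exact: smooth_vsign|exact: vsign_periodic|exact: vsign_bounds|exact: vsign_vert|].
move=> j; exists (vdir j), (vdir j); do 2 (split; first exact: vdir1).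
split; first exact: vdir_even; split=> [E|u Hu].
  by have := vdir_succ E; rewrite pred_succ => ->; apply: vdir_even.
by rewrite (vsign_corner Hu); ring.
Qed.

Lemma smooth_fa : smooth fa. Proof. exact: (smooth_coord fa_data). Qed.
Lemma smooth_fb : smooth fb. Proof. exact: (smooth_coord fb_data). Qed.
Lemma smooth_ft : smooth ft. Proof. exact: (smooth_coord ft_data). Qed.
Lemma smooth_hweight : smooth hweight. Proof. exact: smooth_interp. Qed.

Lemma smooth_fy : smooth fy.
Proof. by rewrite /fy; have H := smooth_hweight; smo. Qed.

Lemma smooth_fX : smooth fX.
Proof.
by apply: smooth_plus; apply: smooth_Derive; [exact: smooth_fa | exact: smooth_fb].
Qed.

Lemma fa_periodic u : fa (u + IZR P) = fa u.
Proof. exact: (coord_periodic fa_data). Qed.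

Lemma fb_periodic u : fb (u + IZR P) = fb u.
Proof. exact: (coord_periodic fb_data). Qed.

Lemma ft_periodic u : ft (u + IZR P) = ft u.
Proof. exact: (coord_periodic ft_data). Qed.

Lemma hweight_periodic u : hweight (u + IZR P) = hweight u.
Proof. by apply: interp_shift => j; rewrite odd_P. Qed.

Lemma moving_even u : moving Z.even u = 1 - hweight u.
Proof.
rewrite /hweight /moving /interp; set j := near_int u; rewrite !Zeven_odd.
by case: (Z.even j); case: (Z.even (j - 1)%Z) => /=; lra.
Qed.

Lemma hweight_bounds u : 0 <= hweight u <= 1.
Proof. exact: moving_bounds. Qed.

Lemma hweight_flat j u : IZR j + 1/4 <= u <= IZR j + 3/4 ->
  hweight u = if Z.odd j then 1 else 0.
Proof. exact: moving_flat. Qed.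

Lemma hweight_corner j u : Rabs (u - IZR j) <= 3/4 ->
  hweight u = if Z.odd j then step (u - IZR j) else 1 - step (u - IZR j).
Proof.
move=> H; rewrite /hweight /moving (interp_near _ H).
have -> : Z.odd (j - 1) = ~~ Z.odd j.
  by rewrite -[X in ~~ Z.odd X](Z.sub_add 1 j) odd_succ negbK.
by case: (Z.odd j) => /=; ring.
Qed.

Lemma time_cases u :
  (exists j, Rabs (u - IZR j) <= 1/4) \/ (exists j, IZR j + 1/4 <= u <= IZR j + 3/4).
Proof.
have := near_intP u; set j := near_int u => Hj.
case: (Rle_lt_dec (Rabs (u - IZR j)) (1/4)) => H; first by left; exists j.
right; case: (Rle_lt_dec (IZR j) u) => Hu.
  by exists j; rewrite Rabs_pos_eq in H; lra.
by exists (j - 1)%Z; rewrite minus_IZR; rewrite Rabs_left in H; lra.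
Qed.

Lemma derive_corner j u : Rabs (u - IZR j) <= 1/4 ->
  is_derive fa u (slow * interp dir u * hweight u) /\
  is_derive fb u (slow * interp dir u * (1 - hweight u)).
Proof.
move=> H; split.
  by apply: (is_derive_eq (is_derive_coord_corner fa_data H)); rewrite /base_speed -/hweight; ring.
by apply: (is_derive_eq (is_derive_coord_corner fb_data H)); rewrite /base_speed moving_even; ring.
Qed.

Lemma derive_corner_t j u : Rabs (u - IZR j) <= 1/4 ->
  is_derive ft u (slow * vdir j * (1 - hweight u)).
Proof.
move=> H; apply: (is_derive_eq (is_derive_coord_corner ft_data H)).
by rewrite /base_speed moving_even (vsign_corner H); ring.
Qed.

Lemma fX_corner j u : Rabs (u - IZR j) <= 1/4 -> fX u = slow * interp dir u.
Proof.
move=> H; have [D1 D2] := derive_corner H.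
by rewrite /fX (is_derive_unique _ _ _ D1) (is_derive_unique _ _ _ D2); ring.
Qed.

Lemma derive_rest M C sf j u : coord_data P M C sf dir -> ~~ M j ->
  IZR j + 1/4 <= u <= IZR j + 3/4 -> is_derive (coord M C sf) u 0.
Proof.
move=> cd E Hu; have D : Rabs (u - IZR j - 1/2) < 3/4 by apply: Rabs_def1; lra.
apply: (is_derive_eq (is_derive_coord cd D)).
by rewrite (bulk_rest cd E) /base_speed (moving_flat M Hu) (negbTE E); ring.
Qed.

Lemma derive_rest_a j u : Z.even j -> IZR j + 1/4 <= u <= IZR j + 3/4 -> is_derive fa u 0.
Proof. by move=> E; apply: (derive_rest fa_data); rewrite Zeven_odd E. Qed.

Lemma derive_rest_b j u : Z.odd j -> IZR j + 1/4 <= u <= IZR j + 3/4 -> is_derive fb u 0.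
Proof. by move=> E; apply: (derive_rest fb_data); rewrite -Zeven_odd. Qed.

Lemma derive_rest_t j u : Z.odd j -> IZR j + 1/4 <= u <= IZR j + 3/4 -> is_derive ft u 0.
Proof. by move=> E; apply: (derive_rest ft_data); rewrite -Zeven_odd. Qed.

Lemma ft_flat_speed j u : Z.even j -> IZR j + 1/4 <= u <= IZR j + 3/4 ->
  slow <= dir j * Derive ft u.
Proof.
by move=> E H; have [l D Hl] := coord_speed ft_data E H; rewrite (is_derive_unique _ _ _ D).
Qed.

Lemma fX_flat j u : IZR j + 1/4 <= u <= IZR j + 3/4 -> slow <= dir j * fX u.
Proof.
move=> H; rewrite /fX; case E: (Z.even j).
  rewrite (is_derive_unique _ _ _ (derive_rest_a E H)).
  have [l D Hl] := coord_speed fb_data E H.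
  by rewrite (is_derive_unique _ _ _ D); lra.
have O : Z.odd j by rewrite Zeven_odd E.
rewrite (is_derive_unique _ _ _ (derive_rest_b O H)).
have [l D Hl] := coord_speed fa_data O H.
by rewrite (is_derive_unique _ _ _ D); lra.
Qed.

(** The velocity of the front is its x-velocity distributed over the two axes with weights [hweight]
    and [1 - hweight]. Hence z' = [fX * fy] identically, at cusps as well, and [fy] is the
    Legendrian lift. *)
Lemma Derive_fab u :
  Derive fa u = fX u * hweight u /\ Derive fb u = fX u * (1 - hweight u).
Proof.
rewrite /fX; case: (time_cases u) => -[j H].
  have [D1 D2] := derive_corner H.
  by rewrite (is_derive_unique _ _ _ D1) (is_derive_unique _ _ _ D2); split; ring.
rewrite (hweight_flat H); case E: (Z.even j).
  by rewrite (is_derive_unique _ _ _ (derive_rest_a E H)) Zeven_odd E /=; split; ring.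
have O : Z.odd j by rewrite Zeven_odd E.
by rewrite (is_derive_unique _ _ _ (derive_rest_b O H)) O; split; ring.
Qed.

Lemma is_derive_fa u : is_derive fa u (fX u * hweight u).
Proof.
by rewrite -(proj1 (Derive_fab u)); apply/Derive_correct/smooth_ex_derive/smooth_fa.
Qed.

Lemma is_derive_fb u : is_derive fb u (fX u * (1 - hweight u)).
Proof.
by rewrite -(proj2 (Derive_fab u)); apply/Derive_correct/smooth_ex_derive/smooth_fb.
Qed.

Lemma is_derive_ft u : is_derive ft u (Derive ft u).
Proof. exact/Derive_correct/smooth_ex_derive/smooth_ft. Qed.

Lemma fX_smooth_corner j u : dir (j - 1)%Z = dir j ->
  IZR j - 3/4 <= u <= IZR j + 3/4 -> 0 < dir j * fX u.
Proof.
move=> E H; have s0 : 0 < slow by rewrite /slow; lra.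
case: (Rle_lt_dec u (IZR j - 1/4)) => H1.
  have := @fX_flat (j - 1)%Z u; rewrite minus_IZR E => K.
  by have := K ltac:(lra); lra.
case: (Rle_lt_dec (IZR j + 1/4) u) => H2.
  by have := @fX_flat j u ltac:(lra); lra.
have A : Rabs (u - IZR j) <= 1/4 by apply: Rabs_le; lra.
have A' : Rabs (u - IZR j) <= 3/4 by lra.
rewrite (fX_corner A) (interp_near _ A') E.
by case: (dir1 j) => ->; rewrite /slow; lra.
Qed.

Lemma step_eq_half x : Rabs x <= 1/4 -> step x = 1/2 -> x = 0.
Proof.
move=> /Rabs_le_between H E; have H0 := step_half.
case: (total_order_T x 0) => [[K|//]|K].
  by have := @step_lt x 0; lra.
by have := @step_lt 0 x; lra.
Qed.

(** Direction and slope change sign at the same moment; close to the corner their product is a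
    multiple of the square of [1 - 2 * step (u - IZR j)]. So z is monotone at a cusp although x is
    not. *)
Lemma fX_fy_cusp j u : dir (j - 1)%Z <> dir j ->
  IZR j - 3/4 <= u <= IZR j + 3/4 -> u <> IZR j ->
  0 < dir j * (if Z.even j then 1 else -1) * (fX u * fy u).
Proof.
move=> E H N; have s0 : 0 < slow by rewrite /slow; lra.
have E' : dir (j - 1)%Z = - dir j.
  by case: (dir1 j) E => ->; case: (dir1 (j - 1)%Z) => -> ?; lra.
have Ev : Z.odd (j - 1) = Z.even j by rewrite Z.odd_sub /=; rewrite -Z.negb_odd; case: (Z.odd j).
rewrite /fy; case: (Rle_lt_dec u (IZR j - 1/4)) => H1.
  have := @fX_flat (j - 1)%Z u; rewrite minus_IZR E' => K.
  have {}K := K ltac:(lra).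
  rewrite (@hweight_flat (j - 1)%Z) ?minus_IZR ?Ev; last lra.
  by case: (Z.even j); lra.
case: (Rle_lt_dec (IZR j + 1/4) u) => H2.
  have K := @fX_flat j u ltac:(lra).
  rewrite (@hweight_flat j); last lra.
  by rewrite Zeven_odd; case: (Z.even j) => /=; lra.
have A : Rabs (u - IZR j) <= 1/4 by apply: Rabs_le; lra.
have A' : Rabs (u - IZR j) <= 3/4 by lra.
rewrite (fX_corner A) (interp_near _ A') E' (hweight_corner A') Zeven_odd.
have G : step (u - IZR j) <> 1/2 by move/(step_eq_half A); lra.
have G2 : 0 < (1 - 2 * step (u - IZR j)) * (1 - 2 * step (u - IZR j)).
  by apply: Rsqr_pos_lt; lra.
rewrite /slow; set g := step _ in G2 *.
by case: (dir1 j) => ->; case: (Z.even j) => /=; lra.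
Qed.

Lemma fX_eq0 u : fX u = 0 -> exists j, u = IZR j /\ dir (j - 1)%Z <> dir j.
Proof.
case: (time_cases u) => -[j H] E.
  have A' : Rabs (u - IZR j) <= 3/4 by lra.
  have Hb : IZR j - 3/4 <= u <= IZR j + 3/4 by move/Rabs_le_between: A'; lra.
  exists j; have N : dir (j - 1)%Z <> dir j.
    by move=> K; have := fX_smooth_corner K Hb; rewrite E; lra.
  split=> //; case: (Req_dec u (IZR j)) => // K.
  by have := fX_fy_cusp N Hb K; rewrite E; lra.
by have := fX_flat H; rewrite E /slow; lra.
Qed.

Lemma fX_cusp j : dir (j - 1)%Z <> dir j -> fX (IZR j) = 0.
Proof.
move=> E; have A : Rabs (IZR j - IZR j) <= 1/4 by rewrite Rminus_diag Rabs_R0; lra.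
have A' : Rabs (IZR j - IZR j) <= 3/4 by lra.
rewrite (fX_corner A) (interp_near _ A') Rminus_diag step_half.
by case: (dir1 j) E => ->; case: (dir1 (j - 1)%Z) => -> ?; rewrite /slow; lra.
Qed.

Lemma vedgeP j : Z.even (vedge j) /\ CA (vedge j) = CA j.
Proof.
rewrite /vedge; case E: (Z.even j) => //.
have Ev : Z.even (j - 1)%Z by rewrite even_pred E.
by split=> //; rewrite -(vert Ev) pred_succ.
Qed.

Lemma hedgeP j : Z.odd (hedge j) /\ CB (hedge j) = CB j.
Proof.
rewrite /hedge; case E: (Z.even j); last by rewrite Zeven_odd E.
have Ev : Z.odd (j - 1)%Z by rewrite Zeven_odd even_pred E.
by split=> //; rewrite -(hori Ev) pred_succ.
Qed.

Definition same_time (u v : R) : Prop := exists n : Z, v = u + IZR (n * P).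

Lemma same_time_sym u v : same_time u v -> same_time v u.
Proof. by case=> n ->; exists (- n)%Z; rewrite !mult_IZR opp_IZR; ring. Qed.

Lemma periodic_mult (f : R -> R) u n : (forall u, f (u + IZR P) = f u) ->
  f (u + IZR (n * P)) = f u.
Proof.
move=> Hf; have Q : periodic (fun t => f (u + t * IZR P)).
  by move=> t; rewrite Rmult_plus_distr_r Rmult_1_l -Rplus_assoc Hf.
have := periodicZ Q 0 n; rewrite Rplus_0_l Rmult_0_l Rplus_0_r => <-.
by rewrite mult_IZR.
Qed.

Definition crossing (u v : R) : Prop :=
  exists i j, [/\ Z.even i, Z.odd j, IZR i + 1/4 <= u <= IZR i + 3/4,
    IZR j + 1/4 <= v <= IZR j + 3/4 &
    0 < dir j * (IZR (CA i) - IZR (CA j)) /\ 0 < dir j * (IZR (CA (j + 1)%Z) - IZR (CA i))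
    /\ 0 < dir i * (IZR (CB j) - IZR (CB i)) /\ 0 < dir i * (IZR (CB (i + 1)%Z) - IZR (CB j))].

(** * Fronts following the path *)

(** What the classification of double points needs: the front follows the path up to small errors
    and is injective in a window around each corner. Both the Legendrian front and its tilted
    versions have these properties. *)
Record rect_front (A B : R -> R) : Prop := RectFront {
  rf_perA : forall u, A (u + IZR P) = A u;
  rf_perB : forall u, B (u + IZR P) = B u;
  rf_flatA : forall j u, Z.even j -> IZR j + 1/4 <= u <= IZR j + 3/4 ->
    Rabs (A u - IZR (CA j)) <= 1/16;
  rf_flatB : forall j u, Z.odd j -> IZR j + 1/4 <= u <= IZR j + 3/4 ->
    Rabs (B u - IZR (CB j)) <= 1/16;
  rf_moveA : forall j u, Z.odd j -> IZR j + 1/4 <= u <= IZR j + 3/4 ->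
    - (1/16) <= dir j * (A u - IZR (CA j)) /\ - (1/16) <= dir j * (IZR (CA (j + 1)%Z) - A u);
  rf_moveB : forall j u, Z.even j -> IZR j + 1/4 <= u <= IZR j + 3/4 ->
    - (1/16) <= dir j * (B u - IZR (CB j)) /\ - (1/16) <= dir j * (IZR (CB (j + 1)%Z) - B u);
  rf_corner : forall j u, Rabs (u - IZR j) <= 1/4 ->
    Rabs (A u - IZR (CA j)) <= 1/8 /\ Rabs (B u - IZR (CB j)) <= 1/8;
  rf_inj : forall j u v, IZR j - 3/4 <= u -> u < v -> v <= IZR j + 3/4 ->
    A u = A v -> B u = B v -> False }.

Section RectFront.
Variables A B : R -> R.
Hypothesis rf : rect_front A B.
Let flatA := rf_flatA rf.
Let flatB := rf_flatB rf.
Let moveA := rf_moveA rf.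
Let moveB := rf_moveB rf.
Let cornerAB := rf_corner rf.
Let front_inj_lt := rf_inj rf.

Lemma front_inj_window j u v :
  IZR j - 3/4 <= u <= IZR j + 3/4 -> IZR j - 3/4 <= v <= IZR j + 3/4 ->
  A u = A v -> B u = B v -> u = v.
Proof.
move=> Hu Hv Ea Eb; case: (total_order_T u v) => [[K|//]|K]; exfalso.
  by apply: (@front_inj_lt j u v) => //; lra.
by apply: (@front_inj_lt j v u) => //; lra.
Qed.

Lemma front_inj_near j n u v :
  IZR j - 3/4 <= u <= IZR j + 3/4 ->
  IZR (j + n * P) - 3/4 <= v <= IZR (j + n * P) + 3/4 ->
  A u = A v -> B u = B v -> same_time u v.
Proof.
move=> Hu Hv Ea Eb; exists n.
have := periodic_mult (v - IZR (n * P)) n (rf_perA rf).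
have := periodic_mult (v - IZR (n * P)) n (rf_perB rf).
have -> : v - IZR (n * P) + IZR (n * P) = v by ring.
move=> Fb Fa; rewrite plus_IZR in Hv.
have := @front_inj_window j u (v - IZR (n * P)) Hu ltac:(lra).
by rewrite -Fa -Fb => /(_ Ea Eb); lra.
Qed.

Lemma IZR_near (m n : Z) x : Rabs (x - IZR m) <= 1/4 -> Rabs (x - IZR n) <= 1/4 -> m = n.
Proof.
move=> /Rabs_le_between H /Rabs_le_between K.
have : (-1 < m - n < 1)%Z by split; apply: lt_IZR; rewrite minus_IZR; lra.
lia.
Qed.

(** The errors being small, the edge lies in the column or row of the corner. A period has only one
    such edge, and it ends at this corner, so that injectivity in the window applies. *)
Lemma double_corner_flat j i u v : Rabs (v - IZR j) <= 1/4 ->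
  IZR i + 1/4 <= u <= IZR i + 3/4 ->
  A u = A v -> B u = B v -> same_time v u.
Proof.
move=> Hv Hu Ea Eb; have [Ka Kb] := cornerAB Hv.
have Hv' : IZR j - 1/4 <= v <= IZR j + 1/4 by move/Rabs_le_between: Hv; lra.
case E: (Z.even i).
  have C : CA i = CA j by apply: (@IZR_near _ _ (A v)); [rewrite -Ea; have := flatA E Hu; lra | lra].
  have [V1 V2] := vedgeP j.
  have [n Hn] := @column_inj (vedge j) i V1 E ltac:(congruence).
  apply: (@front_inj_near j n) => //; first lra.
  move: Hu Hn; rewrite /vedge; case: (Z.even j) => Hu Hn; rewrite Hn in Hu; first lra.
  have X : (j - 1 + n * P = j + n * P - 1)%Z by lia.
  by rewrite X minus_IZR in Hu; lra.
have O : Z.odd i by rewrite Zeven_odd E.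
have C : CB i = CB j by apply: (@IZR_near _ _ (B v)); [rewrite -Eb; have := flatB O Hu; lra | lra].
have [V1 V2] := hedgeP j.
have [n Hn] := @row_inj (hedge j) i V1 O ltac:(congruence).
apply: (@front_inj_near j n) => //; first lra.
move: Hu Hn; rewrite /hedge; case: (Z.even j) => Hu Hn; rewrite Hn in Hu; last lra.
have X : (j - 1 + n * P = j + n * P - 1)%Z by lia.
  by rewrite X minus_IZR in Hu; lra.
Qed.

Lemma CB_periodicZ m n : CB (m + n * P)%Z = CB m.
Proof.
have H (k : nat) i : CB (i + Z.of_nat k * P)%Z = CB i.
  elim: k i => [|k IH] i; first by rewrite Z.add_0_r.
  rewrite -(IH i) -[RHS]PCB Nat2Z.inj_succ; congr CB; ring.
have [K|K] := Z.le_gt_cases 0 n.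
  by rewrite -(H (Z.to_nat n) m) Z2Nat.id.
rewrite -(H (Z.to_nat (- n)) (m + _)%Z) Z2Nat.id; last lia.
by congr CB; ring.
Qed.

(** If one edge lies in the row or column of an end of the other one, the two edges share a corner
    and the times agree modulo the period. Otherwise the inequalities up to 1/16 become strict
    inequalities between integers. *)
Lemma double_vert_hori i j u v : Z.even i -> Z.odd j ->
  IZR i + 1/4 <= u <= IZR i + 3/4 -> IZR j + 1/4 <= v <= IZR j + 3/4 ->
  A u = A v -> B u = B v -> same_time u v \/ crossing u v.
Proof.
move=> Ei Oj Hu Hv Ea Eb.
have [A1 A2] := moveA Oj Hv; have [B1 B2] := moveB Ei Hu.
have FA := flatA Ei Hu; have FB := flatB Oj Hv.
rewrite -Ea in A1 A2; rewrite Eb in B1 B2.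
have Ej : Z.even (j - 1)%Z by rewrite even_pred -Zeven_odd.
have Ej1 : Z.even (j + 1)%Z by rewrite even_succ -Zeven_odd.
case: (Z.eq_dec (CA i) (CA j)) => N1.
  have [n Hn] := @column_inj (j - 1)%Z i Ej Ei ltac:(rewrite -vert // pred_succ; lia).
  left; apply: same_time_sym; apply: (@front_inj_near j n) => //; first lra.
  have X : (i = j + n * P - 1)%Z by lia.
  by rewrite X minus_IZR in Hu; lra.
case: (Z.eq_dec (CA i) (CA (j + 1)%Z)) => N2.
  have [n Hn] := @column_inj (j + 1)%Z i Ej1 Ei ltac:(lia).
  left; apply: same_time_sym; apply: (@front_inj_near (j + 1) n) => //.
    by rewrite plus_IZR; lra.
  by rewrite -Hn; lra.
case: (Z.eq_dec (CB i) (CB j)) => N3.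
  have Oi : Z.odd (i - 1)%Z by rewrite Zeven_odd even_pred Ei.
  have [n Hn] := @row_inj (i - 1)%Z j Oi Oj ltac:(rewrite -hori // pred_succ; lia).
  left; apply: (@front_inj_near i n) => //; first lra.
  have X : (j = i + n * P - 1)%Z by lia.
  by rewrite X minus_IZR in Hv; lra.
case: (Z.eq_dec (CB (i + 1)%Z) (CB j)) => N4.
  have Oi : Z.odd (i + 1)%Z by rewrite odd_succ Zeven_odd Ei.
  have [n Hn] := @row_inj (i + 1)%Z j Oi Oj ltac:(lia).
  left; apply: (@front_inj_near (i + 1) n) => //; first by rewrite plus_IZR; lra.
  by rewrite -Hn; lra.
right; exists i, j; split=> //.
have pos s (m n : Z) x y : (s = 1 \/ s = -1) -> m <> n -> Rabs (x - IZR m) <= 1/16 ->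
    Rabs (y - IZR n) <= 1/16 -> - (1/16) <= s * (x - y) -> 0 < s * (IZR m - IZR n).
  move=> Hs Hmn /Rabs_le_between Hx /Rabs_le_between Hy.
  have : (m + 1 <= n \/ n + 1 <= m)%Z by lia.
  by case=> /IZR_le; rewrite plus_IZR; case: Hs => ->; lra.
have Z0 x : Rabs (x - x) <= 1/16 by rewrite Rminus_diag Rabs_R0; lra.
have D1 := dir1; have N5 := fun H => N2 (esym H); have N6 := fun H => N3 (esym H).
have N7 := fun H => N4 (esym H).
by repeat split; [exact: (pos _ _ _ (A u) (IZR (CA j)))|exact: (pos _ _ _ (IZR (CA (j+1)%Z)) (A u))
  |exact: (pos _ _ _ (B v) (IZR (CB i)))|exact: (pos _ _ _ (IZR (CB (i+1)%Z)) (B v))].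
Qed.

(** Each time is near a corner or in the middle half of an edge. In every combination rounding to
    integers identifies rows or columns, and a period contains each of them once. *)
Lemma double_point u v : A u = A v -> B u = B v ->
  [\/ same_time u v, crossing u v | crossing v u].
Proof.
move=> Ea Eb.
case: (time_cases u) => -[i Hu]; case: (time_cases v) => -[j Hv].
- have [Ka Kb] := cornerAB Hu; have [La Lb] := cornerAB Hv.
  rewrite Ea in Ka; rewrite Eb in Kb.
  have Ca : CA i = CA j by apply: (@IZR_near _ _ (A v)); lra.
  have Cb : CB i = CB j by apply: (@IZR_near _ _ (B v)); lra.
  have [V1 V2] := vedgeP i; have [W1 W2] := vedgeP j.
  have [n Hn] := @column_inj _ _ V1 W1 ltac:(congruence).
  have Hui : IZR i - 1/4 <= u <= IZR i + 1/4 by move/Rabs_le_between: Hu; lra.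
  have Hvj : IZR j - 1/4 <= v <= IZR j + 1/4 by move/Rabs_le_between: Hv; lra.
  have PB m : CB (m + n * P)%Z = CB m by apply: CB_periodicZ.
  suff E : (j = i + n * P)%Z.
    by constructor 1; apply: (@front_inj_near i n) => //; rewrite -?E; lra.
  move: Hn; rewrite /vedge; case Ei: (Z.even i); case Ej: (Z.even j) => // Hn; last lia.
    have E : (j = (i + 1) + n * P)%Z by lia.
    by case: (vert_move Ei); rewrite Cb E PB.
  have E : (i - 1 + n * P = j)%Z by lia.
  have Ei' : Z.even (i - 1) by rewrite even_pred Ei.
  by case: (vert_move Ei'); rewrite pred_succ Cb -E PB.
- by constructor 1; apply/same_time_sym; apply/same_time_sym; apply: (double_corner_flat Hu Hv).
- by constructor 1; apply/same_time_sym; apply: (double_corner_flat Hv Hu).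
- case Ei: (Z.even i); case Ej: (Z.even j).
  + have [n Hn] := @column_inj i j Ei Ej ltac:(apply: (@IZR_near _ _ (A u)); [have := flatA Ei Hu; lra | rewrite Ea; have := flatA Ej Hv; lra]).
    by constructor 1; apply: (@front_inj_near i n) => //; rewrite -?Hn; lra.
  + have Oj : Z.odd j by rewrite Zeven_odd Ej.
    by case: (double_vert_hori Ei Oj Hu Hv Ea Eb); [constructor 1|constructor 2].
  + have Oi : Z.odd i by rewrite Zeven_odd Ei.
    case: (double_vert_hori Ej Oi Hv Hu (esym Ea) (esym Eb)); last by constructor 3.
    by move/same_time_sym; constructor 1.
  + have Oi : Z.odd i by rewrite Zeven_odd Ei.
    have Oj : Z.odd j by rewrite Zeven_odd Ej.
    have [n Hn] := @row_inj i j Oi Oj ltac:(apply: (@IZR_near _ _ (B u)); [have := flatB Oi Hu; lra | rewrite Eb; have := flatB Oj Hv; lra]).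
    by constructor 1; apply: (@front_inj_near i n) => //; rewrite -?Hn; lra.
Qed.
End RectFront.

Lemma fa_flat j u : Z.even j -> IZR j + 1/4 <= u <= IZR j + 3/4 -> fa u = IZR (CA j).
Proof. by move=> E H; apply: (coord_rest fa_data _ H); rewrite Zeven_odd E. Qed.

Lemma fb_flat j u : Z.odd j -> IZR j + 1/4 <= u <= IZR j + 3/4 -> fb u = IZR (CB j).
Proof. by move=> E H; apply: (coord_rest fb_data _ H); rewrite -Zeven_odd. Qed.

Lemma ft_flat j u : Z.odd j -> IZR j + 1/4 <= u <= IZR j + 3/4 -> ft u = IZR (CB j).
Proof. by move=> E H; apply: (coord_rest ft_data _ H); rewrite -Zeven_odd. Qed.

Lemma fa_move j u : Z.odd j -> IZR j + 1/4 <= u <= IZR j + 3/4 ->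
  0 <= dir j * (fa u - IZR (CA j)) /\ 0 <= dir j * (IZR (CA (j + 1)%Z) - fa u).
Proof. exact: (coord_move fa_data). Qed.

Lemma fb_move j u : Z.even j -> IZR j + 1/4 <= u <= IZR j + 3/4 ->
  0 <= dir j * (fb u - IZR (CB j)) /\ 0 <= dir j * (IZR (CB (j + 1)%Z) - fb u).
Proof. exact: (coord_move fb_data). Qed.

Lemma ft_move j u : Z.even j -> IZR j + 1/4 <= u <= IZR j + 3/4 ->
  0 <= dir j * (ft u - IZR (CB j)) /\ 0 <= dir j * (IZR (CB (j + 1)%Z) - ft u).
Proof. exact: (coord_move ft_data). Qed.

Lemma fab_corner j u : Rabs (u - IZR j) <= 1/4 ->
  Rabs (fa u - IZR (CA j)) <= 1/16 /\ Rabs (fb u - IZR (CB j)) <= 1/16.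
Proof. by move=> H; split; [exact: (coord_corner fa_data H)|exact: (coord_corner fb_data H)]. Qed.

Lemma ft_corner j u : Rabs (u - IZR j) <= 1/4 -> Rabs (ft u - IZR (CB j)) <= 1/16.
Proof. exact: (coord_corner ft_data). Qed.

(** For injectivity around a corner, x = a + b is strictly monotone at an ordinary corner, and z = b
    - a at a cusp. *)
Lemma rect_front_flat : rect_front fa fb.
Proof.
split; [exact: fa_periodic|exact: fb_periodic|..].
- by move=> j u E H; rewrite (fa_flat E H) Rminus_diag Rabs_R0; lra.
- by move=> j u E H; rewrite (fb_flat E H) Rminus_diag Rabs_R0; lra.
- by move=> j u E H; have := fa_move E H; lra.
- by move=> j u E H; have := fb_move E H; lra.
- by move=> j u H; have := fab_corner H; lra.
move=> j u v Hu uv Hv Ea Eb.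
case: (Req_dec (dir (j - 1)%Z) (dir j)) => E.
  have : dir j * fa u + dir j * fb u < dir j * fa v + dir j * fb v.
    apply: (@incr_lt (fun u => dir j * fa u + dir j * fb u) (fun u =>
       dir j * (fX u * hweight u) + dir j * (fX u * (1 - hweight u)))) => // t Ht.
      by apply: is_derive_lin3; [exact: is_derive_fa | exact: is_derive_fb].
    by have := @fX_smooth_corner j t E ltac:(lra); lra.
  by rewrite Ea Eb; lra.
pose k := dir j * (if Z.even j then 1 else -1).
have : - k * fa u + k * fb u < - k * fa v + k * fb v.
  apply: (@incr_lt_except (fun u => - k * fa u + k * fb u) (fun u =>
     - k * (fX u * hweight u) + k * (fX u * (1 - hweight u))) _ _ (IZR j)) => // t Ht.
    by apply: is_derive_lin3; [exact: is_derive_fa | exact: is_derive_fb].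
  move=> tj; have := @fX_fy_cusp j t E ltac:(lra) tj.
  by rewrite -/k /fy; lra.
by rewrite Ea Eb; lra.
Qed.

End Front.

Lemma periodic_bounded (P : Z) (f : R -> R) : (0 < P)%Z -> smooth f ->
  (forall u, f (u + IZR P) = f u) -> exists M, 0 < M /\ forall u, Rabs (f u) <= M.
Proof.
move=> P0 S Hf; have P0' : 0 < IZR P by apply: IZR_lt.
have S2 : smooth (fun u => f u * f u) by apply: smooth_mult.
have [||m [Hm _]] := continuity_ab_maj (fun u => f u * f u) 0 (IZR P); first lra.
  by move=> c _; apply: smooth_continuity_pt.
(* A bound on the square suffices, as |x| <= 1 + x^2. *)
exists (1 + f m * f m); split; first by have := Rle_0_sqr (f m); rewrite /Rsqr; lra.
move=> u; have [n Hn] : exists n : Z, 0 <= u - IZR (n * P) <= IZR P.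
  exists (Int_part (u / IZR P)); have [H1 H2] := base_Int_part (u / IZR P).
  have E : u = (u / IZR P) * IZR P by field; lra.
  rewrite mult_IZR {1 3}E; set x := u / IZR P in H1 H2 *; set k := IZR (Int_part x) in H1 H2 *.
  by split; nra.
have := periodic_mult (u - IZR (n * P)) n Hf; have -> : u - IZR (n * P) + IZR (n * P) = u by ring.
move=> ->; have := Hm _ Hn; set x := f _; set y := f m => H.
apply: Rabs_le; have := Rle_0_sqr y; rewrite /Rsqr => Hy; nra.
Qed.

(* On the descending parts of the path, the horizontal edges are followed to the
   left, and the path turns in their middle, away from the other edges. *)
Record braid_path (P : Z) (CA CB : Z -> Z) : Prop := BraidPath {
  bp_up : forall j, Z.odd j -> vdir CA CB j = vdir CA CB (j + 1)%Z -> vdir CA CB j = 1;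
  bp_left : forall j, Z.odd j -> vdir CA CB j <> vdir CA CB (j + 1)%Z -> dir CA CB j = -1;
  bp_free : forall i j, Z.even i -> Z.odd j -> vdir CA CB j <> vdir CA CB (j + 1)%Z ->
    0 < dir CA CB j * (IZR (CA i) - IZR (CA j)) ->
    0 < dir CA CB j * (IZR (CA (j + 1)%Z) - IZR (CA i)) ->
    0 < dir CA CB i * (IZR (CB j) - IZR (CB i)) ->
    0 < dir CA CB i * (IZR (CB (i + 1)%Z) - IZR (CB j)) -> False }.

(** * Tilting the front at its cusps *)

Section Tilt.
Variables (P : Z) (CA CB : Z -> Z).
Hypothesis cp : closed_path P CA CB.
Hypothesis bp : braid_path P CA CB.

Notation dir := (dir CA CB).
Notation vdir := (vdir CA CB).
Notation vsign := (vsign CA CB).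
Notation fa := (fa CA CB).
Notation fb := (fb CA CB).
Notation ft := (ft CA CB).
Notation fX := (fX CA CB).

(** Descending parts are followed down and to the left, so that x decreases throughout and they
    contain no cusp. At a cusp the vertical edge ascends and the horizontal one goes left, so that b
    - a increases along both. *)
Lemma corner_dirs j :
  (vdir j = -1 /\ dir (j - 1)%Z = -1 /\ dir j = -1) \/
  (vdir j = 1 /\ dir (j - 1)%Z = 1 /\ dir j = 1) \/
  (vdir j = 1 /\ dir (j - 1)%Z <> dir j /\ dir (hedge j) = -1).
Proof.
have H1 := dir1 cp (j - 1)%Z; have H2 := dir1 cp j.
have neg : vdir j = -1 -> dir (hedge j) = -1.
  have [O _] := hedgeP cp j; move=> V.
  have N : vdir (hedge j) = vdir (hedge j + 1)%Z -> False.
    move=> E; have := bp_up bp O E; move: E; rewrite /hedge.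
    by case: (Z.even j); rewrite ?pred_succ => ? ?; lra.
  by apply: (bp_left bp O) => E; apply: N.
move: neg; rewrite /vdir /vedge /hedge; case: (Z.even j) => neg.
  case: H2 => E2; rewrite E2 in neg *.
    case: H1 => E1; [by right; left | by right; right; rewrite E1; split => //; split => //; lra].
  by left; rewrite neg.
case: H1 => E1; rewrite E1 in neg *.
  case: H2 => E2; [by right; left | by right; right; rewrite E2; split => //; split => //; lra].
by left; rewrite neg.
Qed.

Lemma interp_dir_corner j u : Rabs (u - IZR j) <= 1/4 ->
  (vdir j = -1 /\ interp dir u = -1) \/ (vdir j = 1 /\ interp dir u = 1) \/
  (vdir j = 1 /\ interp dir u = 1 - 2 * hweight u /\ dir (j - 1)%Z <> dir j).
Proof.
move=> H; have H' : Rabs (u - IZR j) <= 3/4 by lra.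
rewrite (interp_near _ H') (hweight_corner H').
case: (corner_dirs j) => [[V [-> ->]]|[[V [-> ->]]|[V [N D]]]].
- by left; split=> //; ring.
- by right; left; split=> //; ring.
- right; right; split=> //; split=> //.
  move: V D; rewrite /Submission.vdir /vedge /hedge Zeven_odd.
  by case: (Z.even j) => /= -> ->; ring.
Qed.

(** Leads from the Legendrian front to one whose b-coordinate does not turn back at cusps; the
    latter property is used for the rotation around an axis. *)
Definition fm (sig u : R) : R := (1 - sig) * fb u + sig * ft u.
Definition dm (sig u : R) : R := Derive (fm sig) u.

Lemma smooth_fm sig : smooth (fm sig).
Proof.
by apply: smooth_plus; apply: smooth_mult; try exact: smooth_const;
  [exact: (smooth_fb cp)|exact: (smooth_ft cp)].
Qed.

Lemma is_derive_fm sig u : is_derive (fm sig) u (dm sig u).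
Proof. exact/Derive_correct/smooth_ex_derive/smooth_fm. Qed.

Lemma dmE sig u l m : is_derive fb u l -> is_derive ft u m ->
  dm sig u = (1 - sig) * l + sig * m.
Proof. by move=> D1 D2; apply: is_derive_unique; apply: is_derive_lin3. Qed.

Lemma dm_corner sig j u : Rabs (u - IZR j) <= 1/4 ->
  dm sig u = slow * (1 - hweight u) * ((1 - sig) * interp dir u + sig * vdir j).
Proof.
move=> H; have [_ D] := derive_corner cp H.
by rewrite (dmE sig D (derive_corner_t cp H)); ring.
Qed.

Lemma dm_hori sig j u : Z.odd j -> IZR j + 1/4 <= u <= IZR j + 3/4 -> dm sig u = 0.
Proof.
by move=> O H; rewrite (dmE sig (derive_rest_b cp O H) (derive_rest_t cp O H)); ring.
Qed.

Lemma dm_vert sig j u : 0 <= sig <= 1 -> Z.even j ->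
  IZR j + 1/4 <= u <= IZR j + 3/4 -> slow <= dir j * dm sig u.
Proof.
move=> Hs E H; rewrite (dmE sig (is_derive_fb cp u) (is_derive_ft cp u)).
have := ft_flat_speed cp E H; have := fX_flat cp H.
by rewrite (hweight_flat H) Zeven_odd E /=; case: (dir1 cp j) => ->; nra.
Qed.

(** Increases by 1 on the middle half of each vertical edge and is constant elsewhere, thus by P / 2
    over a period. It absorbs the period of [area] where vertical motion is fast anyway. *)
Definition vlad (u : R) : R := interp (fun j => IZR ((j + 1) / 2)) (u + 1/2).
Definition area (u : R) : R := RInt (fun u => hweight u * vsign u) 0 u.
Definition tilt_comp : R := area (IZR P) / (IZR P / 2).

(* A small periodic function whose derivative has the sign of [vsign] outside of
   the vertical edges. *)
Definition tilt (u : R) : R := 1/256 * area u + (- (1/256) * tilt_comp) * vlad u.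

Lemma is_derive_vlad j u : Rabs (u - IZR j - 1/2) < 3/4 ->
  is_derive vlad u ((if Z.even j then 1 else 0) * dstep (u - IZR j - 1/2)).
Proof.
move=> H; have E : u + 1/2 - IZR (j + 1) = u - IZR j - 1/2 by rewrite plus_IZR; lra.
have K := @is_derive_interp (fun j => IZR ((j + 1) / 2)) (u + 1/2) (j + 1)%Z.
rewrite E in K; apply: (is_derive_eq (is_derive_shift (K H))); congr (_ * _).
have -> : (j + 1 - 1 + 1 = j + 1)%Z by lia.
case Ev: (Z.even j).
  have [i Hi] : exists i, (j = 2 * i)%Z by apply/Z.even_spec.
  have -> : ((j + 1 + 1) / 2 = i + 1)%Z by symmetry; apply: (Z.div_unique _ _ _ 0); [left|]; lia.
  have -> : ((j + 1) / 2 = i)%Z by symmetry; apply: (Z.div_unique _ _ _ 1); [left|]; lia.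
  by rewrite plus_IZR; ring.
have [i Hi] : exists i, (j = 2 * i + 1)%Z by apply/Z.odd_spec; rewrite Zeven_odd Ev.
have -> : ((j + 1 + 1) / 2 = i + 1)%Z by symmetry; apply: (Z.div_unique _ _ _ 1); [left|]; lia.
have -> : ((j + 1) / 2 = i + 1)%Z by symmetry; apply: (Z.div_unique _ _ _ 0); [left|]; lia.
by ring.
Qed.

Lemma smooth_vlad : smooth vlad.
Proof. by apply: (smooth_comp (smooth_interp _)); smo. Qed.

Lemma smooth_hv : smooth (fun u => hweight u * vsign u).
Proof. by apply: smooth_mult; [exact: (smooth_hweight) | exact: smooth_vsign]. Qed.

Lemma is_derive_area u : is_derive area u (hweight u * vsign u).
Proof. exact: (is_derive_prim smooth_hv). Qed.

Lemma smooth_tilt : smooth tilt.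
Proof.
apply: smooth_plus; apply: smooth_mult; try exact: smooth_const; last exact: smooth_vlad.
exact: (smooth_antideriv is_derive_area smooth_hv).
Qed.

Definition dtilt (u : R) : R := Derive tilt u.

Lemma is_derive_tilt u : is_derive tilt u (dtilt u).
Proof. exact/Derive_correct/smooth_ex_derive/smooth_tilt. Qed.

Lemma dtiltE j u : Rabs (u - IZR j - 1/2) < 3/4 ->
  dtilt u = 1/256 * (hweight u * vsign u)
    + (- (1/256) * tilt_comp) * ((if Z.even j then 1 else 0) * dstep (u - IZR j - 1/2)).
Proof.
move=> H; apply: is_derive_unique.
exact: (is_derive_lin3 _ _ (is_derive_area u) (is_derive_vlad H)).
Qed.

Lemma dtilt_hori j u : Z.odd j -> IZR j + 1/4 <= u <= IZR j + 3/4 ->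
  dtilt u = 1/256 * vsign u.
Proof.
move=> O H; rewrite (@dtiltE j); last by apply: Rabs_def1; lra.
have -> : Z.even j = false by move: O; rewrite Zeven_odd; case: (Z.even j).
by rewrite (hweight_flat H) O; ring.
Qed.

Lemma dtilt_corner j u : Rabs (u - IZR j) <= 1/4 ->
  dtilt u = 1/256 * (hweight u * vdir j).
Proof.
move=> H; have {H} [H Hb] : Rabs (u - IZR j) <= 1/4 /\ - (1/4) <= u - IZR j <= 1/4.
  by split=> //; move/Rabs_le_between: H.
rewrite -(vsign_corner CA CB H); have [Hu|Hu] := Rle_lt_dec (IZR j) u.
  rewrite (@dtiltE j); last by apply: Rabs_def1; lra.
  by rewrite dstep_eq0; [ring | rewrite Rabs_left; lra].
rewrite (@dtiltE (j - 1)%Z) ?minus_IZR; last by apply: Rabs_def1; lra.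
by rewrite dstep_eq0; [ring | rewrite Rabs_pos_eq; lra].
Qed.

(** The correction by [vlad] acts only where [hweight] vanishes. *)
Lemma hweight_dtilt u : hweight u * dtilt u = 1/256 * (hweight u * hweight u * vsign u).
Proof.
case: (time_cases u) => -[j H].
  by rewrite (dtilt_corner H) (vsign_corner CA CB H); ring.
case E: (Z.even j).
  by rewrite (hweight_flat H) Zeven_odd E /=; ring.
have O : Z.odd j by rewrite Zeven_odd E.
by rewrite (dtilt_hori O H) (hweight_flat H) O; ring.
Qed.

Lemma tilt_periodic u : tilt (u + IZR P) = tilt u.
Proof.
have P0 : 0 < IZR P by apply: IZR_lt; apply: (cp_gt0 cp).
have Bp : forall x, area (x + IZR P) = area x + area (IZR P).
  move=> x; have D t : is_derive (fun x => 1 * area (x + IZR P) + (-1) * area x) t 0.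
    apply: (is_derive_eq (is_derive_lin3 1 (-1)
      (is_derive_shift (is_derive_area (t + IZR P))) (is_derive_area t))).
    by rewrite (hweight_periodic cp) (vsign_periodic cp); ring.
  have K a b : a <= b -> area (b + IZR P) - area b = area (a + IZR P) - area a.
    by move=> ab; have := @deriv0_const _ a b (fun t _ => D t) ab; lra.
  have B0 : area 0 = 0 by rewrite /area RInt_point.
  case: (Rle_lt_dec 0 x) => Hx; [have := K _ _ Hx | have := K _ _ (Rlt_le _ _ Hx)];
  rewrite Rplus_0_l B0; lra.
have [p Hp] : exists p, (P = 2 * p)%Z by apply/Z.even_spec; apply: (cp_even cp).
have V : vlad (u + IZR P) = vlad u + IZR P / 2.
  rewrite /vlad; have -> : u + IZR P + 1/2 = u + 1/2 + IZR P by ring.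
  rewrite -interp_add; apply: interp_shift => j.
  have -> : (j + P + 1 = (j + 1) + p * 2)%Z by lia.
  by rewrite Z.div_add // plus_IZR Hp mult_IZR; field.
by rewrite /tilt Bp V /tilt_comp; field; lra.
Qed.

Lemma dtilt_periodic u : dtilt (u + IZR P) = dtilt u.
Proof.
apply: esym; apply: is_derive_unique.
apply: (is_derive_ext (fun u => tilt (u + IZR P))) => [x|]; first exact: tilt_periodic.
exact/is_derive_shift/is_derive_tilt.
Qed.

Lemma fX_periodic u : fX (u + IZR P) = fX u.
Proof.
rewrite /Submission.fX; congr (_ + _); apply: esym; apply: is_derive_unique.
  apply: (is_derive_ext (fun u => fa (u + IZR P))) => [x|]; first exact: (fa_periodic cp).
  exact/is_derive_shift/Derive_correct/smooth_ex_derive/(smooth_fa cp).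
apply: (is_derive_ext (fun u => fb (u + IZR P))) => [x|]; first exact: (fb_periodic cp).
exact/is_derive_shift/Derive_correct/smooth_ex_derive/(smooth_fb cp).
Qed.

Lemma tilt_bounds : exists M, 1 <= M /\
  forall u, Rabs (tilt u) <= M /\ Rabs (dtilt u) <= M /\ Rabs (fX u) <= M.
Proof.
have [M1 [P1 H1]] := periodic_bounded (cp_gt0 cp) smooth_tilt tilt_periodic.
have [M2 [P2 H2]] := periodic_bounded (cp_gt0 cp) (smooth_Derive smooth_tilt) dtilt_periodic.
have [M3 [P3 H3]] := periodic_bounded (cp_gt0 cp) (smooth_fX cp) fX_periodic.
exists (1 + M1 + M2 + M3); split; first lra.
by move=> u; have := H1 u; have := H2 u; have := H3 u; rewrite -/(dtilt u); lra.
Qed.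

(** * Tilted fronts *)

Definition tb (s sig u : R) : R := fm sig u + s * tilt u.
(** On the Legendrian front this slope alone gives the contact form the value [s * fX^2] per unit of
    path time, so that only the cusps are left to the tilt. *)
Definition ty (s u : R) : R := fy u - s * fX u.

Lemma is_derive_tb s sig u : is_derive (tb s sig) u (dm sig u + s * dtilt u).
Proof.
apply: (is_derive_ext (fun u => 1 * fm sig u + s * tilt u)) => [x|].
  by rewrite /tb Rmult_1_l.
by apply: (is_derive_eq (is_derive_lin3 1 s (is_derive_fm sig u) (is_derive_tilt u))); ring.
Qed.

Section Bounded.
Variables (M s sig : R).
Hypothesis HM : forall u, Rabs (tilt u) <= M /\ Rabs (dtilt u) <= M /\ Rabs (fX u) <= M.
Hypothesis s0 : 0 < s.
Hypothesis sM : s * M <= 1/64.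
Hypothesis Hsig : 0 <= sig <= 1.

Lemma small_tilt u : - (1/64) <= s * tilt u <= 1/64.
Proof.
have [H _] := HM u; have {H} := proj1 (Rabs_le_between _ _) H.
by move=> H; split; nra.
Qed.

Lemma small_dtilt u : - (1/64) <= s * dtilt u <= 1/64.
Proof.
have [_ [H _]] := HM u; have {H} := proj1 (Rabs_le_between _ _) H.
by move=> H; split; nra.
Qed.

Lemma small_fX u : - (1/64) <= s * fX u <= 1/64.
Proof.
have [_ [_ H]] := HM u; have {H} := proj1 (Rabs_le_between _ _) H.
by move=> H; split; nra.
Qed.

Lemma smooth_speed j u : dir (j - 1)%Z = dir j -> IZR j - 3/4 <= u <= IZR j + 3/4 ->
  0 < dir j * (fX u * hweight u + (dm sig u + s * dtilt u)).
Proof.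
move=> E H; have D := small_dtilt u.
have flat i : dir i = dir j -> IZR i + 1/4 <= u <= IZR i + 3/4 ->
   0 < dir j * (fX u * hweight u + (dm sig u + s * dtilt u)).
  move=> Ei Hi; rewrite -Ei; case Ev: (Z.even i).
    have := dm_vert Hsig Ev Hi; rewrite (hweight_flat Hi) Zeven_odd Ev /= /slow.
    by case: (dir1 cp i) => ->; lra.
  have O : Z.odd i by rewrite Zeven_odd Ev.
  have := fX_flat cp Hi; rewrite (dm_hori sig O Hi) (hweight_flat Hi) O /slow.
  by case: (dir1 cp i) => ->; lra.
case: (Rle_lt_dec u (IZR j - 1/4)) => H1; first by apply: (flat (j - 1)%Z) => //; rewrite minus_IZR; lra.
case: (Rle_lt_dec (IZR j + 1/4) u) => H2; first by apply: (flat j) => //; lra.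
have A : Rabs (u - IZR j) <= 1/4 by apply: Rabs_le; lra.
have A' : Rabs (u - IZR j) <= 3/4 by lra.
rewrite (fX_corner cp A) (dm_corner sig A) (interp_near _ A') E.
have -> : vdir j = dir j by rewrite /Submission.vdir /vedge; case: (Z.even j).
by rewrite /slow; case: (dir1 cp j) => ->; lra.
Qed.

(** Up along the vertical edge and left along the horizontal one, b - a increases, and the tilt is
    too small or has the right sign. *)
Lemma cusp_speed j u : dir (j - 1)%Z <> dir j -> IZR j - 3/4 <= u <= IZR j + 3/4 ->
  0 < dm sig u + s * dtilt u - fX u * hweight u.
Proof.
move=> N H; have D := small_dtilt u.
have [V Hh] : vdir j = 1 /\ dir (hedge j) = -1.
  by case: (corner_dirs j) => [[_ [E1 E2]]|[[_ [E1 E2]]|[V [_ Hh]]]] //; lra.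
have [O _] := hedgeP cp j.
have flat i : i = vedge j \/ i = hedge j -> IZR i + 1/4 <= u <= IZR i + 3/4 ->
   0 < dm sig u + s * dtilt u - fX u * hweight u.
  case=> Ei Hi.
    have [Ev _] := vedgeP cp j; rewrite -Ei in Ev.
    have := dm_vert Hsig Ev Hi; rewrite (hweight_flat Hi) Zeven_odd Ev /= /slow.
    by move: V; rewrite /Submission.vdir -Ei => ->; lra.
  rewrite -Ei in O Hh.
  have := fX_flat cp Hi; rewrite (dm_hori sig O Hi) (hweight_flat Hi) O /slow Hh.
  by lra.
case: (Rle_lt_dec u (IZR j - 1/4)) => H1.
  apply: (flat (j - 1)%Z); last by rewrite minus_IZR; lra.
  by rewrite /vedge /hedge; case: (Z.even j); [right|left].
case: (Rle_lt_dec (IZR j + 1/4) u) => H2.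
  apply: (flat j); last lra.
  by rewrite /vedge /hedge; case: (Z.even j); [left|right].
have A : Rabs (u - IZR j) <= 1/4 by apply: Rabs_le; lra.
have Hw := hweight_bounds u.
rewrite (fX_corner cp A) (dm_corner sig A) (dtilt_corner A) V.
case: (interp_dir_corner A) => [[V' _]|[[_ E]|[_ [-> _]]]]; first lra.
  (* A value interpolated strictly between two opposite directions is not 1. *)
  exfalso; have A' : Rabs (u - IZR j) <= 3/4 by lra.
  have := interp_near dir A'; rewrite E.
  have := dir1 cp (j - 1)%Z; have := dir1 cp j.
  have S1 : -1/4 < u - IZR j < 1/4 by lra.
  have S2 : 0 < step (u - IZR j) < 1.
    have E0 := @step0 (-1/4) ltac:(lra); have E1 := @step1 (1/4) ltac:(lra).
    have := @step_lt (-1/4) (u - IZR j); have := @step_lt (u - IZR j) (1/4); lra.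
  by case=> E2; case=> E1; rewrite E1 E2 in N *; try lra.
set h := hweight u in Hw *; rewrite /slow.
have Q : 0 <= (1 - 2 * h) * (1 - 2 * h) by apply: Rle_0_sqr.
have K0 : 0 <= sig * (h * (1 - h)).
  by apply: Rmult_le_pos; [lra | apply: Rmult_le_pos; lra].
case: (Req_dec h 0) => Hh'; first by rewrite Hh'; lra.
have K1 : 0 < s * h by apply: Rmult_lt_0_compat; lra.
lra.
Qed.

Lemma tilt_rect : rect_front P CA CB fa (tb s sig).
Proof.
have Hs := Hsig.
have mix d x y lo : (d = 1 \/ d = -1) -> 0 <= d * (x - lo) -> 0 <= d * (y - lo) ->
    0 <= d * ((1 - sig) * x + sig * y - lo).
  by case=> ->; nra.
have mix' d x y lo : (d = 1 \/ d = -1) -> 0 <= d * (lo - x) -> 0 <= d * (lo - y) ->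
    0 <= d * (lo - ((1 - sig) * x + sig * y)).
  by case=> ->; nra.
split; [exact: (fa_periodic cp)|..].
- by move=> u; rewrite /tb /fm (fb_periodic cp) (ft_periodic cp) tilt_periodic.
- by move=> j u E H; rewrite (fa_flat cp E H) Rminus_diag Rabs_R0; lra.
- move=> j u E H; rewrite /tb /fm (fb_flat cp E H) (ft_flat cp E H).
  by apply: Rabs_le; have := small_tilt u; lra.
- by move=> j u E H; have := fa_move cp E H; lra.
- move=> j u E H; have [B1 B2] := fb_move cp E H; have [T1 T2] := ft_move cp E H.
  have S := small_tilt u; rewrite /tb /fm.
  have D := dir1 cp j; have L := mix _ _ _ _ D B1 T1; have L' := mix' _ _ _ _ D B2 T2.
  by case: D L L' => ->; lra.
- move=> j u H; have [Fa Fb] := fab_corner cp H; have Ft := ft_corner cp H.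
  split; first lra; rewrite /tb /fm.
  have S := small_tilt u; apply: Rabs_le.
  by move/Rabs_le_between: Fb; move/Rabs_le_between: Ft; nra.
move=> j u v Hu uv Hv Ea Eb.
case: (Req_dec (dir (j - 1)%Z) (dir j)) => E.
  have : dir j * fa u + dir j * tb s sig u < dir j * fa v + dir j * tb s sig v.
    apply: (@incr_lt (fun u => dir j * fa u + dir j * tb s sig u) (fun u =>
       dir j * (fX u * hweight u) + dir j * (dm sig u + s * dtilt u))) => // t Ht.
      by apply: is_derive_lin3; [exact: (is_derive_fa cp) | exact: is_derive_tb].
    by have := @smooth_speed j t E ltac:(lra); lra.
  by rewrite Ea Eb; lra.
have : (-1) * fa u + 1 * tb s sig u < (-1) * fa v + 1 * tb s sig v.
  apply: (@incr_lt (fun u => (-1) * fa u + 1 * tb s sig u) (fun u =>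
     (-1) * (fX u * hweight u) + 1 * (dm sig u + s * dtilt u))) => // t Ht.
    by apply: is_derive_lin3; [exact: (is_derive_fa cp) | exact: is_derive_tb].
  by have := @cusp_speed j t E ltac:(lra); lra.
by rewrite Ea Eb; lra.
Qed.

(** With d = [dm sig u], the form equals 2 h (d - X (1 - h)) plus s times X (X h + d) + 2 h [dtilt]
    plus an error of order s. The first part is nonzero only at cusps, where [ft] ascends at least
    as fast as [fb]. At cusps X vanishes but the tilt is positive; at descending corners the tilt is
    negative, but its share 2/256 is below [slow^2 = 1/64]. *)
Lemma tilt_form u : s * (M * M) <= 1/1024 ->
  0 < (dm sig u + s * dtilt u - fX u * hweight u)
      - ty s u * (fX u * hweight u + (dm sig u + s * dtilt u)).
Proof.
move=> sMM; have Hs := Hsig; have Hw := hweight_bounds u.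
have s1 : s * fX u <= 1/64 /\ - (1/64) <= s * fX u by have := small_fX u; lra.
have Err : - (1/1024) <= s * (fX u * dtilt u).
  have [_ [H1 H2]] := HM u.
  have := Rmult_le_compat _ _ _ _ (Rabs_pos (fX u)) (Rabs_pos (dtilt u)) H2 H1.
  rewrite -Rabs_mult => /Rabs_le_between H; nra.
have Vb := vsign_bounds cp u.
set h := hweight u in Hw *; set X := fX u in s1 Err *; set d := dm sig u.
have -> : d + s * dtilt u - X * h - ty s u * (X * h + (d + s * dtilt u)) =
  2 * h * (d - X * (1 - h)) + s * (X * (X * h + d) + 2 * (h * dtilt u) + s * (X * dtilt u)).
  by rewrite /ty /fy -/h -/X; ring.
rewrite hweight_dtilt -/h.
case: (time_cases u) => -[j H].
  rewrite /X (fX_corner cp H) -/X /d (dm_corner sig H) -/h (vsign_corner CA CB H).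
  have EX : X = slow * interp dir u by apply: (fX_corner cp H).
  rewrite -/X -EX.
  case: (interp_dir_corner H) => [[V E]|[[V E]|[V [E N]]]]; rewrite V E in EX *; rewrite EX in Err *;
    rewrite /slow in Err *; set e := s * (_ * dtilt u) in Err *.
  - have : 0 < s * ((1/8) * (1/8) - 2/256 + e) by apply: Rmult_lt_0_compat; lra.
    by have : 0 <= h * h <= 1; [split; nra | nra].
  - have : 0 < s * ((1/8) * (1/8) + e) by apply: Rmult_lt_0_compat; lra.
    by have : 0 <= h * h <= 1; [split; nra | nra].
  - rewrite EX /slow -/h in s1.
    have K0 : 0 <= sig * (h * (1 - h)) by apply: Rmult_le_pos; [lra | apply: Rmult_le_pos; lra].
    have K1 : 0 <= 2 * h + s * (1/8 * (1 - 2 * h)).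
      by case: (Rle_lt_dec h (1/2)) => Hh; [apply: Rplus_le_le_0_compat; nra | lra].
    have K2 : 0 <= sig * (h * (1 - h)) * (2 * h + s * (1/8 * (1 - 2 * h))) by apply: Rmult_le_pos.
    (* The right-hand side is least at h = 4/9, with value 1/576, which exceeds the bound 1/1024 on
       the error. *)
    have K3 : 1/9 * (1/64) <= 1/64 * ((1 - 2 * h) * (1 - 2 * h)) + 2/256 * (h * h).
      by have := Rle_0_sqr (h - 4/9); rewrite /Rsqr; nra.
    have K4 : 0 < s * (1/64 * ((1 - 2 * h) * (1 - 2 * h)) + 2/256 * (h * h) + e).
      by apply: Rmult_lt_0_compat; lra.
    by rewrite -/h in e Err K4 *; nra.
have HX := fX_flat cp H; rewrite -/X in HX.
have HXX : 1/64 <= X * X.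
  by move: HX; rewrite /slow; case: (dir1 cp j) => ->; nra.
case E: (Z.even j).
  have Hh : h = 0 by rewrite /h (hweight_flat H) Zeven_odd E.
  have Hd := dm_vert Hsig E H; rewrite -/d in Hd.
  have HXd : 1/64 <= X * d.
    by move: HX Hd; rewrite /slow; case: (dir1 cp j) => ->; nra.
  rewrite Hh; have : 0 < s * (X * d + s * (X * dtilt u)) by apply: Rmult_lt_0_compat; lra.
  by lra.
have O : Z.odd j by rewrite Zeven_odd E.
have Hh : h = 1 by rewrite /h (hweight_flat H) O.
have Hd : d = 0 by apply: (dm_hori sig O H).
rewrite Hh Hd.
have : 0 < s * (X * X + 2 * (1/256 * vsign u) + s * (X * dtilt u)) by apply: Rmult_lt_0_compat; lra.
by lra.
Qed.
End Bounded.
End Tilt.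

(** * From the Legendrian knot to a closed braid *)

Definition half_step (v : R) : R := step (v / 2 - 1/4).

(** The values at -1, 0 and 1 are -1/4, 0 and C + 1/8, and the derivative is at least 1/8. The
    asymmetry is deliberate: [- ramp] has to stay below 1/2 on descending parts and to be very
    negative on ascending ones. *)
Definition ramp (C v : R) : R := C * half_step v - half_step (- v) / 8 + v / 8.

Lemma half_step_neg v : v <= 0 -> half_step v = 0.
Proof. by move=> H; rewrite /half_step step0; lra. Qed.

Lemma half_step1 : half_step 1 = 1.
Proof. by rewrite /half_step step1; lra. Qed.

Lemma smooth_half_step : smooth half_step.
Proof.
have -> : half_step = fun v => step (/ 2 * v - 1/4).
  by apply: functional_extensionality => v; rewrite /half_step; congr step; field.
by smo.
Qed.

Lemma smooth_ramp C : smooth (ramp C).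
Proof.
have -> : ramp C = fun v => C * half_step v - half_step (- v) * / 8 + v * / 8 by [].
apply: smooth_plus; last by smo.
apply: smooth_minus; first by apply: smooth_mult; [smo|exact: smooth_half_step].
apply: smooth_mult; last by smo.
by apply: (smooth_comp smooth_half_step); smo.
Qed.

Lemma ramp1 C : ramp C 1 = C + 1/8.
Proof. by rewrite /ramp half_step1 half_step_neg; lra. Qed.

Lemma rampN1 C : ramp C (-1) = - (1/4).
Proof. by rewrite /ramp half_step_neg ?Ropp_involutive ?half_step1; lra. Qed.

Lemma ramp_incr C v w : 0 <= C -> v <= w -> (w - v) / 8 <= ramp C w - ramp C v.
Proof.
move=> C0 vw; rewrite /ramp.
have H1 : half_step v <= half_step w by apply: step_le; lra.
have H2 : half_step (- w) <= half_step (- v) by apply: step_le; lra.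
nra.
Qed.

Lemma ramp0 C : ramp C 0 = 0.
Proof. by rewrite /ramp Ropp_0 half_step_neg; lra. Qed.

Lemma ramp_sign C v : 0 <= C -> v * v / 8 <= v * ramp C v.
Proof.
move=> C0; case: (Rle_lt_dec 0 v) => H.
  by have := ramp_incr C0 H; rewrite ramp0; nra.
by have := ramp_incr C0 (Rlt_le _ _ H); rewrite ramp0; nra.
Qed.

Lemma ramp_deriv C v : 0 <= C -> 1/8 <= Derive (ramp C) v.
Proof.
move=> C0; apply: Rnot_lt_le => H.
have D : derivable_pt_lim (ramp C) v (Derive (ramp C) v).
  exact/is_derive_Reals/Derive_correct/smooth_ex_derive/smooth_ramp.
have e0 : 0 < 1/8 - Derive (ramp C) v by lra.
have [[d d0] /= Hd] := D _ e0.
have := Hd (d/2) ltac:(lra); rewrite Rabs_pos_eq; last lra.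
move=> /(_ ltac:(lra)) /Rabs_def2 [K _].
have L := @ramp_incr C v (v + d/2) C0 ltac:(lra).
have : 1/8 <= (ramp C (v + d/2) - ramp C v) / (d/2).
  apply: (Rmult_le_reg_r (d/2)); first lra.
  set w := ramp _ _ - _ in L *; have -> : w / (d/2) * (d/2) = w by field; lra.
  by lra.
lra.
Qed.

Section Curves.
Variables (P : Z) (CA CB : Z -> Z).
Hypothesis cp : closed_path P CA CB.
Hypothesis bp : braid_path P CA CB.

Notation dir := (dir CA CB).
Notation vdir := (vdir CA CB).
Notation vsign := (vsign CA CB).
Notation fa := (fa CA CB).
Notation fb := (fb CA CB).
Notation ft := (ft CA CB).
Notation fX := (fX CA CB).
Notation tb := (tb P CA CB).
Notation ty := (ty CA CB).
Notation tilt := (tilt P CA CB).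
Notation dtilt := (dtilt P CA CB).
Notation dm := (dm CA CB).

Definition pr : R := IZR P.
Definition mk (A B Y : R -> R) : curve :=
  Curve (fun t => A (pr * t) + B (pr * t)) (fun t => Y (pr * t)) (fun t => B (pr * t) - A (pr * t)).

Lemma pr_gt0 : 0 < pr.
Proof. by apply: IZR_lt; apply: (cp_gt0 cp). Qed.

Lemma smooth_pr f : smooth f -> smooth (fun t => f (pr * t)).
Proof. by move=> F; apply: (smooth_comp F); smo. Qed.

Lemma is_derive_extR (f g : R -> R) (x l : R) :
  (forall t, f t = g t) -> is_derive f x l -> is_derive g x l.
Proof. exact: is_derive_ext. Qed.

Lemma is_derive_pr (f : R -> R) l t : is_derive f (pr * t) l ->
  is_derive (fun t => f (pr * t)) t (pr * l).
Proof.
move=> D; apply: (@is_derive_extR (fun t => f (pr * t + 0))) => [x|].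
  by rewrite Rplus_0_r.
by apply: is_derive_affine; rewrite Rplus_0_r.
Qed.

Lemma same_time_pr t u : same_time P (pr * t) (pr * u) -> exists n : Z, u = t + IZR n.
Proof.
have P0 := pr_gt0; move=> [n Hn]; exists n; rewrite mult_IZR -/pr in Hn.
by apply: (Rmult_eq_reg_l pr); [rewrite Hn; ring | lra].
Qed.

Lemma periodic_pr f : (forall u, f (u + IZR P) = f u) -> periodic (fun t => f (pr * t)).
Proof. by move=> H t; rewrite Rmult_plus_distr_l Rmult_1_r H. Qed.

Lemma transverse_mk A B Y dA dB :
  smooth A -> smooth B -> smooth Y ->
  (forall u, is_derive A u (dA u)) -> (forall u, is_derive B u (dB u)) ->
  (forall u, A (u + IZR P) = A u) -> (forall u, B (u + IZR P) = B u) ->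
  (forall u, Y (u + IZR P) = Y u) ->
  (forall u, 0 < dB u - dA u - Y u * (dA u + dB u)) ->
  (forall u v, A u = A v -> B u = B v -> Y u = Y v -> same_time P u v) ->
  transverse (mk A B Y).
Proof.
move=> SA SB SY DA DB PA PB PY F I; have P0 := pr_gt0.
apply: transverseI.
- by apply: smooth_plus; apply: smooth_pr.
- exact: smooth_pr.
- by apply: smooth_minus; apply: smooth_pr.
- by move=> t; rewrite !(periodic_pr PA) !(periodic_pr PB).
- exact: periodic_pr.
- by move=> t; rewrite !(periodic_pr PA) !(periodic_pr PB).
- move=> t; have D1 := is_derive_pr (DA (pr * t)); have D2 := is_derive_pr (DB (pr * t)).
  rewrite /cform (is_derive_unique _ _ _ (is_derive_plus _ _ _ _ _ D1 D2)).
  rewrite (is_derive_unique _ _ _ (is_derive_minus _ _ _ _ _ D2 D1)).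
  rewrite /plus /minus /opp /plus /=; have := Rmult_lt_0_compat _ _ P0 (F (pr * t)); lra.
- by move=> t u X YY Z; apply: same_time_pr; apply: I => //; lra.
Qed.

Lemma fy_per u : fy (u + IZR P) = fy u.
Proof. by rewrite /fy (hweight_periodic cp). Qed.

Lemma fy_vert j u : Z.even j -> IZR j + 1/4 <= u <= IZR j + 3/4 -> hweight u = 0.
Proof. by move=> E H; rewrite (hweight_flat H) Zeven_odd E. Qed.

Lemma fy_hori j u : Z.odd j -> IZR j + 1/4 <= u <= IZR j + 3/4 -> hweight u = 1.
Proof. by move=> E H; rewrite (hweight_flat H) E. Qed.

(** A turning horizontal edge crosses nothing, so that the horizontal strand at a crossing belongs
    to an ascending part. *)
Lemma crossing_signs u v : crossing CA CB u v ->
  [/\ hweight u = 0, hweight v = 1 & vsign v = 1].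
Proof.
move=> [i [j [Ei Oj Hu Hv [L1 [L2 [L3 L4]]]]]].
split; [exact: fy_vert Ei Hu|exact: fy_hori Oj Hv|].
case: (Req_dec (vdir j) (vdir (j + 1)%Z)) => E; last first.
  by case: (bp_free bp Ei Oj E L1 L2 L3 L4).
rewrite (@vsign_near CA CB j); last by apply: Rabs_le; lra.
by rewrite -E (bp_up bp Oj E); ring.
Qed.

Definition bE eps : R -> R := tb eps 1.
Definition dbE eps u : R := dm 1 u + eps * dtilt u.
(** The slope for the front turned to the plane of the coordinates (b, - a). The term in [del]
    separates a vertical from a horizontal ascending strand; without it their slopes would agree at
    a crossing. *)
Definition slope C del u : R := del * (1 - hweight u) - ramp C (vsign u).
Definition dslope C del u : R := Derive (slope C del) u.

Lemma smooth_slope C del : smooth (slope C del).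
Proof.
apply: smooth_minus; last first.
  by apply: (smooth_comp (smooth_ramp C)); apply: smooth_vsign.
by apply: smooth_mult; [smo|apply: smooth_minus; [smo|exact: smooth_hweight]].
Qed.

Lemma slope_periodic C del u : slope C del (u + IZR P) = slope C del u.
Proof. by rewrite /slope (hweight_periodic cp) (vsign_periodic cp). Qed.

Lemma slope_lt1 C del u : 0 <= C -> 0 <= del <= 1/8 -> slope C del u < 1/2.
Proof.
move=> C0 Hd; have Hw := hweight_bounds u; have Hv := vsign_bounds cp u.
have := @ramp_incr C (-1) (vsign u) C0 ltac:(lra); rewrite rampN1 /slope; nra.
Qed.

Section Eps.
Variables (M eps : R).
Hypothesis M1 : 1 <= M.
Hypothesis HM : forall u, Rabs (tilt u) <= M /\ Rabs (dtilt u) <= M /\ Rabs (fX u) <= M.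
Hypothesis eps0 : 0 < eps.
Hypothesis epsM : eps * (M * M) <= 1/1024.

Let small s sig : 0 < s <= eps -> 0 <= sig <= 1 ->
  [/\ 0 < s, s * M <= 1/64, 0 <= sig <= 1 & s * (M * M) <= 1/1024].
Proof.
move=> Hs Hsig; split; [lra| |lra|nra].
have : s * M <= eps * (M * M) by apply: Rmult_le_compat; nra.
lra.
Qed.

Lemma transverse_tilted s sig : 0 < s <= eps -> 0 <= sig <= 1 ->
  transverse (mk fa (tb s sig) (ty s)).
Proof.
move=> Hs Hsig; have [s0 sM H01 sMM] := small Hs Hsig.
have rf := tilt_rect cp bp HM s0 sM H01.
have SY : smooth (ty s).
  apply: smooth_minus; first exact: smooth_fy.
  by apply: smooth_mult; [smo|exact: (smooth_fX cp)].
apply: (@transverse_mk _ _ _ (fun u => fX u * hweight u) (fun u => dm sig u + s * dtilt u)) => //.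
- exact: (smooth_fa cp).
- by apply: smooth_plus; [exact: (smooth_fm cp)|apply: smooth_mult; [smo|apply: smooth_tilt]].
- by move=> u; apply: (is_derive_fa cp).
- by move=> u; apply: (is_derive_tb cp).
- exact: (rf_perA rf).
- exact: (rf_perB rf).
- by move=> u; rewrite /Submission.ty fy_per (fX_periodic cp).
- by move=> u; have := tilt_form cp bp HM s0 sM H01 u sMM; lra.
move=> u v Ea Eb Ey.
have SX w := small_fX HM s0 sM H01 w.
case: (double_point cp rf Ea Eb) => // /crossing_signs [H1 H2 _]; exfalso;
  move: Ey; rewrite /Submission.ty /fy H1 H2; have := SX u; have := SX v; lra.
Qed.

(** Tilt [eps * s] and mixture [s] are increased together: the family starts at the Legendrian curve
    itself and is transverse as soon as [s] is positive. *)
Lemma tilted_pushoff : transverse_pushoff (mk fa fb fy) (mk fa (bE eps) (ty eps)).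
Proof.
pose B s := tb (eps * clamp s) (clamp s); pose Y s := ty (eps * clamp s).
have F3 F1 F2 F : smooth F1 -> smooth F2 -> smooth F ->
    smooth_family (fun s t => ((1 - clamp s) * F1 t + clamp s * F2 t) + eps * clamp s * F t).
  by move=> *; smf.
have FB : smooth_family (fun s t => B s (pr * t)).
  by apply: F3; apply: smooth_pr; [exact: (smooth_fb cp)|exact: (smooth_ft cp)|exact: smooth_tilt].
have F2 F1 F : smooth F1 -> smooth F -> smooth_family (fun s t => F1 t - eps * clamp s * F t).
  by move=> *; smf.
have FY : smooth_family (fun s t => Y s (pr * t)).
  by apply: F2; apply: smooth_pr; [exact: smooth_fy|exact: (smooth_fX cp)].
have FA : smooth_family (fun _ t => fa (pr * t)).
  by apply: sf_static; apply: smooth_pr; apply: (smooth_fa cp).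
have [[_ C1] [_ C2] [_ C3]] :
  [/\ smooth_family (fun s t => fa (pr * t) + B s (pr * t)), smooth_family (fun s t => Y s (pr * t))
    & smooth_family (fun s t => B s (pr * t) - fa (pr * t))].
  by split=> //; [apply: sf_plus|apply: sf_minus].
exists (fun s => mk fa (B s) (Y s)); split; first by split.
- move=> s Hs; rewrite /B /Y clamp_id; last lra.
  by apply: transverse_tilted; [split; nra|lra].
- congr mk; apply: functional_extensionality => u.
    by rewrite /B clamp0 /Submission.tb /fm; ring.
  by rewrite /Y clamp0 /Submission.ty; ring.
- by rewrite /B /Y clamp1 Rmult_1_r.
Qed.

Let Heps : [/\ 0 < eps, eps * M <= 1/64, 0 <= 1 <= 1 & eps * (M * M) <= 1/1024].
Proof. by apply: small; lra. Qed.

Let rfE : rect_front P CA CB fa (bE eps).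
Proof. by case: Heps => s0 sM H01 _; apply: (tilt_rect cp bp HM s0 sM H01). Qed.

Lemma is_derive_bE u : is_derive (bE eps) u (dbE eps u).
Proof. exact: (is_derive_tb cp). Qed.

Lemma dbE_corner j u : Rabs (u - IZR j) <= 1/4 ->
  dbE eps u = vdir j * (slow * (1 - hweight u) + eps / 256 * hweight u).
Proof.
move=> H; rewrite /dbE (dm_corner cp 1 H) (dtilt_corner P CA CB H); field.
Qed.

Lemma dbE_hori j u : Z.odd j -> IZR j + 1/4 <= u <= IZR j + 3/4 ->
  dbE eps u = eps / 256 * vsign u.
Proof. by move=> O H; rewrite /dbE (dm_hori cp 1 O H) (dtilt_hori P CA CB O H); field. Qed.

Lemma dbE_vert j u : Z.even j -> IZR j + 1/4 <= u <= IZR j + 3/4 ->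
  1/16 <= dir j * dbE eps u.
Proof.
case: Heps => s0 sM H01 _; move=> E H; have D := small_dtilt HM s0 sM H01 u.
have := dm_vert cp H01 E H; rewrite /dbE /slow; case: (dir1 cp j) => ->; lra.
Qed.

Lemma eps_small : eps / 256 <= slow.
Proof. by case: Heps => s0 sM H01 _; rewrite /slow; nra. Qed.

Lemma dbE_corner_bound j u : Rabs (u - IZR j) <= 1/4 -> eps / 256 <= vdir j * dbE eps u.
Proof.
move=> H; rewrite (dbE_corner H) -Rmult_assoc.
have -> : vdir j * vdir j = 1 by case: (vdir1 cp j) => ->; ring.
by have := eps_small; have := hweight_bounds u; nra.
Qed.

Section Slope.
Variables C del : R.
Hypothesis HC : 2 * (M + 1) <= C * (eps / 256).
Hypothesis Hdel : 0 < del <= 1/8.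

Lemma C_gt1 : 2 <= C.
Proof. by have := eps_small; rewrite /slow => H; nra. Qed.

Lemma slope_up u : vsign u = 1 -> slope C del u <= - (C / 2).
Proof.
have Hw := hweight_bounds u; have H := C_gt1.
by rewrite /slope => ->; rewrite ramp1; nra.
Qed.

Lemma slope_down u : vsign u = -1 -> 1/4 <= slope C del u.
Proof. by have Hw := hweight_bounds u; rewrite /slope => ->; rewrite rampN1; nra. Qed.

Lemma slope_hori u : hweight u = 1 -> slope C del u = - ramp C (vsign u).
Proof. by rewrite /slope => ->; ring. Qed.

Lemma vsign_turn j u : Z.odd j -> vdir j <> vdir (j + 1)%Z ->
  IZR j + 1/4 <= u <= IZR j + 3/4 -> fX u <= - slow.
Proof. by move=> O N H; have := fX_flat cp H; rewrite (bp_left bp O N); lra. Qed.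

Lemma slope_form u : 0 < - (fX u * hweight u) - slope C del u * dbE eps u.
Proof.
have Hw := hweight_bounds u; have C2 := C_gt1; have e0 := eps0.
have K0 : 0 < eps / 256 by lra.
have [_ [_ /Rabs_le_between HX]] := HM u.
case: (time_cases u) => -[j H].
  have V := vsign_corner CA CB H; have B := dbE_corner_bound H.
  case: (interp_dir_corner cp bp H) => [[E E']|E].
    rewrite E in V B; have Q := slope_down V.
    rewrite (fX_corner cp H) E'; have := Hw; rewrite /slow; nra.
  have {}E : vdir j = 1 by case: E => -[].
  rewrite E in V B; have Q := slope_up V.
  have : M + 1 <= - slope C del u * dbE eps u.
    apply: (Rle_trans _ (C / 2 * (eps / 256))); first lra.
    by apply: Rmult_le_compat; lra.
  nra.
case E: (Z.even j).
  rewrite (fy_vert E H); have B := dbE_vert E H.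
  have V := vsign_vert CA CB E H.
  case: (dir1 cp j) => D; rewrite D in V B.
    by have Q := slope_up V; nra.
  by have Q := slope_down V; nra.
have O : Z.odd j by rewrite Zeven_odd E.
have h1 := fy_hori O H; rewrite (slope_hori h1) h1 (dbE_hori O H).
have RS := @ramp_sign C (vsign u) ltac:(lra).
case: (Req_dec (vdir j) (vdir (j + 1)%Z)) => N.
  have -> : vsign u = 1.
    rewrite (@vsign_near CA CB j); last by apply: Rabs_le; lra.
    by rewrite -N (bp_up bp O N); ring.
  by rewrite ramp1; nra.
have X := vsign_turn O N H; move: X; rewrite /slow => X.
have : 0 <= eps / 256 * (vsign u * ramp C (vsign u)).
  by apply: Rmult_le_pos; [lra|have := Rle_0_sqr (vsign u); rewrite /Rsqr; lra].
lra.
Qed.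

(** The slope of the front (b, - a), rewritten for the coordinates x = a + b, z = b - a. This
    fractional linear function is finite and increasing as long as the argument is below 1. *)
Definition y1 u : R := (1 + slope C del u) / (1 - slope C del u).

Lemma slope_lt_half u : slope C del u < 1/2.
Proof. by apply: slope_lt1; [have := C_gt1|]; lra. Qed.

Lemma smooth_y1 : smooth y1.
Proof.
have S := smooth_slope C del.
apply: smooth_div; [|by apply: smooth_plus; [smo|]|by apply: smooth_minus; [smo|]].
by move=> u; have := slope_lt_half u; lra.
Qed.

Lemma y1_lt u v : slope C del u < slope C del v -> y1 u < y1 v.
Proof.
move=> H; have Hu := slope_lt_half u; have Hv := slope_lt_half v.
have E w : slope C del w < 1/2 -> y1 w = 2 / (1 - slope C del w) - 1.
  by move=> K; rewrite /y1; field; lra.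
rewrite !E //; suff : 2 / (1 - slope C del u) < 2 / (1 - slope C del v) by lra.
apply: Rmult_lt_compat_l; first lra.
by apply: Rinv_lt_contravar; [apply: Rmult_lt_0_compat; lra|lra].
Qed.

Lemma crossing_slope u v : crossing CA CB u v -> slope C del v < slope C del u.
Proof.
move=> /crossing_signs [H1 H2 H3]; rewrite /slope H1 H2 H3.
by have := @ramp_incr C (vsign u) 1 ltac:(have := C_gt1; lra); have := vsign_bounds cp u; lra.
Qed.

(** The front stays fixed while the slopes are interpolated. The contact form is affine in the
    slope, and the two slopes order the strands of every crossing in the same way. *)
Lemma raise_isotopy : transverse_isotopic (mk fa (bE eps) (ty eps)) (mk fa (bE eps) y1).
Proof.
have [s0 sM H01 sMM] := Heps.
have SY : smooth (ty eps).
  apply: smooth_minus; first exact: smooth_fy.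
  by apply: smooth_mult; [smo|exact: (smooth_fX cp)].
have SB : smooth (bE eps).
  by apply: smooth_plus; [exact: (smooth_fm cp)|apply: smooth_mult; [smo|apply: smooth_tilt]].
have SA := smooth_fa cp; have S1 := smooth_y1.
pose Y s u := (1 - s) * ty eps u + s * y1 u.
have -> : ty eps = Y 0 by apply: functional_extensionality => u; rewrite /Y; ring.
have -> : y1 = Y 1 by apply: functional_extensionality => u; rewrite /Y; ring.
apply: (@transverse_isotopicI (fun _ t => fa (pr * t) + bE eps (pr * t))
  (fun s t => Y s (pr * t)) (fun _ t => bE eps (pr * t) - fa (pr * t))).
- by apply: sf_static; apply: smooth_plus; apply: smooth_pr.
- have F2 F1 F : smooth F1 -> smooth F -> smooth_family (fun s t => (1 - s) * F1 t + s * F t).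
    by move=> *; smf.
  by apply: F2; apply: smooth_pr.
- by apply: sf_static; apply: smooth_minus; apply: smooth_pr.
move=> s Hs.
apply: (@transverse_mk fa (bE eps) (Y s) (fun u => fX u * hweight u) (dbE eps)) => //.
- by apply: smooth_plus; apply: smooth_mult => //; smo.
- by move=> u; apply: (is_derive_fa cp).
- exact: is_derive_bE.
- exact: (rf_perA rfE).
- exact: (rf_perB rfE).
- by move=> u; rewrite /Y /Submission.ty fy_per (fX_periodic cp) /y1 slope_periodic.
- move=> u; set dA := fX u * hweight u; set dB := dbE eps u.
  have F0 : 0 < dB - dA - ty eps u * (dA + dB) := tilt_form cp bp HM s0 sM H01 u sMM.
  have F1 : 0 < dB - dA - y1 u * (dA + dB).
    have Hq := slope_lt_half u; have := slope_form u; rewrite -/dA -/dB => K.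
    have -> : dB - dA - y1 u * (dA + dB) = 2 * (- dA - slope C del u * dB) / (1 - slope C del u).
      by rewrite /y1; field; lra.
    by apply: Rdiv_lt_0_compat; lra.
  rewrite /Y; case: (Req_dec s 0) => [->|Ns]; first lra.
  have : 0 < s * (dB - dA - y1 u * (dA + dB)) by apply: Rmult_lt_0_compat; lra.
  have : 0 <= (1 - s) * (dB - dA - ty eps u * (dA + dB)) by apply: Rmult_le_pos; lra.
  lra.
move=> u v Ea Eb Ey.
have SX w := small_fX HM s0 sM H01 w.
have key w x : crossing CA CB w x -> Y s x < Y s w.
  move=> X; have K1 := y1_lt (crossing_slope X).
  have K2 : ty eps x < ty eps w.
    have [H1 H2 _] := crossing_signs X.
    by rewrite /Submission.ty /fy H1 H2; have := SX w; have := SX x; lra.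
  rewrite /Y; case: (Rle_lt_dec s (1/2)) => Hs2.
    have := Rmult_lt_0_compat (1 - s) _ ltac:(lra) (Rlt_Rminus _ _ K2).
    by have := Rmult_le_pos s (y1 w - y1 x) ltac:(lra) ltac:(lra); lra.
  have := Rmult_lt_0_compat s _ ltac:(lra) (Rlt_Rminus _ _ K1).
  by have := Rmult_le_pos (1 - s) (ty eps w - ty eps x) ltac:(lra) ltac:(lra); lra.
by case: (double_point cp rfE Ea Eb) => // /key; rewrite Ey; lra.
Qed.

Variable b0 : R.

Definition braid_curve : curve :=
  Curve (fun t => bE eps (pr * t) - b0) (fun t => slope C del (pr * t)) (fun t => - fa (pr * t)).

(** The linear maps sending (a, b) to (b + (1 - s) a, (1 - s) b - a) have determinant 1 + (1 - s)^2,
    and the slope is transported by the corresponding fractional linear map. The contact form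
    remains a positive multiple of the one in [slope_form]. The axis is moved to [b0] at the same
    time. *)
Lemma rotate_isotopy : transverse_isotopic (mk fa (bE eps) y1) braid_curve.
Proof.
have SB : smooth (bE eps).
  by apply: smooth_plus; [exact: (smooth_fm cp)|apply: smooth_mult; [smo|apply: smooth_tilt]].
have SA := smooth_fa cp; have SS := smooth_slope C del.
have {}SB : smooth (fun t => bE eps (pr * t)) by apply: smooth_pr.
have {}SA : smooth (fun t => fa (pr * t)) by apply: smooth_pr.
have {}SS : smooth (fun t => slope C del (pr * t)) by apply: smooth_pr.
have den s u : 0 < 1 - slope C del u * (1 - clamp s).
  by have := slope_lt_half u; have := clamp_bounds s; nra.
pose X s t := bE eps (pr * t) + (1 - clamp s) * fa (pr * t) - clamp s * b0.
pose Y s t := ((1 - clamp s) + slope C del (pr * t)) / (1 - slope C del (pr * t) * (1 - clamp s)).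
pose W s t := (1 - clamp s) * bE eps (pr * t) - fa (pr * t).
have -> : mk fa (bE eps) y1 = Curve (X 0) (Y 0) (W 0).
  by rewrite /mk /X /Y /W clamp0; congr Curve; apply: functional_extensionality => t;
    rewrite /y1; [ring|rewrite Rminus_0_r Rmult_1_r; congr (_ / _); ring|ring].
have -> : braid_curve = Curve (X 1) (Y 1) (W 1).
  by rewrite /braid_curve /X /Y /W clamp1; congr Curve; apply: functional_extensionality => t;
    [ring|field|ring].
have fam B A Q : smooth B -> smooth A -> smooth Q ->
    [/\ smooth_family (fun s t => B t + (1 - clamp s) * A t - clamp s * b0),
        smooth_family (fun s t => (1 - clamp s) + Q t),
        smooth_family (fun s t => 1 - Q t * (1 - clamp s))
      & smooth_family (fun s t => (1 - clamp s) * B t - A t)].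
  by move=> *; split; smf.
have [FX FY1 FY2 FW] := fam _ _ _ SB SA SS.
have den0 s t : 1 - slope C del (pr * t) * (1 - clamp s) <> 0 by have := den s (pr * t); lra.
have FY := sf_div den0 FY1 FY2.
apply: transverse_isotopicI => //.
move=> s Hs; have Ec := clamp_id Hs.
have den' t : 0 < 1 - slope C del (pr * t) * (1 - s) by rewrite -Ec.
apply: transverseI; [exact: (proj1 (FX) s)|exact: (proj1 FY s)|exact: (proj1 FW s)|..].
- by move=> t; rewrite /X !(periodic_pr (rf_perA rfE)) !(periodic_pr (rf_perB rfE)).
- by move=> t; rewrite /Y !(periodic_pr (slope_periodic C del)).
- by move=> t; rewrite /W !(periodic_pr (rf_perA rfE)) !(periodic_pr (rf_perB rfE)).
- move=> t; have P0 := pr_gt0.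
  have DA := is_derive_pr (is_derive_fa cp (pr * t)).
  have DB := is_derive_pr (is_derive_bE (pr * t)).
  set dA := fX _ * _ in DA; set dB := dbE _ _ in DB.
  have DX : is_derive (X s) t (pr * (dB + (1 - s) * dA)).
    apply: (@is_derive_extR (fun t => - (s * b0) + 1 *
       (1 * bE eps (pr * t) + (1 - s) * fa (pr * t)))) => [x|].
      by rewrite /X /= Ec; ring.
    by apply: (is_derive_eq (is_derive_lin _ 1 (is_derive_lin3 1 (1 - s) DB DA))); ring.
  have DW : is_derive (W s) t (pr * ((1 - s) * dB - dA)).
    apply: (@is_derive_extR (fun t => (1 - s) * bE eps (pr * t) + (-1) * fa (pr * t))) => [x|].
      by rewrite /W /= Ec; ring.
    by apply: (is_derive_eq (is_derive_lin3 (1 - s) (-1) DB DA)); ring.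
  rewrite /cform (is_derive_unique _ _ _ DX) (is_derive_unique _ _ _ DW) /Y Ec.
  have F := slope_form (pr * t); have D := den' t; rewrite -/dA -/dB in F.
  set q := slope _ _ _ in D F *.
  have -> : pr * ((1 - s) * dB - dA) - (1 - s + q) / (1 - q * (1 - s)) * (pr * (dB + (1 - s) * dA))
     = pr * ((1 + (1 - s) * (1 - s)) * (- dA - q * dB)) / (1 - q * (1 - s)) by field; lra.
  apply: Rdiv_lt_0_compat => //; apply: Rmult_lt_0_compat => //.
  by apply: Rmult_lt_0_compat => //; have := Rle_0_sqr (1 - s); rewrite /Rsqr; lra.
move=> t u; rewrite /X /Y /W Ec => HX HY HW; apply: same_time_pr.
have Ea : fa (pr * t) = fa (pr * u).
  have : (1 + (1 - s) * (1 - s)) * (fa (pr * t) - fa (pr * u)) = 0 by nra.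
  by case/Rmult_integral; have := Rle_0_sqr (1 - s); rewrite /Rsqr; lra.
have Eb : bE eps (pr * t) = bE eps (pr * u) by rewrite Ea in HX; lra.
have Eq : slope C del (pr * t) = slope C del (pr * u).
  have D := den' t; have D' := den' u.
  set q := slope _ _ _ in HY D *; set q' := slope _ _ _ in HY D' *.
  have : (1 - s + q) * (1 - q' * (1 - s)) = (1 - s + q') * (1 - q * (1 - s)).
    apply: (Rmult_eq_reg_r (/ (1 - q * (1 - s)) * / (1 - q' * (1 - s)))).
      by transitivity ((1 - s + q) / (1 - q * (1 - s))); [field; lra|rewrite HY; field; lra].
    by apply: Rmult_integral_contrapositive_currified; apply: Rinv_neq_0_compat; lra.
  move=> K; have : (1 + (1 - s) * (1 - s)) * (q - q') = 0 by nra.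
  by case/Rmult_integral; have := Rle_0_sqr (1 - s); rewrite /Rsqr; lra.
by case: (double_point cp rfE Ea Eb) => // /crossing_slope; rewrite Eq; lra.
Qed.

Variables Mb Mh : R.
Hypothesis HMb : forall u, Rabs (bE eps u - b0) <= Mb.
Hypothesis HMh : forall u, Rabs (Derive hweight u) <= Mh.
Hypothesis Hdel2 : del * (Mb * Mh) < eps / 1024.
Hypothesis Hrow : forall j, Z.odd j -> vdir j <> vdir (j + 1)%Z -> 1/4 <= vdir j * (IZR (CB j) - b0).

Lemma is_derive_vsign j u : Rabs (u - IZR j - 1/2) < 3/4 ->
  is_derive vsign u ((vdir (j + 1)%Z - vdir j) * dstep (u - IZR j - 1/2)).
Proof.
move=> H; have E : u + 1/2 - IZR (j + 1) = u - IZR j - 1/2 by rewrite plus_IZR; lra.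
have K := @is_derive_interp vdir (u + 1/2) (j + 1)%Z; rewrite E in K.
have := is_derive_shift (K H); have -> // : (j + 1 - 1 = j)%Z by lia.
Qed.

Lemma dslopeE u l : is_derive vsign u l ->
  dslope C del u = - del * Derive hweight u - Derive (ramp C) (vsign u) * l.
Proof.
move=> D; apply: is_derive_unique.
have Dh : is_derive hweight u (Derive hweight u).
  exact/Derive_correct/smooth_ex_derive/smooth_hweight.
have Dr : is_derive (ramp C) (vsign u) (Derive (ramp C) (vsign u)).
  exact/Derive_correct/smooth_ex_derive/smooth_ramp.
have DD : is_derive (fun u => ramp C (vsign u)) u (l * Derive (ramp C) (vsign u)).
  exact: (is_derive_comp _ _ _ _ _ Dr D).
apply: (@is_derive_extR (fun u => del + 1 * ((- del) * hweight u + (-1) * ramp C (vsign u)))) => [x|].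
  by rewrite /slope; ring.
by apply: (is_derive_eq (is_derive_lin del 1 (is_derive_lin3 (- del) (-1) Dh DD))); ring.
Qed.

Lemma Derive_hweight_flat j u : IZR j + 1/4 <= u <= IZR j + 3/4 -> Derive hweight u = 0.
Proof.
move=> H; case: (Rle_lt_dec u (IZR j + 1/2)) => Hu.
  apply: is_derive_unique; apply: (is_derive_eq (@is_derive_interp _ u j _)).
    by apply: Rabs_def1; lra.
  by rewrite dstep_eq0; [ring|rewrite Rabs_pos_eq; lra].
apply: is_derive_unique; apply: (is_derive_eq (@is_derive_interp _ u (j + 1)%Z _));
  rewrite plus_IZR; first by apply: Rabs_def1; lra.
by rewrite dstep_eq0; [ring|rewrite Rabs_left; lra].
Qed.

(** The point (b - b0, slope) turns counterclockwise around the origin, which makes the curve a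
    closed braid. Away from turns the second term dominates the derivative of the [del] term. In the
    middle of a turn that term vanishes, but the slope passes through 0 there, on the side of the
    axis given by [Hrow]. *)
Lemma slope_rotates u : 0 < (bE eps u - b0) * dslope C del u - slope C del u * dbE eps u.
Proof.
have Hw := hweight_bounds u; have C2 := C_gt1; have e0 := eps0.
have K0 : 0 < eps / 256 by lra.
have Hb := HMb u; have Hh := HMh u.
case: (time_cases u) => -[j H].
  have V := vsign_corner CA CB H; have B := dbE_corner_bound H.
  have Dv : is_derive vsign u 0.
    move/Rabs_le_between: H => H; case: (Rle_lt_dec (IZR j) u) => Hu.
      apply: (is_derive_eq (@is_derive_vsign j u _)); first by apply: Rabs_def1; lra.
      by rewrite dstep_eq0; [ring|rewrite Rabs_left; lra].
    apply: (is_derive_eq (@is_derive_vsign (j - 1)%Z u _)); rewrite minus_IZR;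
      first by apply: Rabs_def1; lra.
    by rewrite dstep_eq0; [ring|rewrite Rabs_pos_eq; lra].
  rewrite (dslopeE Dv).
  have Err : - (eps / 1024) < (bE eps u - b0) * (- del * Derive hweight u).
    have := Rmult_le_compat _ _ _ _ (Rabs_pos _) (Rabs_pos _) Hb Hh.
    rewrite -Rabs_mult => /Rabs_le_between K; nra.
  have : eps / 1024 <= - (slope C del u * dbE eps u).
    case: (vdir1 cp j) => E; rewrite E in V B.
      have Q := slope_up V.
      have : 1 * (eps / 256) <= - slope C del u * dbE eps u by apply: Rmult_le_compat; lra.
      lra.
    have Q := slope_down V.
    have : 1/4 * (eps / 256) <= slope C del u * - dbE eps u by apply: Rmult_le_compat; lra.
    lra.
  lra.
have Dv := @is_derive_vsign j u ltac:(apply: Rabs_def1; lra).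
rewrite (dslopeE Dv) (Derive_hweight_flat H).
case E: (Z.even j).
  rewrite vdir_succ // Rminus_diag; have B := dbE_vert E H; have V := vsign_vert CA CB E H.
  case: (dir1 cp j) => D; rewrite D in V B.
    by have Q := slope_up V; nra.
  by have Q := slope_down V; nra.
have O : Z.odd j by rewrite Zeven_odd E.
have h1 := fy_hori O H; rewrite (slope_hori h1) (dbE_hori O H).
have RS := @ramp_sign C (vsign u) ltac:(lra).
case: (Req_dec (vdir j) (vdir (j + 1)%Z)) => N.
  have -> : vsign u = 1.
    rewrite (@vsign_near CA CB j); last by apply: Rabs_le; lra.
    by rewrite -N (bp_up bp O N); ring.
  by rewrite -N ramp1 Rminus_diag; nra.
have R0 := Hrow O N; have RD := @ramp_deriv C (vsign u) ltac:(lra).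
have FB := rf_flatB rfE O H; move/Rabs_le_between: FB => FB.
have d0 := dstep_ge0 (u - IZR j - 1/2).
have Vd : vdir (j + 1)%Z = - vdir j.
  by case: (vdir1 cp j) N => ->; case: (vdir1 cp (j + 1)%Z) => -> ?; lra.
have Vp : 0 < vdir j * (bE eps u - b0).
  by case: (vdir1 cp j) R0 => ->; lra.
rewrite Vd.
have -> : (bE eps u - b0) * (- del * 0 - Derive (ramp C) (vsign u) *
     ((- vdir j - vdir j) * dstep (u - IZR j - 1/2))) - - ramp C (vsign u) * (eps / 256 * vsign u)
  = 2 * (vdir j * (bE eps u - b0)) * (Derive (ramp C) (vsign u) * dstep (u - IZR j - 1/2))
    + eps / 256 * (vsign u * ramp C (vsign u)) by ring.
have S2 : 0 <= vsign u * vsign u by apply: Rle_0_sqr.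
have T1 : 0 <= Derive (ramp C) (vsign u) * dstep (u - IZR j - 1/2) by apply: Rmult_le_pos; lra.
case: (Req_dec (vsign u) 0) => Vz.
  have : 0 < dstep (u - IZR j - 1/2).
    apply: dstep_gt0; split; apply: Rnot_le_lt => K;
      have := @vsign_near CA CB j u ltac:(apply: Rabs_le; lra); rewrite Vz.
      by rewrite step0 //; case: (vdir1 cp j) => ->; lra.
    by rewrite step1 // Vd; case: (vdir1 cp j) => ->; lra.
  move=> dp; have : 0 < Derive (ramp C) (vsign u) * dstep (u - IZR j - 1/2).
    by apply: Rmult_lt_0_compat; lra.
  by rewrite Vz Rmult_0_l Rmult_0_r; nra.
have : 0 < vsign u * vsign u by apply: Rsqr_pos_lt.
by nra.
Qed.

End Slope.
End Eps.
End Curves.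

(** * Closed braids *)

Lemma is_derive_multR (f g : R -> R) x l m : is_derive f x l -> is_derive g x m ->
  is_derive (fun t => f t * g t) x (l * g x + f x * m).
Proof. by move=> F G; apply: (is_derive_mult f g) => // *; rewrite /mult /= Rmult_comm. Qed.

(** Angles are measured in full turns, so that strands at the same angle differ by integers. *)
Definition co (x : R) : R := cos (2 * PI * x).
Definition si (x : R) : R := sin (2 * PI * x).

Lemma co_si x : co x * co x + si x * si x = 1.
Proof. by have := sin2_cos2 (2 * PI * x); rewrite /Rsqr /co /si; lra. Qed.

Lemma is_derive_co f x l : is_derive f x l ->
  is_derive (fun t => co (f t)) x (- (2 * PI * l) * si (f x)).
Proof.
move=> D; have D2 := is_derive_lin 0 (2 * PI) D.
apply: (@is_derive_extR (fun t => cos (0 + 2 * PI * f t))) => [t|].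
  by rewrite Rplus_0_l.
apply: (is_derive_eq (is_derive_comp _ _ _ _ _ (is_derive_cos _) D2)).
by rewrite /scal /= /mult /= Rplus_0_l /si; ring.
Qed.

Lemma is_derive_si f x l : is_derive f x l ->
  is_derive (fun t => si (f t)) x (2 * PI * l * co (f x)).
Proof.
move=> D; have D2 := is_derive_lin 0 (2 * PI) D.
apply: (@is_derive_extR (fun t => sin (0 + 2 * PI * f t))) => [t|].
  by rewrite Rplus_0_l.
apply: (is_derive_eq (is_derive_comp _ _ _ _ _ (is_derive_sin _) D2)).
by rewrite /scal /= /mult /= Rplus_0_l /co; ring.
Qed.

Lemma smooth_co f : smooth f -> smooth (fun t => co (f t)).
Proof. by move=> F; apply: smooth_cos; smo. Qed.

Lemma smooth_si f : smooth f -> smooth (fun t => si (f t)).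
Proof. by move=> F; apply: smooth_sin; smo. Qed.

Lemma si_eq0 x : si x = 0 -> exists k : Z, 2 * x = IZR k.
Proof.
move=> /sin_eq_0_0 [k Hk]; exists k; have := PI_RGT_0 => P0.
by apply: (Rmult_eq_reg_r PI); lra.
Qed.

(** The hypotheses say that cos (2 pi (y - x)) = 1, hence sin (pi (y - x)) = 0. *)
Lemma co_si_inj x y : co x = co y -> si x = si y -> exists k : Z, y = x + IZR k.
Proof.
move=> C S; have H : sin (PI * (y - x)) * sin (PI * (y - x)) = 0.
  have := cos_2a_sin (PI * (y - x)).
  have -> : 2 * (PI * (y - x)) = 2 * PI * y - 2 * PI * x by ring.
  by rewrite cos_minus -/(co y) -/(co x) -/(si y) -/(si x) -C -S co_si; lra.
have {H} : sin (PI * (y - x)) = 0 by case: (Rmult_integral _ _ H).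
move=> /sin_eq_0_0 [k Hk]; exists k; have := PI_RGT_0 => P0.
have : y - x = IZR k by apply: (Rmult_eq_reg_r PI); lra.
lra.
Qed.

Lemma co_si_shift x (k : Z) : co (x + IZR k) = co x /\ si (x + IZR k) = si x.
Proof.
rewrite /co /si.
have -> : 2 * PI * (x + IZR k) = 2 * PI * x + 2 * IZR k * PI by ring.
case: (Z_le_gt_dec 0 k) => Hk.
  have -> : IZR k = INR (Z.to_nat k) by rewrite INR_IZR_INZ Z2Nat.id.
  by rewrite cos_period sin_period.
have E : IZR k = - INR (Z.to_nat (- k)) by rewrite INR_IZR_INZ Z2Nat.id ?opp_IZR; [ring|lia].
rewrite -{1}(cos_period _ (Z.to_nat (- k))) -{1}(sin_period _ (Z.to_nat (- k))) E.
by split; [congr cos|congr sin]; ring.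
Qed.

(** A closed braid with radius [p], height [h] and angle [th], in the coordinates of [braid_closure]
    but with an angle that need not be proportional to the parameter. *)
Definition bc (p h th : R -> R) : curve :=
  Curve (fun t => p t * co (th t)) (fun t => 2 * (p t * si (th t)))
    (fun t => h t + p t * co (th t) * (p t * si (th t))).

Record braided (m : Z) (p h th : R -> R) : Prop := Braided {
  br_p : smooth p;
  br_h : smooth h;
  br_th : smooth th;
  br_pos : forall t, 0 < p t;
  br_perp : periodic p;
  br_perh : periodic h;
  br_wind : forall t, th (t + 1) = th t + IZR m;
  br_turn : forall t, 0 < Derive th t;
  br_form : forall t, 0 < Derive h t + 2 * PI * (p t * p t) * Derive th t;
  br_emb : forall t u n, th u = th t + IZR n -> p t = p u -> h t = h u ->
    exists k, (n = k * m)%Z }.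

Lemma turning_incr (th : R -> R) t u : smooth th -> (forall t, 0 < Derive th t) ->
  t < u -> th t < th u.
Proof.
move=> S T tu; apply: (@incr_lt th (Derive th)) => // x _.
exact/Derive_correct/smooth_ex_derive.
Qed.

Lemma turning_inj (th : R -> R) t u : smooth th -> (forall t, 0 < Derive th t) ->
  th t = th u -> t = u.
Proof.
move=> S T E; case: (total_order_T t u) => [[H|//]|H]; exfalso;
  have := turning_incr S T H; lra.
Qed.

Lemma windZ (th : R -> R) (m : Z) : (forall t, th (t + 1) = th t + IZR m) ->
  forall t n, th (t + IZR n) = th t + IZR (n * m).
Proof.
move=> W t n; have := @periodicZ (fun t => th t - IZR m * t).
move=> /(_ ltac:(by move=> x; rewrite W; ring)) /(_ t n); rewrite mult_IZR; lra.
Qed.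

Lemma cform_bc p h th t : smooth p -> smooth h -> smooth th ->
  cform (cx (bc p h th)) (cy (bc p h th)) (cz (bc p h th)) t =
  Derive h t + 2 * PI * (p t * p t) * Derive th t.
Proof.
move=> Sp Sh St.
have Dp : is_derive p t (Derive p t) by apply/Derive_correct/smooth_ex_derive.
have Dh : is_derive h t (Derive h t) by apply/Derive_correct/smooth_ex_derive.
have Dt : is_derive th t (Derive th t) by apply/Derive_correct/smooth_ex_derive.
have DX := is_derive_multR Dp (is_derive_co Dt).
have DY := is_derive_multR Dp (is_derive_si Dt).
have DZ := is_derive_plus _ _ _ _ _ Dh (is_derive_multR DX DY).
rewrite /cform (is_derive_unique _ _ _ DX) (is_derive_unique _ _ _ DZ).
rewrite /plus /=; have C := co_si (th t).
set c := co _ in C *; set s := si _ in C *; set dh := Derive h t; set dt := Derive th t.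
set dp := Derive p t; set P := p t.
have -> : 2 * PI * (P * P) * dt = 2 * PI * (P * P) * dt * (c * c + s * s) by rewrite C; ring.
ring.
Qed.

Lemma transverse_bc m p h th : braided m p h th -> transverse (bc p h th).
Proof.
case=> Sp Sh St Pos Pp Ph W T F E.
apply: transverseI.
- by apply: smooth_mult => //; apply: smooth_co.
- by apply: smooth_mult; [smo|apply: smooth_mult => //; apply: smooth_si].
- by apply: smooth_plus => //; do 2 apply: smooth_mult => //; [apply: smooth_co|apply: smooth_si].
- by move=> t; rewrite Pp W; rewrite (proj1 (co_si_shift (th t) m)).
- by move=> t; rewrite Pp W; rewrite (proj2 (co_si_shift (th t) m)).
- by move=> t; rewrite Pp Ph W; case: (co_si_shift (th t) m) => -> ->.
- by move=> t; rewrite (@cform_bc p h th t).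
move=> t u X Y Z.
have Y' : p t * si (th t) = p u * si (th u) by lra.
have Q : p t * p t = p u * p u.
  have := co_si (th t); have := co_si (th u) => Cu Ct.
  transitivity ((p t * co (th t)) * (p t * co (th t)) + (p t * si (th t)) * (p t * si (th t))).
    by transitivity (p t * p t * (co (th t) * co (th t) + si (th t) * si (th t))); [rewrite Ct|]; ring.
  rewrite X Y'.
  by transitivity (p u * p u * (co (th u) * co (th u) + si (th u) * si (th u))); [|rewrite Cu]; ring.
have {Q} Q : p t = p u by have := Pos t; have := Pos u; nra.
have Pu := Pos u.
have Ec : co (th t) = co (th u) by apply: (Rmult_eq_reg_l (p u)); [rewrite -{1}Q|lra].
have Es : si (th t) = si (th u) by apply: (Rmult_eq_reg_l (p u)); [rewrite -{1}Q|lra].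
have Eh : h t = h u by rewrite X Y' in Z; lra.
have [n Hn] := co_si_inj Ec Es; have [k Ek] := E t u n Hn Q Eh.
exists k; apply: (turning_inj St T); rewrite Hn (windZ W) Ek; ring.
Qed.

Lemma isotopy_bc m (p h th : R -> R -> R) :
  smooth_family p -> smooth_family h -> smooth_family th ->
  (forall s, 0 <= s <= 1 -> braided m (p s) (h s) (th s)) ->
  transverse_isotopic (bc (p 0) (h 0) (th 0)) (bc (p 1) (h 1) (th 1)).
Proof.
move=> Fp Fh Ft B; have [Sc Ss] := smooth_cos_sin.
have Fc : smooth_family (fun s t => co (th s t)) by apply: (sf_comp Sc); smf.
have Fs : smooth_family (fun s t => si (th s t)) by apply: (sf_comp Ss); smf.
apply: (@transverse_isotopicI (fun s => cx (bc (p s) (h s) (th s)))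
  (fun s => cy (bc (p s) (h s) (th s))) (fun s => cz (bc (p s) (h s) (th s)))) => /=.
- exact: sf_mult.
- by apply: sf_mult; [smf|apply: sf_mult].
- by apply: sf_plus => //; apply: sf_mult; apply: sf_mult.
by move=> s Hs; apply: transverse_bc (B s Hs).
Qed.

(** * Polar coordinates of a rotating curve *)

Section Polar.
Variables b v w : R -> R.
Hypotheses (Sb : smooth b) (Sv : smooth v) (Sw : smooth w).
Hypotheses (Pb : periodic b) (Pv : periodic v) (Pw : periodic w).
Hypothesis rot : forall t, 0 < b t * Derive v t - v t * Derive b t.
Variables t0 : R.
Hypotheses (b_t0 : b t0 < 0) (v_t0 : v t0 = 0).

Let nn t := b t * b t + v t * v t.
Let g t := (b t * Derive v t - v t * Derive b t) / (2 * PI * nn t).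
Let twopi : 0 < 2 * PI. Proof. by have := PI_RGT_0; lra. Qed.

Let nn_gt0 t : 0 < nn t.
Proof.
have := rot t; rewrite /nn; have := Rle_0_sqr (b t); have := Rle_0_sqr (v t); rewrite /Rsqr.
move=> H1 H2 H; apply: Rnot_le_lt => K.
have E1 : b t = 0 by apply: Rsqr_0_uniq; rewrite /Rsqr; lra.
have E2 : v t = 0 by apply: Rsqr_0_uniq; rewrite /Rsqr; lra.
by rewrite E1 E2 in H; lra.
Qed.

Let Sg : smooth g.
Proof.
apply: smooth_div.
- by move=> t; have := nn_gt0 t => N; apply: Rgt_not_eq; apply: Rmult_lt_0_compat.
- by apply: smooth_minus; apply: smooth_mult => //; apply: smooth_Derive.
by apply: smooth_mult; [smo|apply: smooth_plus; apply: smooth_mult].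
Qed.

(** Integrating the rotation form gives a smooth angle on the whole line at once. The constant is
    half a turn at [t0], where the point lies on the negative half-axis. *)
Definition angle t : R := 1/2 + (RInt g 0 t - RInt g 0 t0).

Let Dangle t : is_derive angle t (g t).
Proof.
apply: (@is_derive_extR (fun t => (1/2 - RInt g 0 t0) + 1 * RInt g 0 t)) => [x|].
  by rewrite /angle; ring.
by apply: (is_derive_eq (is_derive_lin _ 1 (is_derive_prim Sg t))); ring.
Qed.

Lemma smooth_angle : smooth angle.
Proof. exact: (smooth_antideriv Dangle Sg). Qed.

Lemma Derive_angle t : Derive angle t = g t.
Proof. exact: is_derive_unique. Qed.

Lemma angle_turn t : 0 < Derive angle t.
Proof.
by rewrite Derive_angle; apply: Rdiv_lt_0_compat => //; apply: Rmult_lt_0_compat.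
Qed.

Lemma angle_t0 : angle t0 = 1/2.
Proof. by rewrite /angle; ring. Qed.

Definition radius t : R := b t * co (angle t) + v t * si (angle t).
Let S t : R := v t * co (angle t) - b t * si (angle t).

Let b_eq t : b t = radius t * co (angle t) - S t * si (angle t).
Proof.
rewrite /radius /S; have C := co_si (angle t).
transitivity (b t * (co (angle t) * co (angle t) + si (angle t) * si (angle t))); last ring.
by rewrite C; ring.
Qed.

Let v_eq t : v t = radius t * si (angle t) + S t * co (angle t).
Proof.
rewrite /radius /S; have C := co_si (angle t).
transitivity (v t * (co (angle t) * co (angle t) + si (angle t) * si (angle t))); last ring.
by rewrite C; ring.
Qed.

Let nnE t : nn t = radius t * radius t + S t * S t.
Proof.
rewrite /nn /radius /S; have C := co_si (angle t).
transitivity ((b t * b t + v t * v t) * (co (angle t) * co (angle t) + si (angle t) * si (angle t)));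
  last ring.
by rewrite C; ring.
Qed.

Let Db t : is_derive b t (Derive b t). Proof. exact/Derive_correct/smooth_ex_derive. Qed.
Let Dv t : is_derive v t (Derive v t). Proof. exact/Derive_correct/smooth_ex_derive. Qed.

Let DS t : is_derive S t ((b t * Derive b t + v t * Derive v t) / nn t * S t).
Proof.
have D1 := is_derive_multR (Dv t) (is_derive_co (Dangle t)).
have D2 := is_derive_multR (Db t) (is_derive_si (Dangle t)).
apply: (@is_derive_extR (fun t => 1 * (v t * co (angle t)) + (-1) * (b t * si (angle t)))) => [x|].
  by rewrite /S; ring.
apply: (is_derive_eq (is_derive_lin3 1 (-1) D1 D2)).
rewrite /S /g; have N := nn_gt0 t; have P0 := twopi.
set c := co _; set s := si _; set d := Derive v t; set e := Derive b t.
move: N; rewrite /nn => N; field; lra.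
Qed.

(** [S] is the component of (b, v) orthogonal to the direction of the angle. It satisfies S' = (nn'
    / (2 nn)) S, so that S^2 / nn is constant, and it vanishes at [t0]. *)
Let S0 t : S t = 0.
Proof.
have Dn u : is_derive nn u (2 * (b u * Derive b u + v u * Derive v u)).
  apply: (@is_derive_extR (fun u => 1 * (b u * b u) + 1 * (v u * v u))) => [x|].
    by rewrite /nn; ring.
  by apply: (is_derive_eq (is_derive_lin3 1 1 (is_derive_multR (Db u) (Db u))
    (is_derive_multR (Dv u) (Dv u)))); ring.
have Dq u : is_derive (fun u => S u * S u * / nn u) u 0.
  have Di := is_derive_inv _ _ _ (Dn u) (Rgt_not_eq _ _ (nn_gt0 u)).
  apply: (is_derive_eq (is_derive_multR (is_derive_multR (DS u) (DS u)) Di)).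
  by have N := nn_gt0 u; field; lra.
have St0 : S t0 = 0.
  rewrite /S angle_t0 v_t0 /si; have -> : 2 * PI * (1/2) = PI by field.
  by rewrite sin_PI; ring.
have : S t * S t * / nn t = 0.
  have E0 : S t0 * S t0 * / nn t0 = 0 by rewrite St0; ring.
  case: (Rle_lt_dec t0 t) => H.
    by rewrite (@deriv0_const (fun u => S u * S u * / nn u) t0 t).
  by rewrite -(@deriv0_const (fun u => S u * S u * / nn u) t t0) //; lra.
case/Rmult_integral => [/Rmult_integral [] //|].
by move=> K; have := Rinv_0_lt_compat _ (nn_gt0 t); lra.
Qed.

Lemma polar_b t : b t = radius t * co (angle t).
Proof. by rewrite {1}b_eq S0; ring. Qed.

Lemma polar_v t : v t = radius t * si (angle t).
Proof. by rewrite {1}v_eq S0; ring. Qed.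

Let radius2 t : radius t * radius t = nn t.
Proof. by rewrite nnE S0; ring. Qed.

Lemma smooth_radius : smooth radius.
Proof.
apply: smooth_plus; apply: smooth_mult => //;
  [apply: smooth_co|apply: smooth_si]; exact: smooth_angle.
Qed.

Lemma radius_gt0 t : 0 < radius t.
Proof.
have R0 : 0 < radius t0.
  rewrite /radius angle_t0 v_t0 /co; have -> : 2 * PI * (1/2) = PI by field.
  by rewrite cos_PI; lra.
apply: Rnot_le_lt => H.
have N u : radius u <> 0 by move=> E; have := nn_gt0 u; rewrite -radius2 E; lra.
have C : continuity radius by move=> u; apply: smooth_continuity_pt; apply: smooth_radius.
have [z [_ Hz]] : { z : R | Rmin t t0 <= z <= Rmax t t0 /\ radius z = 0 }.
  apply: IVT_gen; first exact: C.
  by rewrite Rmin_left ?Rmax_right; lra.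
by case: (N z).
Qed.

Lemma angle_wind : exists m : Z, forall t, angle (t + 1) = angle t + IZR m.
Proof.
have Pg t : g (t + 1) = g t.
  have PD f : smooth f -> periodic f -> Derive f (t + 1) = Derive f t.
    move=> Sf Pf; symmetry; apply: is_derive_unique.
    apply: (@is_derive_extR (fun t => f (t + 1))) => [x|]; first exact: Pf.
    by apply: is_derive_shift; apply/Derive_correct/smooth_ex_derive.
  by rewrite /g /nn !PD // !Pb !Pv.
have K t : angle (t + 1) - angle t = angle (t0 + 1) - angle t0.
  have D u : is_derive (fun u => angle (u + 1) - angle u) u 0.
    apply: (@is_derive_extR (fun u => 1 * angle (u + 1) + (-1) * angle u)) => [x|]; first ring.
    apply: (is_derive_eq (is_derive_lin3 1 (-1) (is_derive_shift (Dangle (u + 1))) (Dangle u))).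
    by rewrite Pg; ring.
  case: (Rle_lt_dec t0 t) => H.
    by rewrite (@deriv0_const (fun u => angle (u + 1) - angle u) t0 t).
  by rewrite -(@deriv0_const (fun u => angle (u + 1) - angle u) t t0) //; lra.
have R0 := radius_gt0 t0; have R1 := radius_gt0 (t0 + 1).
have Q : radius (t0 + 1) = radius t0.
  have := radius2 t0; have := radius2 (t0 + 1); rewrite /nn Pb Pv; nra.
have [m Hm] : exists m : Z, angle (t0 + 1) = angle t0 + IZR m.
  apply: co_si_inj; apply: (Rmult_eq_reg_l (radius t0)); try lra.
    by rewrite -{2}Q -!polar_b Pb.
  by rewrite -{2}Q -!polar_v Pv.
by exists m => t; have := K t; rewrite Hm; lra.
Qed.

Lemma radius_periodic : periodic radius.
Proof.
by move=> t; have [m W] := angle_wind; rewrite /radius W Pb Pv; case: (co_si_shift (angle t) m) => -> ->.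
Qed.

Definition height t : R := w t - b t * v t.

Lemma smooth_height : smooth height.
Proof. by apply: smooth_minus => //; apply: smooth_mult. Qed.

Lemma height_periodic : periodic height.
Proof. by move=> t; rewrite /height Pb Pv Pw. Qed.

Lemma height_form t : 0 < Derive w t - 2 * v t * Derive b t ->
  0 < Derive height t + 2 * PI * (radius t * radius t) * Derive angle t.
Proof.
have Dw : is_derive w t (Derive w t) by apply/Derive_correct/smooth_ex_derive.
have Dh : is_derive height t (Derive w t - (Derive b t * v t + b t * Derive v t)).
  apply: (@is_derive_extR (fun t => 1 * w t + (-1) * (b t * v t))) => [x|]; first by rewrite /height; ring.
  by apply: (is_derive_eq (is_derive_lin3 1 (-1) Dw (is_derive_multR (Db t) (Dv t)))); ring.
rewrite (is_derive_unique _ _ _ Dh) Derive_angle radius2 /g => H.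
set d := Derive v t; set e := Derive b t.
have -> : 2 * PI * nn t * ((b t * d - v t * e) / (2 * PI * nn t)) = b t * d - v t * e.
  by field; have := nn_gt0 t; have := PI_RGT_0; lra.
by rewrite /d /e; lra.
Qed.

Lemma polar_curve : Curve b (fun t => 2 * v t) w = bc radius height angle.
Proof.
rewrite /bc; congr Curve; apply: functional_extensionality => t.
- exact: polar_b.
- by rewrite -polar_v.
by rewrite -polar_b -polar_v /height; ring.
Qed.

End Polar.

Lemma isotopy_bc_ends m (p h th : R -> R -> R) p0 h0 th0 p1 h1 th1 :
  smooth_family p -> smooth_family h -> smooth_family th ->
  (forall s, 0 <= s <= 1 -> braided m (p s) (h s) (th s)) ->
  (forall t, [/\ p 0 t = p0 t, h 0 t = h0 t & th 0 t = th0 t]) ->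
  (forall t, [/\ p 1 t = p1 t, h 1 t = h1 t & th 1 t = th1 t]) ->
  transverse_isotopic (bc p0 h0 th0) (bc p1 h1 th1).
Proof.
move=> Fp Fh Ft B E0 E1.
have -> : p0 = p 0 by apply: functional_extensionality => t; case: (E0 t).
have -> : h0 = h 0 by apply: functional_extensionality => t; case: (E0 t).
have -> : th0 = th 0 by apply: functional_extensionality => t; case: (E0 t).
have -> : p1 = p 1 by apply: functional_extensionality => t; case: (E1 t).
have -> : h1 = h 1 by apply: functional_extensionality => t; case: (E1 t).
have -> : th1 = th 1 by apply: functional_extensionality => t; case: (E1 t).
exact: isotopy_bc Fp Fh Ft B.
Qed.

Lemma transverse_isotopic_sym T1 T2 : transverse_isotopic T1 T2 -> transverse_isotopic T2 T1.
Proof.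
move=> [H [[C1 C2 C3] Tr H0 H1]].
have rev f s t : continuity_2d_pt f (1 - s) t -> continuity_2d_pt (fun s t => f (1 - s) t) s t.
  move=> F eps; have [d Hd] := F eps; exists d => u v Hu Hv; apply: Hd => //.
  have -> : 1 - u - (1 - s) = - (u - s) by ring.
  by rewrite Rabs_Ropp.
have {}rev f : C1_family f -> C1_family (fun s => f (1 - s)).
  by move=> F s t; have [F1 F2] := F (1 - s) t; split; [exact: rev|exact: (rev (fun s t => Derive (f s) t))].
exists (fun s => H (1 - s)); split.
- by split; [apply: (rev (fun s => cx (H s)))|apply: (rev (fun s => cy (H s)))
    |apply: (rev (fun s => cz (H s)))].
- by move=> s Hs; apply: Tr; lra.
- by rewrite Rminus_0_r.
- by rewrite Rminus_diag.
Qed.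

Lemma form_from (h th : R -> R) (a t dh dt : R) : is_derive h t dh -> is_derive th t dt ->
  0 < dh + 2 * PI * a * dt -> 0 < Derive h t + 2 * PI * a * Derive th t.
Proof. by move=> /is_derive_unique -> /is_derive_unique ->. Qed.

Lemma is_derive_compR (f g : R -> R) t l : smooth f -> is_derive g t l ->
  is_derive (fun t => f (g t)) t (Derive f (g t) * l).
Proof.
move=> S D; apply: (is_derive_eq (is_derive_comp f g t _ _ _ D)).
  exact/Derive_correct/smooth_ex_derive.
by rewrite /scal /= /mult /= Rmult_comm.
Qed.

Lemma Derive_periodic P f : smooth f -> (forall u, f (u + IZR P) = f u) ->
  forall u, Derive f (u + IZR P) = Derive f u.
Proof.
move=> Sf Pf u; symmetry; apply: is_derive_unique.
apply: (@is_derive_extR (fun t => f (t + IZR P))) => [x|]; first exact: Pf.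
by apply: is_derive_shift; apply/Derive_correct/smooth_ex_derive.
Qed.

Lemma PI_gt3 : 3 < PI.
Proof. by have := PI2_3_2; lra. Qed.

(** * Joining two closed 3-braids through a thin tube *)

Section Thin.
Variables r h : R -> R.
Hypotheses (Sr : smooth r) (Sh : smooth h).
Hypotheses (Pr : forall u, r (u + IZR 3) = r u) (Ph : forall u, h (u + IZR 3) = h u).
Hypothesis r_gt0 : forall u, 0 < r u.
Hypothesis form : forall u, 0 < Derive h u + 2 * PI * (r u * r u).
Hypothesis emb : forall u n, r u = r (u + IZR n) -> h u = h (u + IZR n) -> exists k, (n = k * 3)%Z.

Variables p hT th psi : R -> R.
Hypothesis T : braided 3 p hT th.
Hypothesis Spsi : smooth psi.
Hypothesis Ppsi : forall x, psi (x + 1) = psi x + 1.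
Let chi t := psi (th t).
Hypothesis over : forall t u n, th u = th t + IZR n -> ~ (exists k, (n = k * 3)%Z) ->
  r (chi t) = r (chi u) -> 0 < (p t - p u) * (h (chi t) - h (chi u)).
Hypothesis sorted : forall t u n, th u = th t + IZR n -> ~ (exists k, (n = k * 3)%Z) ->
  p t = p u -> (r (chi t) - r (chi u)) * (hT t - hT u) < 0.

Let psiZ x n : psi (x + IZR n) = psi x + IZR n.
Proof. by rewrite (windZ (m := 1)) ?Z.mul_1_r. Qed.

Let bounds : exists B, 1 <= B /\ forall u,
  [/\ Rabs (r u) <= B, Rabs (h u) <= B, Rabs (Derive r u) <= B &
      [/\ Rabs (Derive h u) <= B, Rabs (Derive psi u) <= B, p u <= B & 1 <= B * p u]].
Proof.
have [Sp _ _ Pos Pp _ _ _ _ _] := T.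
have p30 : (0 < 3)%Z by []. have p10 : (0 < 1)%Z by [].
have [B1 [H1 K1]] := periodic_bounded p30 Sr Pr.
have [B2 [H2 K2]] := periodic_bounded p30 Sh Ph.
have [B3 [H3 K3]] := periodic_bounded p30 (smooth_Derive Sr) (Derive_periodic Sr Pr).
have [B4 [H4 K4]] := periodic_bounded p30 (smooth_Derive Sh) (Derive_periodic Sh Ph).
have S5 : smooth (fun x => psi x - x) by smo.
have [|B5 [H5 K5]] := @periodic_bounded 1 _ p10 (smooth_Derive S5).
  by apply: Derive_periodic => // u; rewrite Ppsi; ring.
have [B6 [H6 K6]] := periodic_bounded p10 Sp Pp.
have N u : p u <> 0 by have := Pos u; lra.
have [|B7 [H7 K7]] := @periodic_bounded 1 _ p10 (smooth_inv N Sp).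
  by move=> u; rewrite Pp.
exists (B1 + B2 + B3 + B4 + (B5 + 1) + B6 + B7); split; first lra.
move=> u; split; [have := K1 u; lra|have := K2 u; lra|have := K3 u; lra|split].
- by have := K4 u; lra.
- have D : is_derive (fun x => psi x - x) u (Derive psi u - 1).
    apply: (@is_derive_extR (fun x => (-1) * x + 1 * psi x)) => [x|]; first ring.
    have Dp : is_derive psi u (Derive psi u) by apply/Derive_correct/smooth_ex_derive.
    by apply: (is_derive_eq (is_derive_lin2 (-1) 1 Dp)); ring.
  have := K5 u; rewrite (is_derive_unique _ _ _ D) => /Rabs_le_between K.
  by apply: Rabs_le; lra.
- by have := K6 u => /Rabs_le_between; lra.
have := K7 u; have Q := Pos u; have I0 := Rinv_0_lt_compat _ Q.
rewrite Rabs_pos_eq; last lra.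
move=> K; have : 1 <= B7 * p u by rewrite -(Rinv_l (p u)); [apply: Rmult_le_compat_r|]; lra.
nra.
Qed.

Let wind3 t : 3 * (t + 1) = 3 * t + IZR 3. Proof. by ring. Qed.

(** In a thin tube around a large circle the angular term dominates the contact form, so that
    cross-section and angle can be changed freely. After a quarter turn, (r, h) has become (h, - r);
    radius and height are then replaced by those of the other braid one after the other, with [over]
    excluding collisions for the radius and [sorted] for the height. *)
Lemma thin_isotopy : transverse_isotopic (bc p hT th)
  (bc (fun t => r (3 * t)) (fun t => h (3 * t)) (fun t => 3 * t)).
Proof.
have [Sp ShT Sth Pos Pp PhT W Turn Form Emb] := T.
have [B [B1 HB]] := bounds.
(* The fourth power serves the last stage, where [lam * B^2] has to be below p^2, which is at least
   1 / B^2. *)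
pose lam := / (8 * (B * B * (B * B))).
have B2 : 1 <= B * B by nra.
have B4 : B * B <= B * B * (B * B) by nra.
have l0 : 0 < lam by apply: Rinv_0_lt_compat; nra.
have lE : lam * (B * B * (B * B)) = 1/8 by rewrite /lam; field; nra.
have l2 : lam * (B * B) <= 1/8 by nra.
have l1 : lam * B <= 1/8 by nra.
have lam1 : lam <= 1/8 by nra.
have PI3 := PI_gt3.
pose c := B + 1.
have D3 t : is_derive (fun t => 3 * t) t 3.
  apply: (@is_derive_extR (fun t => 0 + 3 * t)) => [x|]; first ring.
  by apply: (is_derive_eq (is_derive_lin 0 3 (is_derive_id _))); rewrite /one /=; exact: Rmult_1_r.
have Dth t : is_derive th t (Derive th t) by apply/Derive_correct/smooth_ex_derive.
have Dr3 t := is_derive_compR Sr (D3 t); have Dh3 t := is_derive_compR Sh (D3 t).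
have S3 : smooth (fun t => 3 * t) by smo.
have Sr3 := smooth_comp Sr S3; have Sh3 := smooth_comp Sh S3.
have Fr3 := sf_static Sr3; have Fh3 := sf_static Sh3; have F3 := sf_static S3.
have Schi : smooth chi by apply: (smooth_comp Spsi).
have Frc := sf_static (smooth_comp Sr Schi); have Fhc := sf_static (smooth_comp Sh Schi).
have Fp := sf_static Sp; have FhT := sf_static ShT; have Fth := sf_static Sth.
have per3 (f : R -> R) : (forall u, f (u + IZR 3) = f u) -> forall t, f (3 * (t + 1)) = f (3 * t).
  by move=> Pf t; rewrite wind3.
have emb3 t u n : 3 * u = 3 * t + IZR n -> r (3 * t) = r (3 * u) -> h (3 * t) = h (3 * u) ->
  exists k, (n = k * 3)%Z by move=> ->; apply: emb.
have chiP t : chi (t + 1) = chi t + IZR 3 by rewrite /chi W psiZ.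
have perc (f : R -> R) : (forall u, f (u + IZR 3) = f u) -> forall t, f (chi (t + 1)) = f (chi t).
  by move=> Pf t; rewrite chiP.
have Dchi t : is_derive chi t (Derive psi (th t) * Derive th t) by apply: is_derive_compR.
have Drc t := is_derive_compR Sr (Dchi t).
have small x y z : Rabs x <= B -> 0 <= y <= 1 -> Rabs z <= B -> - (1/4) <= lam * (x * ((1 - y) + y * z)) <= 1/4.
  move=> /Rabs_le_between Hx Hy /Rabs_le_between Hz.
  have Q : - (2 * B) <= (1 - y) + y * z <= 2 * B by nra.
  have : - (2 * (B * B)) <= x * ((1 - y) + y * z) <= 2 * (B * B) by nra.
  by nra.
have thick q : 3/4 <= q -> 3 <= 2 * PI * (q * q).
  move=> Hq; have : 9/16 <= q * q by nra.
  nra.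
apply: transverse_isotopic_sym.
(* The tube is shrunk around the circle of radius [c]. *)
apply: (@transverse_isotopic_trans _ (bc (fun t => c + lam * r (3 * t)) (fun t => lam * h (3 * t)) (fun t => 3 * t))).
  apply: (@isotopy_bc_ends 3 (fun s t => (1 - s + s * lam) * r (3 * t) + s * c)
     (fun s t => (1 - s + s * lam) * h (3 * t)) (fun _ t => 3 * t)); [by smf|by smf|done| |by move=> t; split; ring|by move=> t; split; ring].
  move=> s Hs; pose mu := 1 - s + s * lam; have mu0 : 0 < mu by rewrite /mu; nra.
  rewrite -/mu.
  have c0 : 0 <= s * c by apply: Rmult_le_pos; rewrite /c; lra.
  split=> //.
  - by smo.
  - by smo.
  - by move=> t; have := Rmult_lt_0_compat _ _ mu0 (r_gt0 (3 * t)); lra.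
  - by move=> t; rewrite (per3 _ Pr).
  - by move=> t; rewrite (per3 _ Ph).
  - by move=> t; rewrite (is_derive_unique _ _ _ (D3 t)); lra.
  - move=> t.
    have DH : is_derive (fun t => mu * h (3 * t)) t (mu * (Derive h (3 * t) * 3)).
      apply: (@is_derive_extR (fun t => 0 + mu * h (3 * t))) => [x|]; first ring.
      exact: is_derive_lin (Dh3 t).
    apply: (form_from DH (D3 t)).
    have F0 := form (3 * t); have R0 := r_gt0 (3 * t).
    have [/Rabs_le_between rB _ _ _] := HB (3 * t).
    set x := r _ in F0 R0 rB *; set d := Derive _ _ in F0 *.
    have K : mu * (x * x) <= (mu * x + s * c) * (mu * x + s * c).
      have : 0 <= mu * x * (mu * x + 2 * (s * c) - x).
        apply: Rmult_le_pos; first nra.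
        have -> : mu * x + 2 * (s * c) - x = s * (2 * c - x + lam * x) by rewrite /mu; ring.
        by apply: Rmult_le_pos; [|rewrite /c; nra]; lra.
      by nra.
    have : 0 < mu * (d + 2 * PI * (x * x)) by apply: Rmult_lt_0_compat.
    have : 2 * PI * (mu * (x * x)) <= 2 * PI * ((mu * x + s * c) * (mu * x + s * c)).
      by apply: Rmult_le_compat_l; lra.
    lra.
  move=> t u n En Er Eh; apply: (emb3 t u n En).
    by apply: (Rmult_eq_reg_l mu); lra.
  by apply: (Rmult_eq_reg_l mu); lra.
(* The quarter turn follows a segment of matrices, of determinant (1 - s)^2 + s^2. *)
apply: (@transverse_isotopic_trans _ (bc (fun t => c + lam * h (3 * t)) (fun t => - lam * r (3 * t)) (fun t => 3 * t))).
  apply: (@isotopy_bc_ends 3 (fun s t => c + lam * ((1 - s) * r (3 * t) + s * h (3 * t)))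
     (fun s t => lam * ((1 - s) * h (3 * t) - s * r (3 * t))) (fun _ t => 3 * t)); [by smf|by smf|done| |by move=> t; split; ring|by move=> t; split; ring].
  move=> s Hs.
  have thk t : 3/4 <= c + lam * ((1 - s) * r (3 * t) + s * h (3 * t)).
    have [/Rabs_le_between rB /Rabs_le_between hB _ _] := HB (3 * t).
    have : - B <= (1 - s) * r (3 * t) + s * h (3 * t) by nra.
    by rewrite /c; nra.
  split=> //.
  - by smo.
  - by smo.
  - by move=> t; have := thk t; lra.
  - by move=> t; rewrite (per3 _ Pr) (per3 _ Ph).
  - by move=> t; rewrite (per3 _ Pr) (per3 _ Ph).
  - by move=> t; rewrite (is_derive_unique _ _ _ (D3 t)); lra.
  - move=> t.
    have DH : is_derive (fun t => lam * ((1 - s) * h (3 * t) - s * r (3 * t))) t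
       (lam * ((1 - s) * (Derive h (3 * t) * 3) + - s * (Derive r (3 * t) * 3))).
      apply: (@is_derive_extR (fun t => 0 + lam * ((1 - s) * h (3 * t) + - s * r (3 * t)))) => [x|]; first ring.
      exact: is_derive_lin (is_derive_lin3 (1 - s) (- s) (Dh3 t) (Dr3 t)).
    apply: (form_from DH (D3 t)).
    have := thick _ (thk t); set X := 2 * PI * _ => HX.
    have [_ _ /Rabs_le_between rB [/Rabs_le_between hB _ _ _]] := HB (3 * t).
    have : - (2 * B) <= (1 - s) * Derive h (3 * t) + - s * Derive r (3 * t) by nra.
    by nra.
  move=> t u n En Er Eh.
  have E1 : (1 - s) * (r (3 * t) - r (3 * u)) + s * (h (3 * t) - h (3 * u)) = 0.
    by apply: (Rmult_eq_reg_l lam); lra.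
  have E2 : (1 - s) * (h (3 * t) - h (3 * u)) - s * (r (3 * t) - r (3 * u)) = 0.
    by apply: (Rmult_eq_reg_l lam); lra.
  have dt : 0 < (1 - s) * (1 - s) + s * s by nra.
  apply: (emb3 t u n En).
    have : ((1 - s) * (1 - s) + s * s) * (r (3 * t) - r (3 * u)) = 0 by nra.
    by case/Rmult_integral; lra.
  have : ((1 - s) * (1 - s) + s * s) * (h (3 * t) - h (3 * u)) = 0 by nra.
  by case/Rmult_integral; lra.
(* The angle passes from 3 t to [th], and the argument of [r] and [h] to [psi] of the angle. *)
apply: (@transverse_isotopic_trans _ (bc (fun t => c + lam * h (chi t)) (fun t => - lam * r (chi t)) th)).
  pose ths s t := (1 - s) * (3 * t) + s * th t.
  pose chs s t := (1 - s) * ths s t + s * psi (ths s t).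
  have Fths : smooth_family ths by rewrite /ths; smf.
  have Fchs : smooth_family chs.
    have K := sf_comp Spsi Fths; rewrite /chs; smf.
  apply: (@isotopy_bc_ends 3 (fun s t => c + lam * h (chs s t))
     (fun s t => - lam * r (chs s t)) ths) => //.
  - have K := sf_comp Sh Fchs; by smf.
  - have K := sf_comp Sr Fchs; by smf.
  - move=> s Hs.
    have thsP t : ths s (t + 1) = ths s t + IZR 3 by rewrite /ths W; ring.
    have chsP t : chs s (t + 1) = chs s t + IZR 3 by rewrite /chs thsP psiZ; ring.
    have Dths t : is_derive (ths s) t ((1 - s) * 3 + s * Derive th t).
      exact: is_derive_lin3 (D3 t) (Dth t).
    have ths0 t : 0 < (1 - s) * 3 + s * Derive th t by have := Turn t; nra.
    have Dchs t : is_derive (chs s) t (((1 - s) + s * Derive psi (ths s t)) * ((1 - s) * 3 + s * Derive th t)).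
      apply: (is_derive_eq (is_derive_lin3 (1 - s) s (Dths t) (is_derive_compR Spsi (Dths t)))); ring.
    have Schs : smooth (chs s) := proj1 Fchs s.
    have thk t : 3/4 <= c + lam * h (chs s t).
      by have [_ /Rabs_le_between hB _ _] := HB (chs s t); rewrite /c; nra.
    split.
    + have K := smooth_comp Sh Schs; by smo.
    + have K := smooth_comp Sr Schs; by smo.
    + exact: (proj1 Fths s).
    + by move=> t; have := thk t; lra.
    + by move=> t; rewrite chsP Ph.
    + by move=> t; rewrite chsP Pr.
    + exact: thsP.
    + by move=> t; rewrite (is_derive_unique _ _ _ (Dths t)).
    + move=> t.
      have DH : is_derive (fun t => - lam * r (chs s t)) t (- lam * (Derive r (chs s t) *
          (((1 - s) + s * Derive psi (ths s t)) * ((1 - s) * 3 + s * Derive th t)))).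
        apply: (@is_derive_extR (fun t => 0 + - lam * r (chs s t))) => [x|]; first ring.
        exact: is_derive_lin (is_derive_compR Sr (Dchs t)).
      apply: (form_from DH (Dths t)).
      have := thick _ (thk t); set X := 2 * PI * _ => HX.
      have [_ _ rB _] := HB (chs s t); have [_ _ _ [_ psB _ _]] := HB (ths s t).
      have := small _ _ _ rB Hs psB; set Y := lam * _ => HY.
      have -> : - lam * (Derive r (chs s t) * ((1 - s + s * Derive psi (ths s t)) *
         ((1 - s) * 3 + s * Derive th t))) = - Y * ((1 - s) * 3 + s * Derive th t) by rewrite /Y; ring.
      by have := ths0 t; nra.
    move=> t u n En Eh Er.
    have Ec : chs s u = chs s t + IZR n by rewrite /chs En psiZ; ring.
    apply: (@emb (chs s t) n); rewrite -Ec; first by apply: (Rmult_eq_reg_l lam); lra.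
    by apply: (Rmult_eq_reg_l lam); lra.
  - move=> t; have E : ths 0 t = 3 * t by rewrite /ths; ring.
    have E2 : chs 0 t = 3 * t by rewrite /chs E; ring.
    by rewrite E E2.
  move=> t; have E : ths 1 t = th t by rewrite /ths; ring.
  have E2 : chs 1 t = chi t by rewrite /chs E; rewrite /chi; ring.
  by rewrite E E2.
(* The height is fixed, so that strands can meet only where [r] agrees; there [over] gives the old
   and the new radius the same order. *)
apply: (@transverse_isotopic_trans _ (bc (fun t => c + lam * p t) (fun t => - lam * r (chi t)) th)).
  apply: (@isotopy_bc_ends 3 (fun s t => c + lam * ((1 - s) * h (chi t) + s * p t))
     (fun s t => - lam * r (chi t)) (fun _ => th)); [by smf|by smf|done| |by move=> t; split; ring|by move=> t; split; ring].
  move=> s Hs.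
  have thk t : 3/4 <= c + lam * ((1 - s) * h (chi t) + s * p t).
    have [_ /Rabs_le_between hB _ _] := HB (chi t); have := Pos t => P0.
    have : - B <= (1 - s) * h (chi t) + s * p t by nra.
    by rewrite /c; nra.
  have Src := smooth_comp Sr Schi; have Shc := smooth_comp Sh Schi.
  split=> //.
  - by smo.
  - by smo.
  - by move=> t; have := thk t; lra.
  - by move=> t; rewrite (perc _ Ph) Pp.
  - by move=> t; rewrite (perc _ Pr).
  - move=> t.
    have DH : is_derive (fun t => - lam * r (chi t)) t
        (- lam * (Derive r (chi t) * (Derive psi (th t) * Derive th t))).
      apply: (@is_derive_extR (fun t => 0 + - lam * r (chi t))) => [x|]; first ring.
      exact: is_derive_lin (Drc t).
    apply: (form_from DH (Dth t)).
    have := thick _ (thk t); set X := 2 * PI * _ => HX.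
    have [_ _ rB _] := HB (chi t); have [_ _ _ [_ psB _ _]] := HB (th t).
    have := small _ 1 _ rB ltac:(lra) psB; set Y := lam * _ => HY.
    have -> : - lam * (Derive r (chi t) * (Derive psi (th t) * Derive th t)) = - Y * Derive th t.
      by rewrite /Y; ring.
    by have := Turn t; nra.
  move=> t u n En Ep Er; apply: Classical_Prop.NNPP => Hn.
  have {}Er : r (chi t) = r (chi u) by apply: (Rmult_eq_reg_l lam); lra.
  have O := over En Hn Er.
  have : (1 - s) * (h (chi t) - h (chi u)) + s * (p t - p u) = 0 by apply: (Rmult_eq_reg_l lam); lra.
  move: O; set x := p t - p u; set y := h _ - h _ => O E.
  have : (1 - s) * (y * y) + s * (x * y) = 0 by transitivity (((1 - s) * y + s * x) * y); [|rewrite E]; ring.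
  have : 0 < y * y by apply: Rsqr_pos_lt => E0; rewrite E0 in O; lra.
  move=> y2 K; case: (Rle_lt_dec s (1/2)) => Hs2; nra.
(* Strands of equal radius have equal [p], and there [sorted] gives the old and the new height the
   same order. *)
apply: (@isotopy_bc_ends 3 (fun s t => (1 - s) * (c + lam * p t) + s * p t)
     (fun s t => (1 - s) * (- lam * r (chi t)) + s * hT t) (fun _ => th)); [by smf|by smf|done| |by move=> t; split; ring|by move=> t; split; ring].
move=> s Hs.
have Src := smooth_comp Sr Schi.
have big t : p t <= (1 - s) * (c + lam * p t) + s * p t.
  have [_ _ _ [_ _ pB _]] := HB t; have P0 := Pos t.
  have : p t <= c + lam * p t by rewrite /c; nra.
  nra.
split=> //.
- by smo.
- by smo.
- by move=> t; have := big t; have := Pos t; lra.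
- by move=> t; rewrite Pp.
- by move=> t; rewrite (perc _ Pr) PhT.
- move=> t.
  have DhT : is_derive hT t (Derive hT t) by apply/Derive_correct/smooth_ex_derive.
  have DH : is_derive (fun t => (1 - s) * (- lam * r (chi t)) + s * hT t) t
      ((1 - s) * (- lam * (Derive r (chi t) * (Derive psi (th t) * Derive th t))) + s * Derive hT t).
    apply: (@is_derive_extR (fun t => (1 - s) * (0 + - lam * r (chi t)) + s * hT t)) => [x|]; first ring.
    exact: is_derive_lin3 (is_derive_lin _ _ (Drc t)) DhT.
  apply: (form_from DH (Dth t)).
  have [_ _ _ [_ _ pB pB2]] := HB t; have P0 := Pos t; have T0 := Turn t; have F0 := Form t.
  have [_ _ /Rabs_le_between rB _] := HB (chi t); have [_ _ _ [_ /Rabs_le_between psB _ _]] := HB (th t).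
  have Bt := big t; set q := _ + s * p t in Bt *.
  have qq : p t * p t <= q * q by nra.
  have pp : 1 <= B * B * (p t * p t) by nra.
  have Y : lam * (Derive r (chi t) * Derive psi (th t)) <= p t * p t.
    have : Derive r (chi t) * Derive psi (th t) <= B * B by nra.
    move=> K; apply: (Rle_trans _ (lam * (B * B))); first by apply: Rmult_le_compat_l; lra.
    apply: (Rmult_le_reg_l (B * B)); first lra.
    by apply: (Rle_trans _ 1); lra.
  have Y2 : 0 < 2 * PI * (p t * p t) - lam * (Derive r (chi t) * Derive psi (th t)) by nra.
  have K1 : 0 < (2 * PI * (p t * p t) - lam * (Derive r (chi t) * Derive psi (th t))) * Derive th t.
    exact: Rmult_lt_0_compat.
  have K2 : 2 * PI * (p t * p t) * Derive th t <= 2 * PI * (q * q) * Derive th t.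
    by apply: Rmult_le_compat_r; [lra|apply: Rmult_le_compat_l; lra].
  set X := 2 * PI * (q * q) * _ in K2 *; set Z := 2 * PI * (p t * p t) * _ in K2 F0.
  have : 0 < (1 - s) * (Z - lam * (Derive r (chi t) * (Derive psi (th t) * Derive th t))) + s * (Derive hT t + Z).
    have {}K1 : 0 < Z - lam * (Derive r (chi t) * (Derive psi (th t) * Derive th t)) by rewrite /Z; lra.
    by case: (Rle_lt_dec s (1/2)) => Hs2; nra.
  lra.
move=> t u n En Ep Eh; apply: Classical_Prop.NNPP => Hn.
have {}Ep : p t = p u.
  have : ((1 - s) * lam + s) * (p t - p u) = 0 by lra.
  by case/Rmult_integral; nra.
have := sorted En Hn Ep.
have : (1 - s) * lam * (r (chi t) - r (chi u)) = s * (hT t - hT u) by lra.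
set x := r _ - _; set y := hT t - _ => E O.
have : (1 - s) * lam * (x * x) = s * (x * y) by transitivity ((1 - s) * lam * x * x); [ring|rewrite E; ring].
have x2 : 0 < x * x by apply: Rsqr_pos_lt => E0; rewrite E0 in O; lra.
have := Rmult_lt_0_compat _ _ l0 x2 => lx.
move=> K; case: (Rle_lt_dec s (1/2)) => Hs2; nra.
Qed.

End Thin.

(** * The braid of a rectilinear path *)

Section BraidForm.
Variables (P : Z) (CA CB : Z -> Z).
Hypothesis cp : closed_path P CA CB.
Hypothesis bp : braid_path P CA CB.
Variable b0 : R.
Hypothesis Hrow : forall j, Z.odd j -> vdir CA CB j <> vdir CA CB (j + 1)%Z ->
  1/4 <= vdir CA CB j * (IZR (CB j) - b0).
Variable j0 : Z.
Hypotheses (odd_j0 : Z.odd j0) (vdir_j0 : vdir CA CB j0 = -1) (vdir_j0' : vdir CA CB (j0 + 1)%Z = 1).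

(** What remains to be known about the rotated curve once the small constants are hidden. The slope
    is halved since the second coordinate of a closed braid is 2 v. *)
Record braid_form (p hT th B Q : R -> R) (C del : R) (m : Z) : Prop := BraidForm {
  bf_front : rect_front P CA CB (fa CA CB) B;
  bf_C : 2 <= C;
  bf_del : 0 < del <= 1/8;
  bf_Q : forall u, Q u = slope CA CB C del u;
  bf_p : smooth p;
  bf_h : smooth hT;
  bf_th : smooth th;
  bf_pos : forall t, 0 < p t;
  bf_perp : periodic p;
  bf_perh : periodic hT;
  bf_wind : forall t, th (t + 1) = th t + IZR m;
  bf_turn : forall t, 0 < Derive th t;
  bf_form : forall t, 0 < Derive hT t + 2 * PI * (p t * p t) * Derive th t;
  bf_polB : forall t, B (pr P * t) - b0 = p t * co (th t);
  bf_polQ : forall t, Q (pr P * t) / 2 = p t * si (th t);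
  bf_height : forall t, hT t = - fa CA CB (pr P * t) - (B (pr P * t) - b0) * (Q (pr P * t) / 2);
  bf_start : th ((IZR j0 + 1/2) / pr P) = 1/2 }.

Lemma braid_formI : exists p hT th B Q C del m T',
  [/\ braid_form p hT th B Q C del m,
      transverse_pushoff (mk P (fa CA CB) (fb CA CB) fy) T'
    & transverse_isotopic T' (bc p hT th)].
Proof.
have [M [M1 HM]] := tilt_bounds cp.
(* The bound [M] determines [eps]; the slowest ascent eps / 256 determines [C]; the bounds on b and
   on the derivative of [hweight] determine [del]. *)
pose eps := / (1024 * (M * M)).
have eps0 : 0 < eps by apply: Rinv_0_lt_compat; nra.
have epsM : eps * (M * M) <= 1/1024 by right; rewrite /eps; field; lra.
pose C := 512 * (M + 1) / eps.
have HC : 2 * (M + 1) <= C * (eps / 256) by right; rewrite /C; field; lra.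
have epsMs : eps * M <= 1/64 by nra.
have rf := tilt_rect cp bp HM eps0 epsMs (conj Rle_0_1 (Rle_refl 1)).
pose B := bE P CA CB eps.
have PB : forall u, B (u + IZR P) = B u := rf_perB rf.
have SB : smooth B.
  apply: smooth_plus; first exact: (smooth_fm cp).
  by apply: smooth_mult; [smo|apply: smooth_tilt].
have [||Mb [Mb0 HMb]] := @periodic_bounded P (fun u => B u - b0) (cp_gt0 cp).
- by apply: smooth_minus; [|smo].
- by move=> u; rewrite PB.
have [|Mh [Mh0 HMh]] := periodic_bounded (cp_gt0 cp) (smooth_Derive smooth_hweight).
  by apply: Derive_periodic; [exact: smooth_hweight|move=> u; apply: (hweight_periodic cp)].
pose del := Rmin (1/8) (eps / 2048 * / (Mb * Mh)).
have MM : 0 < Mb * Mh by apply: Rmult_lt_0_compat.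
have IM := Rinv_0_lt_compat _ MM.
have Hdel : 0 < del <= 1/8.
  split; last exact: Rmin_l.
  by apply: Rmin_glb_lt; [lra|apply: Rmult_lt_0_compat; lra].
have Hdel2 : del * (Mb * Mh) < eps / 1024.
  apply: (Rle_lt_trans _ (eps / 2048 * / (Mb * Mh) * (Mb * Mh))).
    by apply: Rmult_le_compat_r; [lra|exact: Rmin_r].
  by rewrite Rmult_assoc Rinv_l; lra.
have C2 := C_gt1 M1 eps0 epsM HC.
pose Q := slope CA CB C del.
have rotQ := slope_rotates cp bp M1 HM eps0 epsM HC Hdel HMb HMh Hdel2 Hrow.
have formQ := slope_form cp bp M1 HM eps0 epsM HC Hdel.
have P0 := pr_gt0 cp.
have PQ : forall u, Q (u + IZR P) = Q u := slope_periodic cp C del.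
have SQ : smooth Q := smooth_slope CA CB C del.
have SA := smooth_fa cp.
pose b t := B (pr P * t) - b0; pose v t := Q (pr P * t) / 2; pose w t := - fa CA CB (pr P * t).
have Sb : smooth b by apply: smooth_minus; [exact: smooth_pr|smo].
have Sv : smooth v.
  by apply: smooth_mult; [exact: smooth_pr|smo].
have Sw : smooth w by apply: smooth_opp; exact: smooth_pr.
have Db t : is_derive b t (pr P * dbE P CA CB eps (pr P * t)).
  apply: (@is_derive_extR (fun t => - b0 + 1 * B (pr P * t))) => [x|]; first by rewrite /b; ring.
  have D := is_derive_pr (is_derive_bE cp eps (pr P * t)).
  by apply: (is_derive_eq (is_derive_lin (- b0) 1 D)); ring.
have Dv t : is_derive v t (pr P * dslope CA CB C del (pr P * t) / 2).
  apply: (@is_derive_extR (fun t => 0 + / 2 * Q (pr P * t))) => [x|]; first by rewrite /v; field.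
  have DQ : is_derive Q (pr P * t) (Derive Q (pr P * t)) by apply/Derive_correct/smooth_ex_derive.
  by apply: (is_derive_eq (is_derive_lin 0 (/2) (is_derive_pr DQ))); rewrite /dslope -/Q; field.
have Dw t : is_derive w t (- (pr P * (fX CA CB (pr P * t) * hweight (pr P * t)))).
  apply: (@is_derive_extR (fun t => 0 + -1 * fa CA CB (pr P * t))) => [x|]; first by rewrite /w; ring.
  by apply: (is_derive_eq (is_derive_lin 0 (-1) (is_derive_pr (is_derive_fa cp (pr P * t))))); ring.
have rot t : 0 < b t * Derive v t - v t * Derive b t.
  rewrite (is_derive_unique _ _ _ (Db t)) (is_derive_unique _ _ _ (Dv t)) /b /v.
  have := Rmult_lt_0_compat _ _ P0 (rotQ (pr P * t)); rewrite -/B -/Q; lra.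
(* In the middle of the turn from descending to ascending the slope is 0 and b is below [b0]. *)
pose t0 := (IZR j0 + 1/2) / pr P.
have Et0 : pr P * t0 = IZR j0 + 1/2 by rewrite /t0; field; lra.
have bt0 : b t0 < 0.
  have := rf_flatB rf (j := j0) (u := IZR j0 + 1/2) odd_j0 ltac:(lra) => /Rabs_le_between.
  have := Hrow odd_j0; rewrite vdir_j0 vdir_j0' => /(_ ltac:(lra)).
  by rewrite /b Et0 /B /bE; lra.
have vt0 : v t0 = 0.
  have H : IZR j0 + 1/4 <= IZR j0 + 1/2 <= IZR j0 + 3/4 by lra.
  have h1 := fy_hori odd_j0 H; rewrite /v Et0 /Q (slope_hori CA CB C del h1).
  rewrite (@vsign_near CA CB j0); last by apply: Rabs_le; lra.
  have -> : IZR j0 + 1/2 - IZR j0 - 1/2 = 0 by ring.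
  by rewrite vdir_j0 vdir_j0' step_half (_ : -1 + _ = 0) ?ramp0; lra.
have Pb : periodic b by move=> t; rewrite /b (periodic_pr PB).
have Pv : periodic v by move=> t; rewrite /v (periodic_pr PQ).
have Pw : periodic w by move=> t; rewrite /w (periodic_pr (rf_perA rf)).
have [m Hm] := angle_wind Sb Sv Pb Pv rot bt0 vt0.
exists (radius b v t0), (height b v w), (angle b v t0), B, Q, C, del, m, (mk P (fa CA CB) (bE P CA CB eps) (ty CA CB eps)).
have EB : braid_curve P CA CB eps C del b0 = bc (radius b v t0) (height b v w) (angle b v t0).
  rewrite -(polar_curve w Sb Sv rot vt0) /braid_curve; congr Curve.
  by apply: functional_extensionality => t; rewrite /v /Q; field.
split.
- split=> //.
  + exact: smooth_radius.
  + exact: smooth_height.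
  + exact: smooth_angle.
  + exact: radius_gt0.
  + exact: radius_periodic.
  + exact: height_periodic.
  + exact: angle_turn.
  + move=> t; apply: height_form => //.
    rewrite (is_derive_unique _ _ _ (Db t)) (is_derive_unique _ _ _ (Dw t)) /v.
    by have := Rmult_lt_0_compat _ _ P0 (formQ (pr P * t)); rewrite -/Q; lra.
  + by move=> t; exact: (polar_b Sb Sv rot vt0 t).
  + by move=> t; exact: (polar_v Sb Sv rot vt0 t).
  exact: (angle_t0 b v t0).
- exact: (tilted_pushoff cp bp M1 HM eps0 epsM).
rewrite -EB.
apply: (transverse_isotopic_trans (raise_isotopy cp bp M1 HM eps0 epsM HC Hdel)).
exact: (rotate_isotopy cp bp M1 HM eps0 epsM HC Hdel).
Qed.

End BraidForm.

Lemma IZR_ge (a b : Z) : - (1/2) <= IZR a - IZR b -> (b <= a)%Z.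
Proof.
move=> H; have L : IZR b < IZR (a + 1) by rewrite plus_IZR; lra.
by move: L => /lt_IZR; lia.
Qed.

Lemma si_half (k : Z) : si (IZR k / 2) = 0.
Proof. by apply: sin_eq_0_1; exists k; field. Qed.

(** * Double points of the braid of the path *)

Section Meet.
Variables (P : Z) (CA CB : Z -> Z).
Hypothesis cp : closed_path P CA CB.
Hypothesis bp : braid_path P CA CB.
Variables (b0 : R) (j0 : Z).
Variables (p hT th B Q : R -> R) (C del : R) (m : Z).
Hypothesis bf : braid_form P CA CB b0 j0 p hT th B Q C del m.

Notation dir := (dir CA CB).
Notation vdir := (vdir CA CB).
Notation vsign := (vsign CA CB).
Notation fa := (fa CA CB).
Let rf := bf_front bf.

(** Angle and radius are taken as functions of the path time, in which the edges have length 1. *)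
Definition thu (u : R) : R := th (u / pr P).
Definition pu (u : R) : R := p (u / pr P).

Let P0 : 0 < pr P := pr_gt0 cp.

Lemma pr_div u : pr P * (u / pr P) = u.
Proof. by field; lra. Qed.

Lemma thu_incr u v : u < v -> thu u < thu v.
Proof.
move=> L; apply: (turning_incr (bf_th bf) (bf_turn bf)).
by apply: Rmult_lt_compat_r => //; apply: Rinv_0_lt_compat.
Qed.

Lemma thu_le u v : u <= v -> thu u <= thu v.
Proof. by case=> [/thu_incr|->]; lra. Qed.

Lemma thu_lt_inv u v : thu u < thu v -> u < v.
Proof. by move=> L; apply: Rnot_le_lt => /thu_le; lra. Qed.

Lemma thu_period u (i : Z) : thu (u + IZR (i * P)) = thu u + IZR (i * m).
Proof.
rewrite /thu -(windZ (bf_wind bf)); congr th.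
by rewrite mult_IZR /pr; field; rewrite -/(pr P); lra.
Qed.

Lemma thu_continuity : continuity thu.
Proof.
move=> u; apply: smooth_continuity_pt; apply: (smooth_comp (bf_th bf)).
by apply: smooth_mult; [smo|smo].
Qed.

Lemma thu_ivt u v z : u <= v -> thu u <= z <= thu v -> exists w, u <= w <= v /\ thu w = z.
Proof.
move=> L Hz; case: (Req_dec z (thu u)) => [->|N1]; first by exists u; split; lra.
case: (Req_dec z (thu v)) => [->|N2]; first by exists v; split; lra.
have [w [Hw E]] : { w : R | Rmin u v <= w <= Rmax u v /\ thu w = z }.
  apply: IVT_gen; first exact: thu_continuity.
  by rewrite Rmin_left ?Rmax_right; lra.
by exists w; move: Hw; rewrite Rmin_left ?Rmax_right; lra.
Qed.

Lemma pu_gt0 u : 0 < pu u.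
Proof. exact: (bf_pos bf). Qed.

Lemma polB u : B u - b0 = pu u * co (thu u).
Proof. by rewrite -(bf_polB bf) pr_div. Qed.

Lemma polQ u : Q u / 2 = pu u * si (thu u).
Proof. by rewrite -(bf_polQ bf) pr_div. Qed.

Lemma Q_min u : - (C + 1/8) + del * (1 - hweight u) <= Q u.
Proof.
rewrite (bf_Q bf) /slope; have V := vsign_bounds cp u.
have := @ramp_incr C (vsign u) 1 ltac:(have := bf_C bf; lra) ltac:(lra); rewrite ramp1; lra.
Qed.

Lemma Q_up u : vsign u = 1 -> Q u = del * (1 - hweight u) - (C + 1/8).
Proof. by rewrite (bf_Q bf) /slope => ->; rewrite ramp1. Qed.

Lemma Q_down u : vsign u = -1 -> Q u = del * (1 - hweight u) + 1/4.
Proof. by rewrite (bf_Q bf) /slope => ->; rewrite rampN1; ring. Qed.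

Lemma Q_sign u : (vsign u = 1 -> Q u < 0) /\ (vsign u = -1 -> 0 < Q u).
Proof.
have H := hweight_bounds u; have HC := bf_C bf; have Hd := bf_del bf.
by split => [/Q_up ->|/Q_down ->]; nra.
Qed.

(** [Q] has a strict sign on ascending and on descending parts. On a turning edge it is minus the
    ramp of [vsign], which vanishes only where [vsign] does, in the middle. *)
Lemma Q_zero u : Q u = 0 -> exists j, [/\ Z.odd j, u = IZR j + 1/2 & vdir j <> vdir (j + 1)%Z].
Proof.
move=> E; have [up down] := Q_sign u; have HC := bf_C bf.
case: (time_cases u) => -[j H].
  have V := vsign_corner CA CB H.
  by case: (vdir1 cp j) => D; rewrite D in V; [have := up V|have := down V]; lra.
case Ev: (Z.even j).
  have V := vsign_vert CA CB Ev H.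
  by case: (dir1 cp j) => D; rewrite D in V; [have := up V|have := down V]; lra.
have O : Z.odd j by rewrite Zeven_odd Ev.
have h1 := fy_hori O H.
have V0 : vsign u = 0.
  have := @ramp_sign C (vsign u) ltac:(lra).
  move: E; rewrite (bf_Q bf) (slope_hori _ _ _ _ h1) => E.
  have -> : ramp C (vsign u) = 0 by lra.
  by move=> K; apply: Rsqr_0_uniq; have := Rle_0_sqr (vsign u); rewrite /Rsqr; lra.
have := @vsign_near CA CB j u ltac:(apply: Rabs_le; lra); rewrite V0 => K.
have N : vdir j <> vdir (j + 1)%Z.
  by move=> N; move: K; rewrite -N; case: (vdir1 cp j) => ->; lra.
exists j; split=> //.
have Vd : vdir (j + 1)%Z = - vdir j.
  by case: (vdir1 cp j) N => ->; case: (vdir1 cp (j + 1)%Z) => -> ?; lra.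
have S : step (u - IZR j - 1/2) = step 0.
  by rewrite step_half; move: K; rewrite Vd; case: (vdir1 cp j) => ->; lra.
case: (total_order_T (u - IZR j - 1/2) 0) => [[L|]|L]; [exfalso|lra|exfalso].
  by have := @step_lt (u - IZR j - 1/2) 0; lra.
by have := @step_lt 0 (u - IZR j - 1/2); lra.
Qed.

Lemma half_integer u k : thu u = IZR k / 2 ->
  exists j, [/\ Z.odd j, u = IZR j + 1/2 & vdir j <> vdir (j + 1)%Z].
Proof. by move=> E; apply: Q_zero; have := polQ u; rewrite E si_half; lra. Qed.

(** A full turn after [u] would contain two half-integral angles. Those occur only in the middle of
    horizontal edges, which are at least 2 apart. *)
Lemma thu_window u v : u < v -> v <= u + 2 -> thu v < thu u + 1.
Proof.
move=> L1 L2; apply: Rnot_le_lt => K.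
have [A1 A2] := archimed (2 * thu u); set k := up _ in A1 A2.
have [w1 [W1 E1]] := @thu_ivt u v (IZR k / 2) ltac:(lra) ltac:(lra).
have [w2 [W2 E2]] := @thu_ivt u v (IZR (k + 1) / 2) ltac:(lra) ltac:(rewrite plus_IZR; lra).
have u1 : u < w1 by apply: thu_lt_inv; lra.
have w12 : w1 < w2 by apply: thu_lt_inv; rewrite E1 E2 plus_IZR; lra.
have [i [Oi Ei _]] := half_integer E1; have [j [Oj Ej _]] := half_integer E2.
have ij : (i < j)%Z by apply: lt_IZR; lra.
have : (i + 2 <= j)%Z.
  have [a Ea] := proj1 (Z.odd_spec _) Oi; have [b Eb] := proj1 (Z.odd_spec _) Oj.
  by rewrite Ea Eb in ij *; lia.
by move/IZR_le; rewrite plus_IZR; lra.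
Qed.

(** Up to a multiple of the period the times are close, so that the angles differ by less than a
    turn; an integral difference then comes from the periods alone. *)
Lemma near_same u v n i : thu v = thu u + IZR n -> Rabs (v - u - IZR (i * P)) <= 2 ->
  exists k, (n = k * m)%Z.
Proof.
move=> E /Rabs_le_between H; exists i.
have T := thu_period (v - IZR (i * P)) i.
have Ev : v - IZR (i * P) + IZR (i * P) = v by ring.
rewrite Ev E in T; set w := v - _ in T H.
have L1 : thu w < thu u + 1.
  case: (Rle_lt_dec w u) => [/thu_le|L]; first lra.
  by apply: thu_window => //; rewrite /w; lra.
have L2 : thu u < thu w + 1.
  case: (Rle_lt_dec u w) => [/thu_le|L]; first lra.
  by apply: thu_window => //; rewrite /w; lra.
have K1 : IZR n < IZR (i * m + 1) by rewrite plus_IZR; lra.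
have K2 : IZR (i * m) < IZR (n + 1) by rewrite plus_IZR; lra.
by move: K1 K2 => /lt_IZR K1 /lt_IZR K2; lia.
Qed.

(** The part of the path assigned to a column: from the middle of the horizontal edge before its
    vertical edge to the middle of the one after it. *)
Definition in_cell (i : Z) (u : R) : Prop := IZR (2 * i) - 1/2 <= u < IZR (2 * i) + 3/2.

Lemma even2 i : Z.even (2 * i)%Z.
Proof. by rewrite Z.even_mul. Qed.

Lemma odd2 i : Z.odd (2 * i + 1)%Z.
Proof. by rewrite odd_succ Zeven_odd even2. Qed.

Lemma cellP i u : in_cell i u ->
  (IZR (2 * i) - 1/4 <= u <= IZR (2 * i) + 5/4 /\ Rabs (fa u - IZR (CA (2 * i)%Z)) <= 1/8) \/
  exists j, [/\ Z.odd j, IZR j + 1/4 <= u <= IZR j + 3/4 & (2 * i = j \/ 2 * i = j + 1)%Z \/ (2 * i = j - 1)%Z].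
Proof.
move=> [H1 H2].
case: (Rle_lt_dec (IZR (2 * i) - 1/4) u) => K1; last first.
  right; exists (2 * (i - 1) + 1)%Z; split; [exact: odd2| |by left; right; lia].
  by rewrite plus_IZR !mult_IZR minus_IZR in H1 H2 K1 *; lra.
case: (Rle_lt_dec u (IZR (2 * i) + 5/4)) => K2; last first.
  right; exists (2 * i + 1)%Z; split; [exact: odd2| |by right; lia].
  by rewrite plus_IZR; lra.
left; split=> //.
have V1 := cp_vert cp (even2 i).
case: (Rle_lt_dec u (IZR (2 * i) + 1/4)) => K3.
  by have [] := rf_corner rf (j := (2 * i)%Z) (u := u) ltac:(apply: Rabs_le; lra).
case: (Rle_lt_dec u (IZR (2 * i) + 3/4)) => K4.
  by have := rf_flatA rf (even2 i) (u := u) ltac:(lra); lra.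
have [] := rf_corner rf (j := (2 * i + 1)%Z) (u := u) ltac:(apply: Rabs_le; rewrite plus_IZR; lra).
by rewrite V1.
Qed.

Section Pair.
Variables (u v : R) (n : Z).
Hypothesis Th : thu v = thu u + IZR n.
Hypothesis Hn : ~ exists k, (n = k * m)%Z.
Hypothesis EB : B u = B v.

(** Both edges would lie in one row, hence coincide modulo the period. *)
Lemma hori_hori j i : Z.odd j -> Z.odd i -> IZR j + 1/4 <= u <= IZR j + 3/4 ->
  IZR i + 1/4 <= v <= IZR i + 3/4 -> False.
Proof.
move=> Oj Oi Hu Hv; have Bu := rf_flatB rf Oj Hu; have Bv := rf_flatB rf Oi Hv.
have E : CB j = CB i by apply: (@IZR_near _ _ (B u)); [|rewrite EB]; lra.
have [k Ek] := cp_row cp Oj Oi E.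
apply: Hn; apply: (near_same Th (i := k)); apply: Rabs_le.
by move: Hv; rewrite Ek plus_IZR; lra.
Qed.

Hypothesis EQ : Q u = Q v.

(** The horizontal edge is a turning one, by comparison of slopes, and turning edges cross nothing.
    Hence the column lies outside of its span, and either of its ends may stand for it. *)
Lemma vert_hori i i' j : IZR (2 * i) - 1/4 <= u <= IZR (2 * i) + 5/4 ->
  Rabs (fa u - IZR (CA (2 * i)%Z)) <= 1/8 ->
  Z.odd j -> IZR j + 1/4 <= v <= IZR j + 3/4 -> (i' = CA j \/ i' = CA (j + 1))%Z ->
  0 < (fa u - fa v) * (IZR (CA (2 * i)%Z) - IZR i').
Proof.
move=> Hu Au O Hv Hi'; have Bv := rf_flatB rf O Hv.
have near a k : (a = j - 1 \/ a = j \/ a = j + 1)%Z -> (2 * i = a + k * P)%Z -> False.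
  move=> Ha Hk; apply: Hn; apply: (near_same Th (i := - k)%Z); apply: Rabs_le.
  have -> : IZR (- k * P) = - IZR (k * P) by rewrite -opp_IZR; congr IZR; lia.
  move/(congr1 IZR): Hk; rewrite plus_IZR => E.
  have {}Ha : IZR a = IZR j - 1 \/ IZR a = IZR j \/ IZR a = IZR j + 1.
    by case: Ha => [->|[->|->]]; rewrite ?minus_IZR ?plus_IZR; lra.
  lra.
have rowE k : (k = 2 * i)%Z \/ (k = 2 * i + 1)%Z -> CB k = CB j -> False.
  move=> Hk; have [o [Oo Eo Ho]] : exists o, [/\ Z.odd o, CB o = CB k & (o = k \/ o = k - 1)%Z].
    case: Hk => ->; last by exists (2 * i + 1)%Z; split; [exact: odd2| |left].
    exists (2 * (i - 1) + 1)%Z; split; [exact: odd2| |by right; lia].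
    by rewrite -(cp_hori cp (odd2 _)); congr CB; lia.
  rewrite -Eo => /(cp_row cp Oo O) [q Eq].
  case: Hk Ho => -> [Ho|Ho]; rewrite Ho in Eq.
  - by have := even2 i; move: Oo; rewrite Ho Zeven_odd => /negP.
  - by apply: (near (j + 1)%Z (- q)%Z); lia.
  - by apply: (near (j - 1)%Z (- q)%Z); lia.
  by apply: (near j (- q)%Z); lia.
case: (Rle_lt_dec u (IZR (2 * i) + 1/4)) => K1.
  have [_ Bu] := rf_corner rf (j := (2 * i)%Z) (u := u) ltac:(apply: Rabs_le; lra).
  case: (@rowE (2 * i)%Z); first by left.
  by apply: (@IZR_near _ _ (B u)); [|rewrite EB]; lra.
case: (Rlt_le_dec (IZR (2 * i) + 3/4) u) => K2.
  have [_ Bu] := rf_corner rf (j := (2 * i + 1)%Z) (u := u) ltac:(apply: Rabs_le; rewrite plus_IZR; lra).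
  case: (@rowE (2 * i + 1)%Z); first by right.
  by apply: (@IZR_near _ _ (B u)); [|rewrite EB]; lra.
have Fl : IZR (2 * i) + 1/4 <= u <= IZR (2 * i) + 3/4 by lra.
have hu := fy_vert (even2 i) Fl; have hv := fy_hori O Hv.
have Vu := vsign_vert CA CB (even2 i) Fl.
have Hd := bf_del bf; have HC := bf_C bf.
(* On an ascending horizontal edge the slope has its least value - (C + 1/8), from which that of a
   vertical edge differs at least by [del]. *)
have turn : vdir j <> vdir (j + 1)%Z.
  move=> N; have V1 : vsign v = 1.
    rewrite (@vsign_near CA CB j); last by apply: Rabs_le; lra.
    by rewrite -N (bp_up bp O N); ring.
  move: EQ; rewrite (Q_up V1) hv.
  by case: (dir1 cp (2 * i)%Z) => D; rewrite D in Vu; [rewrite (Q_up Vu)|rewrite (Q_down Vu)]; rewrite hu; lra.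
have [M1 M2] := rf_moveB rf (even2 i) Fl; have [M3 M4] := rf_moveA rf O Hv.
have D2 := dir1 cp (2 * i)%Z; have Dj := dir1 cp j.
have colE k : (k = j \/ k = j + 1)%Z -> CA (2 * i)%Z <> CA k.
  move=> Hk; have [o [Eo Oo Ho]] : exists o, [/\ Z.even o, CA o = CA k & (o = j - 1 \/ o = j + 1)%Z].
    case: Hk => ->; last by exists (j + 1)%Z; split; [by rewrite even_succ -Zeven_odd O| |right].
    have Ej : Z.even (j - 1)%Z by rewrite even_pred -Zeven_odd O.
    by exists (j - 1)%Z; split; [|by have := cp_vert cp Ej; rewrite pred_succ|left].
  rewrite -Oo => /(cp_column cp (even2 i) Eo) [q Eq].
  by apply: (near o (- q)%Z); lia.
have row1 := rowE (2 * i)%Z (or_introl erefl); have row2 := rowE (2 * i + 1)%Z (or_intror erefl).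
have Bu : Rabs (B u - IZR (CB j)) <= 1/16 by rewrite EB.
move/Rabs_le_between: Bu => Bu.
have in1 : 0 < dir (2 * i)%Z * (IZR (CB j) - IZR (CB (2 * i)%Z)).
  case: D2 M1 => -> M1.
    have : (CB (2 * i)%Z <= CB j)%Z by apply: IZR_ge; lra.
    move=> K; have {K} : (CB (2 * i)%Z < CB j)%Z by case: (Z.eq_dec (CB (2 * i)%Z) (CB j)) => // ?; lia.
    by move/IZR_lt; lra.
  have : (CB j <= CB (2 * i)%Z)%Z by apply: IZR_ge; lra.
  move=> K; have {K} : (CB j < CB (2 * i)%Z)%Z by case: (Z.eq_dec (CB (2 * i)%Z) (CB j)) => // ?; lia.
  by move/IZR_lt; lra.
have in2 : 0 < dir (2 * i)%Z * (IZR (CB (2 * i + 1)%Z) - IZR (CB j)).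
  case: D2 M2 => -> M2.
    have : (CB j <= CB (2 * i + 1)%Z)%Z by apply: IZR_ge; lra.
    move=> K; have {K} : (CB j < CB (2 * i + 1)%Z)%Z by case: (Z.eq_dec (CB (2 * i + 1)%Z) (CB j)) => // ?; lia.
    by move/IZR_lt; lra.
  have : (CB (2 * i + 1)%Z <= CB j)%Z by apply: IZR_ge; lra.
  move=> K; have {K} : (CB (2 * i + 1)%Z < CB j)%Z by case: (Z.eq_dec (CB (2 * i + 1)%Z) (CB j)) => // ?; lia.
  by move/IZR_lt; lra.
have free : ~ (0 < dir j * (IZR (CA (2 * i)%Z) - IZR (CA j)) /\
    0 < dir j * (IZR (CA (j + 1)%Z) - IZR (CA (2 * i)%Z))).
  by move=> [F1 F2]; apply: (bp_free bp (even2 i) O turn).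
have c1 := colE j (or_introl erefl); have c2 := colE (j + 1)%Z (or_intror erefl).
move/Rabs_le_between: Au => Au.
set x := CA (2 * i)%Z in c1 c2 free Au *; set y := CA j in c1 free M3 M4 Hi' *.
set z := CA (j + 1)%Z in c2 free M3 M4 Hi' *.
have lt_dec (a b : Z) : a <> b -> IZR a + 1 <= IZR b \/ IZR b + 1 <= IZR a.
  move=> ab; have [K|K] : (a + 1 <= b)%Z \/ (b + 1 <= a)%Z by lia.
    by left; move/IZR_le: K; rewrite plus_IZR.
  by right; move/IZR_le: K; rewrite plus_IZR.
have {c1} c1 := lt_dec _ _ c1; have {c2} c2 := lt_dec _ _ c2.
have zy : 0 <= dir j * (IZR z - IZR y).
  case: Dj M3 M4 => -> M3 M4.
    by have /IZR_le : (y <= z)%Z by [apply: IZR_ge; lra]; lra.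
  by have /IZR_le : (z <= y)%Z by [apply: IZR_ge; lra]; lra.
have Ei : IZR i' = IZR y \/ IZR i' = IZR z by case: Hi' => ->; [left|right].
case: Dj M3 M4 free zy => -> M3 M4 free zy.
  have [S|S] : IZR x + 1 <= IZR y \/ IZR z + 1 <= IZR x.
    by case: c1 => c1; [left|case: c2 => c2; [case: free; lra|right]].
    have K1' : fa u - fa v < 0 by lra.
    have K2' : IZR x - IZR i' < 0 by lra.
    nra.
  have K1' : 0 < fa u - fa v by lra.
  have K2' : 0 < IZR x - IZR i' by lra.
  nra.
have [S|S] : IZR y + 1 <= IZR x \/ IZR x + 1 <= IZR z.
  by case: c1 => c1; [case: c2 => c2; [right|case: free; lra]|left].
  have K1' : 0 < fa u - fa v by lra.
  have K2' : 0 < IZR x - IZR i' by lra.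
  nra.
have K1' : fa u - fa v < 0 by lra.
have K2' : IZR x - IZR i' < 0 by lra.
nra.
Qed.

End Pair.

(** Strands with the same angle and radius agree in b and in the slope, so that their heights differ
    by - a only. The order of these heights is thus read off from the columns. *)
Lemma column_order u v n i i' : thu v = thu u + IZR n -> ~ (exists k, (n = k * m)%Z) ->
  B u = B v -> Q u = Q v -> in_cell i u -> in_cell i' v ->
  0 < (fa u - fa v) * (IZR (CA (2 * i)%Z) - IZR (CA (2 * i')%Z)).
Proof.
move=> Th Hn EB EQ Cu Cv.
have Th' : thu u = thu v + IZR (- n) by rewrite opp_IZR; lra.
have Hn' : ~ (exists k, (- n = k * m)%Z) by move=> [k Hk]; apply: Hn; exists (- k)%Z; lia.
have side k j : (2 * k = j \/ 2 * k = j + 1)%Z \/ (2 * k = j - 1)%Z -> Z.odd j ->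
    (CA (2 * k)%Z = CA j \/ CA (2 * k)%Z = CA (j + 1))%Z.
  move=> [[->|->]|E] O; [by left|by right|left].
  have Ej : Z.even (j - 1)%Z by rewrite even_pred -Zeven_odd O.
  by have := cp_vert cp Ej; rewrite pred_succ E.
case: (cellP Cu) => [[Hu Au]|[j [Oj Hu Sj]]]; case: (cellP Cv) => [[Hv Av]|[l [Ol Hv Sl]]].
- have N : CA (2 * i)%Z <> CA (2 * i')%Z.
    move=> E; have [k Ek] := cp_column cp (even2 i) (even2 i') E.
    apply: Hn; apply: (near_same Th (i := k)); apply: Rabs_le.
    by move: Hv; rewrite Ek plus_IZR; lra.
  move/Rabs_le_between: Au => Au; move/Rabs_le_between: Av => Av.
  have [K|K] : (CA (2 * i)%Z + 1 <= CA (2 * i')%Z)%Z \/ (CA (2 * i')%Z + 1 <= CA (2 * i)%Z)%Z by lia.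
    by move/IZR_le: K; rewrite plus_IZR; nra.
  by move/IZR_le: K; rewrite plus_IZR; nra.
- exact: (vert_hori Th Hn EB EQ Hu Au Ol Hv (side _ _ Sl Ol)).
- have := vert_hori Th' Hn' (esym EB) (esym EQ) Hv Av Oj Hu (side _ _ Sj Oj).
  by nra.
by case: (hori_hori Th Hn EB Oj Ol Hu Hv).
Qed.

Lemma hweight_eq1 u : hweight u = 1 -> exists j, Z.odd j /\ IZR j + 1/4 <= u <= IZR j + 3/4.
Proof.
move=> E; case: (time_cases u) => -[j H]; last first.
  exists j; split=> //; case Ev: (Z.even j); last by rewrite Zeven_odd Ev.
  by move: E; rewrite (fy_vert Ev H); lra.
have St := @hweight_corner j u ltac:(lra); rewrite E in St.
move/Rabs_le_between: H => H; case O: (Z.odd j) St => St.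
  exists j; split=> //; suff : ~ u - IZR j < 1/4 by lra.
  by move=> L; have := @step_lt (u - IZR j) (1/4) ltac:(lra) L ltac:(lra); rewrite -St step1; lra.
exists (j - 1)%Z; split; first by rewrite Zeven_odd even_pred -Zeven_odd O.
rewrite minus_IZR; suff : ~ -1/4 < u - IZR j by lra.
by move=> L; have := @step_lt (-1/4) (u - IZR j) ltac:(lra) L ltac:(lra); rewrite (@step0 (-1/4)); lra.
Qed.

(** [Q] is minimal, and negative, at [u]. A strand at the same angle with at least the same radius
    would have a slope at most as large, hence equal, and would lie on a horizontal edge in the same
    row. *)
Lemma hop_outermost u v n j : Z.odd j -> u = IZR j + 1/2 -> vdir j = vdir (j + 1)%Z ->
  thu v = thu u + IZR n -> ~ (exists k, (n = k * m)%Z) -> pu v < pu u.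
Proof.
move=> O Eu N Th Hn.
have Hu : IZR j + 1/4 <= u <= IZR j + 3/4 by lra.
have V1 : vsign u = 1.
  rewrite (@vsign_near CA CB j); last by apply: Rabs_le; lra.
  by rewrite -N (bp_up bp O N); ring.
have h1 := fy_hori O Hu.
have [Ec Es] := co_si_shift (thu u) n; rewrite -Th in Ec Es.
have Qu := polQ u; have Qv := polQ v; rewrite Es in Qv.
have QE := Q_up V1; rewrite h1 in QE.
have HC := bf_C bf; have Hd := bf_del bf.
have p1 := pu_gt0 u; have p2 := pu_gt0 v.
have s0 : si (thu u) < 0 by nra.
have Qm := Q_min v; have Hw := hweight_bounds v.
case: (Rlt_le_dec (pu v) (pu u)) => // L; exfalso.
have : Q v <= Q u by nra.
move=> Q1; have hv : hweight v = 1 by nra.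
have EQ : Q u = Q v by rewrite hv in Qm; lra.
have EB : B u = B v.
  have Ep : pu u = pu v by apply: (Rmult_eq_reg_r (si (thu u))); lra.
  by have := polB u; have := polB v; rewrite Ec Ep; lra.
have [l [Ol Hv]] := hweight_eq1 hv.
exact: (hori_hori Th Hn EB O Ol Hu Hv).
Qed.

End Meet.

From mathcomp Require Import zify.

(** * The order of the strands of a closed 3-braid *)

Lemma pos_near (g : R -> R) u : smooth g -> 0 < g u ->
  exists d, 0 < d /\ forall x, Rabs (x - u) < d -> 0 < g x.
Proof.
move=> S H; have C := smooth_continuity_pt u S.
move: C; rewrite continuity_pt_locally => /(_ (mkposreal _ H)) [d Hd].
exists d; split; first exact: cond_pos.
by move=> x Hx; have := Hd x Hx => /= /Rabs_def2; lra.
Qed.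

Lemma const_sign (g : R -> R) lo hi x0 : smooth g -> (forall x, lo < x < hi -> g x <> 0) ->
  lo < x0 < hi -> 0 < g x0 -> forall x, lo < x < hi -> 0 < g x.
Proof.
move=> S N H0 G0 x Hx; apply: Rnot_le_lt => L.
have [z [Hz Ez]] : { z : R | Rmin x x0 <= z <= Rmax x x0 /\ g z = 0 }.
  apply: IVT_gen; first by move=> y; exact: smooth_continuity_pt.
  by rewrite Rmin_left ?Rmax_right; lra.
have K1 : lo < Rmin x x0 by apply: Rmin_glb_lt; lra.
have K2 : Rmax x x0 < hi by apply: Rmax_lub_lt; lra.
by apply: (N z) => //; lra.
Qed.

Lemma limit_left (g : R -> R) lo u : smooth g -> lo < u -> (forall x, lo < x < u -> 0 < g x) -> 0 <= g u.
Proof.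
move=> S Hlo Pg; apply: Rnot_lt_le => H.
have [d [d0 Hd]] := @pos_near (fun x => - g x) u (smooth_opp S) ltac:(lra).
have m0 : 0 < Rmin d (u - lo) by apply: Rmin_glb_lt; lra.
have m1 := Rmin_l d (u - lo); have m2 := Rmin_r d (u - lo).
have := Hd (u - Rmin d (u - lo) / 2) ltac:(apply: Rabs_def1; lra).
by have := Pg (u - Rmin d (u - lo) / 2) ltac:(lra); lra.
Qed.

Lemma limit_right (g : R -> R) u hi : smooth g -> u < hi -> (forall x, u < x < hi -> 0 < g x) -> 0 <= g u.
Proof.
move=> S Hhi Pg; apply: Rnot_lt_le => H.
have [d [d0 Hd]] := @pos_near (fun x => - g x) u (smooth_opp S) ltac:(lra).
have m0 : 0 < Rmin d (hi - u) by apply: Rmin_glb_lt; lra.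
have m1 := Rmin_l d (hi - u); have m2 := Rmin_r d (hi - u).
have := Hd (u + Rmin d (hi - u) / 2) ltac:(apply: Rabs_def1; lra).
by have := Pg (u + Rmin d (hi - u) / 2) ltac:(lra); lra.
Qed.

Lemma crossing_sign (g : R -> R) u lo hi : smooth g -> g u = 0 -> 0 < Derive g u ->
  lo < u < hi -> (exists x, lo < x < u /\ g x < 0) /\ (exists x, u < x < hi /\ 0 < g x).
Proof.
move=> S E D H.
have [d [d0 Hd]] := pos_near (smooth_Derive S) D.
have DD x : is_derive g x (Derive g x) by apply/Derive_correct/smooth_ex_derive.
split.
  have m0 : 0 < Rmin d (u - lo) by apply: Rmin_glb_lt; lra.
  have m1 := Rmin_l d (u - lo); have m2 := Rmin_r d (u - lo).
  exists (u - Rmin d (u - lo) / 2); split; first lra.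
  rewrite -E; apply: (@incr_lt g (Derive g)) => [t _|t Ht|]; [exact: DD| |lra].
  by apply: Hd; apply: Rabs_def1; lra.
have m0 : 0 < Rmin d (hi - u) by apply: Rmin_glb_lt; lra.
have m1 := Rmin_l d (hi - u); have m2 := Rmin_r d (hi - u).
exists (u + Rmin d (hi - u) / 2); split; first lra.
rewrite -E; apply: (@incr_lt g (Derive g)) => [t _|t Ht|]; [exact: DD| |lra].
by apply: Hd; apply: Rabs_def1; lra.
Qed.

Definition distinct3 (a b c : Z) : Prop :=
  [/\ (0 <= a < 3)%Z, (0 <= b < 3)%Z, (0 <= c < 3)%Z & [/\ a <> b, a <> c & b <> c]].

Section Order.
Variables r h : R -> R.
Hypotheses (Sr : smooth r).
Hypotheses (Pr : forall u, r (u + IZR 3) = r u) (Ph : forall u, h (u + IZR 3) = h u).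

Let f (a : Z) (x : R) : R := r (x + IZR a).

Let Sf a : smooth (f a).
Proof. by apply: (smooth_comp Sr); smo. Qed.

Let Sfd a b : smooth (fun x => f a x - f b x).
Proof. by apply: smooth_minus. Qed.

Let Dfd a b x : Derive (fun x => f a x - f b x) x = Derive r (x + IZR a) - Derive r (x + IZR b).
Proof.
have D c : is_derive (f c) x (Derive r (x + IZR c)).
  by apply: is_derive_shift; apply/Derive_correct/smooth_ex_derive.
exact: (is_derive_unique _ _ _ (is_derive_minus _ _ _ _ _ (D a) (D b))).
Qed.

(** Here [o], [d] and [e] are the over strand, the under strand and the third one. The index of the
    generator tells whether the third strand is farther from the axis or closer to it. *)
Record crossing3 (u : R) (s : nat * bool) (o d e : Z) : Prop := Crossing3 {
  c3_dist : distinct3 o d e;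
  c3_meet : f o u = f d u;
  c3_over : h (u + IZR d) < h (u + IZR o);
  c3_first : s.1 = 1%N -> f o u < f e u;
  c3_second : s.1 = 2%N -> f e u < f o u;
  c3_sign : if s.2 then Derive r (u + IZR d) < Derive r (u + IZR o)
            else Derive r (u + IZR o) < Derive r (u + IZR d) }.

Lemma crossing3_of u s : crossing_at 3 r h u s -> exists o d e, crossing3 u s o d e.
Proof.
move=> [o [d [[/eqP od Er] Eh C Q D]]].
have [e [eo ed]] : exists e : 'I_3, e <> o /\ e <> d.
  case: o d od {Er Eh C Q D} => [[|[|[|o]]] // Ho] [[|[|[|d]]] // Hd] od;
  try (by case: od; apply: val_inj);
  first [by exists (Ordinal (isT : 0 < 3)%N); split => /(congr1 val)
        |by exists (Ordinal (isT : 1 < 3)%N); split => /(congr1 val)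
        |by exists (Ordinal (isT : 2 < 3)%N); split => /(congr1 val)].
exists (Z.of_nat o), (Z.of_nat d), (Z.of_nat e).
have INZ m : INR m = IZR (Z.of_nat m) by rewrite INR_IZR_INZ.
have Ne : r (u + INR e) <> r (u + INR o).
  move=> E; have /eqP eo' : e != o by apply/eqP.
  by case: (Q e o _ E) => [|[]|[]] //; apply/eqP.
split; rewrite /f -?INZ //.
- have := ltn_ord o; have := ltn_ord d; have := ltn_ord e.
  have oe : (o : nat) <> e by move/val_inj => E; apply: eo.
  have de : (d : nat) <> e by move/val_inj => E; apply: ed.
  have ode : (o : nat) <> d by move/val_inj.
  by move=> *; split; [lia|lia|lia|split; lia].
- move=> s1; move: C; rewrite s1 => -[] /eqP; rewrite cards_eq0 => /eqP C.
  have : e \notin [set k : 'I_3 | Rlt_dec (r (u + INR k)) (r (u + INR o))] by rewrite C inE.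
  by rewrite inE; case: Rlt_dec => //= H _; lra.
move=> s2; move: C; rewrite s2 => -[] /eqP /cards1P [x Hx].
have : x \in [set k : 'I_3 | Rlt_dec (r (u + INR k)) (r (u + INR o))] by rewrite Hx inE.
rewrite inE; case: Rlt_dec => //= H _.
suff -> : e = x by [].
have xo : (x : nat) <> o by move/val_inj => E; rewrite E in H; lra.
have xd : (x : nat) <> d by move/val_inj => E; rewrite E in H; lra.
have oe : (o : nat) <> e by move/val_inj => E; apply: eo.
have de : (d : nat) <> e by move/val_inj => E; apply: ed.
have ode : (o : nat) <> d by move/val_inj.
apply: val_inj => /=.
by have := ltn_ord o; have := ltn_ord d; have := ltn_ord e; have := ltn_ord x; lia.
Qed.

Lemma Dr_per u : Derive r (u + IZR 3) = Derive r u.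
Proof. exact: Derive_periodic. Qed.

Let prev (a : Z) : Z := if (a =? 0)%Z then 2%Z else (a - 1)%Z.

Let prevE (g : R -> R) : (forall u, g (u + IZR 3) = g u) -> forall u a,
  g (u + 1 + IZR (prev a)) = g (u + IZR a).
Proof.
move=> Pg u a; rewrite /prev; case: Z.eqb_spec => [->|_].
  by rewrite -(Pg (u + 0)); congr g; rewrite /=; ring.
by rewrite minus_IZR; congr g; ring.
Qed.

(** After one more turn the same points carry the preceding labels modulo 3. *)
Lemma crossing3_shift u s o d e : crossing3 u s o d e ->
  crossing3 (u + 1) s (prev o) (prev d) (prev e).
Proof.
case=> [[H1 H2 H3 [H4 H5 H6]]] M O F S D.
split; rewrite /f ?(prevE Pr) ?(prevE Ph) ?(prevE Dr_per) //.
by rewrite /prev; split; [| | |split]; do ! case: Z.eqb_spec; lia.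
Qed.

(** The strands that meet are neighbours in the order before the crossing, and the index of the
    generator selects the pair. Of the two choices of the over strand, one is excluded by the sign
    of the derivative. The third strand keeps its place by continuity. *)
Lemma crossing_step lo u hi s1 s2 s3 s o d e :
  distinct3 s1 s2 s3 -> crossing3 u s o d e -> lo < u -> u < hi ->
  (forall x, lo < x < u -> f s1 x < f s2 x < f s3 x) ->
  (forall x a b, u < x < hi -> (0 <= a < 3)%Z -> (0 <= b < 3)%Z -> a <> b -> f a x <> f b x) ->
  (s.1 = 1%N -> [/\ f s1 u = f s2 u, f s2 u < f s3 u,
     if s.2 then h (u + IZR s2) < h (u + IZR s1) else h (u + IZR s1) < h (u + IZR s2)
     & forall x, u < x < hi -> f s2 x < f s1 x < f s3 x]) /\
  (s.1 = 2%N -> [/\ f s2 u = f s3 u, f s1 u < f s2 u,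
     if s.2 then h (u + IZR s3) < h (u + IZR s2) else h (u + IZR s2) < h (u + IZR s3)
     & forall x, u < x < hi -> f s1 x < f s3 x < f s2 x]).
Proof.
move=> [I1 I2 I3 [N12 N13 N23]] [[J1 J2 J3 [M12 M13 M23]]] Meet Over First Second Sign Hlo Hhi Ord Inj.
have W12 : f s1 u <= f s2 u.
  have := @limit_left (fun x => f s2 x - f s1 x) lo u (Sfd _ _) Hlo.
  by move=> /(_ ltac:(by move=> x /Ord; lra)); lra.
have W23 : f s2 u <= f s3 u.
  have := @limit_left (fun x => f s3 x - f s2 x) lo u (Sfd _ _) Hlo.
  by move=> /(_ ltac:(by move=> x /Ord; lra)); lra.
have after a b : (0 <= a < 3)%Z -> (0 <= b < 3)%Z -> f a u < f b u -> forall x, u < x < hi -> f a x < f b x.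
  move=> Ha Hb L x Hx.
  have ab : b <> a by move=> E; rewrite E in L; lra.
  have [dd [d0 Hd]] := @pos_near (fun x => f b x - f a x) u (Sfd _ _) ltac:(lra).
  have m0 : 0 < Rmin dd (hi - u) by apply: Rmin_glb_lt; lra.
  have m1 := Rmin_l dd (hi - u); have m2 := Rmin_r dd (hi - u).
  have := @const_sign (fun x => f b x - f a x) u hi (u + Rmin dd (hi - u) / 2) (Sfd _ _).
  move=> /(_ ltac:(by move=> y Hy; have := Inj y b a Hy Hb Ha ab; lra) ltac:(lra)).
  have P0 := Hd (u + Rmin dd (hi - u) / 2) ltac:(apply: Rabs_def1; lra).
  by move=> /(_ P0 x Hx); lra.
have cross a b : (0 <= a < 3)%Z -> (0 <= b < 3)%Z -> a <> b -> f a u = f b u ->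
  Derive r (u + IZR b) < Derive r (u + IZR a) ->
  (exists x, lo < x < u /\ f a x < f b x) /\ forall x, u < x < hi -> f b x < f a x.
  move=> Ha Hb ab E D.
  have [||[x [Hx Lx]] [y [Hy Ly]]] := @crossing_sign (fun x => f a x - f b x) u lo hi (Sfd _ _) ltac:(lra).
  - by rewrite Dfd; lra.
  - by lra.
  split; first by exists x; split=> //; lra.
  have := @const_sign (fun x => f a x - f b x) u hi y (Sfd _ _).
  move=> /(_ ltac:(by move=> z Hz; have := Inj z a b Hz Ha Hb ab; lra) Hy Ly) K z Hz.
  by have := K z Hz; lra.
have pair a b c : distinct3 a b c -> o = a /\ d = b \/ o = b /\ d = a ->
    (forall x, lo < x < u -> f a x < f b x) ->
    [/\ f a u = f b u, if s.2 then h (u + IZR b) < h (u + IZR a) else h (u + IZR a) < h (u + IZR b)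
      & forall x, u < x < hi -> f b x < f a x].
  move=> [Ha Hb _ [ab _ _]] od before.
  have ba : b <> a by move=> E; apply: ab.
  case: od => -[Eo Ed]; rewrite Eo Ed in Meet Over Sign; case: (s.2) Sign => Sign.
  - by have [_ K] := cross a b Ha Hb ab Meet Sign.
  - have [[x [Hx L]] _] := cross b a Hb Ha ba (esym Meet) Sign.
    by have := before x Hx; lra.
  - have [[x [Hx L]] _] := cross b a Hb Ha ba Meet Sign.
    by have := before x Hx; lra.
  by have [_ K] := cross a b Ha Hb ab (esym Meet) Sign.
have [Eo|[Eo|Eo]] : o = s1 \/ o = s2 \/ o = s3 by lia.
all: have [Ed|[Ed|Ed]] : d = s1 \/ d = s2 \/ d = s3 by lia.
all: have [Ee|[Ee|Ee]] : e = s1 \/ e = s2 \/ e = s3 by lia.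
all: try (exfalso; lia).
all: split=> Hs; [move: (First Hs) => L|move: (Second Hs) => L]; rewrite Eo Ee in L.
all: rewrite Eo Ed in Meet.
all: try (exfalso; lra).
all: first [have [K1 K2 K3] := @pair s1 s2 s3 ltac:(by split=> //; split) ltac:(tauto) ltac:(by move=> x /Ord; lra)
  |have [K1 K2 K3] := @pair s2 s3 s1 ltac:(by split=> //; split=> // E; lia) ltac:(tauto) ltac:(by move=> x /Ord; lra)].
all: split; [by []|lra|by []|move=> x Hx; split; first [exact: K3|apply: after => //; lra]].
Qed.

End Order.

(* The word is read cyclically from the letter that follows the negative crossings
   and the first sigma_2.  [order_at k i] lists the strands from the axis outwards
   after [i] letters, [over_at i] is the over strand of the next crossing. *)
Definition order_at (k i : nat) : Z * Z * Z :=
  if (i < 4)%N then (if odd i then (2, 1, 0) else (1, 2, 0))%Z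
  else if i == (k + 5)%N then (0, 1, 2)%Z
  else (if odd i then (0, 2, 1) else (2, 0, 1))%Z.

Definition over_at (i : nat) : Z :=
  if (i < 4)%N then (if i == 1%N then 2 else 1)%Z else (if odd i then 2 else 0)%Z.

Definition relabel (z0 z1 z2 a : Z) : Z :=
  if (a =? 0)%Z then z0 else if (a =? 1)%Z then z1 else z2.

(** The crossings take place at [X 1], ..., [X (k + 5)], the i-th one, counted from 0, at [X i.+1].
    The times [X 0] and [X (k + 6)] lie between crossings. *)
Record strand_order (k : nat) (r h : R -> R) (X : nat -> R) : Prop := StrandOrder {
  so_incr : forall i, (i < k + 6)%N -> X i < X i.+1;
  so_last : X (k + 6)%N = X 0%N + 1;
  so_meet : forall x a b, X 0%N <= x <= X 0%N + 1 -> (0 <= a < 3)%Z -> (0 <= b < 3)%Z -> a <> b ->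
    r (x + IZR a) = r (x + IZR b) ->
    exists i, [/\ (i < k + 5)%N, x = X i.+1 & a = over_at i \/ b = over_at i];
  so_over : forall i a, (i < k + 5)%N -> (0 <= a < 3)%Z -> a <> over_at i ->
    r (X i.+1 + IZR a) = r (X i.+1 + IZR (over_at i)) ->
    h (X i.+1 + IZR a) < h (X i.+1 + IZR (over_at i));
  so_sort : forall i x, (i <= k + 5)%N -> X i <= x <= X i.+1 ->
    let: (a, b, c) := order_at k i in r (x + IZR a) <= r (x + IZR b) <= r (x + IZR c) }.

Lemma nth_beta n j : (j < 2 * n + 3 + 5)%N -> nth (sigma 0) (beta n) j =
  if (j < 2 * n + 3)%N then sigma_inv 1 else
  if (j == 2 * n + 3)%N || (j == 2 * n + 3 + 4)%N then sigma 2 else sigma 1.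
Proof.
move=> Hj; rewrite /beta nth_cat size_nseq; case: ltnP => H1; first by rewrite nth_nseq H1.
have [i Ei] : exists i, j = (2 * n + 3 + i)%N by exists (j - (2 * n + 3))%N; lia.
rewrite Ei addKn; have : (i < 5)%N by lia.
by case: i {Ei} => [|[|[|[|[|i]]]]] // _;
  rewrite ?addn0 ?eqxx //= -[X in (_ == X)]addn0 !eqn_add2l.
Qed.

Lemma size_beta n : size (beta n) = (2 * n + 3 + 5)%N.
Proof. by rewrite /beta !size_cat !size_nseq /=; lia. Qed.

Section Word.
Variables (n : nat) (r h : R -> R).
Hypotheses (Sr : smooth r).
Hypotheses (Pr : forall u, r (u + IZR 3) = r u) (Ph : forall u, h (u + IZR 3) = h u).
Hypothesis word : reads_word 3 r h (beta n).

Let k := (2 * n + 3)%N.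
Let f (a : Z) (x : R) : R := r (x + IZR a).

Let Sfd a b : smooth (fun x => f a x - f b x).
Proof. by apply: smooth_minus; apply: (smooth_comp Sr); smo. Qed.

(** The letter of index k + 1 + i of the word, read cyclically; the first [sigma 2], of index k,
    comes last. *)
Definition letter_at (i : nat) : nat * bool :=
  if (i < 3)%N then sigma 1 else if (i == 3)%N || (i == k + 4)%N then sigma 2 else sigma_inv 1.

(** [Y 0] is the time of the first [sigma 2], and the crossings of the next turn follow; [Y (k + 5)]
    is the same crossing one turn later. *)
Lemma strand_times : exists Y : nat -> R,
  [/\ forall i, (i < k + 6)%N -> Y i < Y i.+1,
      Y (k + 5)%N = Y 0%N + 1 /\ Y (k + 6)%N = Y 1%N + 1,
      forall i, (i < k + 5)%N -> exists o d e, crossing3 r h (Y i.+1) (letter_at i) o d e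
    & forall i x a b, (i < k + 6)%N -> Y i < x < Y i.+1 -> (0 <= a < 3)%Z -> (0 <= b < 3)%Z ->
        a <> b -> f a x <> f b x].
Proof.
case: word => tau; rewrite size_beta -/k => -[T01 Tmono Tcross Tinj].
pose ext j := if (j < k + 5)%N then tau j else tau (j - (k + 5))%N + 1.
exists (fun i => ext (k + i)%N); split.
- move=> i Hi; rewrite /ext (addnS k i).
  case: ltnP => H1; case: ltnP => H2; try lia.
  + by apply: Tmono; lia.
  + have := T01 _ H1; have := T01 ((k + i).+1 - (k + 5))%N ltac:(lia); lra.
  by have := Tmono (k + i - (k + 5))%N ((k + i).+1 - (k + 5))%N ltac:(lia); lra.
- rewrite /ext addn0; split.
    by rewrite ifF ?ifT; [congr (tau _ + 1)| |]; lia.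
  by rewrite ifF ?ifT; [congr (tau _ + 1)| |]; lia.
- move=> i Hi; have cr j : (j < k + 5)%N -> exists o d e, crossing3 r h (tau j) (nth (sigma 0) (beta n) j) o d e.
    by move=> Hj; apply: crossing3_of; apply: Tcross.
  rewrite /ext (addnS k i); case: ltnP => H1.
    have [o [d [e C]]] := cr _ H1; exists o, d, e.
    suff -> : letter_at i = nth (sigma 0) (beta n) (k + i).+1 by [].
    rewrite nth_beta // -/k /letter_at.
    by do ! (case: ifP => ?); first [by []|exfalso; lia].
  have [o [d [e C]]] := cr ((k + i).+1 - (k + 5))%N ltac:(lia).
  have := crossing3_shift Sr Pr Ph C; set o' := (if _ then _ else _); move=> C'.
  do 3 eexists; suff -> : letter_at i = nth (sigma 0) (beta n) ((k + i).+1 - (k + 5))%N by exact: C'.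
  rewrite nth_beta; last by rewrite -/k; lia.
  by rewrite -/k /letter_at; do ! (case: ifP => ?); first [by []|exfalso; lia].
move=> i x a b Hi Hx Ha Hb ab.
have INZ (m : Z) : (0 <= m < 3)%Z -> exists m' : 'I_3, m = Z.of_nat m'.
  by move=> Hm; have H : (Z.to_nat m < 3)%N by [lia]; exists (Ordinal H) => /=; lia.
have core a' b' y : (0 <= a' < 3)%Z -> (0 <= b' < 3)%Z -> a' <> b' -> 0 <= y < 1 ->
    (forall j, (j < k + 5)%N -> y <> tau j) -> f a' y <> f b' y.
  move=> {a b Ha Hb ab} Ha Hb ab Hy Nt; move: a' b' Ha Hb ab => a b Ha Hb ab; have [a' Ea] := INZ _ Ha; have [b' Eb] := INZ _ Hb.
  have J := Tinj y Hy Nt a' b'; rewrite /f Ea Eb -!INR_IZR_INZ => E.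
  by apply: ab; rewrite Ea Eb (J E).
have shifted : 0 <= x - 1 < 1 -> (forall j, (j < k + 5)%N -> x - 1 <> tau j) -> f a x <> f b x.
  move=> Hy Nt.
  have [a' [Ha' Ea]] : exists a', (0 <= a' < 3)%Z /\ (a' = a + 1 \/ a' = a - 2)%Z.
    by case: (Z.eq_dec a 2) => E; [exists 0%Z; lia|exists (a + 1)%Z; lia].
  have [b' [Hb' Eb]] : exists b', (0 <= b' < 3)%Z /\ (b' = b + 1 \/ b' = b - 2)%Z.
    by case: (Z.eq_dec b 2) => E; [exists 0%Z; lia|exists (b + 1)%Z; lia].
  have sh c c' : (c' = c + 1 \/ c' = c - 2)%Z -> f c x = f c' (x - 1).
    move=> [->|->]; rewrite /f; first by rewrite plus_IZR; congr r; ring.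
    by rewrite -[RHS]Pr minus_IZR; congr r; ring.
  by rewrite (sh a a') // (sh b b') //; apply: core => //; lia.
move: Hx; rewrite /ext (addnS k i).
have mono j1 j2 : (j1 < k + 5)%N -> (j2 < k + 5)%N -> tau j1 < tau j2 -> (j1 < j2)%N.
  move=> B1 B2 L; rewrite ltnNge; apply/negP; rewrite leq_eqVlt => /orP[/eqP E|E].
    by rewrite E in L; lra.
  by have := Tmono j2 j1 ltac:(lia); lra.
case: ltnP => H1; case: ltnP => H2 Hx; try lia.
- apply: core => //; first by have := T01 _ H1; have := T01 _ H2; lra.
  move=> j Hj E; rewrite E in Hx; case: Hx => L1 L2.
  by have := mono _ _ H1 Hj L1; have := mono _ _ Hj H2 L2; lia.
- case: (Rlt_le_dec x 1) => Hx1.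
    apply: core => //; first by have := T01 _ H1; lra.
    move=> j Hj E; rewrite E in Hx; case: Hx => L1 _.
    by have := mono _ _ H1 Hj L1; lia.
  have B2 := T01 ((k + i).+1 - (k + 5))%N ltac:(lia).
  apply: shifted; first lra.
  move=> j Hj E; have L : tau j < tau ((k + i).+1 - (k + 5))%N by lra.
  by have := mono j ((k + i).+1 - (k + 5))%N Hj ltac:(lia) L; lia.
have B1 := T01 (k + i - (k + 5))%N ltac:(lia); have B2 := T01 ((k + i).+1 - (k + 5))%N ltac:(lia).
apply: shifted; first lra.
move=> j Hj E; have L1 : tau (k + i - (k + 5))%N < tau j by lra.
have L2 : tau j < tau ((k + i).+1 - (k + 5))%N by lra.
have := mono (k + i - (k + 5))%N j ltac:(lia) Hj L1.
by have := mono j ((k + i).+1 - (k + 5))%N Hj ltac:(lia) L2; lia.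
Qed.

Lemma limit_closed (g : R -> R) lo hi : smooth g -> lo < hi -> (forall x, lo < x < hi -> 0 < g x) ->
  forall x, lo <= x <= hi -> 0 <= g x.
Proof.
move=> S L G x Hx; case: (Req_dec x lo) => [->|N1]; first exact: limit_right G.
case: (Req_dec x hi) => [->|N2]; first exact: limit_left G.
by have := G x ltac:(lra); lra.
Qed.

Lemma ordered_start Y : Y 0%N < Y 1%N ->
  (forall x a b, Y 0%N < x < Y 1%N -> (0 <= a < 3)%Z -> (0 <= b < 3)%Z -> a <> b -> f a x <> f b x) ->
  exists z0 z1 z2, distinct3 z0 z1 z2 /\
    forall x, Y 0%N < x < Y 1%N -> f z1 x < f z2 x < f z0 x.
Proof.
move=> L Inj; pose x0 := (Y 0%N + Y 1%N) / 2; have Hx0 : Y 0%N < x0 < Y 1%N by rewrite /x0; lra.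
have ext a b : (0 <= a < 3)%Z -> (0 <= b < 3)%Z -> f a x0 < f b x0 ->
    forall x, Y 0%N < x < Y 1%N -> f a x < f b x.
  move=> Ha Hb K x Hx; have ab : b <> a by move=> E; rewrite E in K; lra.
  have := @const_sign (fun x => f b x - f a x) (Y 0%N) (Y 1%N) x0 (Sfd _ _).
  move=> /(_ ltac:(by move=> y Hy; have := Inj y b a Hy Hb Ha ab; lra) Hx0 ltac:(lra) x Hx); lra.
have I01 := Inj x0 0%Z 1%Z Hx0 ltac:(lia) ltac:(lia) ltac:(lia).
have I02 := Inj x0 0%Z 2%Z Hx0 ltac:(lia) ltac:(lia) ltac:(lia).
have I12 := Inj x0 1%Z 2%Z Hx0 ltac:(lia) ltac:(lia) ltac:(lia).
have wit a b c : distinct3 c a b -> f a x0 < f b x0 -> f b x0 < f c x0 -> exists z0 z1 z2,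
    distinct3 z0 z1 z2 /\ forall x, Y 0%N < x < Y 1%N -> f z1 x < f z2 x < f z0 x.
  move=> D K1 K2; exists c, a, b; split=> // x Hx; case: D => Hc Ha Hb _.
  by split; apply: ext.
have D a b c : (0 <= a < 3)%Z -> (0 <= b < 3)%Z -> (0 <= c < 3)%Z -> (c <> a -> c <> b -> a <> b -> distinct3 c a b).
  by move=> *; split.
case: (Rlt_le_dec (f 0%Z x0) (f 1%Z x0)) => K1; case: (Rlt_le_dec (f 0%Z x0) (f 2%Z x0)) => K2;
case: (Rlt_le_dec (f 1%Z x0) (f 2%Z x0)) => K3;
first [exfalso; lra
  |by apply: (@wit 0%Z 1%Z 2%Z); [apply: D|lra|lra]|by apply: (@wit 0%Z 2%Z 1%Z); [apply: D|lra|lra]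
  |by apply: (@wit 1%Z 0%Z 2%Z); [apply: D|lra|lra]|by apply: (@wit 1%Z 2%Z 0%Z); [apply: D|lra|lra]
  |by apply: (@wit 2%Z 0%Z 1%Z); [apply: D|lra|lra]|by apply: (@wit 2%Z 1%Z 0%Z); [apply: D|lra|lra]].
Qed.

Lemma nat_locate (Y : nat -> R) m x : Y 0%N < x -> x < Y m ->
  exists i, (i < m)%N /\ (Y i < x < Y i.+1 \/ ((i.+1 < m)%N /\ x = Y i.+1)).
Proof.
elim: m => [|m IH] H0 H1; first lra.
case: (total_order_T x (Y m)) => [[L|E]|L].
- by have [i [Hi [K|[K1 K2]]]] := IH H0 L; exists i; split; [lia|left|lia|right; split; [lia|]].
- case: m E {IH H1} => [|m] E; first by rewrite E in H0; lra.
  by exists m; split; [lia|right; split; [lia|]].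
by exists m; split; [lia|left].
Qed.

(** The order of the strands is followed through the word by [crossing_step]. Comparing it before
    and after a full turn shows that the initial labels are a cyclic shift of 0, 1, 2, and a shift
    of the time by [z0] normalises them. *)
Lemma strand_orderI : exists X, strand_order k r h X.
Proof.
have [Y [Yincr [Y1 Y2] Cross Inj]] := strand_times.
have [||z0 [z1 [z2 [Dz Ord0]]]] := @ordered_start Y.
- by apply: Yincr; lia.
- by move=> x a b; apply: (Inj 0%N); lia.
pose g := relabel z0 z1 z2.
have g0 : g 0%Z = z0 by []. have g1 : g 1%Z = z1 by []. have g2 : g 2%Z = z2 by [].
have [Z0 Z1 Z2 [N01 N02 N12]] := Dz.
have gI a b c : distinct3 a b c -> distinct3 (g a) (g b) (g c).
{ move=> [Ha Hb Hc [Nab Nac Nbc]].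
  have [Ea|[Ea|Ea]] : (a = 0 \/ a = 1 \/ a = 2)%Z by lia.
  all: have [Eb|[Eb|Eb]] : (b = 0 \/ b = 1 \/ b = 2)%Z by lia.
  all: have [Ec|[Ec|Ec]] : (c = 0 \/ c = 1 \/ c = 2)%Z by lia.
  all: try (exfalso; lia).
  all: by rewrite Ea Eb Ec ?g0 ?g1 ?g2; split=> //; split=> // /esym. }
pose ordered i := forall x, Y i < x < Y i.+1 ->
  let: (a, b, c) := order_at k i in f (g a) x < f (g b) x < f (g c) x.
pose info i := exists d e, [/\ distinct3 (over_at i) d e, f (g (over_at i)) (Y i.+1) = f (g d) (Y i.+1),
  h (Y i.+1 + IZR (g d)) < h (Y i.+1 + IZR (g (over_at i))) & f (g e) (Y i.+1) <> f (g (over_at i)) (Y i.+1)].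
have step i : (i < k + 5)%N -> ordered i -> ordered i.+1 /\ info i.
  move=> Hi O; have [o [d [e C]]] := Cross i Hi.
  have L1 := Yincr i ltac:(lia); have L2 := Yincr i.+1 ltac:(lia).
  have CS a b c : distinct3 a b c -> (forall x, Y i < x < Y i.+1 -> f (g a) x < f (g b) x < f (g c) x) ->
      _ := fun D H => crossing_step Sr (gI _ _ _ D) C L1 L2 H (fun x a b => Inj i.+1 x a b ltac:(lia)).
  have D102 : distinct3 1 2 0 by split=> //; split.
  have D210 : distinct3 2 1 0 by split=> //; split.
  have D201 : distinct3 2 0 1 by split=> //; split.
  have D021 : distinct3 0 2 1 by split=> //; split.
  have D012 : distinct3 0 1 2 by split=> //; split.
  have D120 : distinct3 1 0 2 by split=> //; split.
  have first_ a b c : order_at k i = (a, b, c) -> distinct3 a b c -> (letter_at i).1 = 1%N ->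
      (if (letter_at i).2 then over_at i = a else over_at i = b) -> order_at k i.+1 = (b, a, c) ->
      ordered i.+1 /\ info i.
    move=> E1 D E2 E3 E4; move: O; rewrite /ordered E1 E4 => O.
    have [/(_ E2) [K1 K2 K3 K4] _] := CS a b c D O; split=> //.
    case: D => H1 H2 H3 [H4 H5 H6].
    case: (letter_at i).2 E3 K3 => E3 K3; rewrite /info E3.
      by exists b, c; split=> //; move: K1 K2; rewrite /f; lra.
    by exists a, c; split; [split=> //; split=> // /esym|by []|by []|move: K1 K2; rewrite /f; lra].
  have second_ a b c : order_at k i = (a, b, c) -> distinct3 a b c -> (letter_at i) = sigma 2 ->
      over_at i = b -> order_at k i.+1 = (a, c, b) -> ordered i.+1 /\ info i.
    move=> E1 D E2 E3 E4; move: O; rewrite /ordered E1 E4 => O.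
    have [_] := CS a b c D O; rewrite E2 => /(_ erefl) [K1 K2 K3 K4]; split=> //.
    case: D => H1 H2 H3 [H4 H5 H6]; rewrite /info E3.
    by exists c, a; split; [split=> //; split=> // /esym|by []|by []|move: K1 K2; rewrite /f; lra].
  have odd_k : odd k by rewrite /k; lia.
  case: (ltnP i 4) => Hi4.
    case: i Hi O C L1 L2 CS first_ second_ Hi4 => [|[|[|[|i]]]] // _ O C L1 L2 CS first_ second_ _.
    - by apply: (@first_ 1 2 0)%Z.
    - by apply: (@first_ 2 1 0)%Z.
    - by apply: (@first_ 1 2 0)%Z.
    by apply: (@second_ 2 1 0)%Z => //; rewrite /order_at /=; case: eqP => //; lia.
  have lt4 : (i < 4)%N = false by lia.
  have lt4' : (i.+1 < 4)%N = false by lia.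
  case: (eqVneq i (k + 4)%N) => Ei.
    have oi : odd i by lia.
    apply: (@second_ 0 2 1)%Z => //.
    - by rewrite /order_at lt4 oi; case: eqP => //; lia.
    - by rewrite /letter_at Ei eqxx orbT; case: ifP => //; lia.
    - by rewrite /over_at lt4 oi.
    by rewrite /order_at lt4' Ei -addnS eqxx.
  have let1 : letter_at i = sigma_inv 1.
    by rewrite /letter_at (negbTE Ei); case: ifP; [lia|]; case: eqP => //; lia.
  case oi: (odd i).
    apply: (@first_ 0 2 1)%Z => //; rewrite ?let1 //=.
    - by rewrite /order_at lt4 oi; case: eqP => //; lia.
    - by rewrite /over_at lt4 oi.
    by rewrite /order_at lt4' /= oi; case: eqP => //; lia.
  apply: (@first_ 2 0 1)%Z => //; rewrite ?let1 //=.
  - by rewrite /order_at lt4 oi; case: eqP => //; lia.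
  - by rewrite /over_at lt4 oi.
  by rewrite /order_at lt4' /= oi; case: eqP => //; lia.
have ord i : (i <= k + 5)%N -> ordered i.
  elim: i => [|i IH] Hi; first by move=> x Hx; apply: Ord0.
  by have [] := step i Hi (IH (ltnW Hi)).
have inf i : (i < k + 5)%N -> info i by move=> Hi; have [] := step i Hi (ord i (ltnW Hi)).
pose x0 := (Y 0%N + Y 1%N) / 2.
have Y01 := Yincr 0%N ltac:(lia); have Yk := Yincr (k + 5)%N ltac:(lia).
have closing : f z0 (x0 + 1) < f z1 (x0 + 1) < f z2 (x0 + 1).
  have := ord (k + 5)%N (leqnn _); rewrite /ordered /order_at ifF ?eqxx; last by lia.
  by rewrite g0 g1 g2; apply; rewrite /x0 -addnS Y1 Y2; lra.
have opening := Ord0 x0 ltac:(rewrite /x0; lra).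
have shiftf a x : f a (x + 1) = f (a + 1)%Z x by rewrite /f plus_IZR; congr r; ring.
have f3 a x : f (a + 3)%Z x = f a x by rewrite /f plus_IZR -[RHS]Pr; congr r; ring.
have gE a : (0 <= a < 3)%Z -> forall u, (forall x, u (x + IZR 3) = u x) -> forall x, u (x + IZR (g a)) = u (x + IZR z0 + IZR a) :> R.
{ move: closing; rewrite !shiftf => closing Ha u Pu x.
  have [Ez0|[Ez0|Ez0]] : (z0 = 0 \/ z0 = 1 \/ z0 = 2)%Z by lia.
  all: have [Ez1|[Ez1|Ez1]] : (z1 = 0 \/ z1 = 1 \/ z1 = 2)%Z by lia.
  all: have [Ez2|[Ez2|Ez2]] : (z2 = 0 \/ z2 = 1 \/ z2 = 2)%Z by lia.
  all: try (exfalso; lia).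
  all: move: closing opening; rewrite Ez0 Ez1 Ez2 /= ?(f3 0%Z) => closing opening.
  all: have F3 := f3 0%Z x0; rewrite /= in F3.
  all: try (exfalso; lra).
  all: have [Ea|[Ea|Ea]] : (a = 0 \/ a = 1 \/ a = 2)%Z by lia.
  all: rewrite Ea ?g0 ?g1 ?g2 ?Ez0 ?Ez1 ?Ez2.
  all: first [by congr u; ring|by rewrite -[LHS]Pu; congr u; ring]. }
(* Cutting at the midpoint [x0] makes the first and the last time differ by exactly one turn and
   avoids crossing times. *)
pose X i := (if i == 0%N then x0 else if (i <= k + 5)%N then Y i else x0 + 1) + IZR z0.
have Xin i : (i < k + 5)%N -> X i.+1 = Y i.+1 + IZR z0 by move=> Hi; rewrite /X /= Hi.
have X0 : X 0%N = x0 + IZR z0 by [].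
have Xk : X (k + 6)%N = x0 + 1 + IZR z0 by rewrite /X !ifF //; lia.
have rE x a : (0 <= a < 3)%Z -> r (x + IZR a) = f (g a) (x - IZR z0).
  by move=> Ha; rewrite /f (gE a Ha r Pr); congr r; ring.
have hE x a : (0 <= a < 3)%Z -> h (x + IZR a) = h (x - IZR z0 + IZR (g a)).
  by move=> Ha; rewrite (gE a Ha h Ph); congr h; ring.
have over3 i : (0 <= over_at i < 3)%Z by rewrite /over_at; do ! case: ifP.
have Xlo i x : (i <= k + 5)%N -> X i <= x -> Y i <= x - IZR z0.
  move=> Hi; case: i Hi => [|i] Hi; first by rewrite X0 /x0; lra.
  by rewrite Xin //; lra.
have Xhi i x : (i <= k + 5)%N -> x <= X i.+1 -> x - IZR z0 <= Y i.+1.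
  move=> Hi; case: (ltnP i (k + 5)) => H1; first by rewrite Xin //; lra.
  have -> : i = (k + 5)%N by lia.
  by rewrite -addnS Xk Y2 /x0; lra.
have ZI := fun i => Yincr i.
exists X; split.
- move=> i Hi; case: i Hi => [|i] Hi.
    by rewrite Xin ?X0 /x0; [lra|lia].
  case: (ltnP i.+1 (k + 5)) => H1; first by rewrite !Xin //; [have := Yincr i.+1 ltac:(lia); lra|lia].
  have Ei : i.+2 = (k + 6)%N by lia.
  rewrite Ei Xk Xin; last by lia.
  have -> : i.+1 = (k + 5)%N by lia.
  by rewrite Y1 /x0; lra.
- by rewrite Xk X0; ring.
- move=> x a b Hx Ha Hb ab; rewrite (rE x a Ha) (rE x b Hb) => E.
  have Hx' : Y 0%N < x - IZR z0 /\ x - IZR z0 < Y (k + 6)%N.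
    by move: Hx; rewrite X0 Y2 /x0; lra.
  have ga : (0 <= g a < 3)%Z by rewrite /g /relabel; do ! case: Z.eqb_spec.
  have gb : (0 <= g b < 3)%Z by rewrite /g /relabel; do ! case: Z.eqb_spec.
  have gab : g a <> g b by rewrite /g /relabel; do ! case: Z.eqb_spec; lia.
  have [i [Hi [K|[H1 K]]]] := nat_locate (proj1 Hx') (proj2 Hx').
    by case: (Inj i _ _ _ Hi K ga gb gab).
  exists i; split; [lia|by rewrite Xin; [lra|lia]|].
  have [d [e [[Ho Hd He [od oe de]] M _ F]]] := inf i ltac:(lia).
  rewrite K in E.
  case: (Z.eq_dec a (over_at i)) => Na; first by left.
  case: (Z.eq_dec b (over_at i)) => Nb; first by right.
  have [[E1 E2]|[E1 E2]] : (a = d /\ b = e) \/ (a = e /\ b = d) by lia.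
    by case: F; rewrite -E2 -E E1.
  by case: F; rewrite -E1 E E2.
- move=> i a Hi Ha Na; rewrite Xin // (rE _ a Ha) (rE _ _ (over3 i)) (hE _ a Ha) (hE _ _ (over3 i)).
  have -> : Y i.+1 + IZR z0 - IZR z0 = Y i.+1 by ring.
  have [d [e [[Ho Hd He [od oe de]] M HH F]]] := inf i Hi.
  have [->|->] // : (a = d \/ a = e)%Z by lia.
move=> i x Hi [H1 H2]; have := ord i Hi; rewrite /ordered; case E: (order_at k i) => [[a b] c] O.
have K1 := Xlo i x Hi H1; have K2 := Xhi i x Hi H2; have L := Yincr i ltac:(lia).
have [Ha [Hb Hc]] : (0 <= a < 3)%Z /\ (0 <= b < 3)%Z /\ (0 <= c < 3)%Z.
  by move: E; rewrite /order_at; do ! (case: ifP => _); move=> [<- <- <-].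
rewrite (rE _ a Ha) (rE _ b Hb) (rE _ c Hc).
have := @limit_closed (fun x => f (g b) x - f (g a) x) _ _ (Sfd _ _) L.
move=> /(_ ltac:(by move=> y /O; lra) (x - IZR z0) ltac:(lra)).
have := @limit_closed (fun x => f (g c) x - f (g b) x) _ _ (Sfd _ _) L.
by move=> /(_ ltac:(by move=> y /O; lra) (x - IZR z0) ltac:(lra)); lra.
Qed.

End Word.

(** * Interpolation of the circle *)

Section Interpolation.
Variables (M : nat) (x y : nat -> R).
Hypothesis xincr : forall i, (i < M)%N -> x i < x i.+1.
Hypothesis yincr : forall i, (i < M)%N -> y i < y i.+1.
Hypothesis xlast : x M = x 0%N + 1.
Hypothesis ylast : y M = y 0%N + 1.

Let S (i : nat) (t : R) : R := step ((t - x i) / (x i.+1 - x i) / 2 - 1/4).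

Let psum (m : nat) (t : R) : R := sum_n (fun i => (y i.+1 - y i) * S i t) m.

Let smooth_S i : smooth (S i).
Proof.
by apply: (smooth_comp smooth_step); rewrite /Rdiv; smo.
Qed.

Let smooth_psum m : smooth (psum m).
Proof.
elim: m => [|m IH].
  have -> : psum 0 = fun t => (y 1%N - y 0%N) * S 0 t.
    by apply: functional_extensionality => t; rewrite /psum sum_O.
  by apply: smooth_mult; [smo|exact: smooth_S].
have -> : psum m.+1 = fun t => psum m t + (y m.+2 - y m.+1) * S m.+1 t.
  by apply: functional_extensionality => t; rewrite /psum sum_Sn.
by apply: smooth_plus => //; apply: smooth_mult; [smo|exact: smooth_S].
Qed.

Let S_le i t : (i < M)%N -> t <= x i -> S i t = 0.
Proof.
move=> Hi H; have L := xincr Hi; apply: step0.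
suff : (t - x i) / (x i.+1 - x i) <= 0 by lra.
by apply: Rmult_le_0_r; [lra|have := Rinv_0_lt_compat (x i.+1 - x i); lra].
Qed.

Let S_ge i t : (i < M)%N -> x i.+1 <= t -> S i t = 1.
Proof.
move=> Hi H; have L := xincr Hi; apply: step1.
suff : 1 <= (t - x i) / (x i.+1 - x i) by lra.
by apply/Rle_div_r; lra.
Qed.

Let S_mid i t : (i < M)%N -> x i < t < x i.+1 -> 0 < S i t < 1.
Proof.
move=> Hi H; have L := xincr Hi.
have A : 0 < (t - x i) / (x i.+1 - x i) by apply: Rdiv_lt_0_compat; lra.
have B : (t - x i) / (x i.+1 - x i) < 1 by apply/Rlt_div_l; lra.
have K1 := @step_lt (-1/4) ((t - x i) / (x i.+1 - x i) / 2 - 1/4) ltac:(lra) ltac:(lra) ltac:(lra).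
have K2 := @step_lt ((t - x i) / (x i.+1 - x i) / 2 - 1/4) (1/4) ltac:(lra) ltac:(lra) ltac:(lra).
have E0 := @step0 (-1/4) ltac:(lra); have E1 := @step1 (1/4) ltac:(lra).
by rewrite /S; lra.
Qed.

Let x_le i j : (i <= j)%N -> (j <= M)%N -> x i <= x j.
Proof.
move=> ij; elim: j ij => [|j IH]; first by rewrite leqn0 => /eqP -> _; lra.
rewrite leq_eqVlt ltnS => /orP[/eqP -> _|ij jM]; first lra.
by have := IH ij (ltnW jM); have := xincr jM; lra.
Qed.

Let psum_le m t : (m < M)%N -> t <= x 0%N -> psum m t = 0.
Proof.
move=> Hm Ht; elim: m Hm => [|m IH] Hm.
  by rewrite /psum sum_O S_le //; ring.
rewrite /psum sum_Sn -/(psum m t) IH; last exact: ltnW.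
rewrite /plus /= S_le //; first ring.
by have := x_le (leq0n m.+1) (ltnW Hm); lra.
Qed.

Let psum_ge m t : (m < M)%N -> x m.+1 <= t -> psum m t = y m.+1 - y 0%N.
Proof.
move=> Hm Ht; elim: m Hm Ht => [|m IH] Hm Ht.
  by rewrite /psum sum_O S_ge //; ring.
rewrite /psum sum_Sn -/(psum m t) IH; [|exact: ltnW|].
  by rewrite /plus /= S_ge //; ring.
by have := xincr Hm; lra.
Qed.

Let psum_mid m i t : (m < M)%N -> (i <= m)%N -> x i <= t <= x i.+1 ->
  psum m t = y i - y 0%N + (y i.+1 - y i) * S i t.
Proof.
move=> Hm Hi Ht; elim: m Hm Hi => [|m IH] Hm.
  rewrite leqn0 => /eqP Ei; rewrite Ei in Ht *; rewrite /psum sum_O; ring.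
rewrite leq_eqVlt ltnS => /orP[/eqP Ei|Hi].
  rewrite Ei in Ht *; rewrite /psum sum_Sn -/(psum m t) psum_ge; [|exact: ltnW|lra].
  by rewrite /plus /=; ring.
rewrite /psum sum_Sn -/(psum m t) IH //; last exact: ltnW.
rewrite /plus /= (@S_le m.+1) //; first ring.
by have := @x_le i.+1 m.+1 ltac:(lia) (ltnW Hm); lra.
Qed.

Let M_gt0 : (0 < M)%N.
Proof. by case: (M) xlast => //; lra. Qed.

Let F (t : R) : R := psum M.-1 t.
Let Mp : M.-1.+1 = M. Proof. exact: prednK. Qed.

Let F_le t : t <= x 0%N -> F t = 0.
Proof. by move=> H; apply: psum_le => //; rewrite Mp. Qed.

Let F_ge t : x 0%N + 1 <= t -> F t = 1.
Proof. by rewrite -xlast => H; rewrite /F psum_ge Mp // ylast; ring. Qed.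

Let fl (t : R) : Z := Int_part (t - x 0%N).

(** A smooth map of degree one of the circle that sends the knots [x i] to the [y i] and each gap
    into the corresponding gap. It matches the angles of the crossings of two braids. *)
Definition circle_interp (t : R) : R := y 0%N + IZR (fl t) + F (t - IZR (fl t)).

Let flP t : IZR (fl t) <= t - x 0%N < IZR (fl t) + 1.
Proof. by have := base_Int_part (t - x 0%N); rewrite -/(fl t); lra. Qed.

Let fl_eq t (q : Z) : IZR q <= t - x 0%N < IZR q + 1 -> fl t = q.
Proof.
move=> H; have K := flP t.
have L1 : IZR q < IZR (fl t + 1) by rewrite plus_IZR; lra.
have L2 : IZR (fl t) < IZR (q + 1) by rewrite plus_IZR; lra.
by move: L1 L2 => /lt_IZR L1 /lt_IZR L2; lia.
Qed.

Lemma circle_interp_shift t : circle_interp (t + 1) = circle_interp t + 1.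
Proof.
have -> : circle_interp (t + 1) = y 0%N + IZR (fl t + 1) + F (t + 1 - IZR (fl t + 1)).
  by rewrite /circle_interp (@fl_eq _ (fl t + 1)%Z) //; have := flP t; rewrite plus_IZR; lra.
rewrite /circle_interp plus_IZR.
have -> : t + 1 - (IZR (fl t) + 1) = t - IZR (fl t) by ring.
ring.
Qed.

(** The integer part jumps. Since [F] is 0 before its window and 1 after it, a sum of three
    translates of [F] gives the same function for the integer parts q - 1, q and q + 1. *)
Lemma smooth_circle_interp : smooth circle_interp.
Proof.
have SF : smooth F := smooth_psum M.-1.
have SFc c : smooth (fun t => F (t - c)) by apply: (@smooth_comp F (fun t => t - c)) => //; smo.
apply: smooth_local => t; set q := fl t.
exists (fun t => y 0%N + IZR q - 1 + F (t - (IZR q - 1)) + F (t - IZR q) + F (t - (IZR q + 1))).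
split.
  by do 3 (apply: smooth_plus; last by apply: SFc); smo.
exists (mkposreal 1 Rlt_0_1) => u Hu.
have {Hu} Hu : Rabs (u - t) < 1 by exact: Hu.
have Ht := flP t; rewrite -/q in Ht; have Hu' := flP u; move: Hu => /Rabs_def2 Hu.
rewrite /circle_interp.
have [E|[E|E]] : (fl u = q - 1 \/ fl u = q \/ fl u = q + 1)%Z.
  have L1 : IZR q < IZR (fl u + 2) by rewrite plus_IZR; lra.
  have L2 : IZR (fl u) < IZR (q + 2) by rewrite plus_IZR; lra.
  by move: L1 L2 => /lt_IZR L1 /lt_IZR L2; lia.
- rewrite E minus_IZR in Hu' *; rewrite (@F_le (u - IZR q)) ?(@F_le (u - (IZR q + 1))); lra.
- rewrite E in Hu' *; rewrite (@F_ge (u - (IZR q - 1))) ?(@F_le (u - (IZR q + 1))); lra.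
rewrite E plus_IZR in Hu' *; rewrite (@F_ge (u - (IZR q - 1))) ?(@F_ge (u - IZR q)); lra.
Qed.

Lemma circle_interp_mid i t : (i < M)%N -> x i <= t < x i.+1 ->
  circle_interp t = y i + (y i.+1 - y i) * S i t.
Proof.
move=> Hi Ht; have L1 := x_le (leq0n i) (ltnW Hi); have L2 := @x_le i.+1 M Hi (leqnn _).
rewrite /circle_interp (@fl_eq t 0); last by lra.
rewrite Rminus_0_r /F (@psum_mid _ i) ?Mp //; [ring| |lra].
by rewrite -ltnS Mp.
Qed.

Lemma circle_interp_knot i : (i < M)%N -> circle_interp (x i) = y i.
Proof.
by move=> Hi; rewrite (circle_interp_mid Hi) ?S_le //; [ring|lra|have := xincr Hi; lra].
Qed.

Lemma circle_interp_between i t : (i < M)%N -> x i < t < x i.+1 -> y i < circle_interp t < y i.+1.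
Proof.
move=> Hi Ht; rewrite (circle_interp_mid Hi); last lra.
by have := S_mid Hi Ht; have := yincr Hi; nra.
Qed.

End Interpolation.

(** * Comparing the two closed braids *)

(* The index of the column occupied by the strand [L] of the path after [i] crossings. *)
Definition idx (n : nat) (L : Z) (i : nat) : Z :=
  if (L =? 0)%Z then Z.of_nat (1 + (i - 3)./2)
  else if (L =? 1)%Z then Z.of_nat (n + 5 + (0 < i) + (2 < i) + (3 < i))
  else Z.of_nat (n + 10 + (1 < i) + (i - 4)./2).

Lemma idxE n i :
  [/\ idx n 0 i = Z.of_nat (1 + (i - 3)./2), idx n 1 i = Z.of_nat (n + 5 + (0 < i) + (2 < i) + (3 < i))
    & idx n 2 i = Z.of_nat (n + 10 + (1 < i) + (i - 4)./2)].
Proof. by []. Qed.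

Lemma nat_locate_closed (Y : nat -> R) m x : Y 0%N <= x -> x < Y m ->
  exists i, (i < m)%N /\ Y i <= x < Y i.+1.
Proof.
elim: m => [|m IH] H0 H1; first lra.
case: (Rle_lt_dec (Y m) x) => [L|L]; first by exists m; split; [lia|lra].
by have [i [Hi K]] := IH H0 L; exists i; split; [lia|].
Qed.

Lemma strand_cases (L : Z) : (0 <= L < 3)%Z -> L = 0%Z \/ L = 1%Z \/ L = 2%Z.
Proof. lia. Qed.

Lemma over_at_range i : (0 <= over_at i < 3)%Z.
Proof. by rewrite /over_at; do ! case: ifP. Qed.

Section Compare.
Variables (n : nat) (P : Z) (CA CB : Z -> Z).
Hypothesis cp : closed_path P CA CB.
Hypothesis bp : braid_path P CA CB.
Variables (b0 : R).
Variables (p hT th B Q : R -> R) (C del : R) (m : Z).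
Hypothesis bf : braid_form P CA CB b0 1 p hT th B Q C del m.

Let k := (2 * n + 3)%N.
Notation dir := (dir CA CB).
Notation vdir := (vdir CA CB).
Notation fa := (fa CA CB).
Notation turn j := (vdir j <> vdir (j + 1)%Z).
Notation thu := (thu P th).
Notation pu := (pu P p).

Let NZ : Z := Z.of_nat n.
Hypothesis HP : P = (4 * NZ + 28)%Z.
Hypothesis Hturn : forall j, Z.odd j -> (1 <= j <= 4 * NZ + 28)%Z -> turn j ->
  (j = 1 \/ j = 2 * NZ + 7 \/ j = 2 * NZ + 9 \/ j = 2 * NZ + 17 \/ j = 2 * NZ + 19 \/ j = 4 * NZ + 27)%Z.
Hypothesis turns : forall j, (j = 2 * NZ + 7 \/ j = 2 * NZ + 9 \/ j = 2 * NZ + 17 \/ j = 2 * NZ + 19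
  \/ j = 4 * NZ + 27)%Z -> turn j.
Hypothesis hop_row : forall i, (i < k + 5)%N ->
  CB (2 * idx n (over_at i) i + 1)%Z = Z.of_nat (3 + i).
Hypothesis hop_dir : forall i, (i < k + 5)%N ->
  vdir (2 * idx n (over_at i) i + 1)%Z = vdir (2 * idx n (over_at i) i + 1 + 1)%Z.
Hypothesis col_sort : forall i, (i <= k + 5)%N ->
  let: (a, b, c) := order_at k i in
  (CA (2 * idx n a i) < CA (2 * idx n b i) < CA (2 * idx n c i))%Z.
Hypothesis col_down :
  (CA (2 * (idx n 0 (k + 5) + 1)) < CA (2 * (idx n 1 (k + 5) + 1)) < CA (2 * (idx n 2 (k + 5) + 1)))%Z.

Let incr := thu_incr cp bf.

(** Half-integral angles are attained only in the middle of turns; without a turn in between none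
    can be skipped. *)
Lemma next_half u v z : u < v -> thu u = IZR z / 2 -> si (thu v) = 0 ->
  (forall j, Z.odd j -> u < IZR j + 1/2 < v -> ~ turn j) -> thu v = IZR (z + 1) / 2.
Proof.
move=> L Eu Sv N; have [z' Ez] := si_eq0 Sv; have L' := incr L.
have z1 : (z < z')%Z by apply: lt_IZR; lra.
case: (Z.eq_dec z' (z + 1)) => [<-|z2]; first lra.
have {z1 z2} /IZR_le : (z + 2 <= z')%Z by lia.
rewrite plus_IZR => K.
have Hz : thu u <= IZR (z + 1) / 2 <= thu v by rewrite plus_IZR; lra.
have [w [Hw Ew]] := thu_ivt bf (Rlt_le _ _ L) Hz.
have [j [O Ej T]] := half_integer cp bf Ew.
case: (N j O) => //; rewrite -Ej; split; apply: (thu_lt_inv cp bf); rewrite Ew plus_IZR; lra.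
Qed.

Lemma turn_zero j : Z.odd j -> turn j -> si (thu (IZR j + 1/2)) = 0.
Proof.
move=> O T; have := polQ cp bf (IZR j + 1/2); have := pu_gt0 bf (IZR j + 1/2) => pp.
have H : IZR j + 1/4 <= IZR j + 1/2 <= IZR j + 3/4 by lra.
rewrite (bf_Q bf) (slope_hori _ _ _ _ (fy_hori O H)).
rewrite (@vsign_near CA CB j); last by apply: Rabs_le; lra.
have -> : IZR j + 1/2 - IZR j - 1/2 = 0 by ring.
have Vd : vdir (j + 1)%Z = - vdir j.
  by case: (vdir1 cp j) T => ->; case: (vdir1 cp (j + 1)%Z) => -> ?; lra.
rewrite step_half Vd; have -> : vdir j + (- vdir j - vdir j) * (1/2) = 0 by field.
rewrite ramp0 => E; have : pu (IZR j + 1/2) * si (thu (IZR j + 1/2)) = 0 by lra.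
by case/Rmult_integral; lra.
Qed.

Let N0 : (0 <= NZ)%Z. Proof. by rewrite /NZ; lia. Qed.

Let IZRt (j : Z) (x : R) : x = IZR j + 1/2 -> x = IZR j + 1/2. Proof. by []. Qed.

(** The six turns of a period have consecutive half-integral angles, beginning with 1/2 by
    [bf_start]. *)
Lemma turn_angles :
  [/\ thu (IZR 1 + 1/2) = 1/2, thu (IZR (2 * NZ + 7) + 1/2) = 1, thu (IZR (2 * NZ + 9) + 1/2) = 3/2
    & [/\ thu (IZR (2 * NZ + 17) + 1/2) = 2, thu (IZR (2 * NZ + 19) + 1/2) = 5/2,
      thu (IZR (4 * NZ + 27) + 1/2) = 3 & thu (IZR (4 * NZ + 29) + 1/2) = 7/2]].
Proof.
have T0 : thu (IZR 1 + 1/2) = 1/2 := bf_start bf.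
have seg a b z : (1 <= a)%Z -> (a < b)%Z -> (b <= 4 * NZ + 29)%Z -> thu (IZR a + 1/2) = IZR z / 2 ->
    si (thu (IZR b + 1/2)) = 0 ->
    (forall j, (a < j < b)%Z -> ~ (j = 1 \/ j = 2 * NZ + 7 \/ j = 2 * NZ + 9 \/ j = 2 * NZ + 17 \/
       j = 2 * NZ + 19 \/ j = 4 * NZ + 27)%Z) ->
    thu (IZR b + 1/2) = IZR (z + 1) / 2.
  move=> a1 ab b1 Ta Sb Nj; apply: (next_half (u := IZR a + 1/2)) => //.
    by have := IZR_lt _ _ ab; lra.
  move=> j O [H1 H2] Tj.
  have H1' : (a < j)%Z by apply: lt_IZR; lra.
  have H2' : (j < b)%Z by apply: lt_IZR; lra.
  by apply: (Nj j) => //; apply: Hturn => //; lia.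
have odd7 : Z.odd (2 * NZ + 7) by rewrite (_ : (2 * NZ + 7 = 2 * (NZ + 3) + 1)%Z) ?odd2 //; lia.
have odd9 : Z.odd (2 * NZ + 9) by rewrite (_ : (2 * NZ + 9 = 2 * (NZ + 4) + 1)%Z) ?odd2 //; lia.
have odd17 : Z.odd (2 * NZ + 17) by rewrite (_ : (2 * NZ + 17 = 2 * (NZ + 8) + 1)%Z) ?odd2 //; lia.
have odd19 : Z.odd (2 * NZ + 19) by rewrite (_ : (2 * NZ + 19 = 2 * (NZ + 9) + 1)%Z) ?odd2 //; lia.
have odd27 : Z.odd (4 * NZ + 27) by rewrite (_ : (4 * NZ + 27 = 2 * (2 * NZ + 13) + 1)%Z) ?odd2 //; lia.
have T1 : thu (IZR (2 * NZ + 7) + 1/2) = IZR 2 / 2.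
  by apply: (@seg 1%Z _ 1%Z); try lia; [done|apply: turn_zero => //; apply: turns; lia].
have T2 : thu (IZR (2 * NZ + 9) + 1/2) = IZR 3 / 2.
  by apply: (@seg (2 * NZ + 7)%Z _ 2%Z); try lia; [done|apply: turn_zero => //; apply: turns; lia].
have T3 : thu (IZR (2 * NZ + 17) + 1/2) = IZR 4 / 2.
  by apply: (@seg (2 * NZ + 9)%Z _ 3%Z); try lia; [done|apply: turn_zero => //; apply: turns; lia].
have T4 : thu (IZR (2 * NZ + 19) + 1/2) = IZR 5 / 2.
  by apply: (@seg (2 * NZ + 17)%Z _ 4%Z); try lia; [done|apply: turn_zero => //; apply: turns; lia].
have T5 : thu (IZR (4 * NZ + 27) + 1/2) = IZR 6 / 2.
  by apply: (@seg (2 * NZ + 19)%Z _ 5%Z); try lia; [done|apply: turn_zero => //; apply: turns; lia].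
have T6 : thu (IZR (4 * NZ + 29) + 1/2) = IZR 7 / 2.
  apply: (@seg (4 * NZ + 27)%Z _ 6%Z); try lia; first done.
  have -> : IZR (4 * NZ + 29) + 1/2 = IZR 1 + 1/2 + IZR (1 * P).
    by rewrite HP (_ : (4 * NZ + 29 = 1 + 1 * (4 * NZ + 28))%Z) ?plus_IZR; [lra|lia].
  rewrite (thu_period cp bf) T0; have := si_half (1 + 2 * (1 * m)); rewrite plus_IZR mult_IZR.
  by have -> : (1 + 2 * IZR (1 * m)) / 2 = 1/2 + IZR (1 * m) by field.
by split; [| | |split]; lra.
Qed.

Lemma wind3 : m = 3%Z.
Proof.
have [T0 _ _ [_ _ _ T6]] := turn_angles.
have := thu_period cp bf (IZR 1 + 1/2) 1.
have -> : IZR 1 + 1/2 + IZR (1 * P) = IZR (4 * NZ + 29) + 1/2.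
  by rewrite HP (_ : (4 * NZ + 29 = 1 + 1 * (4 * NZ + 28))%Z) ?plus_IZR; [lra|lia].
by rewrite T0 T6 => E; apply: eq_IZR; rewrite mult_IZR in E; lra.
Qed.

Lemma idx_step L i : (0 <= L < 3)%Z -> (i < k + 5)%N ->
  idx n L i.+1 = (idx n L i + (if over_at i =? L then 1 else 0))%Z.
Proof.
move=> /strand_cases [|[|]] -> Hi; rewrite /idx /over_at /=.
- case: (ltnP i 4) => H.
    by case: i H Hi => [|[|[|[|i]]]].
  by case O: (odd i); rewrite /=; lia.
- case: (ltnP i 4) => H.
    by case: i H Hi => [|[|[|[|i]]]] //= _ _; lia.
  by case O: (odd i); rewrite /=; lia.
case: (ltnP i 4) => H.
  by case: i H Hi => [|[|[|[|i]]]] //= _ _; lia.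
by case O: (odd i); rewrite /=; lia.
Qed.

Lemma idx_bounds L i : (0 <= L < 3)%Z -> (i <= k + 5)%N -> (idx n L 0 <= idx n L i <= idx n L (k + 5))%Z.
Proof. by move=> /strand_cases [|[|]] -> Hi; rewrite /idx /= /k; lia. Qed.

(** Strand [L] ascends from angle L + 1/2 to L + 1 and then descends in a single column up to L +
    3/2. *)
Lemma lap_angles L : (0 <= L < 3)%Z ->
  [/\ thu (IZR (2 * idx n L 0) - 1/2) = IZR L + 1/2,
      thu (IZR (2 * idx n L (k + 5)) + 3/2) = IZR L + 1
    & thu (IZR (2 * (idx n L (k + 5) + 1)) + 3/2) = IZR L + 3/2].
Proof.
have [T0 T1 T2 [T3 T4 T5 T6]] := turn_angles.
have low (x j : Z) : x = (j + 1)%Z -> IZR x - 1/2 = IZR j + 1/2 by move=> ->; rewrite plus_IZR; lra.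
have high (x j : Z) : x = (j - 1)%Z -> IZR x + 3/2 = IZR j + 1/2 by move=> ->; rewrite minus_IZR; lra.
have [A0 A1 A2] := idxE n (k + 5); have [B0 B1 B2] := idxE n 0.
move=> /strand_cases [|[|]] ->.
- have E1 : (2 * idx n 0 0 = 1 + 1)%Z by [].
  have E2 : (2 * idx n 0 (k + 5) = 2 * NZ + 7 - 1)%Z by rewrite ?A0 ?A1 ?A2 /k /NZ; lia.
  have E3 : (2 * (idx n 0 (k + 5) + 1) = 2 * NZ + 9 - 1)%Z by lia.
  by rewrite (low _ _ E1) (high _ _ E2) (high _ _ E3); split; lra.
- have E1 : (2 * idx n 1 0 = 2 * NZ + 9 + 1)%Z by rewrite ?B0 ?B1 ?B2 /NZ; lia.
  have E2 : (2 * idx n 1 (k + 5) = 2 * NZ + 17 - 1)%Z by rewrite ?A0 ?A1 ?A2 /k /NZ; lia.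
  have E3 : (2 * (idx n 1 (k + 5) + 1) = 2 * NZ + 19 - 1)%Z by lia.
  by rewrite (low _ _ E1) (high _ _ E2) (high _ _ E3); split; lra.
have E1 : (2 * idx n 2 0 = 2 * NZ + 19 + 1)%Z by rewrite ?B0 ?B1 ?B2 /NZ; lia.
have E2 : (2 * idx n 2 (k + 5) = 4 * NZ + 27 - 1)%Z by rewrite ?A0 ?A1 ?A2 /k /NZ; lia.
have E3 : (2 * (idx n 2 (k + 5) + 1) = 4 * NZ + 29 - 1)%Z by lia.
by rewrite (low _ _ E1) (high _ _ E2) (high _ _ E3); split; lra.
Qed.

(** The middle of the horizontal edge that carries crossing [i]; [phi i] is its angle, reduced by
    the full turns of its strand. *)
Definition hop (i : nat) : R := IZR (2 * idx n (over_at i) i + 1) + 1/2.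
Definition phi (i : nat) : R := thu (hop i) - IZR (over_at i).

Lemma hopE i : hop i = IZR (2 * idx n (over_at i) i) + 3/2.
Proof. by rewrite /hop plus_IZR; lra. Qed.

Lemma phi_bounds i : (i < k + 5)%N -> 1/2 < phi i < 1.
Proof.
move=> Hi; have Ho := over_at_range i; have [E1 E2 _] := lap_angles Ho.
have [L1 _] := idx_bounds Ho (ltnW Hi); have [_ L2] := idx_bounds Ho (Hi : (i.+1 <= k + 5)%N).
rewrite (idx_step Ho Hi) Z.eqb_refl in L2.
have /IZR_le K1 : (2 * idx n (over_at i) 0 <= 2 * idx n (over_at i) i)%Z by lia.
have /IZR_le K2 : (2 * idx n (over_at i) i + 2 <= 2 * idx n (over_at i) (k + 5))%Z by lia.
rewrite plus_IZR in K2; rewrite /phi hopE; split.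
  have := @incr (IZR (2 * idx n (over_at i) 0) - 1/2) (IZR (2 * idx n (over_at i) i) + 3/2) ltac:(lra).
  by rewrite E1; lra.
have := @incr (IZR (2 * idx n (over_at i) i) + 3/2) (IZR (2 * idx n (over_at i) (k + 5)) + 3/2) ltac:(lra).
by rewrite E2; lra.
Qed.

Lemma hop_polar i : (i < k + 5)%N ->
  pu (hop i) * si (phi i) = - (C + 1/8) / 2 /\
  Rabs (pu (hop i) * co (phi i) - (IZR (Z.of_nat (3 + i)) - b0)) <= 1/16.
Proof.
move=> Hi; set j := (2 * idx n (over_at i) i + 1)%Z.
have O : Z.odd j := odd2 _.
have Hu : IZR j + 1/4 <= hop i <= IZR j + 3/4 by rewrite /hop -/j; lra.
have V1 : vsign CA CB (hop i) = 1.
  rewrite (@vsign_near CA CB j); last by apply: Rabs_le; lra.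
  by rewrite -(hop_dir Hi) (bp_up bp O (hop_dir Hi)); ring.
have [Ec Es] := co_si_shift (phi i) (over_at i).
have Ep : phi i + IZR (over_at i) = thu (hop i) by rewrite /phi; ring.
rewrite Ep in Ec Es; rewrite -Ec -Es -(polQ cp bf) -(polB cp bf) (Q_up bf V1) (fy_hori O Hu).
split; first by field.
have := rf_flatB (bf_front bf) O Hu; rewrite /j (hop_row Hi).
by have -> // : B (hop i) - b0 - (IZR (Z.of_nat (3 + i)) - b0) = B (hop i) - IZR (Z.of_nat (3 + i)) by ring.
Qed.

(** All hops have the same, least slope, while b grows by about 1 from each row to the next. Along a
    horizontal line below the origin the angle increases with the abscissa; the sign is that of a
    cross product. *)
Lemma phi_incr i : (i.+1 < k + 5)%N -> phi i < phi i.+1.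
Proof.
move=> Hi; have [S1 /Rabs_le_between B1] := hop_polar (ltnW Hi); have [S2 /Rabs_le_between B2] := hop_polar Hi.
have b1 := phi_bounds (ltnW Hi); have b2 := phi_bounds Hi.
apply: Rnot_le_lt => L.
have p1 := pu_gt0 bf (hop i); have p2 := pu_gt0 bf (hop i.+1); have HC := bf_C bf.
have : 0 <= sin (2 * PI * phi i - 2 * PI * phi i.+1).
  by have := PI_RGT_0 => PI0; apply: sin_ge_0; nra.
rewrite sin_minus -/(si (phi i)) -/(co (phi i)) -/(si (phi i.+1)) -/(co (phi i.+1)).
move: S1 S2 B1 B2; rewrite addnS Nat2Z.inj_succ succ_IZR.
set s := si (phi i); set c := co (phi i); set s' := si _; set c' := co _.
set x := pu (hop i) in p1 *; set y := pu (hop i.+1) in p2 *.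
move=> S1 S2 B1 B2 K.
have : 0 <= (x * s) * (y * c') - (x * c) * (y * s').
  by have := Rmult_lt_0_compat _ _ p1 p2; nra.
rewrite S1 S2; nra.
Qed.

Definition kx (i : nat) : R := if i is j.+1 then (if (j < k + 5)%N then phi j else 3/2) else 1/2.

Lemma kx_incr i : (i < k + 6)%N -> kx i < kx i.+1.
Proof.
case: i => [|i] Hi /=.
  by have := @phi_bounds 0 ltac:(lia); rewrite ifT; [lra|lia].
rewrite ifT; last by lia.
case: ltnP => H; first exact: phi_incr.
by have := @phi_bounds i ltac:(lia); lra.
Qed.

Lemma kx_last : kx (k + 6) = kx 0 + 1.
Proof. by rewrite /kx addnS ltnn; lra. Qed.

Lemma kx_phi i : (i < k + 5)%N -> kx i.+1 = phi i.
Proof. by move=> Hi; rewrite /kx Hi. Qed.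

(** A strand passes to its next cell at its own hops and nowhere else during the ascent, in step
    with [idx]. *)
Lemma cell_low L i : (0 <= L < 3)%Z -> (i <= k + 5)%N -> thu (IZR (2 * idx n L i) - 1/2) <= kx i + IZR L.
Proof.
move=> HL; elim: i => [|i IH] Hi; first by have [-> _ _] := lap_angles HL; rewrite /kx; lra.
rewrite (idx_step HL Hi) (kx_phi Hi); case: Z.eqb_spec => [E|_]; last first.
  rewrite Z.add_0_r; have := IH (ltnW Hi); have := @kx_incr i ltac:(lia).
  by rewrite kx_phi //; lra.
right; rewrite /phi hopE E.
have -> : IZR (2 * (idx n L i + 1)) - 1/2 = IZR (2 * idx n L i) + 3/2.
  by rewrite !mult_IZR plus_IZR; lra.
ring.
Qed.

Lemma cell_high L i : (0 <= L < 3)%Z -> (i <= k + 5)%N ->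
  (if (i < k + 5)%N then phi i else 1) + IZR L <= thu (IZR (2 * idx n L i) + 3/2).
Proof.
move=> HL; have [d Ed] : exists d, d = (k + 5 - i)%N by exists (k + 5 - i)%N.
elim: d i Ed => [|d IH] i Ed Hi.
  have -> : i = (k + 5)%N by lia.
  by rewrite ltnn; have [_ -> _] := lap_angles HL; lra.
have Hi' : (i < k + 5)%N by lia.
rewrite Hi'; have := IH i.+1 ltac:(lia) Hi'; rewrite (idx_step HL Hi').
case: Z.eqb_spec => [E _|_]; first by right; rewrite /phi hopE E; ring.
rewrite Z.add_0_r; case: ltnP => H; first by have := phi_incr H; lra.
by have := phi_bounds Hi'; lra.
Qed.

Lemma in_cell_of L i u : (0 <= L < 3)%Z -> (i <= k + 5)%N -> kx i <= thu u - IZR L ->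
  thu u - IZR L < (if (i < k + 5)%N then phi i else 1) -> in_cell (idx n L i) u.
Proof.
move=> HL Hi H1 H2; have L1 := cell_low HL Hi; have L2 := cell_high HL Hi; split.
  by apply: Rnot_lt_le => K; have := incr K; lra.
by apply: (thu_lt_inv cp bf); lra.
Qed.

Lemma in_cell_down L u : (0 <= L < 3)%Z -> 1 <= thu u - IZR L < 3/2 ->
  in_cell (idx n L (k + 5) + 1) u.
Proof.
move=> HL [H1 H2]; have [_ E2 E3] := lap_angles HL; split; last first.
  by apply: (thu_lt_inv cp bf); lra.
have -> : IZR (2 * (idx n L (k + 5) + 1)) - 1/2 = IZR (2 * idx n L (k + 5)) + 3/2.
  by rewrite !mult_IZR plus_IZR; lra.
by apply: Rnot_lt_le => K; have := incr K; lra.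
Qed.

Variables (r h : R -> R) (X : nat -> R).
Hypotheses (Sr : smooth r) (Sh : smooth h).
Hypotheses (Pr : forall u, r (u + IZR 3) = r u) (Ph : forall u, h (u + IZR 3) = h u).
Hypothesis r_gt0 : forall u, 0 < r u.
Hypothesis rform : forall u, 0 < Derive h u + 2 * PI * (r u * r u).
Hypothesis remb : forall u n, r u = r (u + IZR n) -> h u = h (u + IZR n) -> exists k, (n = k * 3)%Z.
Hypothesis so : strand_order k r h X.

Let psi := circle_interp (k + 6) kx X.

Let psi_shift x : psi (x + 1) = psi x + 1.
Proof. exact: (circle_interp_shift X kx_last). Qed.

Let psi_shiftZ x z : psi (x + IZR z) = psi x + IZR z.
Proof. by rewrite (windZ (m := 1)) ?Z.mul_1_r. Qed.

Let psi_knot i : (i < k + 6)%N -> psi (kx i) = X i.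
Proof. by move=> Hi; exact: (circle_interp_knot X kx_incr kx_last). Qed.

Let psi_between i x : (i < k + 6)%N -> kx i < x < kx i.+1 -> X i < psi x < X i.+1.
Proof. exact: (circle_interp_between kx_incr (so_incr so) kx_last). Qed.

Let X_le i j : (i <= j)%N -> (j <= k + 6)%N -> X i <= X j.
Proof.
move=> ij; elim: j ij => [|j IH]; first by rewrite leqn0 => /eqP -> _; lra.
rewrite leq_eqVlt ltnS => /orP[/eqP -> _|ij jM]; first lra.
by have := IH ij (ltnW jM); have := so_incr so jM; lra.
Qed.

Let gap x : 1/2 <= x < 3/2 -> exists i, [/\ (i <= k + 5)%N, kx i <= x < kx i.+1 & X i <= psi x < X i.+1].
Proof.
move=> Hx; have [||i [Hi K]] := @nat_locate_closed kx (k + 6) x.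
- by rewrite /kx; lra.
- by rewrite kx_last /kx; lra.
exists i; split=> //; first by lia.
case: (Req_dec x (kx i)) => [->|N]; first by rewrite psi_knot //; have := so_incr so Hi; lra.
by have := @psi_between i x Hi ltac:(lra); lra.
Qed.

(** The common angle is brought into [1/2, 3/2), where the knots lie, and the strands are labelled
    modulo 3. *)
Let pairP t u z : th u = th t + IZR z -> ~ (exists i, (z = i * 3)%Z) ->
  exists x L L' q q', [/\ 1/2 <= x < 3/2, (0 <= L < 3)%Z, (0 <= L' < 3)%Z, L <> L' &
    th t = x + IZR L + IZR (q * 3) /\ th u = x + IZR L' + IZR (q' * 3)].
Proof.
move=> E N; pose f := Int_part (th t - 1/2); have Hf := base_Int_part (th t - 1/2); rewrite -/f in Hf.
exists (th t - IZR f), (f mod 3)%Z, ((f + z) mod 3)%Z, (f / 3)%Z, ((f + z) / 3)%Z.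
have D1 := Z.div_mod f 3 ltac:(lia); have D2 := Z.div_mod (f + z) 3 ltac:(lia).
split; [lra|exact: Z.mod_pos_bound|exact: Z.mod_pos_bound| |].
  by move=> E'; apply: N; exists ((f + z) / 3 - f / 3)%Z; lia.
split.
  by rewrite Rplus_assoc -plus_IZR (_ : (_ + _ = f)%Z); [ring|lia].
by rewrite Rplus_assoc -plus_IZR (_ : (_ + _ = f + z)%Z); [rewrite E plus_IZR; ring|lia].
Qed.

Let per3 (f : R -> R) (Pf : forall u, f (u + IZR 3) = f u) x L q :
  f (psi (x + IZR L + IZR (q * 3))) = f (psi x + IZR L).
Proof. by rewrite !psi_shiftZ; exact: (periodic_mult _ q Pf). Qed.

Let W3 t : th (t + 1) = th t + IZR 3. Proof. by rewrite (bf_wind bf) wind3. Qed.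

(** The radii of the word agree only at crossings. There the angle is that of a hop, and
    [hop_outermost] puts the over strand outside. *)
Let over t u z : th u = th t + IZR z -> ~ (exists i, (z = i * 3)%Z) ->
  r (psi (th t)) = r (psi (th u)) -> 0 < (p t - p u) * (h (psi (th t)) - h (psi (th u))).
Proof.
have main t' u' x L L' q q' : 1/2 <= x < 3/2 -> (0 <= L < 3)%Z -> (0 <= L' < 3)%Z -> L <> L' ->
    th t' = x + IZR L + IZR (q * 3) -> th u' = x + IZR L' + IZR (q' * 3) ->
    forall i, (i < k + 5)%N -> psi x = X i.+1 -> L = over_at i ->
    r (psi x + IZR L) = r (psi x + IZR L') ->
    p u' < p t' /\ h (psi (th u')) < h (psi (th t')).
  move=> Hx HL HL' N Et Eu i Hi Ei Lo Er; split; last first.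
    rewrite Et Eu !(per3 Ph) Ei Lo; apply: (so_over so) => //; first by rewrite -Lo => E; apply: N.
    by rewrite -Ei -Lo.
  (* Gaps between knots go into gaps, so that only the knot itself is sent to [X i.+1]. *)
  have Ex : x = phi i.
    have [j [Hj Kj Xj]] := gap Hx; rewrite Ei in Xj.
    have Ej : j = i.+1.
      apply/eqP; rewrite eqn_leq; apply/andP; split; rewrite leqNgt; apply/negP => H.
        have := @X_le i.+2 j H ltac:(lia); have := @so_incr _ _ _ _ so i.+1 ltac:(lia); lra.
      by have := @X_le j.+1 i.+1 H ltac:(lia); lra.
    rewrite Ej (kx_phi Hi) in Kj; case: (Req_dec x (phi i)) => // Nx.
    have := @psi_between i.+1 x ltac:(lia); rewrite (kx_phi Hi) => /(_ ltac:(lra)); lra.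
  have Eh : thu (hop i) = th t' - IZR (q * 3) by rewrite Et Ex /phi Lo; ring.
  have Et' : p t' = pu (hop i).
    have Ew : th (t' - IZR q) = th (hop i / pr P).
      have := windZ W3 (t' - IZR q) q; have -> : t' - IZR q + IZR q = t' by ring.
      by move=> K; have := Eh; rewrite /Submission.thu; lra.
    rewrite /Submission.pu -(turning_inj (bf_th bf) (bf_turn bf) Ew).
    by have := periodicZ (bf_perp bf) (t' - IZR q) q; have -> : t' - IZR q + IZR q = t' by ring.
  have Eu' : p u' = pu (pr P * u').
    by rewrite /Submission.pu; congr p; field; have := pr_gt0 cp; lra.
  rewrite Et' Eu'; apply: (hop_outermost cp bp bf (odd2 _) (erefl (hop i)) (hop_dir Hi) (n := (L' - L + 3 * q')%Z)).
    have -> : thu (pr P * u') = th u' by rewrite /Submission.thu; congr th; field; have := pr_gt0 cp; lra.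
    by rewrite Eh Et Eu plus_IZR minus_IZR !mult_IZR; ring.
  by rewrite wind3 => -[z0 Ez]; apply: N; lia.
move=> E N; have [x [L [L' [q [q' [Hx HL HL' LL [Et Eu]]]]]]] := pairP E N.
have := Et; have := Eu => Eu' Et' Er.
have {}Er : r (psi x + IZR L) = r (psi x + IZR L') by rewrite Et Eu !(per3 Pr) in Er.
have [j [Hj Kj Xj]] := gap Hx.
have HX : X 0%N <= psi x <= X 0%N + 1.
  have := @X_le 0 j (leq0n _) ltac:(lia); have := @X_le j.+1 (k + 6) ltac:(lia) (leqnn _).
  by rewrite (so_last so); lra.
have [i [Hi Ei [Lo|Lo]]] := so_meet so HX HL HL' LL Er.
  by have [] := main t u x L L' q q' Hx HL HL' LL Et Eu i Hi Ei Lo Er; nra.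
have [] := main u t x L' L q' q Hx HL' HL (fun e => LL (esym e)) Eu Et i Hi Ei Lo (esym Er).
by nra.
Qed.

Lemma sorted3 (f : Z -> R) (g : Z -> Z) a b c L L' : distinct3 a b c ->
  f a <= f b <= f c -> (g a < g b < g c)%Z -> (0 <= L < 3)%Z -> (0 <= L' < 3)%Z -> L <> L' -> f L <> f L' ->
  0 < (f L - f L') * (IZR (g L) - IZR (g L')).
Proof.
move=> [Ha Hb Hc [ab ac bc]] [F1 F2] [/IZR_lt G1 /IZR_lt G2] HL HL' LL N.
have [E|[E|E]] : L = a \/ L = b \/ L = c by lia.
all: have [E'|[E'|E']] : L' = a \/ L' = b \/ L' = c by lia.
all: try (exfalso; lia).
all: rewrite E E' in N *.
all: first [have K1 : f a < f b by [lra]|have K1 : f b < f c by [lra]|have K1 : f a < f c by [lra]].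
all: nra.
Qed.

Lemma order_at_distinct i : let: (a, b, c) := order_at k i in distinct3 a b c.
Proof. by rewrite /order_at; do ! case: ifP => _; split=> //; split. Qed.

(** At equal radii [column_order] expresses the heights by columns, [so_sort] gives the order of the
    radii of the word, and [col_sort] matches the two. The reversal of signs comes from the term - a
    in the height. *)
Let sorted t u z : th u = th t + IZR z -> ~ (exists i, (z = i * 3)%Z) ->
  p t = p u -> (r (psi (th t)) - r (psi (th u))) * (hT t - hT u) < 0.
Proof.
move=> E N Ep; have [x [L [L' [q [q' [Hx HL HL' LL [Et Eu]]]]]]] := pairP E N.
have Nr : r (psi (th t)) <> r (psi (th u)) by move=> Er; have := over E N Er; rewrite Ep; lra.
have prj s : thu (pr P * s) = th s.
  by rewrite /Submission.thu; congr th; field; have := pr_gt0 cp; lra.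
have [Ec Es] := co_si_shift (th t) z; rewrite -E in Ec Es.
have EB : B (pr P * t) = B (pr P * u).
  by have := bf_polB bf t; have := bf_polB bf u; rewrite Ec Ep; lra.
have EQ : Q (pr P * t) = Q (pr P * u).
  by have := bf_polQ bf t; have := bf_polQ bf u; rewrite Es Ep; lra.
have Eh : hT t - hT u = - (fa (pr P * t) - fa (pr P * u)).
  by rewrite !(bf_height bf) EB EQ; ring.
pose t1 := pr P * t - IZR (q * P); pose u1 := pr P * u - IZR (q' * P).
have back s i : pr P * s = (pr P * s - IZR (i * P)) + IZR (i * P) by ring.
have perA s i : fa (pr P * s) = fa (pr P * s - IZR (i * P)).
  by rewrite [in LHS](back s i); exact: (periodic_mult _ i (rf_perA (bf_front bf))).
have perB s i : B (pr P * s) = B (pr P * s - IZR (i * P)).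
  by rewrite [in LHS](back s i); exact: (periodic_mult _ i (rf_perB (bf_front bf))).
have Qper s : Q (s + IZR P) = Q s by rewrite !(bf_Q bf) (slope_periodic cp).
have perQ s i : Q (pr P * s) = Q (pr P * s - IZR (i * P)).
  by rewrite [in LHS](back s i); exact: (periodic_mult _ i Qper).
have T1 : thu t1 = x + IZR L.
  have := thu_period cp bf t1 q; rewrite /t1 -back prj Et wind3; lra.
have U1 : thu u1 = x + IZR L'.
  have := thu_period cp bf u1 q'; rewrite /u1 -back prj Eu wind3; lra.
have TU : thu u1 = thu t1 + IZR (L' - L) by rewrite T1 U1 minus_IZR; ring.
have Nz : ~ (exists i, (L' - L = i * m)%Z) by rewrite wind3 => -[i Hi]; lia.
have CO i i' : in_cell i t1 -> in_cell i' u1 ->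
    0 < (fa (pr P * t) - fa (pr P * u)) * (IZR (CA (2 * i)%Z) - IZR (CA (2 * i')%Z)).
  move=> C1 C2; rewrite (perA t q) (perA u q').
  apply: (column_order cp bp bf TU Nz _ _ C1 C2); first by rewrite -perB -perB.
  by rewrite -perQ -perQ.
have {Nr} Nr : r (psi x + IZR L) <> r (psi x + IZR L') by move: Nr; rewrite Et Eu !(per3 Pr).
suff key : exists g : Z -> Z, [/\ in_cell (g L) t1, in_cell (g L') u1 &
    0 < (r (psi x + IZR L) - r (psi x + IZR L')) * (IZR (CA (2 * g L)) - IZR (CA (2 * g L')))].
  have [g [C1 C2 K]] := key; have := CO _ _ C1 C2; move: K.
  rewrite Et Eu !(per3 Pr) Eh; set a := r _ - r _; set b := fa _ - fa _; set c := IZR _ - IZR _.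
  move=> K1 K2; have : 0 < (a * c) * (b * c) by apply: Rmult_lt_0_compat.
  have -> : (a * c) * (b * c) = (a * b) * (c * c) by ring.
  have : 0 <= c * c by apply: Rle_0_sqr.
  by nra.
have [i [Hi Ki Xi]] := gap Hx.
have so_i := so_sort so Hi (x := psi x) ltac:(lra); have cs := col_sort Hi; have dd := order_at_distinct i.
case: (Rlt_le_dec x 1) => x1.
  have hi : x < (if (i < k + 5)%N then phi i else 1).
    by case: ltnP => H //; rewrite (kx_phi H) in Ki; lra.
  exists (fun L => idx n L i); split.
  - by apply: in_cell_of => //; rewrite T1; lra.
  - by apply: in_cell_of => //; rewrite U1; lra.
  move: so_i cs dd; case: (order_at k i) => [[a b] c] so_i cs dd.
  exact: (@sorted3 (fun L => r (psi x + IZR L)) (fun L => CA (2 * idx n L i)) a b c).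
(* From angle 1 on the strands descend, in the order reached after the last crossing. *)
exists (fun L => idx n L (k + 5) + 1)%Z; split.
- by apply: in_cell_down => //; rewrite T1; lra.
- by apply: in_cell_down => //; rewrite U1; lra.
have Ei : i = (k + 5)%N.
  apply/eqP; rewrite eqn_leq Hi leqNgt; apply/negP => H.
  by rewrite (kx_phi H) in Ki; have := phi_bounds H; lra.
move: so_i; rewrite Ei /order_at ifF ?eqxx; last by lia.
move=> so_i.
apply: (@sorted3 (fun L => r (psi x + IZR L)) (fun L => CA (2 * (idx n L (k + 5) + 1))) 0 1 2) => //.
Qed.

Lemma compare_isotopy : transverse_isotopic (bc p hT th)
  (bc (fun t => r (3 * t)) (fun t => h (3 * t)) (fun t => 3 * t)).
Proof.
have Spsi : smooth psi.
  exact: (smooth_circle_interp kx_incr kx_last (so_last so)).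
apply: (@thin_isotopy r h Sr Sh Pr Ph r_gt0 rform remb p hT th psi) => //.
case: (bf) => *; split=> //.
move=> t u z E Ep Eh; apply: Classical_Prop.NNPP => N.
by have := sorted E N Ep; rewrite Eh; lra.
Qed.

End Compare.

(** * The Legendrian front of a grid diagram *)

Section GridPath.
Variables (N : nat) (G : grid N) (a0 : 'I_N).
Hypothesis knot : is_knot_grid G.

Let NZ : Z := Z.of_nat N.
Definition period : Z := (2 * Z.of_nat N)%Z.

Lemma N_gt0 : (0 < N)%N.
Proof. exact: leq_ltn_trans (leq0n a0) (ltn_ord a0). Qed.

Lemma NZ_gt0 : (0 < Z.of_nat N)%Z.
Proof. by have /ltP := N_gt0; lia. Qed.

Definition col (i : Z) : 'I_N := iter (Z.to_nat (i mod Z.of_nat N)) (next_col G) a0.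
Definition cornerA (j : Z) : Z := Z.of_nat (col (j / 2)).
Definition cornerB (j : Z) : Z :=
  Z.of_nat (if Z.even j then gridX G (col (j / 2)) else gridO G (col (j / 2))).

Lemma next_col_inj : injective (next_col G).
Proof. by move=> x y /perm_inj /perm_inj. Qed.

Lemma order_next_col : fingraph.order (next_col G) a0 = N.
Proof.
rewrite /fingraph.order -[RHS]card_ord; apply: eq_card => b.
have [k ->] := knot a0 b; rewrite !inE; exact: fconnect_iter.
Qed.

Lemma iter_next_col_N : iter N (next_col G) a0 = a0.
Proof. by have := iter_order next_col_inj a0; rewrite order_next_col. Qed.

Lemma col_period i : col (i + Z.of_nat N) = col i.
Proof.
have NZ0 := NZ_gt0; rewrite /col.
have -> : (i + Z.of_nat N = i + 1 * Z.of_nat N)%Z by lia.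
by rewrite Z_mod_plus_full.
Qed.

Lemma col_succ i : col (i + 1) = next_col G (col i).
Proof.
have NZ0 := NZ_gt0; rewrite /col -iterS.
have B := Z.mod_pos_bound i (Z.of_nat N) NZ0.
have E := Z.div_mod i (Z.of_nat N) ltac:(lia).
case: (Z.eq_dec (i mod Z.of_nat N + 1)%Z (Z.of_nat N)) => H.
  have -> : ((i + 1) mod Z.of_nat N = 0)%Z.
    symmetry; apply: (Z.mod_unique _ _ (i / Z.of_nat N + 1)); [left; lia | nia].
  have -> : (Z.to_nat (i mod Z.of_nat N)).+1 = N by lia.
  by rewrite iter_next_col_N.
have -> : ((i + 1) mod Z.of_nat N = i mod Z.of_nat N + 1)%Z.
  symmetry; apply: (Z.mod_unique _ _ (i / Z.of_nat N)); [left; lia | nia].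
by congr iter; lia.
Qed.

Lemma col_inj i j : col i = col j -> exists n, (j = i + n * Z.of_nat N)%Z.
Proof.
have NZ0 := NZ_gt0; rewrite /col => E.
have Bi := Z.mod_pos_bound i (Z.of_nat N) NZ0.
have Bj := Z.mod_pos_bound j (Z.of_nat N) NZ0.
have Fi : findex (next_col G) a0 (iter (Z.to_nat (i mod Z.of_nat N)) (next_col G) a0) =
          Z.to_nat (i mod Z.of_nat N).
  by apply: findex_iter; rewrite order_next_col; apply/ltP; lia.
have Fj : findex (next_col G) a0 (iter (Z.to_nat (j mod Z.of_nat N)) (next_col G) a0) =
          Z.to_nat (j mod Z.of_nat N).
  by apply: findex_iter; rewrite order_next_col; apply/ltP; lia.
have {Fi Fj} M : (i mod Z.of_nat N = j mod Z.of_nat N)%Z.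
  by move: Fj; rewrite -E Fi; lia.
have Ei := Z.div_mod i (Z.of_nat N) ltac:(lia).
have Ej := Z.div_mod j (Z.of_nat N) ltac:(lia).
by exists (j / Z.of_nat N - i / Z.of_nat N)%Z; nia.
Qed.

Lemma half_even j : Z.even j -> ((j + 1) / 2 = j / 2)%Z.
Proof.
move/Z.even_spec => -[i ->]; rewrite Z.mul_comm Z.div_mul //.
by symmetry; apply: (Z.div_unique _ _ _ 1); [left; lia | lia].
Qed.

Lemma half_odd j : Z.odd j -> ((j + 1) / 2 = j / 2 + 1)%Z.
Proof.
move/Z.odd_spec => -[i ->].
have -> : (2 * i + 1 + 1 = (i + 1) * 2)%Z by lia.
rewrite Z.div_mul //; suff -> : ((2 * i + 1) / 2 = i)%Z by lia.
by symmetry; apply: (Z.div_unique _ _ _ 1); [left; lia | lia].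
Qed.

Lemma period_gt0 : (0 < period)%Z.
Proof. by have := NZ_gt0; rewrite /period; lia. Qed.

Lemma period_even : Z.even period.
Proof. by rewrite /period Z.even_mul. Qed.

Lemma half_period j : ((j + period) / 2 = j / 2 + Z.of_nat N)%Z.
Proof. by rewrite /period Z.mul_comm Z.div_add. Qed.

Lemma cornerA_period j : cornerA (j + period) = cornerA j.
Proof. by rewrite /cornerA half_period col_period. Qed.

Lemma cornerB_period j : cornerB (j + period) = cornerB j.
Proof. by rewrite /cornerB half_period col_period Z.even_add period_even; case: (Z.even j). Qed.

Lemma ord_Z_inj (i j : 'I_N) : Z.of_nat i = Z.of_nat j -> i = j.
Proof. by move/Nat2Z.inj/val_inj. Qed.

Lemma cornerA_vert j : Z.even j -> cornerA (j + 1) = cornerA j.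
Proof. by move=> E; rewrite /cornerA half_even. Qed.

Lemma cornerB_vert j : Z.even j -> cornerB (j + 1) <> cornerB j.
Proof.
move=> E; rewrite /cornerB half_even // even_succ E /= => /ord_Z_inj H.
by have := gridOX G (col (j / 2)); rewrite H eqxx.
Qed.

Lemma next_colX a : gridX G (next_col G a) = gridO G a.
Proof. by rewrite /next_col permKV. Qed.

Lemma cornerB_hori j : Z.odd j -> cornerB (j + 1) = cornerB j.
Proof.
move=> O; have E : Z.even j = false by move: O; rewrite Zeven_odd; case: (Z.even j).
by rewrite /cornerB half_odd // even_succ E /= col_succ next_colX.
Qed.

Lemma cornerA_hori j : Z.odd j -> cornerA (j + 1) <> cornerA j.
Proof.
move=> O; rewrite /cornerA half_odd // col_succ => /ord_Z_inj H.
by have := gridOX G (col (j / 2)); rewrite -next_colX H eqxx.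
Qed.

Lemma period_half (i j n : Z) : Z.even i = Z.even j ->
  (j / 2 = i / 2 + n * Z.of_nat N)%Z -> (j = i + n * period)%Z.
Proof.
rewrite /period => E H.
have Ei := Z.div_mod i 2 ltac:(lia); have Ej := Z.div_mod j 2 ltac:(lia).
rewrite !Zmod_even E in Ei; rewrite Zmod_even in Ej.
by case: (Z.even j) Ei Ej; nia.
Qed.

Lemma cornerA_inj i j : Z.even i -> Z.even j -> cornerA i = cornerA j ->
  exists n, (j = i + n * period)%Z.
Proof.
move=> Ei Ej /ord_Z_inj /col_inj [n Hn]; exists n.
by apply: period_half => //; rewrite Ei Ej.
Qed.

Lemma cornerB_inj i j : Z.odd i -> Z.odd j -> cornerB i = cornerB j ->
  exists n, (j = i + n * period)%Z.
Proof.
rewrite !Zeven_odd /cornerB => /negbTE Ei /negbTE Ej.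
rewrite Ei Ej => /ord_Z_inj /perm_inj /col_inj [n Hn]; exists n.
by apply: period_half => //; rewrite Ei Ej.
Qed.

Lemma grid_path : closed_path period cornerA cornerB.
Proof.
by split; first [exact: cornerA_period | exact: cornerB_period
  | exact: cornerA_vert | exact: cornerB_vert | exact: cornerA_hori | exact: cornerB_hori
  | exact: cornerA_inj | exact: cornerB_inj | exact: period_gt0 | exact: period_even].
Qed.

Let grid_rect := rect_front_flat grid_path.

Definition ga : R -> R := fa cornerA cornerB.
Definition gb : R -> R := fb cornerA cornerB.
Definition gX : R -> R := fX cornerA cornerB.
Definition gdir : Z -> R := dir cornerA cornerB.

Definition PR : R := IZR period.

Lemma PR_gt0 : 0 < PR.
Proof. by apply: IZR_lt; apply: period_gt0. Qed.

Lemma scaled_derive (f : R -> R) (df : R -> R) t : (forall u, is_derive f u (df u)) ->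
  is_derive (fun t => f (PR * t)) t (PR * df (PR * t)).
Proof.
move=> D; apply: (is_derive_ext (fun t => f (PR * t + 0))) => [x|].
  by rewrite Rplus_0_r.
by apply: is_derive_affine; rewrite Rplus_0_r.
Qed.

Lemma smooth_scaled f : smooth f -> smooth (fun t => f (PR * t)).
Proof. by move=> F; apply: (smooth_comp F); smo. Qed.

Definition front_curve : curve :=
  Curve (fun t => ga (PR * t) + gb (PR * t)) (fun t => fy (PR * t))
        (fun t => gb (PR * t) - ga (PR * t)).

Lemma is_derive_ga u : is_derive ga u (gX u * hweight u).
Proof. exact: (is_derive_fa grid_path). Qed.

Lemma is_derive_gb u : is_derive gb u (gX u * (1 - hweight u)).
Proof. exact: (is_derive_fb grid_path). Qed.

Lemma is_derive_plusR (f g : R -> R) t l m :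
  is_derive f t l -> is_derive g t m -> is_derive (fun t => f t + g t) t (l + m).
Proof. by move=> F K; apply: (is_derive_plus _ _ _ _ _ F K). Qed.

Lemma is_derive_minusR (f g : R -> R) t l m :
  is_derive f t l -> is_derive g t m -> is_derive (fun t => f t - g t) t (l - m).
Proof. by move=> F K; apply: (is_derive_minus _ _ _ _ _ F K). Qed.

Lemma Derive_front_x t : Derive (cx front_curve) t = PR * gX (PR * t).
Proof.
apply: is_derive_unique => /=.
have Da := scaled_derive t is_derive_ga; have Db := scaled_derive t is_derive_gb.
by apply: (is_derive_eq (is_derive_plusR Da Db)); ring.
Qed.

Lemma Derive_front_z t : Derive (cz front_curve) t = PR * (gX (PR * t) * fy (PR * t)).
Proof.
apply: is_derive_unique => /=.
have Da := scaled_derive t is_derive_ga; have Db := scaled_derive t is_derive_gb.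
by apply: (is_derive_eq (is_derive_minusR Db Da)); rewrite /fy; ring.
Qed.

Lemma ga_periodic u : ga (u + PR) = ga u.
Proof. exact: (fa_periodic grid_path). Qed.

Lemma gb_periodic u : gb (u + PR) = gb u.
Proof. exact: (fb_periodic grid_path). Qed.

Lemma fy_periodic u : fy (u + PR) = fy u.
Proof. by rewrite /fy (hweight_periodic grid_path). Qed.

Lemma fy_flat j u : IZR j + 1/4 <= u <= IZR j + 3/4 -> fy u = if Z.even j then 1 else -1.
Proof. by move=> H; rewrite /fy (hweight_flat H) Zeven_odd; case: (Z.even j) => /=; ring. Qed.

Lemma is_derive_fy_corner j u : Rabs (u - IZR j) < 3/4 ->
  is_derive fy u (if Z.even j then 2 * dstep (u - IZR j) else -2 * dstep (u - IZR j)).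
Proof.
move=> H.
have D := @is_derive_interp (fun j => if Z.odd j then 1 else 0) u j H.
have K := is_derive_lin 1 (-2) D.
have {}K : is_derive fy u (-2 * (((if Z.odd j then 1 else 0) -
    (if Z.odd (j - 1) then 1 else 0)) * dstep (u - IZR j))).
  by apply: is_derive_ext K => x; rewrite /fy /hweight /moving /=; lra.
apply: (is_derive_eq K).
have -> : Z.odd (j - 1) = Z.even j by rewrite Zeven_odd even_pred negbK.
by rewrite Zeven_odd; case: (Z.even j) => /=; lra.
Qed.

Lemma fy_cusp j : Derive fy (IZR j) <> 0.
Proof.
have H : Rabs (IZR j - IZR j) < 3/4 by rewrite Rminus_diag Rabs_R0; lra.
rewrite (is_derive_unique _ _ _ (is_derive_fy_corner H)) Rminus_diag.
by have := @dstep_gt0 0; case: (Z.even j); lra.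
Qed.

(** At a stationary point of x there is a cusp, where the slope has a nonzero derivative. At a
    double point of the front there is a crossing, where the slopes are 1 and -1. *)
Lemma legendrian_front : legendrian front_curve.
Proof.
have P0 := PR_gt0.
have Sa : smooth ga by apply: (smooth_fa grid_path).
have Sb : smooth gb by apply: (smooth_fb grid_path).
split; last first.
  by move=> t; rewrite /contact_form Derive_front_x Derive_front_z /=; ring.
split.
- split; last split; rewrite /=.
  + by apply: smooth_plus; apply: smooth_scaled.
  + by apply: smooth_scaled; apply: smooth_fy.
  + by apply: smooth_minus; apply: smooth_scaled.
- move=> t /=; have -> : PR * (t + 1) = PR * t + PR by ring.
  by rewrite ga_periodic gb_periodic fy_periodic.
- move=> t [X Y _]; rewrite Derive_front_x in X.
  have /(fX_eq0 grid_path) [j [E _]] : gX (PR * t) = 0 by apply: (Rmult_eq_reg_l PR); lra.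
  case: (@fy_cusp j); apply: (Rmult_eq_reg_l PR); last lra.
  rewrite Rmult_0_r -Y /=; symmetry; apply: is_derive_unique; rewrite -E.
  have D u : is_derive fy u (Derive fy u).
    by apply/Derive_correct/smooth_ex_derive/smooth_fy.
  exact: (scaled_derive t D).
- move=> t u Ht Hu /= X Y Z.
  have Ea : ga (PR * t) = ga (PR * u) by lra.
  have Eb : gb (PR * t) = gb (PR * u) by lra.
  case: (double_point grid_path grid_rect Ea Eb).
  + case=> n Hn; rewrite mult_IZR in Hn.
    have E : u = t + IZR n.
      by apply: (Rmult_eq_reg_l PR); [rewrite Hn /PR; ring | lra].
    suff n0 : n = 0%Z by rewrite E n0 Rplus_0_r.
    have : (-1 < n < 1)%Z by split; apply: lt_IZR; lra.
    lia.
  + move=> [i [j [Ei Oj Hi Hj _]]]; rewrite (fy_flat Hi) (fy_flat Hj) Ei in Y.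
    by rewrite Zeven_odd in Oj; rewrite (negbTE Oj) in Y; lra.
  + move=> [i [j [Ei Oj Hi Hj _]]]; rewrite (fy_flat Hi) (fy_flat Hj) Ei in Y.
    by rewrite Zeven_odd in Oj; rewrite (negbTE Oj) in Y; lra.
Qed.

Lemma cornerE (j : nat) : (j <= 2 * N)%N ->
  IZR (cornerA (Z.of_nat j)) = INR (corner G a0 j).1 /\
  IZR (cornerB (Z.of_nat j)) = INR (corner G a0 j).2.
Proof.
move=> jN; have NZ0 := NZ_gt0.
have H2 : (Z.of_nat j / 2 = Z.of_nat j./2)%Z.
  symmetry; apply: (Z.div_unique _ _ _ (Z.of_nat (odd j))).
    by left; case: (odd j) => /=; lia.
  by lia.
have E : Z.even (Z.of_nat j) = ~~ odd j.
  have {1}-> : Z.of_nat j = (2 * Z.of_nat j./2 + Z.of_nat (odd j))%Z by lia.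
  by rewrite Z.even_add Z.even_mul; case: (odd j).
have C : col (Z.of_nat j / 2) = iter j./2 (next_col G) a0.
  rewrite H2 /col; have [L|L] := ltnP j./2 N.
    by rewrite Z.mod_small ?Nat2Z.id //; move/ltP: L; lia.
  have -> : j./2 = N.
    apply/eqP; rewrite eqn_leq L andbT.
    by have := half_leq jN; rewrite mul2n doubleK.
  by rewrite Z_mod_same_full iter_next_col_N.
by rewrite /cornerA /cornerB E C !INR_IZR_INZ /corner; case: (odd j).
Qed.

Lemma PR_grid_time u : PR * grid_time N u = u.
Proof.
have := PR_gt0; rewrite /grid_time /PR /period mult_IZR -INR_IZR_INZ => H.
by field; lra.
Qed.

(** The northeast and southwest corners are those at which x = a + b has a local extremum. *)
Lemma cuspE (j : Z) : is_cusp G (Z.odd j) (col (j / 2)) <-> gdir (j - 1) <> gdir j.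
Proof.
rewrite /gdir /dir pred_succ /is_cusp.
have sgnP (m n : 'I_N) : m <> n ->
   IZR (Z.sgn (Z.of_nat n - Z.of_nat m)) = if (m < n)%N then 1 else -1.
  move=> mn; case: ltnP => [/ltP|/leP] H; first by rewrite Z.sgn_pos //; lia.
  rewrite Z.sgn_neg //; suff : nat_of_ord m <> n by lia.
  by move/val_inj.
have ltN (m n : 'I_N) : m <> n -> (n < m)%N = ~~ (m < n)%N.
  by move=> mn; rewrite -leqNgt ltn_neqAle; case: eqP => // /val_inj /esym.
set a := col (j / 2).
have OX b : gridO G b <> gridX G b by apply/eqP; apply: gridOX.
case E: (Z.even j).
  have O : Z.odd j = false by rewrite Zeven_odd E.
  have O1 : Z.odd (j - 1) by rewrite Zeven_odd even_pred E.
  have Ea : a = next_col G (col ((j - 1) / 2)).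
    by rewrite -col_succ -half_odd // pred_succ.
  set p := col ((j - 1) / 2) in Ea.
  have pa : p <> a by move=> H; case: (OX p); rewrite -next_colX -Ea -H.
  have Ep : (gridO G)^-1%g (gridX G a) = p by rewrite Ea next_colX permK.
  have -> : (cornerA j - cornerA (j - 1) + (cornerB j - cornerB (j - 1)) = Z.of_nat a - Z.of_nat p)%Z.
    have := cornerB_hori O1; rewrite pred_succ => ->.
    by rewrite /cornerA -/a -/p; lia.
  have -> : (cornerA (j + 1) - cornerA j + (cornerB (j + 1) - cornerB j) =
             Z.of_nat (gridO G a) - Z.of_nat (gridX G a))%Z.
    rewrite cornerA_vert // /cornerB half_even // even_succ E /= -/a; lia.
  rewrite O Ep !sgnP //; last by move/esym/OX.
  rewrite (ltN _ _ (fun H => OX a (esym H))).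
  by case: (p < a)%N; case: (gridX G a < gridO G a)%N; split => //=; lra.
have O : Z.odd j by rewrite Zeven_odd E.
have E1 : Z.even (j - 1) by rewrite even_pred E.
have Eh : ((j - 1) / 2 = j / 2)%Z by have := half_even E1; rewrite pred_succ.
set n := next_col G a.
have En : col ((j + 1) / 2) = n by rewrite half_odd // col_succ.
have na : a <> n by move=> H; case: (OX a); rewrite -next_colX -/n -H.
have En' : (gridX G)^-1%g (gridO G a) = n by [].
have -> : (cornerA j - cornerA (j - 1) + (cornerB j - cornerB (j - 1)) =
             Z.of_nat (gridO G a) - Z.of_nat (gridX G a))%Z.
  by rewrite /cornerA /cornerB Eh E E1 -/a; lia.
have -> : (cornerA (j + 1) - cornerA j + (cornerB (j + 1) - cornerB j) =
             Z.of_nat n - Z.of_nat a)%Z.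
  by rewrite cornerB_hori // /cornerA En -/a; lia.
rewrite O En' !sgnP //; last by move/esym/OX.
rewrite (ltN _ _ na) (ltN _ _ (OX a)) -(ltN _ _ (OX a)).
by case: (a < n)%N; case: (gridX G a < gridO G a)%N; split => //=; lra.
Qed.

Lemma front_abE u : front_a front_curve (grid_time N u) = ga u /\
  front_b front_curve (grid_time N u) = gb u.
Proof. by rewrite /front_a /front_b /= PR_grid_time; split; field. Qed.

Lemma Derive_front_ab u :
  Derive (front_a front_curve) (grid_time N u) = PR * (gX u * hweight u) /\
  Derive (front_b front_curve) (grid_time N u) = PR * (gX u * (1 - hweight u)).
Proof.
set t := grid_time N u; have Et : PR * t = u by apply: PR_grid_time.
have Da := scaled_derive t is_derive_ga; have Db := scaled_derive t is_derive_gb.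
rewrite Et in Da Db; split; apply: is_derive_unique.
  by apply: (is_derive_ext _ _ _ _ _ Da) => x; rewrite /front_a /=; field.
by apply: (is_derive_ext _ _ _ _ _ Db) => x; rewrite /front_b /=; field.
Qed.

Lemma legendrian_of_grid_front : legendrian_of_grid G front_curve.
Proof.
have P0 := PR_gt0; split; first exact: legendrian_front.
exists a0 => j jN; have s0 : 0 < slow by rewrite /slow; lra.
have [A0 B0] := @cornerE j (ltnW jN); have [A1 B1] := @cornerE j.+1 jN.
have Sj : Z.of_nat j.+1 = (Z.of_nat j + 1)%Z by lia.
rewrite Sj in A1 B1.
have IJ : INR j = IZR (Z.of_nat j) by rewrite INR_IZR_INZ.
have mm (s x y z : R) : (s = 1 \/ s = -1) -> 0 <= s * (z - x) -> 0 <= s * (y - z) ->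
    Rmin x y <= z <= Rmax x y.
  by case=> ->; rewrite /Rmin /Rmax; case: Rle_dec; lra.
have pm (s d X : R) : (s = 1 \/ s = -1) -> 1 <= s * d -> slow <= s * X -> 0 < PR * (d * X).
  move=> Hs H1 H2; apply: Rmult_lt_0_compat => //.
  by case: Hs H1 H2 => -> ? ?; nra.
split.
- rewrite /follows_edge -A0 -B0 -A1 -B1 => u; rewrite IJ => Hu.
  have [-> ->] := front_abE u; have [-> ->] := Derive_front_ab u.
  have S := dir1 grid_path (Z.of_nat j).
  have X := fX_flat grid_path Hu; rewrite -/(gX u) in X.
  case E: (Z.even (Z.of_nat j)).
    have -> : ga u = IZR (cornerA (Z.of_nat j)) := fa_flat grid_path E Hu.
    have [K1 K2] := fb_move grid_path E Hu.
    have D := dir_vert grid_path E.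
    rewrite (cornerA_vert E) (hweight_flat Hu) Zeven_odd E /=.
    split; first by rewrite Rmin_left ?Rmax_left; lra.
      exact: (mm _ _ _ _ S).
    by have := pm _ _ _ S D X; lra.
  have O : Z.odd (Z.of_nat j) by rewrite Zeven_odd E.
  have -> : gb u = IZR (cornerB (Z.of_nat j)) := fb_flat grid_path O Hu.
  have [K1 K2] := fa_move grid_path O Hu.
  have D := dir_hori grid_path O.
  rewrite (cornerB_hori O) (hweight_flat Hu) O /=.
  split; last by have := pm _ _ _ S D X; lra.
    exact: (mm _ _ _ _ S).
  by rewrite Rmin_left ?Rmax_left; lra.
- rewrite /rounds_corner -A0 -B0; split.
    move=> u; rewrite IJ => Hu; have [-> ->] := front_abE u.
    have A : Rabs (u - IZR (Z.of_nat j)) <= 1/4 by apply: Rabs_le; lra.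
    have [F1 F2] := fab_corner grid_path A; split; [rewrite /ga; lra|rewrite /gb; lra|].
    rewrite Derive_front_x PR_grid_time.
    have -> : is_cusp G (odd j) (corner G a0 j).1 <-> gdir (Z.of_nat j - 1) <> gdir (Z.of_nat j).
      rewrite -cuspE; have -> : Z.odd (Z.of_nat j) = odd j.
        have {1}-> : Z.of_nat j = (2 * Z.of_nat j./2 + Z.of_nat (odd j))%Z by lia.
        by rewrite Z.odd_add Z.odd_mul; case: (odd j).
      suff -> : col (Z.of_nat j / 2) = (corner G a0 j).1 by [].
      by apply: ord_Z_inj; apply: eq_IZR; rewrite -/(cornerA (Z.of_nat j)) A0 INR_IZR_INZ.
    split.
      move=> H; have X0 : gX u = 0 by apply: (Rmult_eq_reg_l PR); lra.
      have [i [Ei Hi]] := fX_eq0 grid_path X0.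
      suff Eij : i = Z.of_nat j by rewrite -Eij; split.
      have : (-1 < i - Z.of_nat j < 1)%Z by split; apply: lt_IZR; rewrite minus_IZR; lra.
      lia.
    by move=> [H ->]; rewrite /gX (fX_cusp grid_path) //; ring.
  move=> u v; rewrite IJ => Hu Hv; have [-> ->] := front_abE u; have [-> ->] := front_abE v.
  exact: (front_inj_window grid_rect Hu Hv).
Qed.
End GridPath.

(** Solving the coordinates of the curve for radius and height shows that these are smooth and have
    period 3, which the definition of a closure leaves implicit. *)
Lemma closure_data n K : braid_closure 3 (beta n) K -> exists r h X,
  [/\ smooth r /\ smooth h,
      (forall u, r (u + IZR 3) = r u) /\ (forall u, h (u + IZR 3) = h u),
      (forall u, 0 < r u) /\ (forall u, 0 < Derive h u + 2 * PI * (r u * r u)),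
      (forall u z, r u = r (u + IZR z) -> h u = h (u + IZR z) -> exists k, (z = k * 3)%Z)
    & strand_order (2 * n + 3) r h X /\
      K = bc (fun t => r (3 * t)) (fun t => h (3 * t)) (fun t => 3 * t)].
Proof.
move=> [TK [r [h [r0 HK word]]]].
have [[[Sx [Sy Sz]] Per _ _] Form] := TK.
have E3 : INR 3 = 3 by rewrite /=; ring.
have EK : K = bc (fun t => r (3 * t)) (fun t => h (3 * t)) (fun t => 3 * t).
  rewrite (curve_eta K) /bc; congr Curve; apply: functional_extensionality => t;
    by have [X Y Z] := HK t; rewrite E3 in X Y Z.
have X t : cx K t = r (3 * t) * co (3 * t) by rewrite EK.
have Y t : cy K t = 2 * (r (3 * t) * si (3 * t)) by rewrite EK.
have Z t : cz K t = h (3 * t) + r (3 * t) * co (3 * t) * (r (3 * t) * si (3 * t)) by rewrite EK.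
have third u : 3 * (/3 * u) = u by field.
have rE u : r u = cx K (/3 * u) * co u + cy K (/3 * u) / 2 * si u.
  rewrite X Y third; have C := co_si u.
  by transitivity (r u * (co u * co u + si u * si u)); [rewrite C|]; field.
have hE u : h u = cz K (/3 * u) - cx K (/3 * u) * (cy K (/3 * u) / 2).
  by rewrite X Y Z third; field.
have Pr u : r (u + IZR 3) = r u.
  rewrite !rE; have -> : /3 * (u + IZR 3) = /3 * u + 1 by field.
  by have [-> -> _] := Per (/3 * u); have [-> ->] := co_si_shift u 3.
have Ph u : h (u + IZR 3) = h u.
  rewrite !hE; have -> : /3 * (u + IZR 3) = /3 * u + 1 by field.
  by have [-> -> ->] := Per (/3 * u).
have Sthird f : smooth f -> smooth (fun u => f (/3 * u)) by move=> Sf; apply: (smooth_comp Sf); smo.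
have Sr : smooth r.
  have -> : r = fun u => cx K (/3 * u) * co u + cy K (/3 * u) * / 2 * si u.
    exact: functional_extensionality.
  apply: smooth_plus; apply: smooth_mult; [exact: Sthird|apply: smooth_co; smo| |apply: smooth_si; smo].
  by apply: smooth_mult; [exact: Sthird|smo].
have Sh : smooth h.
  have -> : h = fun u => cz K (/3 * u) - cx K (/3 * u) * (cy K (/3 * u) * / 2).
    exact: functional_extensionality.
  apply: smooth_minus; first exact: Sthird.
  by apply: smooth_mult; [exact: Sthird|apply: smooth_mult; [exact: Sthird|smo]].
have S3 : smooth (fun t => 3 * t) by smo.
have D3 t : is_derive (fun t => 3 * t) t 3.
  apply: (@is_derive_extR (fun t => 0 + 3 * t)) => [x|]; first ring.
  by apply: (is_derive_eq (is_derive_lin 0 3 (is_derive_id _))); rewrite /one /=; exact: Rmult_1_r.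
have F u : 0 < Derive h u + 2 * PI * (r u * r u).
  have := Form (/3 * u); rewrite /contact_form EK.
  have := cform_bc (/3 * u) (smooth_comp Sr S3) (smooth_comp Sh S3) S3; rewrite /cform => ->.
  rewrite (is_derive_unique _ _ _ (is_derive_compR Sh (D3 _))) (is_derive_unique _ _ _ (D3 _)) third; lra.
have E u z : r u = r (u + IZR z) -> h u = h (u + IZR z) -> exists k, (z = k * 3)%Z.
  move=> Er Eh; have [Ec Es] := co_si_shift u z.
  have := transverse_embedded TK (t := /3 * u) (u := /3 * (u + IZR z)).
  rewrite !X !Y !Z !third Ec Es -Er -Eh => /(_ erefl erefl erefl) [k Hk].
  by exists k; apply: eq_IZR; rewrite mult_IZR; lra.
have [S HS] := strand_orderI Sr Pr Ph word.
by exists r, h, S; split.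
Qed.

Local Open Scope nat_scope.

(** * The grid diagrams *)

Section Grid.
Variable n : nat.
Notation k := (2 * n + 3).
Notation N := (2 * n + 14).

Definition Orow (c : nat) : nat :=
  if c == 0 then 3 else if c == 1 then 2 else if c <= k + 1 then k + 10 - c
  else if c == k + 2 then 4 else if c == k + 3 then 5 else if c == k + 4 then 8
  else if c == k + 5 then 6 else if c == k + 6 then 1 else if c == k + 7 then 7
  else if c == k + 8 then k + 9 else if c == k + 9 then 0 else k + 10.

Definition Xrow (c : nat) : nat :=
  if c == 0 then 2 else if c == 1 then k + 8 else if c <= k + 1 then k + 8 - c
  else if c == k + 2 then 1 else if c == k + 3 then 3 else if c == k + 4 then 4
  else if c == k + 5 then 5 else if c == k + 6 then k + 9 else if c == k + 7 then 0
  else if c == k + 8 then 6 else if c == k + 9 then k + 10 else k + 7.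

Definition nxt (c : nat) : nat :=
  if c == 0 then k + 3 else if c == 1 then 0 else if c == 2 then 1 else if c == 3 then k + 10
  else if c <= k + 1 then c - 2
  else if c == k + 2 then k + 4 else if c == k + 3 then k + 5 else if c == k + 4 then k
  else if c == k + 5 then k + 8 else if c == k + 6 then k + 2 else if c == k + 7 then k + 1
  else if c == k + 8 then k + 6 else if c == k + 9 then k + 7 else k + 9.

(** The columns in the order of the knot: each of the descending columns [k + 9], [1] and [k + 6] is
    followed by the ascending columns of the next strand. *)
Definition colseq (i : nat) : nat :=
  if i == 0 then k + 9 else if i == 1 then k + 7 else if i <= n + 3 then k + 5 - i.*2
  else if i == n + 4 then 1 else if i == n + 5 then 0 else if i == n + 6 then k + 3
  else if i == n + 7 then k + 5 else if i == n + 8 then k + 8 else if i == n + 9 then k + 6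
  else if i == n + 10 then k + 2 else if i == n + 11 then k + 4
  else if i <= n.*2 + 12 then k + n.*2 + 24 - i.*2 else k + 10.

Definition isdown (c : nat) : bool := (c == 1) || (c == k + 6) || (c == k + 9).

Ltac ifs := repeat (simpl; case: ifP => ?); simpl.
Ltac pick := first [by (split; lia)|by (left; split; lia)|(right; pick)].
Ltac ifsp := repeat (simpl; case: ifP => ?; try (exfalso; lia)); simpl.

Lemma Orow_lt c : c < N -> Orow c < N.
Proof. by rewrite /Orow => H; ifs; lia. Qed.

Lemma Xrow_lt c : c < N -> Xrow c < N.
Proof. by rewrite /Xrow => H; ifs; lia. Qed.

Lemma nxt_lt c : c < N -> nxt c < N.
Proof. by rewrite /nxt => H; ifs; lia. Qed.

Lemma Orow_inj c d : c < N -> d < N -> Orow c = Orow d -> c = d.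
Proof.
move=> Hc Hd; rewrite {1}/Orow; ifs; rewrite /Orow; ifs; lia.
Qed.

Lemma Xrow_inj c d : c < N -> d < N -> Xrow c = Xrow d -> c = d.
Proof.
move=> Hc Hd; rewrite {1}/Xrow; ifs; rewrite /Xrow; ifs; lia.
Qed.

Lemma OXrow c : c < N -> Orow c != Xrow c.
Proof. by rewrite /Orow /Xrow => H; ifs; lia. Qed.

Lemma Xrow_nxt c : c < N -> Xrow (nxt c) = Orow c.
Proof.
by rewrite /nxt /Orow => H; ifs; rewrite /Xrow; ifs; lia.
Qed.

Lemma colseq_lt i : colseq i < N.
Proof. by rewrite /colseq; ifs; lia. Qed.

Lemma colseq_nxt i : i.+1 < N -> colseq i.+1 = nxt (colseq i).
Proof.
move=> H; rewrite {2}/colseq; ifs; rewrite /colseq; ifsp; rewrite /nxt; ifsp; lia.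
Qed.

Lemma colseq_last : nxt (colseq (N - 1)) = colseq 0.
Proof. by rewrite /colseq; ifs; try lia; rewrite /nxt; ifs; lia. Qed.

Definition colidx (c : nat) : nat :=
  if c == 0 then n + 5 else if c == 1 then n + 4
  else if c <= k + 1 then (if odd c then n + 13 - c./2 + n else n + 4 - c./2)
  else if c == k + 2 then n + 10 else if c == k + 3 then n + 6 else if c == k + 4 then n + 11
  else if c == k + 5 then n + 7 else if c == k + 6 then n + 9 else if c == k + 7 then 1
  else if c == k + 8 then n + 8 else if c == k + 9 then 0 else n.*2 + 13.

Lemma colidxK c : c < N -> colseq (colidx c) = c /\ colidx c < N.
Proof.
rewrite /colidx => H; ifs; rewrite /colseq; split; ifs; lia.
Qed.

Definition rowmap (f : nat -> nat) (Hf : forall c, c < N -> f c < N) (a : 'I_N) : 'I_N :=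
  Ordinal (Hf a (ltn_ord a)).

Lemma rowmap_inj f Hf : (forall c d, c < N -> d < N -> f c = f d -> c = d) ->
  injective (@rowmap f Hf).
Proof. by move=> I a b /(congr1 val) E; apply: val_inj; exact: (I _ _ (ltn_ord a) (ltn_ord b) E). Qed.

Definition theO : {perm 'I_N} := perm (@rowmap_inj Orow Orow_lt Orow_inj).
Definition theX : {perm 'I_N} := perm (@rowmap_inj Xrow Xrow_lt Xrow_inj).

Lemma theOX (a : 'I_N) : theO a != theX a.
Proof. by rewrite !permE -val_eqE /=; apply: OXrow. Qed.

Definition the_grid : grid N := Grid theOX.

Lemma N_pos : 0 < N. Proof. by lia. Qed.

Definition start : 'I_N := Ordinal (colseq_lt 0).

Lemma next_colE (a : 'I_N) : next_col the_grid a = nxt a :> nat.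
Proof.
have H := nxt_lt (ltn_ord a).
suff -> : next_col the_grid a = Ordinal H by [].
rewrite /next_col /=; apply: (canLR (permK _)).
by apply: val_inj; rewrite !permE /= Xrow_nxt.
Qed.

Lemma iter_next i : i < N -> iter i (next_col the_grid) start = colseq i :> nat.
Proof.
elim: i => [|i IH] Hi //.
by rewrite iterS next_colE IH 1?ltnW // colseq_nxt.
Qed.

Lemma the_grid_knot : is_knot_grid the_grid.
Proof.
have cyc : iter (N - 1).+1 (next_col the_grid) start = start.
  rewrite iterS; apply: val_inj; rewrite [LHS]next_colE iter_next; last by lia.
  exact: colseq_last.
have reach (a : 'I_N) : exists2 i, i < N & a = iter i (next_col the_grid) start.
  have [E L] := colidxK (ltn_ord a); exists (colidx a) => //.
  by apply: val_inj; rewrite [RHS]iter_next.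
move=> a b; have [i Hi ->] := reach a; have [j Hj ->] := reach b.
exists (N - i + j); rewrite -iterD.
have -> : N - i + j + i = j + (N - 1).+1 by lia.
by rewrite iterD cyc.
Qed.

Lemma colE (i : Z) : col the_grid start i = colseq (Z.to_nat (i mod Z.of_nat N)) :> nat.
Proof.
rewrite /col iter_next //.
by have := Z.mod_pos_bound i (Z.of_nat N); have := N_pos; lia.
Qed.

Lemma col_lt (i : Z) : (0 <= i < Z.of_nat N)%Z -> col the_grid start i = colseq (Z.to_nat i) :> nat.
Proof. by move=> H; rewrite colE Z.mod_small. Qed.

Lemma col_nxt (i : Z) : col the_grid start (i + 1) = nxt (col the_grid start i) :> nat.
Proof. by rewrite (col_succ _ the_grid_knot) next_colE. Qed.

Lemma nxtP c : c < N ->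
  (c = 0 /\ nxt c = k + 3) \/ (c = 1 /\ nxt c = 0) \/ (c = 2 /\ nxt c = 1) \/ (c = 3 /\ nxt c = k + 10)
  \/ (4 <= c <= k + 1 /\ nxt c = c - 2) \/ (c = k + 2 /\ nxt c = k + 4) \/ (c = k + 3 /\ nxt c = k + 5)
  \/ (c = k + 4 /\ nxt c = k) \/ (c = k + 5 /\ nxt c = k + 8) \/ (c = k + 6 /\ nxt c = k + 2)
  \/ (c = k + 7 /\ nxt c = k + 1) \/ (c = k + 8 /\ nxt c = k + 6) \/ (c = k + 9 /\ nxt c = k + 7)
  \/ (c = k + 10 /\ nxt c = k + 9).
Proof. by rewrite /nxt => H; ifs; pick. Qed.

Lemma OrowP c : c < N ->
  (c = 0 /\ Orow c = 3) \/ (c = 1 /\ Orow c = 2) \/ (2 <= c <= k + 1 /\ Orow c = k + 10 - c)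
  \/ (c = k + 2 /\ Orow c = 4) \/ (c = k + 3 /\ Orow c = 5) \/ (c = k + 4 /\ Orow c = 8)
  \/ (c = k + 5 /\ Orow c = 6) \/ (c = k + 6 /\ Orow c = 1) \/ (c = k + 7 /\ Orow c = 7)
  \/ (c = k + 8 /\ Orow c = k + 9) \/ (c = k + 9 /\ Orow c = 0) \/ (c = k + 10 /\ Orow c = k + 10).
Proof. by rewrite /Orow => H; ifs; pick. Qed.

Lemma XrowP c : c < N ->
  (c = 0 /\ Xrow c = 2) \/ (c = 1 /\ Xrow c = k + 8) \/ (2 <= c <= k + 1 /\ Xrow c = k + 8 - c)
  \/ (c = k + 2 /\ Xrow c = 1) \/ (c = k + 3 /\ Xrow c = 3) \/ (c = k + 4 /\ Xrow c = 4)
  \/ (c = k + 5 /\ Xrow c = 5) \/ (c = k + 6 /\ Xrow c = k + 9) \/ (c = k + 7 /\ Xrow c = 0)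
  \/ (c = k + 8 /\ Xrow c = 6) \/ (c = k + 9 /\ Xrow c = k + 10) \/ (c = k + 10 /\ Xrow c = k + 7).
Proof. by rewrite /Xrow => H; ifs; pick. Qed.

Lemma down_nxt c : c < N -> isdown c -> ~~ isdown (nxt c).
Proof. by move=> /nxtP H; rewrite /isdown; lia. Qed.

Lemma isdownE c : c < N -> isdown c = (Orow c < Xrow c).
Proof. by rewrite /isdown /Orow /Xrow => H; ifs; lia. Qed.

Lemma turn_left c : c < N -> isdown c != isdown (nxt c) -> nxt c < c.
Proof. by move=> /nxtP H; rewrite /isdown; lia. Qed.

Lemma turn_columns c : c < N -> isdown c != isdown (nxt c) ->
  c = 1 \/ c = 2 \/ c = k + 6 \/ c = k + 8 \/ c = k + 9 \/ c = k + 10.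
Proof. by move=> /nxtP H; rewrite /isdown; lia. Qed.

(** Only three turning edges span other columns. They lie in the rows 0, [k + 9] and 1, and the
    columns concerned stop short of these rows. *)
Lemma turn_free c d : c < N -> d < N -> isdown c != isdown (nxt c) -> nxt c < d < c ->
  ~~ ((Xrow d < Orow c < Orow d) || (Orow d < Orow c < Xrow d)).
Proof.
move=> Hc Hd T B.
have : (c = k + 9 /\ d = k + 8) \/ (c = k + 8 /\ d = k + 7) \/
    (c = k + 6 /\ (d = k + 3 \/ d = k + 4 \/ d = k + 5)).
  by have := turn_columns Hc T; have := nxtP Hc; lia.
case=> [[Ec Ed]|[[Ec Ed]|[Ec Ed]]].
- have A1 : Orow c = 0 by have := OrowP Hc; lia.
  have A2 : Xrow d = 6 by have := XrowP Hd; lia.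
  by lia.
- have A1 : Orow c = k + 9 by have := OrowP Hc; lia.
  have A2 : Xrow d = 0 by have := XrowP Hd; lia.
  have A3 : Orow d = 7 by have := OrowP Hd; lia.
  by lia.
have A1 : Orow c = 1 by have := OrowP Hc; lia.
have A2 : 3 <= Xrow d by have := XrowP Hd; lia.
have A3 : 3 <= Orow d by have := OrowP Hd; lia.
by lia.
Qed.

Lemma turn_row c : c < N -> isdown c != isdown (nxt c) ->
  if isdown c then Orow c <= 2 else 3 <= Orow c.
Proof.
move=> H T; have := turn_columns H T; have := OrowP H.
by case: ifP T; rewrite {1}/isdown => D T; first lia; have := nxtP H; move: T; rewrite /isdown; lia.
Qed.

Lemma colseqP (i : nat) : (i < N)%N ->
  (i = 0 /\ colseq i = k + 9)%N \/ (i = 1 /\ colseq i = k + 7)%N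
  \/ (2 <= i <= n + 3 /\ colseq i = k + 5 - i.*2)%N \/ (i = n + 4 /\ colseq i = 1)%N
  \/ (i = n + 5 /\ colseq i = 0)%N \/ (i = n + 6 /\ colseq i = k + 3)%N
  \/ (i = n + 7 /\ colseq i = k + 5)%N \/ (i = n + 8 /\ colseq i = k + 8)%N
  \/ (i = n + 9 /\ colseq i = k + 6)%N \/ (i = n + 10 /\ colseq i = k + 2)%N
  \/ (i = n + 11 /\ colseq i = k + 4)%N
  \/ (n + 12 <= i <= n.*2 + 12 /\ colseq i = k + n.*2 + 24 - i.*2)%N
  \/ (i = n.*2 + 13 /\ colseq i = k + 10)%N.
Proof. by rewrite /colseq => H; ifs; pick. Qed.

Lemma turn_index i : i < N -> isdown (colseq i) != isdown (nxt (colseq i)) ->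
  [\/ i = 0, i = n + 3 | i = n + 4] \/ [\/ i = n + 8, i = n + 9 | i = n.*2 + 13].
Proof.
move=> Hi T.
suff : i = 0 \/ i = n + 3 \/ i = n + 4 \/ i = n + 8 \/ i = n + 9 \/ i = n.*2 + 13.
  by case=> [|[|[|[|[|]]]]] ->; [left; constructor 1|left; constructor 2|left; constructor 3
    |right; constructor 1|right; constructor 2|right; constructor 3].
by have := turn_columns (colseq_lt i) T; rewrite /colseq; ifs; lia.
Qed.

Lemma turn_index_inv i : (i = n + 3 \/ i = n + 4 \/ i = n + 8 \/ i = n + 9 \/ i = n.*2 + 13) ->
  isdown (colseq i) != isdown (nxt (colseq i)).
Proof.
move=> H.
have {H} : colseq i = 2 \/ colseq i = 1 \/ colseq i = k + 8 \/ colseq i = k + 6 \/ colseq i = k + 10.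
  by case: H => [|[|[|[|]]]] ->; rewrite /colseq; ifsp; lia.
by have := nxtP (colseq_lt i); rewrite /isdown; lia.
Qed.

End Grid.

Local Open Scope R_scope.

(** * The closed braid of the grid *)

Section GridBraid.
Variable n : nat.
Let G := the_grid n.
Let a0 := start n.
Let knot : is_knot_grid G := @the_grid_knot n.
Notation N := (2 * n + 14)%N.
Notation k := (2 * n + 3)%N.
Let P := period N.
Let CA := cornerA G a0.
Let CB := cornerB G a0.
Let colv (i : Z) : nat := col G a0 i.
Let cp : closed_path P CA CB := grid_path a0 knot.

Let colv_lt i : (colv i < N)%N. Proof. exact: ltn_ord. Qed.

Let colv_nxt i : colv (i + 1) = nxt n (colv i). Proof. exact: col_nxt. Qed.

Let half2 i : (2 * i / 2 = i)%Z. Proof. by rewrite Z.mul_comm Z.div_mul. Qed.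

Let half21 i : ((2 * i + 1) / 2 = i)%Z.
Proof. by rewrite Z.add_comm Z.mul_comm Z.div_add. Qed.

Let CA2 i : CA (2 * i)%Z = Z.of_nat (colv i). Proof. by rewrite /CA /cornerA half2. Qed.
Let CA21 i : CA (2 * i + 1)%Z = Z.of_nat (colv i). Proof. by rewrite /CA /cornerA half21. Qed.

Let CB2 i : CB (2 * i)%Z = Z.of_nat (Xrow n (colv i)).
Proof. by rewrite /CB /cornerB even2 half2 /= permE. Qed.

Let CB21 i : CB (2 * i + 1)%Z = Z.of_nat (Orow n (colv i)).
Proof. by rewrite /CB /cornerB half21; have := odd2 i; rewrite Zeven_odd => /negbTE -> /=; rewrite permE. Qed.

Let succ2 i : (2 * i + 1 + 1 = 2 * (i + 1))%Z. Proof. by lia. Qed.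

Let oddP j : Z.odd j -> exists i, j = (2 * i + 1)%Z.
Proof. by move/Z.odd_spec => [i ->]; exists i. Qed.

Let evenP j : Z.even j -> exists i, j = (2 * i)%Z.
Proof. by move/Z.even_spec => [i ->]; exists i. Qed.

Let sg (c : nat) : R := if isdown n c then -1 else 1.

Let dir2 i : dir CA CB (2 * i)%Z = sg (colv i).
Proof.
rewrite /dir CA2 CA21 CB2 CB21 /sg (isdownE (colv_lt i)).
have := OXrow (colv_lt i); set x := Orow _ _; set y := Xrow _ _ => xy.
by case: ifP => H; [rewrite Z.sgn_neg //|rewrite Z.sgn_pos //]; lia.
Qed.

Let vdir2 i : vdir CA CB (2 * i)%Z = sg (colv i).
Proof. by rewrite /vdir /vedge even2 dir2. Qed.

Let vdir21 i : vdir CA CB (2 * i + 1)%Z = sg (colv i).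
Proof.
rewrite /vdir /vedge; have := odd2 i; rewrite Zeven_odd => /negbTE ->.
by have -> : (2 * i + 1 - 1 = 2 * i)%Z by [lia]; rewrite dir2.
Qed.

Let vdir22 i : vdir CA CB (2 * i + 1 + 1)%Z = sg (nxt n (colv i)).
Proof. by rewrite succ2 vdir2 colv_nxt. Qed.

Let sg_turn c d : sg c <> sg d <-> isdown n c != isdown n d.
Proof. by rewrite /sg; case: (isdown n c); case: (isdown n d); split => //= H; lra. Qed.

Let turnP i : vdir CA CB (2 * i + 1)%Z <> vdir CA CB (2 * i + 1 + 1)%Z <->
  isdown n (colv i) != isdown n (nxt n (colv i)).
Proof. by rewrite vdir21 vdir22; exact: sg_turn. Qed.

Let dir21 i : isdown n (colv i) != isdown n (nxt n (colv i)) -> dir CA CB (2 * i + 1)%Z = -1.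
Proof.
move=> T; have L := turn_left (colv_lt i) T.
rewrite /dir succ2 CA2 CA21 CB2 CB21 colv_nxt (Xrow_nxt (colv_lt i)).
by rewrite Z.sgn_neg //; lia.
Qed.

Let bp : braid_path P CA CB.
Proof.
split.
- move=> j /oddP [i ->]; rewrite vdir21 vdir22 /sg.
  have := @down_nxt n (colv i) (colv_lt i).
  by case: (isdown n (colv i)) => // /(_ isT) /negbTE ->; lra.
- by move=> j /oddP [i ->] /turnP; exact: dir21.
move=> e j /evenP [i ->] /oddP [f ->] /turnP T; rewrite (dir21 T) dir2.
rewrite succ2 !CA2 CA21 CB2 !CB21 colv_nxt => H1 H2.
have lt (x y : nat) : 0 < IZR (Z.of_nat y) - IZR (Z.of_nat x) -> (x < y)%N.
  by move=> H; apply/ltP; apply/Nat2Z.inj_lt; apply: lt_IZR; lra.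
have B : (nxt n (colv f) < colv i < colv f)%N by apply/andP; split; apply: lt; lra.
have := turn_free (colv_lt f) (colv_lt i) T B.
rewrite negb_or /sg; case: (isdown n (colv i)) => /andP [F1 F2] K1 K2.
  by move/negP: F2; apply; apply/andP; split; apply: lt; lra.
by move/negP: F1; apply; apply/andP; split; apply: lt; lra.
Qed.

(** The axis at 5/2 separates the rows 0, 1, 2 of the lower turns from those of the upper turns and
    of the crossings. *)
Let Hrow j : Z.odd j -> vdir CA CB j <> vdir CA CB (j + 1)%Z ->
  1/4 <= vdir CA CB j * (IZR (CB j) - 5/2).
Proof.
move=> /oddP [i ->] /turnP T; rewrite vdir21 CB21 /sg.
have := turn_row (colv_lt i) T; case: (isdown n (colv i)) => H.
  have : IZR (Z.of_nat (Orow n (colv i))) <= IZR 2 by apply: IZR_le; lia.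
  lra.
have : IZR 3 <= IZR (Z.of_nat (Orow n (colv i))) by apply: IZR_le; lia.
lra.
Qed.

Let colvE (i : nat) : (i < N)%N -> colv (Z.of_nat i) = colseq n i.
Proof. by move=> H; rewrite /colv col_lt ?Nat2Z.id //; lia. Qed.

Let down0 : isdown n (colseq n 0).
Proof.
have -> : colseq n 0 = (k + 9)%N by [].
by rewrite /isdown eqxx orbT. Qed.

Let vdir1E : vdir CA CB 1 = -1.
Proof.
have := vdir21 0; rewrite /= => ->; rewrite (colvE (i := 0%N)); last by lia.
by rewrite /sg down0.
Qed.

Let vdir2E : vdir CA CB (1 + 1)%Z = 1.
Proof.
have := vdir22 0; rewrite /= => ->; rewrite (colvE (i := 0%N)); last by lia.
by rewrite /sg (negbTE (down_nxt (colseq_lt n 0) down0)).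
Qed.

Let NZ := Z.of_nat n.

Let turns_only j : Z.odd j -> (1 <= j <= 4 * NZ + 28)%Z -> vdir CA CB j <> vdir CA CB (j + 1)%Z ->
  (j = 1 \/ j = 2 * NZ + 7 \/ j = 2 * NZ + 9 \/ j = 2 * NZ + 17 \/ j = 2 * NZ + 19 \/ j = 4 * NZ + 27)%Z.
Proof.
move=> /oddP [i ->] Hj /turnP; have Ei : i = Z.of_nat (Z.to_nat i) by lia.
have Hi : (Z.to_nat i < N)%N by rewrite /NZ in Hj; lia.
rewrite Ei (colvE Hi) => /(turn_index Hi); rewrite /NZ.
by case=> -[] H; lia.
Qed.

Let turns_at j : (j = 2 * NZ + 7 \/ j = 2 * NZ + 9 \/ j = 2 * NZ + 17 \/ j = 2 * NZ + 19
  \/ j = 4 * NZ + 27)%Z -> vdir CA CB j <> vdir CA CB (j + 1)%Z.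
Proof.
move=> Hj; have [i [Ei Hi]] : exists i : nat, j = (2 * Z.of_nat i + 1)%Z /\
    (i = n + 3 \/ i = n + 4 \/ i = n + 8 \/ i = n + 9 \/ i = n.*2 + 13)%N.
  rewrite /NZ in Hj; case: Hj => [->|[->|[->|[->|->]]]];
    [exists (n + 3)%N|exists (n + 4)%N|exists (n + 8)%N|exists (n + 9)%N|exists (n.*2 + 13)%N]; lia.
by rewrite Ei; apply/turnP; rewrite colvE; [exact: turn_index_inv|lia].
Qed.

Definition hopidx (i : nat) : nat :=
  if (i < 4)%N then (if i == 0 then n + 5 else if i == 1 then n + 10 else if i == 2 then n + 6 else n + 7)%N
  else if odd i then (n + 11 + (i - 4)./2)%N else (1 + (i - 3)./2)%N.

Let hopidxE i : idx n (over_at i) i = Z.of_nat (hopidx i).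
Proof.
rewrite /over_at /hopidx; case: (ltnP i 4) => H.
  by case: i H => [|[|[|[|i]]]] //= _; rewrite /idx /=; lia.
by case O: (odd i); rewrite /idx /=; lia.
Qed.

Let hopidx_lt i : (i < k + 5)%N -> (hopidx i < N)%N.
Proof. by move=> H; rewrite /hopidx; do ! (case: ifP => ?); lia. Qed.

Let hop_Orow i : (i < k + 5)%N -> Orow n (colseq n (hopidx i)) = (3 + i)%N.
Proof.
move=> Hi; have L := hopidx_lt Hi.
have O := OrowP (colseq_lt n (hopidx i)).
suff E : colseq n (hopidx i) = (if i == 0 then 0 else if i == 1 then k + 2 else if i == 2 then k + 3
    else if i == 3 then k + 5 else if i == 4 then k + 7 else if i == 5 then k + 4 else k + 7 - i)%N.
  by move: E; do ! (case: eqP => ?); lia.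
have {O} C := colseqP L; move: C; rewrite /hopidx.
by do ! (case: ifP => ?); lia.
Qed.

Let CAidx (m : nat) : (m < N)%N -> CA (2 * Z.of_nat m)%Z = Z.of_nat (colseq n m).
Proof. by move=> H; rewrite CA2 colvE. Qed.

Let colA i : (i <= k + 5)%N ->
  CA (2 * idx n 0 i)%Z = Z.of_nat (if i <= 4 then k + 7 else k + 3 - ((i - 3)./2).*2)%N.
Proof.
move=> Hi; have [-> _ _] := idxE n i; have L : (1 + (i - 3)./2 < N)%N by lia.
by rewrite CAidx //; have C := colseqP L; case: ifP => ?; lia.
Qed.

Let colB i : (i <= k + 5)%N -> CA (2 * idx n 1 i)%Z =
  Z.of_nat (if i == 0 then 0 else if i <= 2 then k + 3 else if i == 3 then k + 5 else k + 8)%N.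
Proof.
move=> Hi; have [_ -> _] := idxE n i; have L : (n + 5 + (0 < i) + (2 < i) + (3 < i) < N)%N by lia.
by rewrite CAidx //; have C := colseqP L; do ! (case: ifP => ?); lia.
Qed.

Let colC i : (i <= k + 5)%N -> CA (2 * idx n 2 i)%Z =
  Z.of_nat (if i <= 1 then k + 2 else if i <= 5 then k + 4 else if i == k + 5 then k + 10
            else k + 2 - ((i - 4)./2).*2)%N.
Proof.
move=> Hi; have [_ _ ->] := idxE n i; have L : (n + 10 + (1 < i) + (i - 4)./2 < N)%N by lia.
by rewrite CAidx //; have C := colseqP L; do ! (case: ifP => ?); lia.
Qed.

Let col_sort i : (i <= k + 5)%N -> let: (a, b, c) := order_at k i in
  (CA (2 * idx n a i) < CA (2 * idx n b i) < CA (2 * idx n c i))%Z.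
Proof.
move=> Hi; have A := colA Hi; have B := colB Hi; have C := colC Hi.
case: (ltnP i 4) => H.
  move: i H Hi A B C => [|[|[|[|i]]]] // _ _ A B C.
  - have -> : order_at k 0 = (1, 2, 0)%Z by [].
    by rewrite A B C /=; lia.
  - have -> : order_at k 1 = (2, 1, 0)%Z by [].
    by rewrite A B C /=; lia.
  - have -> : order_at k 2 = (1, 2, 0)%Z by [].
    by rewrite A B C /=; lia.
  have -> : order_at k 3 = (2, 1, 0)%Z by [].
    by rewrite A B C /=; lia.
rewrite /order_at ifF; last by lia.
case: eqP => Ei.
  rewrite A B C Ei; do ! (case: ifP => ?); lia.
by case: ifP => Od; rewrite A B C; do ! (case: ifP => ?); lia.
Qed.

Let col_down : (CA (2 * (idx n 0 (k + 5) + 1)) < CA (2 * (idx n 1 (k + 5) + 1)) <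
  CA (2 * (idx n 2 (k + 5) + 1)))%Z.
Proof.
have [-> -> ->] := idxE n (k + 5).
have -> : (Z.of_nat (1 + (k + 5 - 3)./2) + 1 = Z.of_nat (n + 4))%Z by lia.
have -> : (Z.of_nat (n + 5 + (0 < k + 5) + (2 < k + 5) + (3 < k + 5)) + 1 = Z.of_nat (n + 9))%Z by lia.
have -> : (Z.of_nat (n + 10 + (1 < k + 5) + (k + 5 - 4)./2) + 1 = 0 + 1 * Z.of_nat N)%Z by lia.
have -> : CA (2 * (0 + 1 * Z.of_nat N))%Z = CA (2 * Z.of_nat 0)%Z.
  rewrite -[RHS](cp_perA cp); congr CA; rewrite /P /period; lia.
have E1 : colseq n (n + 4) = 1%N by have := @colseqP n (n + 4) ltac:(lia); lia.
have E2 : colseq n (n + 9) = (k + 6)%N by have := @colseqP n (n + 9) ltac:(lia); lia.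
have E3 : colseq n 0 = (k + 9)%N by [].
by rewrite !CAidx ?E1 ?E2 ?E3; lia.
Qed.

Let hop_row i : (i < k + 5)%N -> CB (2 * idx n (over_at i) i + 1)%Z = Z.of_nat (3 + i).
Proof. by move=> Hi; rewrite hopidxE CB21 colvE ?hop_Orow //; exact: hopidx_lt. Qed.

Let hop_dir i : (i < k + 5)%N ->
  vdir CA CB (2 * idx n (over_at i) i + 1)%Z = vdir CA CB (2 * idx n (over_at i) i + 1 + 1)%Z.
Proof.
move=> Hi; have O := hop_Orow Hi; have L := hopidx_lt Hi.
rewrite hopidxE vdir21 vdir22 (colvE L) /sg.
suff [/negbTE -> /negbTE ->] : ~~ isdown n (colseq n (hopidx i)) /\ ~~ isdown n (nxt n (colseq n (hopidx i))) by [].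
have C := colseq_lt n (hopidx i).
have := OrowP C; have D : ~~ isdown n (colseq n (hopidx i)) by move: O; rewrite /isdown; have := OrowP C; lia.
split=> //; apply/negP => D'; have T : isdown n (colseq n (hopidx i)) != isdown n (nxt n (colseq n (hopidx i))).
  by rewrite (negbTE D) D'.
have := turn_columns C T; move: D O; rewrite /isdown; have := OrowP C; lia.
Qed.

Lemma represents_closure K : braid_closure 3 (beta n) K -> represents G K.
Proof.
move=> HK; have [r [h [X [[Sr Sh] [Pr Ph] [r0 F] E [so ->]]]]] := closure_data HK.
have [p [hT [th [B [Q [C [del [m [T' [bf push iso]]]]]]]]]] :=
  braid_formI cp bp Hrow (isT : Z.odd 1) vdir1E vdir2E.
split; first exact: knot.
exists (front_curve G a0), T'; split.
- exact: legendrian_of_grid_front.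
- exact: push.
have HP : P = (4 * NZ + 28)%Z by rewrite /P /period /NZ; lia.
apply: (transverse_isotopic_trans iso).
exact: (compare_isotopy cp bp bf HP turns_only turns_at hop_row hop_dir col_sort col_down Sr Sh Pr Ph r0 F E so).
Qed.

End GridBraid.

Local Open Scope nat_scope.

(** * Rectangles in the grid diagrams *)

(** The interval [cyc] without remainders, in a form suited to linear arithmetic. *)
Definition cycn (i j a : nat) : bool :=
  ((i <= a) && (a < j)) || ((j < i) && ((i <= a) || (a < j))).

Section Rectangles.
Variable n : nat.
Notation k := (2 * n + 3).
Notation N := (2 * n + 14).

(* [x^+] as a function on columns. *)
Definition xpn (c : nat) : nat :=
  if c == 0 then k + 8 else if c == 1 then 3 else if c == 2 then k + 9
  else if c <= k + 2 then k + 10 - c else if c == k + 3 then 2 else if c == k + 4 then 4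
  else if c == k + 5 then 5 else if c == k + 6 then 6 else if c == k + 7 then k + 10
  else if c == k + 8 then 1 else if c == k + 9 then 7 else 0.

Lemma xpn_Xrow c : c < N -> xpn c = (Xrow n (if c == 0 then N - 1 else c - 1)).+1 %% N.
Proof.
move=> Hc; set a := (if c == 0 then N - 1 else c - 1).
have Ea : (c = 0 /\ a = N - 1) \/ (0 < c /\ a = c - 1) by rewrite /a; case: (eqVneq c 0); lia.
have H : a < N by lia.
have K x : x < N -> (x = N - 1 /\ x.+1 %% N = 0) \/ (x < N - 1 /\ x.+1 %% N = x.+1).
  move=> Hx; case: (eqVneq x (N - 1)) => [->|E].
    by left; have -> : (N - 1).+1 = N by [lia]; rewrite modnn.
  by right; rewrite modn_small //; lia.
have := XrowP H; have := K _ (Xrow_lt H); clearbody a; clear K.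
by rewrite /xpn; do ! (case: ifP => ?); lia.
Qed.

Definition ischain (c : nat) : bool := (c == k + 9) || (c == 0) || (3 <= c <= k + 2).

Lemma nonchainP c : c < N -> ~~ ischain c ->
  (c = 1 /\ xpn c = 3) \/ (c = 2 /\ xpn c = k + 9) \/ (c = k + 3 /\ xpn c = 2)
  \/ (c = k + 4 /\ xpn c = 4) \/ (c = k + 5 /\ xpn c = 5) \/ (c = k + 6 /\ xpn c = 6)
  \/ (c = k + 7 /\ xpn c = k + 10) \/ (c = k + 8 /\ xpn c = 1) \/ (c = k + 10 /\ xpn c = 0).
Proof. by rewrite /ischain /xpn => H C; do ! (case: ifP => ?); lia. Qed.

Definition freen (L R b t : nat) : Prop :=
  forall c, c < N -> ~~ (cycn L R c && cycn b t (Orow n c)) /\ ~~ (cycn L R c && cycn b t (Xrow n c)).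

Lemma Orow_marks :
  [/\ Orow n 0 = 3, Orow n 1 = 2, Orow n 2 = k + 8 &
    [/\ Orow n (k + 2) = 4, Orow n (k + 3) = 5, Orow n (k + 4) = 8 & Orow n (k + 5) = 6] /\
    [/\ Orow n (k + 6) = 1, Orow n (k + 7) = 7, Orow n (k + 8) = k + 9
      & Orow n (k + 9) = 0 /\ Orow n (k + 10) = k + 10]].
Proof.
have O c : c < N -> _ := fun H => OrowP H.
split=> //; first by have := O 2; lia.
split.
  by split; [have := O (k + 2)|have := O (k + 3)|have := O (k + 4)|have := O (k + 5)]; lia.
split; [have := O (k + 6)|have := O (k + 7)|have := O (k + 8)|]; try lia.
by split; [have := O (k + 9)|have := O (k + 10)]; lia.
Qed.

Lemma kd_lt d : d <= 10 -> k + d < N.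
Proof. by lia. Qed.

Lemma small_lt d : d <= 10 -> d < N.
Proof. by lia. Qed.

Section Free.
Variables L R b t : nat.
Hypotheses (HL : L < N) (HR : R < N) (LR : L != R) (bt : b != t).
Hypothesis F : freen L R b t.

Let FO c r : c < N -> Orow n c = r -> ~~ (cycn L R c && cycn b t r).
Proof. by move=> H <-; have [] := F H. Qed.

Let FX c r : c < N -> Xrow n c = r -> ~~ (cycn L R c && cycn b t r).
Proof. by move=> H <-; have [] := F H. Qed.

(** The upper left corner (L, t) belongs to the final generator. Off the chain columns its height is
    that of x^+, and for each of the nine possible columns a few O's meet every rectangle with this
    corner. *)
Lemma left_chain : (ischain L -> 7 <= t <= k + 8) -> (~~ ischain L -> t = xpn L) ->
  (ischain R -> 7 <= b <= k + 8) -> (~~ ischain R -> b = xpn R) -> ischain L.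
Proof.
move=> _ HT HB1 HB2; apply/negPn/negP => C.
have [O0 O1 O2 [[O3 O4 O5 O6] [O7 O8 O9 [O10 O11]]]] := Orow_marks.
have G0 := @FO 0 _ (@small_lt 0 isT) O0; have G1 := @FO 1 _ (@small_lt 1 isT) O1; have G2 := @FO 2 _ (@small_lt 2 isT) O2.
have G3 := @FO (k + 2) _ (@kd_lt 2 isT) O3; have G4 := @FO (k + 3) _ (@kd_lt 3 isT) O4.
have G5 := @FO (k + 4) _ (@kd_lt 4 isT) O5; have G6 := @FO (k + 5) _ (@kd_lt 5 isT) O6.
have G7 := @FO (k + 6) _ (@kd_lt 6 isT) O7; have G8 := @FO (k + 7) _ (@kd_lt 7 isT) O8.
have G9 := @FO (k + 8) _ (@kd_lt 8 isT) O9; have G10 := @FO (k + 9) _ (@kd_lt 9 isT) O10.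
have G11 := @FO (k + 10) _ (@kd_lt 10 isT) O11.
have {HB1 HB2} HB : (ischain R /\ 7 <= b <= k + 8) \/
   ((R = 1 /\ b = 3) \/ (R = 2 /\ b = k + 9) \/ (R = k + 3 /\ b = 2)
  \/ (R = k + 4 /\ b = 4) \/ (R = k + 5 /\ b = 5) \/ (R = k + 6 /\ b = 6)
  \/ (R = k + 7 /\ b = k + 10) \/ (R = k + 8 /\ b = 1) \/ (R = k + 10 /\ b = 0)).
  case: (boolP (ischain R)) => CR; first by left; split=> //; exact: HB1.
  by right; have := nonchainP HR CR; rewrite (HB2 CR).
have := nonchainP HL C; rewrite -(HT C) => {HT C O0 O1 O2 O3 O4 O5 O6 O7 O8 O9 O10 O11}.
rewrite /cycn in G0 G1 G2 G3 G4 G5 G6 G7 G8 G9 G10 G11.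
case=> [[EL ET]|[[EL ET]|[[EL ET]|[[EL ET]|[[EL ET]|[[EL ET]|[[EL ET]|[[EL ET]|[EL ET]]]]]]]]].
- by clear - EL ET G1 LR bt HB HR; lia.
- by clear - EL ET G2 LR bt HB HR; lia.
- clear - EL ET G4 G5 G7 LR bt HB HR; rewrite /ischain in HB.
  by case: HB => [[]|[|[|[|[|[|[|[|[]]]]]]]]]; lia.
- clear - EL ET G0 G5 G7 LR bt HB HR; rewrite /ischain in HB.
  by case: HB => [[]|[|[|[|[|[|[|[|[]]]]]]]]]; lia.
- clear - EL ET G0 G3 G6 G7 LR bt HB HR; rewrite /ischain in HB.
  by case: HB => [[]|[|[|[|[|[|[|[|[]]]]]]]]]; lia.
- clear - EL ET G0 G4 G7 LR bt HB HR; rewrite /ischain in HB.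
  by case: HB => [[]|[|[|[|[|[|[|[|[]]]]]]]]]; lia.
- clear - EL ET G8 G9 LR bt HB HR; rewrite /ischain in HB.
  by case: HB => [[]|[|[|[|[|[|[|[|[]]]]]]]]]; lia.
- clear - EL ET G9 G10 LR bt HB HR; rewrite /ischain in HB.
  by case: HB => [[]|[|[|[|[|[|[|[|[]]]]]]]]]; lia.
by clear - EL ET G11 LR bt HB HR; lia.
Qed.

(** The same for the lower right corner (R, b); now that the left side is on the chain, five O's
    suffice. *)
Lemma right_chain : ischain L -> 7 <= t <= k + 8 -> (3 <= L <= k + 2 -> t <= k + 11 - L) ->
  (~~ ischain R -> b = xpn R) -> ischain R.
Proof.
move=> CL T1 T2 HB; apply/negPn/negP => C.
have {CL} CL : L = k + 9 \/ L = 0 \/ 3 <= L <= k + 2.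
  by clear - CL; move: CL; rewrite /ischain; lia.
have [O0 O1 O2 [[O3 O4 O5 O6] [O7 O8 O9 [O10 O11]]]] := Orow_marks.
have G0 := @FO 0 _ (@small_lt 0 isT) O0; have G3 := @FO (k + 2) _ (@kd_lt 2 isT) O3.
have G4 := @FO (k + 3) _ (@kd_lt 3 isT) O4; have G6 := @FO (k + 5) _ (@kd_lt 5 isT) O6.
have G10 := @FO (k + 9) _ (@kd_lt 9 isT) O10.
have := nonchainP HR C; rewrite -(HB C) => {HB C O0 O1 O2 O3 O4 O5 O6 O7 O8 O9 O10 O11}.
rewrite /cycn in G0 G3 G4 G6 G10.
case=> [[ER EB]|[[ER EB]|[[ER EB]|[[ER EB]|[[ER EB]|[[ER EB]|[[ER EB]|[[ER EB]|[ER EB]]]]]]]]];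
  case: CL => [EL|[EL|EL]]; clear F HL HR FO FX; lia.
Qed.

End Free.

(* The columns on which the generators y_I may differ from x^+: column [k + 9],
   followed by those on which x^+ descends from [k + 8] to [8]. *)
Definition pc (j : nat) : nat := if j == 0 then k + 9 else if j == 1 then 0 else minn (j + 1) (k + 2).
Definition chidx (c : nat) : nat := if c == k + 9 then 0 else if c == 0 then 1 else c - 1.

Lemma pc_lt j : pc j < N.
Proof. by rewrite /pc; do ! (case: ifP => ?); lia. Qed.

Lemma pcP j : j <= k + 1 -> (j = 0 /\ pc j = k + 9) \/ (j = 1 /\ pc j = 0) \/ (2 <= j /\ pc j = j + 1).
Proof. by rewrite /pc => H; do ! (case: eqP => ?); lia. Qed.

Lemma pcK j : j <= k + 1 -> chidx (pc j) = j /\ ischain (pc j).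
Proof.
move=> H; have := pcP H; rewrite /chidx /ischain; set c := pc j => Hc; clearbody c.
by split; [do ! (case: eqP => ?)|]; lia.
Qed.

Lemma chidxK c : ischain c -> pc (chidx c) = c /\ chidx c <= k + 1.
Proof.
move=> H; have L : chidx c <= k + 1 by move: H; rewrite /chidx /ischain; do ! (case: eqP => ?); lia.
split=> //; have := pcP L; move: H; rewrite /chidx /ischain.
by set d := pc _; clearbody d; do ! (case: eqP => ?); lia.
Qed.

Lemma OX_chain c : 2 <= c <= k + 1 -> [/\ c < N, Orow n c = k + 10 - c & Xrow n c = k + 8 - c].
Proof.
move=> H; have L : c < N by lia.
by have := OrowP L; have := XrowP L; split; lia.
Qed.

(* [m] is the height of the point on the chain column [j], counted from above. *)
Definition chain_height (j m : nat) : bool :=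
  if j == 0 then 2 <= m <= k + 2
  else (1 <= m <= k + 2) && [|| m == j, (m == j - 1) && (2 <= j) | (j <= k) && (j + 2 <= m)].

Lemma chain_heightP j m : chain_height j m ->
  (j = 0 /\ 2 <= m <= k + 2) \/ (1 <= j /\ 1 <= m <= k + 2 /\ (m = j \/ (m = j - 1 /\ 2 <= j) \/ (j <= k /\ j + 2 <= m))).
Proof. by rewrite /chain_height; case: eqP => ?; lia. Qed.

Lemma freenO L R b t c r : freen L R b t -> c < N -> Orow n c = r -> ~~ (cycn L R c && cycn b t r).
Proof. by move=> F H <-; have [] := F c H. Qed.

Lemma freenX L R b t c r : freen L R b t -> c < N -> Xrow n c = r -> ~~ (cycn L R c && cycn b t r).
Proof. by move=> F H <-; have [] := F c H. Qed.

Lemma freen_chain L R b t c : freen L R b t -> 2 <= c <= k + 1 ->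
  ~~ (cycn L R c && cycn b t (k + 10 - c)) /\ ~~ (cycn L R c && cycn b t (k + 8 - c)).
Proof.
by move=> F /OX_chain [L' E1 E2]; split; [exact: freenO F L' E1|exact: freenX F L' E2].
Qed.

(** The rectangle covers all columns from [L] to [k + 8]. If it reaches down to row 7, it contains
    the O of column [k + 7]. Otherwise its top row contains the O of column [m + 2] or, if m = k,
    that of column [k + 4] in row 8. *)
Lemma wrap_false L R m m' : R < L \/ R = k + 9 -> 3 <= L -> L <= m + 2 -> L <= k + 2 -> m < m' -> m' <= k + 2 ->
  freen L R (k + 9 - m') (k + 9 - m) -> False.
Proof.
move=> H0 H1 H2 H3 H4 H5 F.
have [_ _ _ [[_ _ O5 _] [_ O8 _ _]]] := Orow_marks.
have G5 := freenO F (@kd_lt 4 isT) O5; have G8 := freenO F (@kd_lt 7 isT) O8.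
have G := @freen_chain _ _ _ _ (m + 2) F; clear F O5 O8; rewrite /cycn in G5 G8 G.
case: (eqVneq m' (k + 2)) => E.
  by clear G G5; lia.
case: (leqP m (k - 1)) => Hm.
  by have [A _] := G ltac:(clear G G5 G8; lia); clear G G5 G8; lia.
by clear G G8; lia.
Qed.

(** The two diagonals of O's and X's in the columns from 2 to k + 1 leave two kinds of rectangles:
    those that lie below all X's of the diagonal in their columns, and strips of one row that pass
    between the X's and the O's. *)
Lemma chain_rect j j' m m' : j <= k + 1 -> j' <= k + 1 -> j != j' -> m != m' ->
  chain_height j m -> chain_height j' m' ->
  freen (pc j) (pc j') (k + 9 - m') (k + 9 - m) ->
  [/\ j < j', m < m' & (j' + 1 <= m) || [&& 1 <= j, j' == j.+1, m == j & m' == j.+1]].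
Proof.
move=> Hj Hj' jj' mm' /chain_heightP Cm /chain_heightP Cm' F.
have m2 : m <= k + 2 by clear - Cm; lia.
have m2' : m' <= k + 2 by clear - Cm'; lia.
have [O0 _ _ [_ [_ _ O9 [O10 O11]]]] := Orow_marks.
(* Such a rectangle wraps around vertically; it meets an O in row 0, 3, [k + 9] or [k + 10], or one
   of the diagonal. *)
have down : m' < m -> False.
  move=> Hm.
  have G0 := freenO F (@small_lt 0 isT) O0; have G9 := freenO F (@kd_lt 8 isT) O9.
  have G10 := freenO F (@kd_lt 9 isT) O10; have G11 := freenO F (@kd_lt 10 isT) O11.
  have GL := @freen_chain _ _ _ _ (j + 1) F.
  have := pcP Hj; have := pcP Hj'; clear F O0 O9 O10 O11.
  case=> [[E3 E4]|[[E3 E4]|[E3 E4]]]; case=> [[E1 E2]|[[E1 E2]|[E1 E2]]];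
    rewrite E2 E4 /cycn in G0 G9 G10 G11 GL.
  - by clear - E1 E3 jj'; lia.
  - by clear - G0 E1 E3 Hm m2 m2'; lia.
  - by clear - G9 E1 E3 Hm m2 m2' Hj; lia.
  - by clear - G10 E1 E3 Hm m2 m2'; lia.
  - by clear - E1 E3 jj'; lia.
  - by clear - G11 E1 E3 Hm m2 m2' Hj; lia.
  - by clear - G0 E1 E3 Hm m2 m2' Hj'; lia.
  - by clear - G0 E1 E3 Hm m2 m2' Hj'; lia.
  case: (ltnP j j') => Hjj; last by clear - G0 E1 E3 Hm m2 m2' Hj Hj' Hjj jj'; lia.
  have [A _] := GL ltac:(clear - E1 E3 Hjj Hj'; lia).
  by clear - A Cm' Hm m2 m2' E1 E3 Hjj Hj'; lia.
have {down} Hm : m < m'.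
  by case: (ltngtP m m') mm' => // /down [].
have Gm := @freen_chain _ _ _ _ m F; have G3 := @freen_chain _ _ _ _ 3 F.
have G2 := @freen_chain _ _ _ _ 2 F; have GL := @freen_chain _ _ _ _ (j + 1) F.
have GR := @freen_chain _ _ _ _ j' F.
have W : 2 <= j -> j' < j -> False.
  move=> H1 H2; apply: (wrap_false _ _ _ _ Hm m2' F); have := pcP Hj; have := pcP Hj';
  clear - Cm H1 H2 Hj; lia.
clear F O0 O9 O10 O11.
case: (leqP (j' + 1) m) => Hjm.
  split=> //; case: (ltngtP j j') jj' => // Hjj _; exfalso.
  case: (leqP 2 j) => j2; first exact: W.
  have Ej : j = 1 by clear - Hjj j2; lia.
  have Ej' : j' = 0 by clear - Ej Hjj; lia.
  have E2 : pc j = 0 by rewrite Ej.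
  have E4 : pc j' = k + 9 by rewrite Ej'.
  have [A _] := G3 ltac:(clear; lia).
  rewrite E2 E4 /cycn in A Gm.
  case: (leqP m 1) => m1; first by clear - A m1 Hm m2' Ej Cm; lia.
  have [_ B] := Gm ltac:(clear - m1 Hm m2'; lia).
  by clear - B m1 Hm m2'; lia.
have deep : j + 2 <= m -> j < j' -> 1 <= j -> False.
  move=> H1 H2 H3; have [_ A] := Gm ltac:(clear - Hjm H1 Hj'; lia).
  have := pcP Hj; have := pcP Hj'; rewrite /cycn in A.
  by clear - A Hm Hjm H1 H2 H3 Hj Hj' m2'; lia.
case: (eqVneq j 0) => j0.
  have [_ A] := Gm ltac:(clear - Cm j0 Hjm Hj'; lia).
  exfalso; have := pcP Hj; have := pcP Hj'; rewrite /cycn in A.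
  by clear - A Cm j0 Hjm Hm Hj' m2' jj'; lia.
case: (ltngtP j j') jj' => // Hjj _; last first.
  exfalso; case: (leqP 2 j) => j2; first exact: W.
  have Ej : j = 1 by clear - j0 j2; lia.
  have Ej' : j' = 0 by clear - Ej Hjj; lia.
  by clear - Cm Cm' Hjm Ej Ej'; lia.
case: (eqVneq j 1) => j1.
  have Em : m = 1.
    by case: (leqP (j + 2) m) => H; [case: deep => //; clear - j1; lia|clear - Cm j1 H; lia].
  have [A _] := G3 ltac:(clear; lia); have [_ B] := G2 ltac:(clear; lia).
  have := pcP Hj; have := pcP Hj'; rewrite /cycn in A B.
  have Ej' : 2 <= j' by clear - j1 Hjj; lia.
  case=> [[E _]|[[E _]|[_ E4]]]; [by clear - E Ej'; lia|by clear - E Ej'; lia|].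
  case=> [[E _]|[[_ E2]|[E _]]]; [by clear - E j1; lia| |by clear - E j1; lia].
  rewrite E2 E4 in A B.
  have A' : j' <= 2 by clear - A Em Hm m2' Ej' Hj'; lia.
  have B' : m' <= 2 by clear - B Em Hm m2' Ej' Hj'; lia.
  by split=> //; clear - A' B' Ej' Em Hm j1; lia.
have j2 : 2 <= j by clear - j0 j1; lia.
have Em : m = j \/ m = j - 1.
  case: (leqP (j + 2) m) => H; last by clear - Cm H j2; lia.
  by case: deep => //; clear - j2; lia.
have [A B] := GL ltac:(clear - Hjj Hj' j2; lia).
have [A2 _] := GR ltac:(clear - Hjj Hj' j2; lia).
have := pcP Hj; have := pcP Hj'; rewrite /cycn in A B A2.
case=> [[E _]|[[E _]|[_ E4]]]; [by clear - E Hjj; lia|by clear - E Hjj j2; lia|].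
case=> [[E _]|[[E _]|[_ E2]]]; [by clear - E j2; lia|by clear - E j2; lia|].
rewrite E2 E4 in A B A2; case: Em => Em; last by exfalso; clear - A Em Hm m2' Hjj Hj' j2; lia.
have Em' : m' = j + 1 by clear - B Em Hm m2' Hjj Hj' j2; lia.
have Ej' : j' <= j + 1.
  case: (leqP j' (j + 1)) => // H; have E : j' = j + 2 by clear - Cm' Em' H; lia.
  by exfalso; clear - A2 E Em Em' Hj'; lia.
by split=> //; clear - Ej' Em' Em Hjj j2; lia.
Qed.

End Rectangles.

(** * A family of generators *)

Section Heights.
Variable n : nat.
Notation k := (2 * n + 3).
Notation N := (2 * n + 14).

(** The next element of I after [j], with value [k + 1] if there is none, because [find] then
    returns the length of the list. Dually, [prevI] falls back to 0. *)
Definition nextI (p : nat -> bool) (j : nat) : nat := j.+1 + find p (iota j.+1 (k - j)).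

Fixpoint prevI (p : nat -> bool) (i : nat) : nat :=
  if i is j.+1 then (if (j == 0) || p j then j else prevI p j) else 0.

Definition sparse (p : nat -> bool) : Prop := forall j, p j -> 1 <= j <= k /\ ~~ p j.+1.

Lemma nextI_P (p : nat -> bool) j : j <= k -> [/\ j < nextI p j, nextI p j <= k + 1, nextI p j <= k -> p (nextI p j)
  & forall l, j < l -> l < nextI p j -> ~~ p l].
Proof.
move=> Hj; rewrite /nextI; set s := iota _ _.
have Hs : find p s <= k - j by rewrite -[k - j](size_iota j.+1); apply: find_size.
split; [lia|lia| |].
  move=> H; have Hh : has p s by rewrite has_find size_iota; lia.
  by have := nth_find 0 Hh; rewrite nth_iota //; lia.
move=> l H1 H2; have H : l - j.+1 < find p s by lia.
have := before_find 0 H; rewrite nth_iota; last by lia.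
by have -> : j.+1 + (l - j.+1) = l by [lia]; move=> ->.
Qed.

Lemma nextI_eq (p : nat -> bool) j e : j <= k -> j < e -> e <= k + 1 -> (e <= k -> p e) ->
  (forall l, j < l -> l < e -> ~~ p l) -> nextI p j = e.
Proof.
move=> Hj H1 H2 H3 H4; have [K1 K2 K3 K4] := nextI_P p Hj.
case: (ltngtP (nextI p j) e) => // H.
  by have := H4 _ K1 H; rewrite K3 //; lia.
by have := K4 _ H1 H; rewrite H3 //; lia.
Qed.

Lemma prevI_P (p : nat -> bool) i : 1 <= i -> [/\ prevI p i < i, (prevI p i = 0) \/ p (prevI p i)
  & forall l, prevI p i < l -> l < i -> ~~ p l].
Proof.
elim: i => [//|i IH] _ /=; case: eqP => [->|i0] /=.
  by split; [|left|lia].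
case pi: (p i); first by split; [lia|right|lia].
have [H1 H2 H3] := IH ltac:(lia); split; [lia|by []|].
move=> l L1 L2; case: (eqVneq l i) => [->|li]; first by rewrite pi.
by apply: H3; lia.
Qed.

(* The height [k + 9 - Mv p j] of the point of y_I on the chain column [j], where [p]
   is the indicator function of I. *)
Definition Mv (p : nat -> bool) (j : nat) : nat :=
  if (j == 0) || p j then (nextI p j).+1 else if (2 <= j) && p j.-1 then j.-1 else j.

(** The numbers whose membership in I can be changed freely without creating consecutive
    elements. *)
Definition allowed (p : nat -> bool) (i : nat) : bool := [&& 1 <= i, i <= k, ~~ p i.-1 & ~~ p i.+1].
(* The chain columns bounding the rectangle that ends in y_I and corresponds to [i]. *)
Definition lft (p : nat -> bool) (i : nat) : nat := if p i then prevI p i else i.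
Definition rgt (p : nat -> bool) (i : nat) : nat := if p i then i else i.+1.

Section Sparse.
Variable p : nat -> bool.
Hypothesis sp : sparse p.

Let p0 : p 0 = false.
Proof. by apply/negP => /sp []. Qed.

Lemma MvP j : j <= k + 1 ->
  [\/ [/\ (j = 0) \/ p j, j <= k & Mv p j = (nextI p j).+1],
      [/\ 2 <= j, p j.-1, ~~ p j & Mv p j = j.-1] | [/\ 1 <= j, ~~ p j, ~~ p j.-1 & Mv p j = j]].
Proof.
move=> Hj; rewrite /Mv; case: (eqVneq j 0) => [->|j0] /=.
  by constructor 1; split; [left|lia|].
case pj: (p j) => /=; first by constructor 1; split; [right|have := sp pj; lia|].
case: ifP => [/andP[j2 pj']|H]; first by constructor 2; split.
constructor 3; split=> //; first by lia.
case: (leqP 2 j) H => /= [_ ->//|j1 _].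
by have -> : j.-1 = 0 by [lia]; rewrite p0.
Qed.

Lemma Mv_height j : j <= k + 1 -> chain_height n j (Mv p j).
Proof.
move=> Hj; rewrite /chain_height; case: (MvP Hj) => [[H1 H2 ->]|[H1 H2 H3 ->]|[H1 H2 H3 ->]].
- have [K1 K2 K3 _] := nextI_P p H2.
  case: H1 => [E|pj]; first by rewrite E eqxx; rewrite E in K1 K2; lia.
  have [Hp1 Hp2] := sp pj.
  by case: eqP; lia.
- by case: eqP; lia.
by case: eqP; lia.
Qed.

Lemma Mv_inj i j : i <= k + 1 -> j <= k + 1 -> Mv p i = Mv p j -> i = j.
Proof.
suff W : forall i j, i <= k + 1 -> j <= k + 1 -> i < j -> Mv p i <> Mv p j.
  by move=> Hi Hj E; case: (ltngtP i j) => // H; [case: (W i j)|case: (W j i)].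
move=> {}i {}j Hi Hj ij E.
have nj (a b : nat) : a <= k -> a < b -> b <= k + 1 -> (b = 0 \/ p b) -> nextI p a <= b.
  move=> Ha ab Hb; case=> [b0|pb]; first by lia.
  have [_ _ _ K] := nextI_P p Ha; rewrite leqNgt; apply/negP => H.
  by have := K b ab H; rewrite pb.
case: (MvP Hi) => [[A1 A2 A3]|[A1 A2 A3 A4]|[A1 A2 A3 A4]];
case: (MvP Hj) => [[B1 B2 B3]|[B1 B2 B3 B4]|[B1 B2 B3 B4]].
- have := nj i j A2 ij Hj B1; have [K1 _ _ _] := nextI_P p B2; lia.
- have [K1 K2 K3 K4] := nextI_P p A2.
  have Ej : (nextI p i).+1 = j.-1 by lia.
  have := K3 ltac:(lia) => pn; have := sp pn => -[_]; rewrite Ej A3 in E *.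
  by rewrite B2.
- have [K1 K2 K3 K4] := nextI_P p A2.
  have Ej : nextI p i = j.-1 by lia.
  by have := K3 ltac:(lia); rewrite Ej (negbTE B3).
- by have [K1 _ _ _] := nextI_P p B2; lia.
- by lia.
- by lia.
- by have [K1 _ _ _] := nextI_P p B2; lia.
- have Ei : i = j.-1 by lia.
  by rewrite Ei B2 in A2.
by lia.
Qed.

Lemma Mv_prev i : p i -> [/\ prevI p i < i, Mv p (prevI p i) = i.+1,
  (prevI p i = 0) \/ p (prevI p i) & forall l, prevI p i < l -> l < i -> ~~ p l].
Proof.
move=> pi; have [Hi _] := sp pi; have [H1 H2 H3] := prevI_P p (proj1 (andP Hi)).
split=> //; rewrite /Mv; have -> : (prevI p i == 0) || p (prevI p i).
  by case: H2 => [->|->]; rewrite ?eqxx ?orbT.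
by rewrite (@nextI_eq p _ i) //; lia.
Qed.

Lemma Mv_self i : p i -> Mv p i = (nextI p i).+1.
Proof. by rewrite /Mv => ->; rewrite orbT. Qed.

Lemma Mv_strip i : 1 <= i -> i <= k -> ~~ p i -> ~~ p i.-1 -> ~~ p i.+1 -> Mv p i = i /\ Mv p i.+1 = i.+1.
Proof.
move=> H1 H2 /negbTE P1 /negbTE P2 /negbTE P3; rewrite /Mv /= P1 P2 P3 !andbF !orbF.
by case: (eqVneq i 0) => ?; [lia|].
Qed.

(** Strips come from the numbers i = j outside I. A rectangle below the diagonal comes from an
    element i = j' of I; its left side is at the preceding element, or at 0. *)
Lemma rect_class j j' : j < j' -> j' <= k + 1 -> Mv p j < Mv p j' ->
  (j' + 1 <= Mv p j) || [&& 1 <= j, j' == j.+1, Mv p j == j & Mv p j' == j.+1] ->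
  exists i, [/\ allowed p i, j = lft p i & j' = rgt p i].
Proof.
move=> jj' Hj' MM /orP[deep|/and4P [j1 /eqP Ej /eqP E1 /eqP E2]]; last first.
  have Hk : j <= k by lia.
  have P1 : ~~ p j.
    by apply/negP => pj; move: E1; rewrite Mv_self //; have [K1 _ _ _] := nextI_P p Hk; lia.
  have P2 : ~~ p j.-1.
    apply/negP => pj; move: E1; rewrite /Mv (negbTE P1) pj orbF.
    case: eqP; first lia; move=> _; case: ltnP => //= H; first by lia.
    by have [Hp _] := sp pj; lia.
  have P3 : ~~ p j.+1.
    apply/negP => pj; move: E2; rewrite Ej Mv_self //.
    have [Hp _] := sp pj; have [K1 _ _ _] := nextI_P p (proj2 (andP Hp)); lia.
  exists j; rewrite /allowed /lft /rgt (negbTE P1) P2 P3 j1 Hk; split=> //.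
have Hj : j <= k by lia.
have [j0p EM] : ((j = 0) \/ p j) /\ Mv p j = (nextI p j).+1.
  have Hj1 : j <= k + 1 by lia.
  by case: (MvP Hj1) => [[? ? ?]|[? ? ? E]|[? ? ? E]] //; exfalso; lia.
have [K1 K2 K3 K4] := nextI_P p Hj.
have pj' : p j'.
  case: (MvP Hj') => [[[?|//] _ _]|[? ? ? E]|[? ? ? E]]; exfalso; lia.
have En : nextI p j = j'.
  case: (ltngtP (nextI p j) j') => // H; first lia.
  by have := K4 _ jj' H; rewrite pj'.
have [Hp1 Hp2] := sp pj'.
have P2 : ~~ p j'.-1.
  apply/negP => q; have [_] := sp q; have -> : j'.-1.+1 = j' by lia.
  by rewrite pj'.
exists j'; rewrite /allowed /lft /rgt pj' P2 Hp2 !andbT; split=> //.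
have [H1 H2 H3] := prevI_P p (proj1 (andP Hp1)).
case: (ltngtP j (prevI p j')) => // H.
  by case: H2 => [E|q]; [lia|have := K4 _ H ltac:(lia); rewrite q].
by case: j0p => [E|q]; [lia|have := H3 _ H jj'; rewrite q].
Qed.

Definition yn (c : nat) : nat := if ischain n c then k + 9 - Mv p (chidx n c) else xpn n c.

Lemma yn_pc j : j <= k + 1 -> yn (pc n j) = k + 9 - Mv p j.
Proof. by move=> H; have [E C] := pcK H; rewrite /yn C E. Qed.

Lemma Mv_range j : j <= k + 1 -> 1 <= Mv p j <= k + 2.
Proof. by move=> H; have := chain_heightP (Mv_height H); lia. Qed.

Lemma xpn_nonchain_inj c d : c < N -> d < N -> ~~ ischain n c -> ~~ ischain n d -> xpn n c = xpn n d -> c = d.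
Proof. by move=> Hc Hd Cc Cd; have := nonchainP Hc Cc; have := nonchainP Hd Cd; lia. Qed.

Lemma yn_lt c : c < N -> yn c < N.
Proof.
move=> Hc; rewrite /yn; case: ifP => [C|/negbT C]; last by have := nonchainP Hc C; lia.
have [_ H] := chidxK C; have := Mv_range H; lia.
Qed.

Lemma yn_inj c d : c < N -> d < N -> yn c = yn d -> c = d.
Proof.
have mix a b : a < N -> b < N -> ischain n a -> ~~ ischain n b -> yn a <> yn b.
  move=> Ha Hb Ca Cb; rewrite /yn Ca (negbTE Cb).
  have [_ H] := chidxK Ca; have R := Mv_range H; have := nonchainP Hb Cb; clear -R; lia.
move=> Hc Hd E; case: (boolP (ischain n c)) => Cc; case: (boolP (ischain n d)) => Cd.
- have [E1 L1] := chidxK Cc; have [E2 L2] := chidxK Cd.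
  have R1 := Mv_range L1; have R2 := Mv_range L2.
  rewrite -E1 -E2; congr pc; apply: Mv_inj => //.
  by move: E; rewrite /yn Cc Cd; lia.
- by case: (mix c d).
- by case: (mix d c).
by apply: xpn_nonchain_inj => //; move: E; rewrite /yn (negbTE Cc) (negbTE Cd).
Qed.

(** Freedom from marks is checked column by column. For i in I, no element of I lies strictly
    between the two sides, so that the points of y_I there are above the rectangle; for other i the
    rectangle is only one row high. *)
Lemma rect_valid i : allowed p i ->
  [/\ lft p i < rgt p i, rgt p i <= k + 1, Mv p (lft p i) < Mv p (rgt p i),
      freen n (pc n (lft p i)) (pc n (rgt p i)) (k + 9 - Mv p (rgt p i)) (k + 9 - Mv p (lft p i))
    & forall c, c < N -> ~~ [&& cycn (pc n (lft p i)) (pc n (rgt p i)) c,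
        cycn (k + 9 - Mv p (rgt p i)) (k + 9 - Mv p (lft p i)) (yn c),
        c != pc n (lft p i) & yn c != k + 9 - Mv p (rgt p i)]].
Proof.
move=> /and4P [i1 ik P2 P3]; rewrite /lft /rgt; case pi: (p i); last first.
  have [E1 E2] := Mv_strip i1 ik (negbT pi) P2 P3.
  rewrite E1 E2; split; [lia|lia|lia| |].
    have Hi : i <= k + 1 by lia.
    have Hi' : i.+1 <= k + 1 by lia.
    have := pcP Hi; have := pcP Hi' => PR PL c Hc.
    have := OrowP Hc; have := XrowP Hc; rewrite /cycn; clear E1 E2 sp p0.
    have {}PR : pc n i.+1 = i + 2 by lia.
    have {}PL : (i = 1 /\ pc n i = 0) \/ (2 <= i /\ pc n i = i + 1) by lia.
    by rewrite PR => HX HO; split; [clear HX|clear HO]; case: PL => -[H1 ->]; lia.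
  move=> c _; apply/negP => /and4P [_ H _]; move: H; rewrite /cycn; clear; lia.
have [H1 E1 H2 H3] := Mv_prev pi; have [K1 K2 _ _] := nextI_P p ik.
rewrite E1 (Mv_self pi); set e := prevI p i in H1 H2 H3 *; set x := nextI p i in K1 K2 *.
have Hi : i <= k + 1 by lia.
have He : e <= k + 1 by lia.
have := pcP Hi; have := pcP He => PL PR.
split; [lia|lia|lia| |].
  move=> c Hc; have := OrowP Hc; have := XrowP Hc; rewrite /cycn => HX HO.
  split; [clear HX|clear HO].
    by case: PL => [[Ee ->]|[[Ee ->]|[Ee ->]]];
      case: PR => [[Ei ->]|[[Ei ->]|[Ei ->]]]; clear - Ee Ei HO H1 K1 K2 ik i1 Hc; lia.
  by case: PL => [[Ee ->]|[[Ee ->]|[Ee ->]]];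
    case: PR => [[Ei ->]|[[Ei ->]|[Ei ->]]]; clear - Ee Ei HX H1 K1 K2 ik i1 Hc; lia.
move=> c Hc; apply/negP => /and4P [C1 C2 C3 _]; move: C2; rewrite /yn /cycn.
case: ifP => [C|/negbT C]; last first.
  by have := nonchainP Hc C; clear - K1 K2 ik i1 PL PR C1 C3 H1; rewrite /cycn in C1;
    case: PL => [[Ee EE]|[[Ee EE]|[Ee EE]]]; case: PR => [[Ei EI]|[[Ei EI]|[Ei EI]]]; rewrite EE EI in C1 C3; lia.
have [Ec Lc] := chidxK C; set l := chidx n c in Ec Lc *.
have Pc := pcP Lc; rewrite Ec in Pc.
have [l1 l2] : e < l /\ l < i.
  move: C1 C3; rewrite /cycn; clear - PL PR Pc H1 Lc ik Hc.
  by case: PL => [[Ee ->]|[[Ee ->]|[Ee ->]]]; case: PR => [[Ei ->]|[[Ei ->]|[Ei ->]]];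
    case: Pc => [[El ->]|[[El ->]|[El ->]]]; lia.
have Ml : Mv p l <= l.
  rewrite /Mv (negbTE (H3 l l1 l2)) orbF; case: eqP; first by lia.
  by case: ifP => _ _; lia.
have R := Mv_range Lc; clear - Ml R l2 K1 K2 ik; lia.
Qed.

Lemma rgt_inj i i' : allowed p i -> allowed p i' -> rgt p i = rgt p i' -> i = i'.
Proof.
move=> /and4P [i1 ik P2 P3] /and4P [i1' ik' P2' P3']; rewrite /rgt.
case pi: (p i); case pi': (p i') => E; try lia.
  by rewrite -E pi in P3'.
by rewrite E pi' in P3.
Qed.

End Sparse.
End Heights.

(** * The cocycle *)

From mathcomp Require Import all_algebra.
From mathcomp.multinomials Require Import mpoly.

Section Toggle.
Variable n : nat.
Notation k := (2 * n + 3).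
Notation N := (2 * n + 14).
Variables (p p' : nat -> bool) (i : nat).
Hypothesis pp' : forall j, p' j = (j == i) || p j.
Hypothesis pi : ~~ p i.

Let p'_ne j : j != i -> p' j = p j.
Proof. by rewrite pp' => /negbTE ->. Qed.

Let p'i : p' i.
Proof. by rewrite pp' eqxx. Qed.

Lemma allowed_toggle : 1 <= i -> allowed n p' i = allowed n p i.
Proof. by move=> i1; rewrite /allowed !p'_ne //; lia. Qed.

Lemma sparse_toggle : allowed n p i -> sparse n p <-> sparse n p'.
Proof.
move=> /and4P[i1 ik P1 P2]; split=> S j.
  rewrite {1}pp' => /orP[/eqP ->|pj]; first by rewrite p'_ne //; [lia|lia].
  have [H1 H2] := S _ pj; split=> //; rewrite pp' (negbTE H2) orbF.
  by apply/negP => /eqP E; rewrite -E /= pj in P1.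
move=> pj; have p'j : p' j by rewrite pp' pj orbT.
by have [H1 H2] := S _ p'j; split=> //; move: H2; rewrite pp' negb_or => /andP[].
Qed.

(** The heights of the generator at which the rectangle of [i] starts. *)
Definition swapM (p : nat -> bool) (i j : nat) : nat :=
  if j == lft p i then Mv n p (rgt p i) else if j == rgt p i then Mv n p (lft p i) else Mv n p j.

(** Let e and x be the neighbours of i in I, or the default values. Exchanging the heights at e and
    i when i is in I, or those at i and i + 1 when it is not, results in the heights x + 1 at e, i +
    1 at i and i at i + 1 in both cases. *)
Lemma swapM_toggle j : sparse n p -> allowed n p i -> j <= k + 1 -> swapM p' i j = swapM p i j.
Proof.
move=> S A Hj; have S' := (sparse_toggle A).1 S; have /and4P[i1 ik P1 P2] := A.
have [E1 E2] := Mv_strip S i1 ik pi P1 P2.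
have [H1 H2 H3 H4] := Mv_prev S' p'i.
have Q1 : p' i.+1 = false by rewrite p'_ne ?(negbTE P2) //; lia.
rewrite /swapM /lft /rgt p'i (negbTE pi) E1 E2; set e := prevI p' i in H1 H2 H3 H4 *.
have nx : nextI n p' i = nextI n p e.
  have [K1 K2 K3 K4] := nextI_P p' ik.
  apply/esym/nextI_eq; [lia|lia|lia| |].
    by move=> H; rewrite -p'_ne ?K3 //; lia.
  move=> l L1 L2; case: (ltngtP l i) => L.
  - by rewrite -p'_ne ?H4 //; lia.
  - by rewrite -p'_ne ?K4 //; lia.
  by rewrite L.
case: (eqVneq j e) => [->|je].
  have -> : (e == i) = false by lia.
  have -> : (e == i.+1) = false by lia.
  rewrite (Mv_self _ p'i) nx /Mv.
  have -> : (e == 0) || p e; last by [].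
  by case: H3 => [->//|]; rewrite p'_ne ?orbT; [move=> ->; rewrite orbT|lia].
case: (eqVneq j i) => [_|ji]; first by rewrite H2.
case: (eqVneq j i.+1) => [->|ji1].
  by rewrite /Mv Q1 /= p'i andbT; case: ltnP => //; lia.
rewrite /Mv p'_ne //; case: ifP => [C|_]; last first.
  by case: (leqP 2 j) => //= j2; rewrite p'_ne //; lia.
have jk : j <= k.
  by case/orP: C => [/eqP ->//|pj]; have := S _ pj; lia.
congr _.+1; have [K1 K2 K3 K4] := nextI_P p jk.
have ne : nextI n p j != i.
  apply/negP => /eqP E.
  case: (ltngtP j e) => [L|L|L]; [|by have := H4 j L; rewrite p'_ne //; case/orP: C => [|->]; [lia|move=> HH; have := HH ltac:(lia)]|by rewrite L eqxx in je].
  case: H3 => [|]; first lia.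
  rewrite p'_ne; last by lia.
  by move=> pe; have := K4 e L; rewrite pe E => HH; have := HH ltac:(lia).
apply: nextI_eq => //.
  by move=> H; rewrite p'_ne // K3.
move=> l L1 L2; rewrite pp' negb_or K4 // andbT; apply/negP => /eqP E.
have {L2} L2 : i < nextI n p j by lia.
have L0 : j < i by lia.
case: (ltngtP j e) => [L|L|L]; [|by have := H4 j L; rewrite p'_ne //; case/orP: C => [|->]; [lia|move=> HH; have := HH ltac:(lia)]|by rewrite L eqxx in je].
case: H3 => [|]; first lia.
rewrite p'_ne; last by lia.
by move=> pe; have := K4 e L; rewrite pe => HH; have := HH ltac:(lia).
Qed.

End Toggle.

Lemma cycE N (i j a : 'I_N) : i != j -> cyc i j a = cycn i j a.
Proof.
move=> ij; have Hi := ltn_ord i; have Hj := ltn_ord j; have Ha := ltn_ord a.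
have {}ij : (i : nat) <> j by move=> E; case/eqP: ij; apply: val_inj.
have E (x : nat) : x < N -> (x + N - i) %% N = if i <= x then x - i else x + N - i.
  move=> Hx; case: ifP => H; last by rewrite modn_small //; lia.
  by have -> : x + N - i = x - i + N by [lia]; rewrite modnDr modn_small //; lia.
rewrite /cyc /cycn !E //; clear E.
by do ! case: ifP => ?; lia.
Qed.

Section Algebra.
Variable n : nat.
Notation k := (2 * n + 3).
Notation N := (2 * n + 14).
Notation G := (the_grid n).

Lemma xplusE (c : 'I_N) : xplus G c = xpn n c :> nat.
Proof.
rewrite /xplus -{1}(ord_predK c) -[ordS _](permE (@ordS_inj N)) permJ permE /= permE /=.
rewrite (xpn_Xrow (ltn_ord c)); congr ((Xrow n _).+1 %% N).
have Hc := ltn_ord c; case: eqP => [->|c0]; first by rewrite modn_small; lia.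
by have -> : (c + N).-1 = c - 1 + N by [lia]; rewrite modnDr modn_small //; lia.
Qed.

Definition memI (I : {set 'I_N}) (j : nat) : bool := [exists a, (a \in I) && (val a == j)].

Lemma memIE I (a : 'I_N) : memI I a = (a \in I).
Proof.
apply/existsP/idP => [[b /andP[bI /eqP E]]|aI]; last by exists a; rewrite aI eqxx.
by rewrite -(val_inj E).
Qed.

Lemma memIU I (i : 'I_N) j : memI (i |: I) j = (j == i) || memI I j.
Proof.
apply/existsP/orP => [[b /andP[/setU1P[->|bI] /eqP E]]|[/eqP ->|/existsP[b /andP[bI /eqP E]]]].
- by left; rewrite -E.
- by right; apply/existsP; exists b; rewrite bI E eqxx.
- by exists i; rewrite setU11 eqxx.
by exists b; rewrite !inE bI orbT E eqxx.
Qed.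

Definition good (I : {set 'I_N}) : bool :=
  [forall a in I, (1 <= (a : nat) <= k) && ~~ memI I a.+1].

Lemma goodP I : reflect (sparse n (memI I)) (good I).
Proof.
apply: (iffP forall_inP) => [H j /existsP[a /andP[aI /eqP <-]]|S a aI].
  by have /andP[? ?] := H a aI.
by apply/andP; apply: S; rewrite memIE.
Qed.

(** Defined on all sets, so that sums over sets can be formed; the identity is a dummy value for
    those that are not good. *)
Definition ygen (I : {set 'I_N}) : {perm 'I_N} :=
  odflt 1%g [pick s : {perm 'I_N} | [forall c, val (s c) == yn n (memI I) c]].

Lemma ygenE I (c : 'I_N) : good I -> ygen I c = yn n (memI I) c :> nat.
Proof.
move=> /goodP S; rewrite /ygen; case: pickP => [s /forallP H|H]; first by apply/eqP; apply: H.
have f_inj : injective (rowmap (fun c => yn_lt S (c := c))).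
  by apply: rowmap_inj => a b Ha Hb; apply: yn_inj.
by have /negP[] := negbT (H (perm f_inj)); apply/forallP => a; rewrite permE.
Qed.

Lemma permP_val (s t : {perm 'I_N}) : (forall c, s c = t c :> nat) -> s = t.
Proof. by move=> H; apply/permP => c; apply: val_inj; apply: H. Qed.

Lemma memI0 j : memI set0 j = false.
Proof. by apply/existsP => -[a]; rewrite inE. Qed.

Lemma good0 : good set0.
Proof. by apply/goodP => j; rewrite memI0. Qed.

Lemma nextI0 j : j <= k -> nextI n (memI set0) j = k + 1.
Proof. by move=> H; apply: nextI_eq => *; rewrite ?memI0 //; lia. Qed.

Lemma ygen0 : ygen set0 = xplus G.
Proof.
apply: permP_val => c; rewrite (ygenE _ good0) xplusE /yn; case: ifP => // C.
have [_ HC] := chidxK C; rewrite /Mv !memI0 andbF orbF; case: eqP => [E|E]; first rewrite E nextI0 //.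
  by move: C E; rewrite /ischain /chidx /xpn; do ! case: ifP => ?; lia.
by move: C E; rewrite /ischain /chidx /xpn; do ! case: ifP => ?; lia.
Qed.

(** The value at column [k + 9] encodes the least element of I. *)
Lemma ygen_eq0 I : good I -> ygen I = xplus G -> I = set0.
Proof.
move=> gI E; have Hc : k + 9 < N by lia.
have := ygenE (Ordinal Hc) gI; rewrite E xplusE /= -[k + 9]/(pc n 0) yn_pc //.
rewrite /pc eqxx {1}/xpn /Mv eqxx /= => H.
have [K1 K2 K3 K4] := @nextI_P n (memI I) 0 ltac:(lia).
have {}H : nextI n (memI I) 0 = k + 1 by move: H; do ! case: ifP => ?; lia.
apply/setP => a; rewrite inE -memIE; case aI: (memI I a) => //.
have [a1 _] := goodP I gI _ aI.
by have := K4 a; rewrite H aI => HH; have := HH ltac:(lia) ltac:(lia).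
Qed.

Definition opc (j : nat) : 'I_N := Ordinal (pc_lt n j).

Lemma ygen_opc I j : good I -> j <= k + 1 -> ygen I (opc j) = k + 9 - Mv n (memI I) j :> nat.
Proof. by move=> gI Hj; rewrite (ygenE _ gI) yn_pc. Qed.

Definition rect_of (I : {set 'I_N}) (i : nat) : rectangle N :=
  ((opc (lft (memI I) i), opc (rgt (memI I) i)),
   (ygen I (opc (rgt (memI I) i)), ygen I (opc (lft (memI I) i)))).

Definition no_O (r : rectangle N) : bool := [forall a, ~~ in_rect r a (gridO G a)].

Lemma freenP (r : rectangle N) : rleft r != rright r -> rbottom r != rtop r ->
  reflect (freen n (rleft r) (rright r) (rbottom r) (rtop r)) (no_X G r && no_O r).
Proof.
move=> LR bt; apply: (iffP andP) => [[/forallP HX /forallP HO] c Hc|H].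
  have := HX (Ordinal Hc); have := HO (Ordinal Hc); rewrite /in_rect !cycE // !permE /=.
  by split.
by split; apply/forallP => c; rewrite /in_rect !cycE // !permE /=; have [] := H c (ltn_ord c).
Qed.

Definition zgen (I : {set 'I_N}) (i : nat) : {perm 'I_N} :=
  (tperm (opc (lft (memI I) i)) (opc (rgt (memI I) i)) * ygen I)%g.

(** A rectangle and its start are determined by its end and its two vertical sides. *)
Lemma connects_tperm (x y : generator N) (r : rectangle N) :
  connects x y r = [&& rleft r != rright r, rbottom r == y (rright r), rtop r == y (rleft r)
    & x == (tperm (rleft r) (rright r) * y)%g].
Proof.
rewrite /connects; case: (eqVneq (rleft r) (rright r)) => //= LR.
apply/and5P/and3P => [[/eqP h1 /eqP h2 /eqP h3 /eqP h4 /forallP h5]|[/eqP h1 /eqP h2 /eqP ->]].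
  rewrite h3 h4 !eqxx; split=> //; apply/eqP/permP => c; rewrite permM.
  case: tpermP => [->|->|/eqP c1 /eqP c2]; [by rewrite h1 h4|by rewrite h2 h3|].
  by apply/eqP; have := h5 c; rewrite c1 c2.
rewrite !permM tpermL tpermR h1 h2 !eqxx; split=> //.
by apply/forallP => c; apply/implyP => /andP[c1 c2]; rewrite permM tpermD // eq_sym.
Qed.

Definition counted (x y : generator N) (r : rectangle N) : bool :=
  [&& connects x y r, empty_rect x r & no_X G r] && no_O r.

(** The marks force both sides onto chain columns, by [left_chain] and [right_chain]; then
    [chain_rect] and [rect_class] produce [i]. Conversely, [rect_valid] applies. *)
Lemma countedE x I r : good I ->
  counted x (ygen I) r = [exists i : 'I_N, [&& allowed n (memI I) i, x == zgen I i & r == rect_of I i]].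
Proof.
move=> gI; have S := goodP I gI; apply/idP/existsP.
  rewrite /counted connects_tperm => /andP[/and3P[/and4P[LR /eqP Hb /eqP Ht /eqP Hx] _ nX] nO].
  have bt : rbottom r != rtop r by rewrite Hb Ht (inj_eq perm_inj) eq_sym.
  have F : freen n (rleft r) (rright r) (rbottom r) (rtop r) by apply/freenP => //; rewrite nX.
  case: r LR Hb Ht Hx nX nO bt F => -[L R] [b t]; rewrite /rleft /rright /rbottom /rtop /=.
  move=> LR Hb Ht Hx _ _ bt F.
  have LRn : (L : nat) != R by [].
  have btn : (b : nat) != t by [].
  have EL := ygenE L gI; have ER := ygenE R gI; rewrite -Hb in ER; rewrite -Ht in EL.
  have CH c : ischain n c -> [/\ yn n (memI I) c = k + 9 - Mv n (memI I) (chidx n c),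
      pc n (chidx n c) = c, chidx n c <= k + 1 & chain_height n (chidx n c) (Mv n (memI I) (chidx n c))].
    by move=> C; have [? ?] := chidxK C; rewrite /yn C; split=> //; apply: Mv_height.
  have NC c : ~~ ischain n c -> yn n (memI I) c = xpn n c by rewrite /yn => /negbTE ->.
  have CV c : ischain n c -> 7 <= yn n (memI I) c <= k + 8.
    by move=> C; have [-> _ _ H] := CH c C; have := chain_heightP H; lia.
  have CL : ischain n L.
    apply: (@left_chain n L R b t) => //.
    - by rewrite EL; apply: CV.
    - by rewrite EL; apply: NC.
    - by rewrite ER; apply: CV.
    - by rewrite ER; apply: NC.
  have CR : ischain n R.
    apply: (@right_chain n L R b t) => //.
    - by rewrite EL; apply: CV.
    - move=> HL; have [E1 E2 _ H] := CH _ CL; rewrite EL E1; have := chain_heightP H.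
      by move: E2 HL (pcP (proj2 (chidxK CL))); lia.
    - by rewrite ER; apply: NC.
  have [E1 P1 K1 H1] := CH _ CL; have [E2 P2 K2 H2] := CH _ CR.
  rewrite E1 in EL; rewrite E2 in ER.
  have jj : chidx n L != chidx n R by apply/negP => /eqP E; rewrite -P1 -P2 E eqxx in LRn.
  have mm : Mv n (memI I) (chidx n L) != Mv n (memI I) (chidx n R).
    by apply/negP => /eqP E; rewrite EL ER E eqxx in btn.
  have [j1 j2 j3] : [/\ chidx n L < chidx n R, Mv n (memI I) (chidx n L) < Mv n (memI I) (chidx n R)
    & (chidx n R + 1 <= Mv n (memI I) (chidx n L)) || [&& 1 <= chidx n L, chidx n R == (chidx n L).+1,
       Mv n (memI I) (chidx n L) == chidx n L & Mv n (memI I) (chidx n R) == (chidx n L).+1]].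
    by apply: (chain_rect K1 K2 jj mm H1 H2); rewrite P1 P2 -EL -ER.
  have [i [Ai Li Ri]] := rect_class S j1 K2 j2 j3.
  have iN : i < N by case/and4P: Ai; lia.
  have EL' : L = opc (lft (memI I) i) by apply: val_inj; rewrite /= -Li P1.
  have ER' : R = opc (rgt (memI I) i) by apply: val_inj; rewrite /= -Ri P2.
  exists (Ordinal iN); rewrite /= Ai Hx /zgen /rect_of -EL' -ER' Hb Ht.
  by rewrite !eqxx.
move=> [i /and3P[Ai /eqP -> /eqP ->]]; rewrite /counted connects_tperm.
have [h1 h2 h3 h4 h5] := rect_valid S Ai.
rewrite /rect_of /rleft /rright /rbottom /rtop /= !eqxx !andbT.
set L := opc (lft _ _); set R := opc (rgt _ _).
have h1' : lft (memI I) i <= k + 1 by lia.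
have LR : L != R.
  apply/negP => /eqP /(congr1 (@nat_of_ord _)) /= E.
  by have := (pcK h2).1; rewrite -E (pcK h1').1; lia.
have bt : ygen I R != ygen I L by rewrite (inj_eq perm_inj) eq_sym.
have EL : ygen I L = k + 9 - Mv n (memI I) (lft (memI I) i) :> nat by apply: ygen_opc.
have ER : ygen I R = k + 9 - Mv n (memI I) (rgt (memI I) i) :> nat by apply: ygen_opc.
have := @freenP ((L, R), (ygen I R, ygen I L)) LR bt; rewrite /rleft /rright /rbottom /rtop /= EL ER.
move=> /introT /(_ h4) /andP[-> ->]; rewrite LR !andbT /=.
apply/forallP => c; apply/negP => /and3P[]; rewrite /in_rect /rleft /rright /rbottom /rtop /=.
rewrite !cycE // => /andP[C1 C2] cL cb.
have cR : R != c by apply/negP => /eqP E; move: C1; rewrite -E /cycn ltnn !andbF orbF; lia.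
rewrite permM tpermD // in C2 cb; last by rewrite eq_sym.
have /negP[] := h5 c (ltn_ord c); apply/and4P; split=> //.
  by rewrite -EL -ER -ygenE.
by rewrite -ER -ygenE.
Qed.

Lemma zgen_toggle (I : {set 'I_N}) (i : 'I_N) : i \notin I -> good I -> allowed n (memI I) i -> good (i |: I) ->
  zgen (i |: I) i = zgen I i.
Proof.
move=> iI gI A gI'; have S := goodP I gI; have S' := goodP _ gI'.
have pi : ~~ memI I i by rewrite memIE.
have pp' := memIU I i.
have A' : allowed n (memI (i |: I)) i.
  by rewrite (allowed_toggle n pp') //; case/and4P: A.
have W J : good J -> allowed n (memI J) i -> forall c : 'I_N, (zgen J i c : nat) =
    if ischain n c then k + 9 - swapM n (memI J) i (chidx n c) else xpn n c :> nat.
  move=> gJ AJ c; have [h1 h2 h3 _ _] := rect_valid (goodP J gJ) AJ.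
  have h1' : lft (memI J) i <= k + 1 by lia.
  rewrite /zgen permM; case: tpermP => [->|->|n1 n2].
  - have [q1 q2] := pcK h2; move: (ygen_opc gJ h2) => ->; change (nat_of_ord (opc (lft (memI J) i))) with (pc n (lft (memI J) i)).
    by have [-> ->] := pcK h1'; rewrite /swapM eqxx.
  - move: (ygen_opc gJ h1') => ->; change (nat_of_ord (opc (rgt (memI J) i))) with (pc n (rgt (memI J) i)).
    have [-> ->] := pcK h2; rewrite /swapM eqxx; case: ifP => // /eqP E.
    by rewrite -E ltnn in h1.
  rewrite ygenE // /yn; case: ifP => // C; have [E1 E2] := chidxK C.
  rewrite /swapM; case: eqP => [E|_]; first by case: n1; apply: val_inj; rewrite /= -E E1.
  by case: eqP => [E|_] //; case: n2; apply: val_inj; rewrite /= -E E1.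
apply: permP_val => c; rewrite !W //; case: ifP => // C.
by have [_ H] := chidxK C; rewrite (swapM_toggle pp').
Qed.

Lemma rect_of_inj I (i j : 'I_N) : good I -> allowed n (memI I) i -> allowed n (memI I) j ->
  rect_of I i = rect_of I j -> i = j.
Proof.
move=> gI Ai Aj /(congr1 (fun r => nat_of_ord (rright r))) E; apply: val_inj.
have {}E : pc n (rgt (memI I) i) = pc n (rgt (memI I) j) := E.
have [_ hi _ _ _] := rect_valid (goodP I gI) Ai; have [_ hj _ _ _] := rect_valid (goodP I gI) Aj.
apply: (rgt_inj (goodP I gI) Ai Aj).
have [q1 _] := pcK hi; have [q2 _] := pcK hj.
by rewrite -q1 -q2 E.
Qed.

Import GRing.Theory.
Local Open Scope ring_scope.

Definition ev0 : {mpoly 'F_2[N]} -> 'F_2 := meval (fun=> 0).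

(** Each O contributes a variable as a factor, so that constant terms count exactly the rectangles
    without O. *)
Lemma ev0_d_coef x I : good I ->
  ev0 (d_coef G x (ygen I)) = \sum_(i : 'I_N | allowed n (memI I) i && (x == zgen I i)) 1.
Proof.
move=> gI; rewrite /d_coef /ev0 rmorph_sum /=.
under eq_bigr => r _ do rewrite rmorph_prod /=.
have E (r : rectangle N) : \prod_(i < N) meval (fun=> 0) ('X_i ^+ countO G r i) = (no_O r)%:R :> 'F_2.
  case O: (no_O r); last first.
    have [i Hi] : exists i, in_rect r i (gridO G i).
      by move/negbT: O; rewrite negb_forall => /existsP[i]; rewrite negbK; exists i.
    by rewrite (bigD1 i) //= rmorphXn /= mevalXU /countO Hi expr1 mul0r.
  by rewrite big1 // => i _; rewrite /countO (negbTE (forallP O i)) expr0 rmorph1.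
under eq_bigr => r _ do rewrite E.
transitivity (\sum_(r : rectangle N | counted x (ygen I) r) (1 : 'F_2)).
  by rewrite /counted [RHS]big_mkcondr; apply: eq_bigr => r _; case: (no_O r).
rewrite !sumr_const; congr (_ *+ _).
transitivity #|[set rect_of I i | i : 'I_N in [pred i : 'I_N | allowed n (memI I) i && (x == zgen I i)]]|.
  apply: eq_card => r; rewrite -[LHS]/(counted x (ygen I) r) countedE //.
  apply/existsP/imsetP => [[i /and3P[a b /eqP c]]|[i]]; first by exists i => //; rewrite inE a b.
  by rewrite inE => /andP[a b] ->; exists i; rewrite a b eqxx.
rewrite card_in_imset; first by apply: eq_card.
by move=> i j; rewrite !inE => /andP[ai _] /andP[aj _]; apply: rect_of_inj.
Qed.

(** After exchanging the sums, [i] is fixed. Adding and removing [i] pairs the sets that contribute,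
    by [zgen_toggle], and each pair counts 2 = 0. *)
Lemma sum_counted x : \sum_(I | good I) ev0 (d_coef G x (ygen I)) = 0.
Proof.
under eq_bigr => I gI do rewrite ev0_d_coef //.
rewrite (exchange_big_dep xpredT) //= big1 // => i _.
rewrite (bigID (fun I : {set 'I_N} => i \in I)) /=.
set S2 := (X in _ + X); suff -> : \sum_(I | good I && (allowed n (memI I) i && (x == zgen I i)) && (i \in I)) (1 : 'F_2) = S2.
  by rewrite -mulr2n -mulr_natr (_ : 2%:R = 0 :> 'F_2) ?mulr0 //; apply/val_inj.
rewrite (reindex_onto (fun I => i |: I) (fun I => I :\ i)) /=; last first.
  by move=> I /andP[_ iI]; rewrite setD1K.
apply: eq_bigl => I; case iI: (i \in I).
  rewrite andbF; apply/negP => /andP[_ /eqP E].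
  by have := setD11 i (i |: I); rewrite E iI.
rewrite setU1K ?iI // eqxx setU11 !andbT.
have pi : ~~ memI I i by rewrite memIE iI.
have pp' := memIU I i.
case A: (allowed n (memI I) i); last first.
  rewrite andbF; apply/negP => /and3P[_ A' _].
  have i1 : (0 < i)%N by case/and4P: A'.
  by move: A'; rewrite (allowed_toggle n pp' pi i1) A.
have i1 : (0 < i)%N by case/and4P: A.
rewrite (allowed_toggle n pp' pi i1) A.
have gg : good (i |: I) = good I.
  by apply/goodP/goodP => S; apply/(sparse_toggle pp' pi A).
rewrite gg; case gI: (good I) => //=; rewrite zgen_toggle ?gg ?iI //.
Qed.

Theorem theta_hat_grid (i : 'I_N) : theta_hat_class_nonzero G i.
Proof.
case=> b [e E].
have : \sum_(I | good I) ev0 (gen_chain (xplus G) (ygen I)) = 1.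
  rewrite (bigD1 set0) ?good0 //= /gen_chain ffunE ygen0 eqxx /ev0 rmorph1 big1 ?addr0 // => I /andP[gI nI].
  by rewrite ffunE (_ : (ygen I == xplus G) = false) ?rmorph0 //; apply/negP => /eqP /(ygen_eq0 gI) /eqP; apply/negP.
suff -> : \sum_(I | good I) ev0 (gen_chain (xplus G) (ygen I)) = 0 by move/eqP; rewrite eq_sym oner_eq0.
under eq_bigr => I gI.
  rewrite E ffunE /diff_minus /mulU !ffunE /ev0 rmorphD rmorphM /= mevalXU mul0r addr0 rmorph_sum /=.
  under eq_bigr => x _ do rewrite rmorphM /=.
  over.
rewrite exchange_big /= big1 // => x _.
by rewrite -mulr_sumr sum_counted mulr0.
Qed.

End Algebra.

Theorem proposition2p12 (n : nat) (hn : (1 <= n)%N) (K : curve)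
    (hK : braid_closure 3 (beta n) K) :
  theta_hat_nonzero K.
Proof.
exists (2 * n + 14)%N, (the_grid n); split; first exact: represents_closure hK.
exact: theta_hat_grid.
Qed.
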